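(* Let $K$ be either $\mathbb{Q}$ or an imaginary quadratic extension of $\mathbb{Q}$, let correspondingly $\widehat K$ be $\mathbb{R}$ or $\mathbb{C}$, let $\mathcal O_K$ be the ring of integers of $K$, and let $\Gamma$ be a finite index subgroup of $\mathrm{PSL}_2(\mathcal O_K)$. Let $\alpha_0\in\widehat K$ be a fixed quadratic irrational and let $\gamma_0\in\Gamma$ be a primitive element of $\Gamma$ fixing $\alpha_0$ with $|\gamma_0'(\alpha_0)|>1$. Let $\mu^F_{x_0}$ be a Patterson measure on $\widehat K\cup\{\infty\}$ associated to a potential $\widetilde F$ for $\Gamma$ such that $\delta=\delta_{\Gamma,F}$ and $m_F$ are finite. Let $\delta_0$ be the critical exponent of $\gamma_0^{\mathbb{Z}}$ for $\widetilde F$. Let $\varphi:[0,+\infty[\,\to\,]0,+\infty[$ be a map such that $t\mapsto\varphi(e^t)$ is slowly varying. If the integral $\int_1^{+\infty}\varphi(t)^{\delta-\delta_0}/t\;dt$ diverges (respectively converges), then for $\mu^F_{x_0}$-almost every $x\in\widehat K$, $$\liminf_{r\in\mathcal E_{\alpha_0,\Gamma}}\;\frac{h(r)}{\varphi(h(r))}\,|x-r|=0\quad(\text{respectively }=+\infty).$$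
   Context: A quadratic irrational is an element of $\widehat K$ which is quadratic irrational over $K$; $\alpha^\sigma$ is the Galois conjugate over $K$ of a quadratic irrational $\alpha$. $\mathrm{PSL}_2(\widehat K)$ acts on $\widehat K\cup\{\infty\}$ by homographies. For a quadratic irrational $\alpha$, $h(\alpha)=\frac{2}{|\alpha-\alpha^\sigma|}$ and $\mathcal E_{\alpha,\Gamma}$ is the countable set $\Gamma\cdot\{\alpha,\alpha^\sigma\}$ endowed with its Fréchet filter (the liminf is along the filter of complements of finite subsets). A map $f:[0,+\infty[\,\to\,]0,+\infty[$ is slowly varying if it is measurable and there exist $B>0$ and $A\ge1$ such that for all $x,y\in[0,+\infty[$, if $|x-y|\le B$ then $f(y)\le A f(x)$. Let $\widetilde M$ be the real hyperbolic plane $\mathbb{H}^2_{\mathbb{R}}$ if $\widehat K=\mathbb{R}$ and the real hyperbolic space $\mathbb{H}^3_{\mathbb{R}}$ if $\widehat K=\mathbb{C}$ (upper halfspace models), so that $\partial_\infty\widetilde M=\widehat K\cup\{\infty\}$ and $\Gamma$ is a discrete group of isometries of $\widetilde M$; fix $x_0\in\widetilde M$. A potential $\widetilde F$ for $\Gamma$ is a Hölder-continuous $\Gamma$-invariant map $\widetilde F:T^1\widetilde M\to\mathbb{R}$, inducing $F$ on $\Gamma\backslash T^1\widetilde M$. Let $\pi:T^1\widetilde M\to\widetilde M$ be the projection, $(g^t)$ the geodesic flow, $v_\pm$ the endpoints at $\pm\infty$ of the geodesic line defined by $v$, $\iota v=-v$, $\Lambda\Gamma$ the limit set. For $x\neq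 y$ in $\widetilde M$, $\int_x^y\widetilde F=\int_0^{d(x,y)}\widetilde F(g^tv_{xy})\,dt$, with $v_{xy}$ the initial unit tangent vector of the geodesic segment from $x$ to $y$. The critical exponent of a subgroup $G$ of $\Gamma$ for $\widetilde F$ is $\limsup_{n\to+\infty}\frac1n\log\sum_{\gamma\in G,\,n-1<d(x,\gamma y)\le n}e^{\int_x^{\gamma y}\widetilde F}$ (independent of $x,y$); for $G=\Gamma$ it is $\delta_{\Gamma,F}$, and $\delta_{\Gamma,F\circ\iota}=\delta_{\Gamma,F}$. Gibbs cocycle: $C^F_\xi(x,y)=\lim_{t\to+\infty}\int_y^{\xi_t}(\widetilde F-\delta)-\int_x^{\xi_t}(\widetilde F-\delta)$ for any geodesic ray $t\mapsto\xi_t$ ending at $\xi$. A Patterson density for $(\Gamma,\widetilde F)$ is a family $(\mu^F_x)_{x\in\widetilde M}$ of finite nonzero measures on $\partial_\infty\widetilde M$ with support $\Lambda\Gamma$, with $\gamma_*\mu^F_x=\mu^F_{\gamma x}$ and $\frac{d\mu^F_x}{d\mu^F_y}(\xi)=e^{-C^F_\xi(x,y)}$ almost everywhere; $\mu^F_{x_0}$ is called a Patterson measure. Identify $v\in T^1\widetilde M$ with $(v_-,v_+,t)$, $t$ being the signed distance from the closest point to $x_0$ on the geodesic line of $v$ to $\pi(v)$. The Gibbs measure $m_F$ is the measure on $\Gamma\backslash T^1\widetilde M$ induced by the $\Gamma$-invariant measure $d\widetilde m_F(v)=e^{C^{F\circ\iota}_{v_-}(x_0,\pi(v))+C^F_{v_+}(x_0,\pi(v))}\,d\mu^{F\circ\iota}_{x_0}(v_-)\,d\mu^F_{x_0}(v_+)\,dt$,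 for Patterson densities for $(\Gamma,\widetilde F\circ\iota)$ and $(\Gamma,\widetilde F)$. *)

(* Defs.v *)
From HB Require Import structures.
From mathcomp Require Import all_boot all_order all_algebra all_field.
From mathcomp Require Import generic_quotient monoid.
From mathcomp Require Import all_classical all_reals all_analysis.
From mathcomp Require Import complex.

Set Implicit Arguments.
Unset Strict Implicit.
Unset Printing Implicit Defensive.

Import Order.TTheory GRing.Theory Num.Theory.
Import numFieldNormedType.Exports.
Import Normc.

Local Open Scope classical_set_scope.
Local Open Scope ring_scope.

HB.instance Definition _ (R : realType) := NormedModule.copy R[i] R[i]^o.

(* Conventions.  Everything takes place in C = R[i].  The completion of K is a
   subset Kh of C: the real line if K = Q, and C itself if K is imaginary
   quadratic.  The space M is the set of points (z, t) of the upper half-space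
   model of H^3 with z in Kh, so it is the totally geodesic hyperbolic plane
   over the real line when K = Q.  Its boundary is the subset of the Riemann
   sphere consisting of Kh and the point at infinity. *)

Section PSL2.
Variable R : realType.

Definition SL2 : Type := {A : 'M[R[i]]_2 | \det A == 1}.
HB.instance Definition _ := SubChoice.on SL2.

Implicit Types A B : SL2.

Lemma SL2_mul_subproof A B : \det (val A *m val B) == 1.
Proof. by rewrite det_mulmx (eqP (valP A)) (eqP (valP B)) mulr1. Qed.
Definition SL2_mul A B : SL2 := Sub (val A *m val B) (SL2_mul_subproof A B).

Lemma SL2_one_subproof : \det (1%:M : 'M[R[i]]_2) == 1.
Proof. by rewrite det1. Qed.
Definition SL2_one : SL2 := Sub 1%:M SL2_one_subproof.

Lemma SL2_inv_subproof A : \det (invmx (val A)) == 1.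
Proof. by rewrite det_inv (eqP (valP A)) invr1. Qed.
Definition SL2_inv A : SL2 := Sub (invmx (val A)) (SL2_inv_subproof A).

Lemma SL2_unit A : val A \in unitmx.
Proof. by rewrite unitmxE (eqP (valP A)) unitr1. Qed.

Lemma SL2_mulA : associative SL2_mul.
Proof. by move=> A B D; apply: val_inj; rewrite /= mulmxA. Qed.
Lemma SL2_mul1 : left_id SL2_one SL2_mul.
Proof. by move=> A; apply: val_inj; rewrite /= mul1mx. Qed.
Lemma SL2_mulr1 : right_id SL2_one SL2_mul.
Proof. by move=> A; apply: val_inj; rewrite /= mulmx1. Qed.
Lemma SL2_mulV : left_inverse SL2_one SL2_inv SL2_mul.
Proof. by move=> A; apply: val_inj; rewrite /= mulVmx // SL2_unit. Qed.
Lemma SL2_mulrV : right_inverse SL2_one SL2_inv SL2_mul.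
Proof. by move=> A; apply: val_inj; rewrite /= mulmxV // SL2_unit. Qed.

HB.instance Definition _ := isGroup.Build SL2
  SL2_mulA SL2_mul1 SL2_mulr1 SL2_mulV SL2_mulrV.

Definition SL2_pm : rel SL2 := fun A B => (val A == val B) || (val A == - val B).

Lemma SL2_pm_refl : reflexive SL2_pm.
Proof. by move=> A; rewrite /SL2_pm eqxx. Qed.
Lemma SL2_pm_sym : symmetric SL2_pm.
Proof.
by move=> A B; rewrite /SL2_pm eq_sym [val B == - _]eq_sym eqr_oppLR.
Qed.
Lemma SL2_pm_trans : transitive SL2_pm.
Proof.
move=> B A D /orP[] /eqP e1 /orP[] /eqP e2; apply/orP; rewrite e1 e2 ?opprK eqxx;
  by [left | right].
Qed.

Canonical SL2_pm_equiv := EquivRel SL2_pm SL2_pm_refl SL2_pm_sym SL2_pm_trans.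

Definition PSL2 : Type := {eq_quot SL2_pm}%qT.
HB.instance Definition _ := Choice.on PSL2.
HB.instance Definition _ := EqQuotient.on PSL2.

Implicit Types g h k : PSL2.

Definition PSL2_pi A : PSL2 := \pi_PSL2%qT A.
Definition PSL2_mul g h : PSL2 := PSL2_pi (SL2_mul (repr g) (repr h)).
Definition PSL2_one : PSL2 := PSL2_pi SL2_one.
Definition PSL2_inv g : PSL2 := PSL2_pi (SL2_inv (repr g)).

Lemma PSL2_piP A B : reflect (PSL2_pi A = PSL2_pi B) (SL2_pm A B).
Proof. by apply: (iffP idP) => [/eqmodP|/eqmodP]. Qed.

Lemma PSL2_pi_repr g : PSL2_pi (repr g) = g.
Proof. exact: reprK. Qed.

Lemma repr_PSL2_pi A : SL2_pm (repr (PSL2_pi A)) A.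
Proof. by apply/PSL2_piP; rewrite PSL2_pi_repr. Qed.

Lemma PSL2_piM A B : PSL2_mul (PSL2_pi A) (PSL2_pi B) = PSL2_pi (SL2_mul A B).
Proof.
apply/PSL2_piP; rewrite /SL2_pm /=.
case/orP: (repr_PSL2_pi A) => /eqP ->; case/orP: (repr_PSL2_pi B) => /eqP ->;
  by rewrite ?(mulNmx, mulmxN, opprK) eqxx ?orbT.
Qed.

Lemma PSL2_mulA : associative PSL2_mul.
Proof.
move=> g h k; rewrite -[g]PSL2_pi_repr -[h]PSL2_pi_repr -[k]PSL2_pi_repr.
by rewrite !PSL2_piM SL2_mulA.
Qed.
Lemma PSL2_mul1 : left_id PSL2_one PSL2_mul.
Proof. by move=> g; rewrite -[g]PSL2_pi_repr PSL2_piM SL2_mul1. Qed.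
Lemma PSL2_mulr1 : right_id PSL2_one PSL2_mul.
Proof. by move=> g; rewrite -[g]PSL2_pi_repr PSL2_piM SL2_mulr1. Qed.
Lemma PSL2_mulV : left_inverse PSL2_one PSL2_inv PSL2_mul.
Proof. by move=> g; rewrite -[X in PSL2_mul _ X]PSL2_pi_repr PSL2_piM SL2_mulV. Qed.
Lemma PSL2_mulrV : right_inverse PSL2_one PSL2_inv PSL2_mul.
Proof. by move=> g; rewrite -[X in PSL2_mul X _]PSL2_pi_repr PSL2_piM SL2_mulrV. Qed.

HB.instance Definition _ := isGroup.Build PSL2
  PSL2_mulA PSL2_mul1 PSL2_mulr1 PSL2_mulV PSL2_mulrV.

(* A matrix of determinant 1 representing g, well defined up to sign. *)
Definition mat g : 'M[R[i]]_2 := val (repr g).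

End PSL2.

Section Arithmetic.
Variables (R : realType) (K : fieldExtType rat) (iota : {rmorphism K -> R[i]}).

Definition rational_or_imaginary_quadratic : Prop :=
  \dim {:K} = 1%N \/ (\dim {:K} = 2%N /\ exists x : K, Im (iota x) != 0).

Definition Khat : set R[i] := [set z | \dim {:K} = 1%N -> Im z = 0].

Definition ring_of_integers : set R[i] :=
  [set iota x | x in [set x : K | integralOver (intr : int -> K) x]].

Definition PSL2_integers : set (PSL2 R) :=
  [set g | forall i j, ring_of_integers (mat g i j)].

Definition finite_index_subgroup (Gam G : set (PSL2 R)) : Prop :=
  [/\ Gam `<=` G, group_closed [in Gam] &
      finite_set [set [set (g * k)%g | k in Gam] | g in G]].

Definition monic_quadratic_irreducible (p : {poly K}) : Prop :=
  [/\ p \is monic, irreducible_poly p & size p = 3%N].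

Definition quadratic_irrational (a : R[i]) : Prop :=
  Khat a /\ exists2 p : {poly K}, monic_quadratic_irreducible p &
                                  root (map_poly iota p) a.

Definition galois_conj (a : R[i]) : R[i] :=
  xget 0 [set b | exists2 p : {poly K}, monic_quadratic_irreducible p &
                  map_poly iota p = ('X - a%:P) * ('X - b%:P)].

Definition height (a : R[i]) : R := 2 / normc (a - galois_conj a).

End Arithmetic.

Section HyperbolicSpace.
Variable R : realType.

Definition ch (s : R) : R := (expR s + expR (- s)) / 2.
Definition sh (s : R) : R := (expR s - expR (- s)) / 2.
Definition arcosh (u : R) : R := ln (u + Num.sqrt (u ^+ 2 - 1)).

Definition hpoint : Type := (R[i] * R)%type.
HB.instance Definition _ := Topological.on hpoint.
HB.instance Definition _ := Pointed.on hpoint.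

(* (p, u) stands for the hyperbolic tangent vector p.2 * u at p. *)
Definition vect : Type := (hpoint * hpoint)%type.
HB.instance Definition _ := Topological.on vect.
HB.instance Definition _ := Pointed.on vect.

Definition bdry : Type := one_point_compactification R[i].
HB.instance Definition _ := Topological.on bdry.
HB.instance Definition _ := Pointed.on bdry.

Definition bdry_borel := g_sigma_algebraType (@open bdry).

Implicit Types (x y : hpoint) (v w : vect) (xi : bdry) (g : PSL2 R)
  (Kh : set R[i]) (F : vect -> R) (Gam : set (PSL2 R)).

Definition hdist x y : R :=
  arcosh (1 + (normc (x.1 - y.1) ^+ 2 + (x.2 - y.2) ^+ 2) / (2 * x.2 * y.2)).

Definition upper Kh : set hpoint := [set x | Kh x.1 /\ 0 < x.2].

Definition T1 Kh : set vect :=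
  [set v | [/\ upper Kh v.1, Kh v.2.1 & normc v.2.1 ^+ 2 + v.2.2 ^+ 2 = 1]].

Definition foot v : hpoint := v.1.

(* Geodesic flow.  The geodesic line with initial point (z, t) and normalised
   direction (zeta, tau) is
     s |-> (z + t * sinh s / D(s) * zeta, t / D(s)),
   where D(s) = cosh s - tau * sinh s. *)
Definition flow (s : R) v : vect :=
  let: ((z, t), (zeta, tau)) := v in
  let D := ch s - tau * sh s in
  ((z + (t * sh s / D)%:C%C * zeta, t / D),
   ((D^-1)%:C%C * zeta, (tau * ch s - sh s) / D)).

Definition flip v : vect := (v.1, (- v.2.1, - v.2.2)).

(* The closure of M is seen inside the one-point compactification of C x R. *)
Definition tends_to {T : Type} (P : set_system T) (f : T -> hpoint) xi : Prop :=
  (fun i => Some (f i) : one_point_compactification hpoint) @ P -->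
  (omap (fun z : R[i] => (z, 0 : R)) xi : one_point_compactification hpoint).

Definition vplus v : bdry :=
  xget (None : bdry) [set xi | tends_to +oo (fun s => foot (flow s v)) xi].
Definition vminus v : bdry :=
  xget (None : bdry) [set xi | tends_to -oo (fun s => foot (flow s v)) xi].

Definition homography g (z : R[i]) : R[i] :=
  (mat g 0 0 * z + mat g 0 1) / (mat g 1 0 * z + mat g 1 1).

Definition bact g xi : bdry :=
  match xi with
  | Some z => if mat g 1 0 * z + mat g 1 1 == 0 then None
              else Some (homography g z)
  | None => if mat g 1 0 == 0 then None else Some (mat g 0 0 / mat g 1 0)
  end.

(* Poincare extension. *)
Definition hact g x : hpoint :=
  let: (z, t) := x in
  let q := mat g 1 0 * z + mat g 1 1 in
  let N := normc q ^+ 2 + normc (mat g 1 0) ^+ 2 * t ^+ 2 in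
  (((mat g 0 0 * z + mat g 0 1) * conjc q
    + mat g 0 0 * conjc (mat g 1 0) * (t ^+ 2)%:C%C) / N%:C%C, t / N).

(* The differential of the isometry g, as the unit vector whose geodesic line
   is the image under g of the geodesic line of v. *)
Definition tact g v : vect :=
  xget v [set w | T1 setT w /\
                  forall s, foot (flow s w) = hact g (foot (flow s v))].

Definition limit_set Gam x0 : set bdry :=
  [set xi | exists2 u : nat -> PSL2 R, (forall n, Gam (u n)) &
            tends_to \oo (fun n => hact (u n) x0) xi].

Definition dist_T1 v w : R :=
  sup [set hdist (foot (flow s v)) (foot (flow s w)) | s in `[0, 1]].

Definition holder Kh F : Prop :=
  exists a c : R, [/\ 0 < a <= 1, 0 < c &
    forall v w, T1 Kh v -> T1 Kh w -> dist_T1 v w <= 1 ->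
      `|F v - F w| <= c * dist_T1 v w `^ a].

Definition potential Kh Gam F : Prop :=
  holder Kh F /\
  forall g v, Gam g -> T1 Kh v -> F (tact g v) = F v.

(* For x = y any unit vector at x qualifies; it is then only used over a
   segment of length 0. *)
Definition vect_to x y : vect :=
  xget (x, (0, 1)) [set v | [/\ T1 setT v, foot v = x &
                                foot (flow (hdist x y) v) = y]].

Definition segment_int F x y : R :=
  \int[lebesgue_measure]_(t in `[0, hdist x y]) F (flow t (vect_to x y)).

Definition critical_exponent Gam F x y : \bar R :=
  limn_esup (fun n : nat => (n%:R^-1)%:E *
    lne (\esum_(g in [set g | Gam g /\
                        (n%:R - 1 < hdist x (hact g y) <= n%:R)%R])
           (expR (segment_int F x (hact g y)))%:E))%E.

Section GibbsMeasures.
Variables (Kh : set R[i]) (Gam : set (PSL2 R)) (x0 : hpoint).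

Definition crit_delta F : R := fine (critical_exponent Gam F x0 x0).

Definition cocycle F xi x y : R :=
  xget 0 [set c : R | forall v, T1 Kh v -> vplus v = xi ->
    segment_int (fun w => F w - crit_delta F) y (foot (flow t v)) -
    segment_int (fun w => F w - crit_delta F) x (foot (flow t v))
      @[t --> +oo] --> c].

Definition msupport (m : set bdry_borel -> \bar R) : set bdry :=
  [set xi | forall U : set bdry, open U -> U xi -> (0 < m U)%E].

Definition patterson_density F
    (mu : hpoint -> {finite_measure set bdry_borel -> \bar R}) : Prop :=
  [/\ forall x, upper Kh x -> mu x setT <> 0%E /\
                              msupport (mu x) = limit_set Gam x0,
      forall g x (A : set bdry_borel), Gam g -> upper Kh x -> measurable A ->
        pushforward (mu x) (bact g : bdry_borel -> bdry_borel) A =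
        mu (hact g x) A &
      forall x y (A : set bdry_borel), upper Kh x -> upper Kh y ->
        measurable A ->
        mu x A = (\int[mu y]_(xi in A) (expR (- cocycle F xi x y))%:E)%E].

Definition hopf_time v : R :=
  xget 0 [set t | forall s, hdist x0 (foot (flow (- t) v)) <=
                            hdist x0 (foot (flow s v))].

Definition hopf v : bdry_borel * bdry_borel * R :=
  (vminus v, vplus v, hopf_time v).

Definition hopf_inv (p : bdry_borel * bdry_borel * R) : vect :=
  xget (x0, (0, 1)) [set v | T1 Kh v /\ hopf v = p].

Definition gibbs_lift F
    (mu' mu : hpoint -> {finite_measure set bdry_borel -> \bar R})
    (A : set vect) : \bar R :=
  (\int[mu' x0 \x mu x0 \x (@lebesgue_measure R)]_(p in hopf @` (A `&` T1 Kh))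
     (expR (cocycle (F \o flip) p.1.1 x0 (foot (hopf_inv p)) +
            cocycle F p.1.2 x0 (foot (hopf_inv p))))%:E)%E.

(* A measure on Gam \ T^1 M is a measure on the sigma-algebra of the Borel
   sets that are Gam-invariant within T^1 M. *)
Definition invariant_borel : set_system vect :=
  [set A | <<s @open vect >> A /\
           forall g v, Gam g -> T1 Kh v -> A (tact g v) <-> A v].

Definition quotient_T1 := g_sigma_algebraType invariant_borel.

(* m is the measure induced by the lift: for every Borel map f >= 0 on T^1 M,
   the lift of f has the integral over the quotient of
   v |-> sum over g in Gam of f (g v); taking indicator functions suffices. *)
Definition gibbs_measure F
    (mu' mu : hpoint -> {finite_measure set bdry_borel -> \bar R})
    (m : {measure set quotient_T1 -> \bar R}) : Prop :=
  forall A : set vect, <<s @open vect >> A -> A `<=` T1 Kh ->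
    gibbs_lift F mu' mu A =
    (\int[m]_(v in T1 Kh) counting [set g | Gam g /\ A (tact g v)])%E.

End GibbsMeasures.

Definition cyclic_subgroup (g0 : PSL2 R) : set (PSL2 R) :=
  [set g | exists n, g = (g0 ^+ n)%g \/ g = (g0 ^- n)%g].

Definition primitive Gam (g0 : PSL2 R) : Prop :=
  Gam g0 /\ forall (g : PSL2 R) n, Gam g -> (1 < n)%N -> (g ^+ n)%g <> g0.

Definition bdry_orbit Gam (S : set R[i]) : set R[i] :=
  [set r | exists g z, [/\ Gam g, S z & bact g (Some z) = Some r]].

Definition frechet (E : set R[i]) : set_system R[i] :=
  [set A | finite_set (E `\` A)].

Definition slowly_varying (f : R -> R) : Prop :=
  [/\ forall x : R, 0 <= x -> 0 < f x,
      measurable_fun (`[0, +oo[ : set R) f &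
      exists A B : R, [/\ 0 < B, 1 <= A &
        forall x y : R, 0 <= x -> 0 <= y -> `|x - y| <= B -> f y <= A * f x]].

End HyperbolicSpace.

(* Main.v *)
Require Import Defs.
From HB Require Import structures.
From mathcomp Require Import all_boot all_order all_algebra all_field.
From mathcomp Require Import generic_quotient monoid.
From mathcomp Require Import all_classical all_reals all_analysis.
From mathcomp Require Import complex.
From mathcomp Require Import measurable_realfun.
From mathcomp Require Import ring lra zify.

(* Let u be alpha0 or its conjugate and let kappa > 0 be minus the mean of F - delta over the closed
   geodesic of gamma0, oriented towards u.  Then delta - delta0 is the smaller of the two values of
   kappa.  By the shadow lemma, the Patterson measure of a ball B(r, y) around a point r of the orbit
   of u is w(r) (y h(r))^kappa up to bounded factors, as long as y h(r) and r stay bounded; the lower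
   bound also holds for the restriction of the measure to any invariant set of positive measure.
   Orbit points of height about e^n are separated by about e^-n, so that their weights w(r) have a
   bounded sum; when the integral converges, the Borel-Cantelli lemma concludes.

   When the integral diverges, suppose that the invariant set N of badly approximable points has
   positive measure.  Since the Gibbs measure is finite, mass cannot escape to the cusps: for each n,
   a fixed proportion of N near u consists of points x such that (x, e^-n) is at bounded distance from
   the orbit of x0, hence such that x is within about e^-n of an orbit point of height about e^n.  The
   weights at level n thus have a sum bounded below.  The unions over a level of the balls of radius
   phi(e^n) e^-n, intersected with N, are quasi-independent by separation and their measures have
   divergent sum, so their limsup has positive measure: a contradiction. *)

Set Implicit Arguments.
Unset Strict Implicit.
Unset Printing Implicit Defensive.

Import Order.TTheory GRing.Theory Num.Theory.
Import numFieldNormedType.Exports.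
Import Normc.

Local Open Scope classical_set_scope.
Local Open Scope ring_scope.

(** The potential is Hölder only at distances at most 1 and may be unbounded in the cusps. It grows
    at most linearly with the distance to the orbit of [x0]. Asymptotic rays approach each other
    exponentially, which beats this growth, so the cocycles exist; but comparison constants are
    uniform only near the orbit. Hence shadows are centred at images of a point of the axis of
    gamma0, and the mass high in the cusps needs a separate control.

    That control is uniform in n for the following reason: if a vector is far from the orbit now and
    was near the orbit n units of time ago, then the number of group elements carrying its past
    position near [x0] is bounded independently of n. The lift of such vectors is thus at most a
    constant times the measure of the far part of the quotient.

    The potential need not be reversible, so the two orientations of the axis have different
    exponents and are treated separately throughout. Slow variation makes the set of badly
    approximable points invariant, as the lower shadow bound requires. The separation of orbit
    points comes from the resultant of two integral quadratic forms, a nonzero algebraic integer. *)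

Local Notation reC := complex.Re.
Local Notation imC := complex.Im.

(** * Hyperbolic cosine and sine, and moduli of complex numbers *)

Section HyperbolicFunctions.
Context {R : realType}.
Implicit Types s t u : R.

Lemma le_of_sqr (a b : R) : 0 <= b -> a ^+ 2 <= b ^+ 2 -> a <= b.
Proof. by move=> b0 h; rewrite leNgt; apply/negP => ab; nra. Qed.

Lemma sqr_le (a b : R) : 0 <= a -> a <= b -> a ^+ 2 <= b ^+ 2.
Proof. by move=> a0 ab; nra. Qed.

Lemma normc2 (z : R[i]) : normc z ^+ 2 = reC z ^+ 2 + imC z ^+ 2.
Proof. by case: z => a b /=; rewrite sqr_sqrtr // addr_ge0 ?sqr_ge0. Qed.

Lemma normc_ge0' (z : R[i]) : 0 <= normc z.
Proof. by case: z => a b /=; rewrite sqrtr_ge0. Qed.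

Lemma normc_gt0 (z : R[i]) : (0 < normc z) = (z != 0).
Proof.
rewrite lt0r normc_ge0' andbT; apply/idP/idP; apply: contra.
  by move=> /eqP ->; rewrite normc0.
by move=> /eqP /eq0_normc ->.
Qed.

Lemma expR_mulN s : expR s * expR (- s) = 1.
Proof. by rewrite -expRD subrr expR0. Qed.

Lemma ch2sh2 s : ch s ^+ 2 - sh s ^+ 2 = 1.
Proof. rewrite /ch /sh; have := expR_mulN s; nra. Qed.

Lemma chD s t : ch (s + t) = ch s * ch t + sh s * sh t.
Proof. rewrite /ch /sh opprD !expRD; by field. Qed.

Lemma shD s t : sh (s + t) = sh s * ch t + ch s * sh t.
Proof. rewrite /ch /sh opprD !expRD; by field. Qed.

Lemma chN s : ch (- s) = ch s.
Proof. by rewrite /ch opprK addrC. Qed.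

Lemma shN s : sh (- s) = - sh s.
Proof. by rewrite /sh opprK -mulNr opprB. Qed.

Lemma ch0 : ch 0 = 1 :> R.
Proof. by rewrite /ch oppr0 expR0; lra. Qed.

Lemma sh0 : sh 0 = 0 :> R.
Proof. by rewrite /sh oppr0 expR0; lra. Qed.

Lemma ch_ge1 s : 1 <= ch s.
Proof.
have := expR_mulN s; have := expR_gt0 s; have := expR_gt0 (- s); rewrite /ch.
set x := expR s; set y := expR (- s) => y0 x0 xy.
have := sqr_ge0 (x - y); rewrite ler_pdivlMr // mul1r => h; rewrite leNgt; apply/negP => h'; nra.
Qed.

Lemma ch_gt0 s : 0 < ch s.
Proof. exact: lt_le_trans (ch_ge1 s). Qed.

Lemma sh_ge0 s : 0 <= s -> 0 <= sh s.
Proof.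
by move=> s0; rewrite /sh divr_ge0 // subr_ge0 ler_expR; lra.
Qed.

Lemma sh_gt0 s : 0 < s -> 0 < sh s.
Proof.
by move=> s0; rewrite /sh divr_gt0 // subr_gt0 ltr_expR; lra.
Qed.

Lemma sh_eq0 s : sh s = 0 -> s = 0.
Proof.
case: (ltgtP s 0) => // s0 h; last by have := sh_gt0 s0; rewrite h ltxx.
by have := @sh_gt0 (- s); rewrite shN h oppr0 ltxx oppr_gt0 => /(_ s0).
Qed.

Lemma sh_le s t : s <= t -> sh s <= sh t.
Proof.
move=> st; rewrite /sh ler_pM2r ?invr_gt0 //.
by apply: lerB; rewrite ler_expR // lerN2.
Qed.

Lemma abs_sh_lt_ch s : `|sh s| < ch s.
Proof.
rewrite ltr_norml /sh /ch; have := expR_gt0 s; have := expR_gt0 (- s).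
by move=> *; apply/andP; split; lra.
Qed.

Lemma ch_norm s : ch `|s| = ch s.
Proof. by case: (ger0P s) => // _; rewrite chN. Qed.

Lemma ch_le s t : `|s| <= `|t| -> ch s <= ch t.
Proof.
rewrite -(ch_norm s) -(ch_norm t); move: `|s| `|t| (normr_ge0 s) => x y x0 xy.
have sx := sh_ge0 x0; have sxy := sh_le xy; have h1 := ch2sh2 x; have h2 := ch2sh2 y.
apply: le_of_sqr; first exact/ltW/ch_gt0.
have : sh x ^+ 2 <= sh y ^+ 2 by rewrite ler_pXn2r ?nnegrE // (le_trans sx).
lra.
Qed.

Lemma ch_lt s t : `|s| < `|t| -> ch s < ch t.
Proof.
move=> st; rewrite lt_neqAle ch_le ?ltW // andbT; apply/eqP => e.
move: st e; rewrite -(ch_norm s) -(ch_norm t).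
move: `|s| `|t| (normr_ge0 s) => x y x0 xy e.
have sx := sh_ge0 x0; have := @sh_gt0 (y - x); rewrite subr_gt0 => /(_ xy) h0.
have : sh (y - x) = 0.
  rewrite shD chN shN e.
  have h : sh y ^+ 2 = sh x ^+ 2.
    by have := ch2sh2 x; have := ch2sh2 y; rewrite e; lra.
  suff -> : sh y = sh x by ring.
  move: h => /eqP; rewrite eqf_sqr => /orP[/eqP //|/eqP h].
      by have := sh_ge0 (ltW (le_lt_trans x0 xy)); lra.
by move=> z; rewrite z ltxx in h0.
Qed.

Lemma ch_le_inv s t : ch s <= ch t -> `|s| <= `|t|.
Proof. by move=> h; rewrite leNgt; apply/negP => /ch_lt; rewrite ltNge h. Qed.

Lemma ch_arcosh u : 1 <= u -> ch (arcosh u) = u.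
Proof.
move=> u1; rewrite /ch /arcosh.
set r := Num.sqrt _.
have r2 : r ^+ 2 = u ^+ 2 - 1 by rewrite sqr_sqrtr //; nra.
have r0 : 0 <= r by rewrite sqrtr_ge0.
have p : 0 < u + r by lra.
rewrite expRN lnK ?posrE //.
have -> : (u + r)^-1 = u - r; last by lra.
by apply: (mulfI (lt0r_neq0 p)); rewrite mulfV ?lt0r_neq0 //; lra.
Qed.

Lemma arcosh_ge0 u : 1 <= u -> 0 <= arcosh u.
Proof.
move=> u1; rewrite /arcosh ln_ge0 //.
by have := sqrtr_ge0 (u ^+ 2 - 1); lra.
Qed.

Lemma arcosh_ch s : arcosh (ch s) = `|s|.
Proof.
apply/eqP; rewrite eq_le -[leLHS]ger0_norm ?arcosh_ge0 ?ch_ge1 //.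
rewrite ch_le_inv ?ch_arcosh ?ch_ge1 //=.
by rewrite -[leRHS]ger0_norm ?arcosh_ge0 ?ch_ge1 // ch_le_inv ?ch_arcosh ?ch_ge1.
Qed.

Lemma arcosh_le u u' : 1 <= u -> u <= u' -> arcosh u <= arcosh u'.
Proof.
move=> u1 uu'; have u1' := le_trans u1 uu'.
have := @ch_le_inv (arcosh u) (arcosh u'); rewrite !ch_arcosh // => /(_ uu').
by rewrite !ger0_norm ?arcosh_ge0.
Qed.

Lemma arcosh_leP u s : 0 <= s -> 1 <= u -> (arcosh u <= s) = (u <= ch s).
Proof.
move=> s0 u1; rewrite -[s in LHS]ger0_norm // -arcosh_ch; apply/idP/idP; last first.
  exact: arcosh_le.
move=> h; rewrite -(ch_arcosh u1) -(ch_arcosh (ch_ge1 s)).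
by apply: ch_le; rewrite !ger0_norm ?arcosh_ge0 ?ch_ge1.
Qed.

(** The right-hand side is (e^(s/2) - e^(-s/2))^2 / 2, and e^x >= 1 + x bounds the difference from
    below. With [ch_ub] it converts bounds on cosh d into bounds on d and back. *)
Lemma ch_lb s : s ^+ 2 / 8 <= ch s - 1.
Proof.
wlog s0 : s / 0 <= s.
  move=> h; case: (lerP 0 s) => [/h //|/ltW s0].
  by rewrite -chN -(sqrrN s) h // oppr_ge0.
have e1 := @expR_ge1Dx R (s / 2).
have e2 := expR_mulN (s / 2).
have -> : ch s - 1 = (expR (s / 2) - expR (- (s / 2))) ^+ 2 / 2.
  have es : s = s / 2 + s / 2 by field.
  rewrite /ch {1 2}es opprD !expRD.
  by move: e2; set x := expR (s / 2); set y := expR _ => xy; lra.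
move: e1 e2; set x := expR _; set y := expR _ => e1 e2.
have y1 : y <= 1 by rewrite -expR0 ler_expR; lra.
have h : s / 2 <= x - y by lra.
have : (s / 2) ^+ 2 <= (x - y) ^+ 2 by apply: sqr_le => //; lra.
by lra.
Qed.

End HyperbolicFunctions.

(** * Distance and geodesic flow in the upper half-space *)

Section Geometry.
Context {R : realType}.
Implicit Types (p q r : hpoint R) (v w : vect R) (s t : R) (Kh : set R[i]).

Lemma reCD (z w : R[i]) : reC (z + w) = reC z + reC w.
Proof. by case: z w => a b [c d]. Qed.
Lemma imCD (z w : R[i]) : imC (z + w) = imC z + imC w.
Proof. by case: z w => a b [c d]. Qed.
Lemma reCN (z : R[i]) : reC (- z) = - reC z.
Proof. by case: z. Qed.
Lemma imCN (z : R[i]) : imC (- z) = - imC z.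
Proof. by case: z. Qed.
Lemma reCZ (a : R) (z : R[i]) : reC (a%:C%C * z) = a * reC z.
Proof. by case: z => c d /=; rewrite mul0r subr0. Qed.
Lemma imCZ (a : R) (z : R[i]) : imC (a%:C%C * z) = a * imC z.
Proof. by case: z => c d /=; rewrite mul0r addr0. Qed.
Definition reimE := (reCD, imCD, reCN, imCN, reCZ, imCZ).

Lemma complex_eq (z w : R[i]) : reC z = reC w -> imC z = imC w -> z = w.
Proof. by case: z w => a b [c d] /= -> ->. Qed.

(* The hyperbolic cosine of the distance. *)
Definition cd p q : R :=
  1 + (normc (p.1 - q.1) ^+ 2 + (p.2 - q.2) ^+ 2) / (2 * p.2 * q.2).

(** Directions are stored with the height factored out, so for a common foot this Euclidean product
    is the cosine of the hyperbolic angle. *)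
Definition ip v w : R :=
  reC v.2.1 * reC w.2.1 + imC v.2.1 * imC w.2.1 + v.2.2 * w.2.2.

Lemma hdistE p q : hdist p q = arcosh (cd p q).
Proof. by []. Qed.

Lemma T1_setT Kh v : T1 Kh v -> T1 setT v.
Proof. by move=> [[_ h] _ h1]; split => //; split. Qed.

Lemma T1_gt0 Kh v : T1 Kh v -> 0 < v.1.2.
Proof. by move=> [[]]. Qed.

Lemma T1_norm Kh v : T1 Kh v -> reC v.2.1 ^+ 2 + imC v.2.1 ^+ 2 + v.2.2 ^+ 2 = 1.
Proof. by move=> [_ _]; rewrite normc2. Qed.

Lemma flow_den_gt0 Kh v s : T1 Kh v -> 0 < ch s - v.2.2 * sh s.
Proof.
move=> /T1_norm h; have := abs_sh_lt_ch s; have := ch_gt0 s.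
move: h; set a := reC _; set b := imC _; move: v.2.2 (sh s) (ch s) => c S C h C0.
rewrite ltr_norml => /andP[h1 h2].
have c1 : c ^+ 2 <= 1 by have := sqr_ge0 a; have := sqr_ge0 b; lra.
have : (-1 <= c) /\ (c <= 1) by split; nra.
by move=> [c2 c3]; case: (lerP 0 S) => S0; nra.
Qed.

(** The metric facts below (triangle inequality, uniqueness of geodesics, exponential contraction)
    are read off from this one identity, with the sign of [ip] as the only geometric input. *)
Lemma law_of_cosines Kh v w a b : T1 Kh v -> T1 Kh w -> foot v = foot w ->
  cd (foot (flow a v)) (foot (flow b w)) = ch a * ch b - sh a * sh b * ip v w.
Proof.
move=> Tv Tw; have := flow_den_gt0 a Tv; have := flow_den_gt0 b Tw.
have nv := T1_norm Tv; have nw := T1_norm Tw; have t0 := T1_gt0 Tw.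
case: v w {Tv Tw} nv nw t0 => [[z t] [zeta tau]] [[z' t'] [zeta' tau']] /=.
rewrite /foot /cd /= => nv nw t0 + + [-> ->]; rewrite normc2 !reimE /ip /=.
move: nv nw; set x1 := reC zeta; set y1 := imC zeta.
set x2 := reC zeta'; set y2 := imC zeta'.
have := ch2sh2 a; have := ch2sh2 b.
move: (ch a) (sh a) (ch b) (sh b) (reC z') (imC z') => C S C' S' x y hb ha nv nw.
set D' := C' - _; set D := C - _ => D'0 D0.
have dn : D != 0 by rewrite gt_eqF.
have dn' : D' != 0 by rewrite gt_eqF.
have tn : t' != 0 by rewrite gt_eqF.
have -> : (x + t' * S / D * x1 - (x + t' * S' / D' * x2)) ^+ 2 +
  (y + t' * S / D * y1 - (y + t' * S' / D' * y2)) ^+ 2 + (t' / D - t' / D') ^+ 2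
  = (t' / D) * (t' / D') * ((((S * D' * x1 - S' * D * x2) ^+ 2 +
      (S * D' * y1 - S' * D * y2) ^+ 2 + (D' - D) ^+ 2)) / (D * D')).
  by field; rewrite dn dn'.
(* The four correction terms vanish by cosh^2 - sinh^2 = 1 and by the unit norms; adding them makes
   the equality a ring identity. *)
have -> : (S * D' * x1 - S' * D * x2) ^+ 2 +
      (S * D' * y1 - S' * D * y2) ^+ 2 + (D' - D) ^+ 2 =
   2 * (D * D') * (C * C' - S * S' * (x1 * x2 + y1 * y2 + tau * tau') - 1)
   - D' ^+ 2 * (C ^+ 2 - S ^+ 2 - 1) - D ^+ 2 * (C' ^+ 2 - S' ^+ 2 - 1)
   + S ^+ 2 * D' ^+ 2 * (x1 ^+ 2 + y1 ^+ 2 + tau ^+ 2 - 1)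
   + S' ^+ 2 * D ^+ 2 * (x2 ^+ 2 + y2 ^+ 2 + tau' ^+ 2 - 1).
  by rewrite /D /D'; ring.
rewrite nv nw ha hb !subrr !mulr0 !subr0 !addr0.
by field; rewrite dn dn' tn.
Qed.

Lemma cd_ge1 p q : 0 < p.2 -> 0 < q.2 -> 1 <= cd p q.
Proof.
move=> p0 q0; rewrite /cd lerDl divr_ge0 ?addr_ge0 ?sqr_ge0 //.
by rewrite !mulr_ge0 // ltW.
Qed.

Lemma cd_sym p q : cd p q = cd q p.
Proof.
rewrite /cd -(normcN (p.1 - q.1)) opprB -(sqrrN (p.2 - q.2)) opprB.
by congr (1 + _ / _); ring.
Qed.

Lemma ch_hdist p q : 0 < p.2 -> 0 < q.2 -> ch (hdist p q) = cd p q.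
Proof. by move=> p0 q0; rewrite hdistE ch_arcosh // cd_ge1. Qed.

Lemma hdist_sym p q : hdist p q = hdist q p.
Proof. by rewrite !hdistE cd_sym. Qed.

Lemma hdist_ge0 p q : 0 < p.2 -> 0 < q.2 -> 0 <= hdist p q.
Proof. by move=> p0 q0; rewrite hdistE arcosh_ge0 // cd_ge1. Qed.

Lemma hdist_le p q s : 0 < p.2 -> 0 < q.2 -> 0 <= s -> (hdist p q <= s) = (cd p q <= ch s).
Proof. by move=> p0 q0 s0; rewrite hdistE arcosh_leP // cd_ge1. Qed.

Lemma hdistxx p : hdist p p = 0.
Proof.
by rewrite hdistE /cd !subrr normc0 expr0n /= addr0 mul0r addr0 -ch0 arcosh_ch normr0.
Qed.

Lemma cd_eq1 p q : 0 < p.2 -> 0 < q.2 -> cd p q = 1 -> p = q.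
Proof.
move=> p0 q0; rewrite /cd normc2 !reimE => h.
have {h} h : (reC p.1 - reC q.1) ^+ 2 + (imC p.1 - imC q.1) ^+ 2 + (p.2 - q.2) ^+ 2 = 0.
  have d0 : 2 * p.2 * q.2 != 0 by rewrite !mulf_neq0 ?gt_eqF.
  by apply: (mulIf (invr_neq0 d0)); lra.
move: h; rewrite (surjective_pairing p) (surjective_pairing q) /=.
have := sqr_ge0 (reC p.1 - reC q.1); have := sqr_ge0 (imC p.1 - imC q.1).
have := sqr_ge0 (p.2 - q.2) => h1 h2 h3 h.
have /eqP : (p.2 - q.2) ^+ 2 = 0 by lra.
have /eqP : (reC p.1 - reC q.1) ^+ 2 = 0 by lra.
have /eqP : (imC p.1 - imC q.1) ^+ 2 = 0 by lra.
rewrite !sqrf_eq0 !subr_eq0 => /eqP e1 /eqP e2 /eqP e3.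
by congr (_, _) => //; apply: complex_eq.
Qed.

Lemma hdist_eq0 p q : 0 < p.2 -> 0 < q.2 -> hdist p q = 0 -> p = q.
Proof. by move=> p0 q0 h; apply: cd_eq1 => //; rewrite -ch_hdist // h ch0. Qed.

Lemma flow0 v : flow 0 v = v.
Proof.
case: v => [[z t] [ze ta]] /=.
by rewrite ch0 sh0 !mulr0 subr0 invr1 !mulr1 mul0r addr0 mul1r subr0.
Qed.

Lemma flow_gt0 Kh v s : T1 Kh v -> 0 < (flow s v).1.2.
Proof.
move=> Tv; have := flow_den_gt0 s Tv; have := T1_gt0 Tv.
by case: v {Tv} => [[z t] [ze ta]] /= *; rewrite divr_gt0.
Qed.

Lemma foot_flow_gt0 Kh v s : T1 Kh v -> 0 < (foot (flow s v)).2.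
Proof. exact: flow_gt0. Qed.

Lemma flowD Kh v s t : T1 Kh v -> flow s (flow t v) = flow (s + t) v.
Proof.
move=> Tv; have := flow_den_gt0 t Tv; have := flow_den_gt0 (s + t) Tv.
case: v {Tv} => [[z h] [ze ta]] /=.
rewrite chD shD; have := ch2sh2 s; have := ch2sh2 t.
move: (ch s) (sh s) (ch t) (sh t) => C S C' S' ht hs d0 d'0.
have d1 : C' - ta * S' != 0 by rewrite gt_eqF.
have d2 : C * C' + S * S' - ta * (S * C' + C * S') != 0 by rewrite gt_eqF.
have e : C - (ta * C' - S') / (C' - ta * S') * S =
   (C * C' + S * S' - ta * (S * C' + C * S')) / (C' - ta * S') by field.
rewrite e !invf_div; congr (_, _, (_, _)).
- rewrite -addrA; congr (_ + _); rewrite mulrA -rmorphM -mulrDl -rmorphD.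
  congr (_%:C%C * _).
  move: d1 d2; set d1 := C' - _; set d2 := C * C' + _ - _ => n1 n2.
  have key : S' * d2 = (S * C' + C * S') * d1 - S.
    have : S' * d2 - ((S * C' + C * S') * d1 - S) = - S * (C' ^+ 2 - S' ^+ 2 - 1).
      by rewrite /d1 /d2; ring.
    by rewrite ht subrr mulr0 => /eqP; rewrite subr_eq0 => /eqP.
  have -> : h * S' / d1 = h * (S' * d2) / (d2 * d1) by field; rewrite n1 n2.
  by rewrite key; field; rewrite n1 n2.
- by field; rewrite d1 d2.
- rewrite mulrA -rmorphM; congr (_%:C%C * _).
  by field; rewrite d1 d2.
- by field; rewrite d1 d2.
Qed.

(** Stability under real combinations is what the explicit flow preserves, so the plane over the
    real line and the whole space are handled by one argument. *)
Definition real_subspace Kh := forall (a b : R) (z w : R[i]), Kh z -> Kh w ->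
  Kh (a%:C%C * z + b%:C%C * w).

Lemma real_subspace_setT : real_subspace setT.
Proof. by []. Qed.

Lemma real_subspaceZ Kh (a : R) (z : R[i]) : real_subspace Kh -> Kh z -> Kh (a%:C%C * z).
Proof. by move=> h kz; have := h a 0 z z kz kz; rewrite mul0r addr0. Qed.

Lemma real_subspaceD Kh (z w : R[i]) : real_subspace Kh -> Kh z -> Kh w -> Kh (z + w).
Proof. by move=> h kz kw; have := h 1 1 z w kz kw; rewrite !mul1r. Qed.

Lemma real_subspaceB Kh (z w : R[i]) : real_subspace Kh -> Kh z -> Kh w -> Kh (z - w).
Proof. by move=> h kz kw; have := h 1 (-1) z w kz kw; rewrite rmorphN !mul1r mulN1r. Qed.

Lemma T1_flow Kh v s : real_subspace Kh -> T1 Kh v -> T1 Kh (flow s v).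
Proof.
move=> rK Tv; have := flow_den_gt0 s Tv; have := T1_norm Tv.
case: v Tv => [[z t] [ze ta]] [[/= Kz t0] Kze _] /= n d0; split => /=.
- split => /=; last by rewrite divr_gt0.
  by apply: real_subspaceD => //; apply: real_subspaceZ.
- exact: real_subspaceZ.
- rewrite normc2 !reCZ !imCZ.
  have d1 : ch s - ta * sh s != 0 by rewrite gt_eqF.
  move: (ch2sh2 s) d1; move: (ch s) (sh s) => C S h d1.
  have -> : ((C - ta * S)^-1 * reC ze) ^+ 2 + ((C - ta * S)^-1 * imC ze) ^+ 2 +
     ((ta * C - S) / (C - ta * S)) ^+ 2 =
     (reC ze ^+ 2 + imC ze ^+ 2 + ta ^+ 2 + ta ^+ 2 * (C ^+ 2 - S ^+ 2 - 1) - (C ^+ 2 - S ^+ 2)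
     + (C - ta * S) ^+ 2) / (C - ta * S) ^+ 2 by field.
  rewrite n h subrr mulr0 addr0 subrr add0r mulfV // expf_neq0 //.
Qed.

Lemma T1_flip Kh v : real_subspace Kh -> T1 Kh v -> T1 Kh (flip v).
Proof.
case: v => [[z t] [ze ta]] rK [[/= Kz t0] Kze n]; split => //=.
  by have := real_subspaceZ (-1) rK Kze; rewrite rmorphN mulN1r.
by rewrite normcN sqrrN.
Qed.

Lemma flipK : involutive (@flip R).
Proof. by move=> [[z t] [ze ta]]; rewrite /flip /= !opprK. Qed.

Lemma flow_flip v s : flow s (flip v) = flip (flow (- s) v).
Proof.
case: v => [[z t] [ze ta]]; rewrite /flip /= chN shN.
have -> : ch s - - ta * sh s = ch s - ta * - sh s by ring.
congr (_, _, (_, _)).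
- by rewrite mulrN -mulNr -rmorphN; congr (_ + _%:C%C * _); ring.
- by rewrite mulrN.
- by rewrite -[RHS]mulNr; congr (_ / _); ring.
Qed.

Lemma foot_flip v : foot (flip v) = foot v.
Proof. by []. Qed.

Lemma ip_bound Kh v w : T1 Kh v -> T1 Kh w -> `|ip v w| <= 1.
Proof.
move=> /T1_norm + /T1_norm; rewrite /ip ler_norml.
move: (reC _) (imC _) (v.2.2) (reC _) (imC _) (w.2.2) => a b c d e f h1 h2.
apply/andP; split.
  by have := sqr_ge0 (a + d); have := sqr_ge0 (b + e); have := sqr_ge0 (c + f); lra.
by have := sqr_ge0 (a - d); have := sqr_ge0 (b - e); have := sqr_ge0 (c - f); lra.
Qed.

Lemma ip_eq1 Kh v w : T1 Kh v -> T1 Kh w -> foot v = foot w -> ip v w = 1 -> v = w.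
Proof.
move=> /T1_norm + /T1_norm; rewrite /ip /foot; case: v w => [p [z a]] [p' [z' a']] /= h1 h2 -> h.
have g1 := sqr_ge0 (reC z - reC z'); have g2 := sqr_ge0 (imC z - imC z').
have g3 := sqr_ge0 (a - a').
have /eqP : (a - a') ^+ 2 = 0 by lra.
have /eqP : (reC z - reC z') ^+ 2 = 0 by lra.
have /eqP : (imC z - imC z') ^+ 2 = 0 by lra.
rewrite !sqrf_eq0 !subr_eq0 => /eqP e1 /eqP e2 /eqP ->.
by congr (_, (_, _)); apply: complex_eq.
Qed.

Lemma ipN v w : ip (flip v) w = - ip v w.
Proof. by rewrite /ip /flip /= !reimE; ring. Qed.

Lemma ip_self Kh v : T1 Kh v -> ip v v = 1.
Proof. by move=> /T1_norm <-; rewrite /ip; ring. Qed.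

Lemma cd_flow Kh v a b : T1 Kh v -> cd (foot (flow a v)) (foot (flow b v)) = ch (a - b).
Proof.
by move=> Tv; rewrite (law_of_cosines _ _ Tv Tv) // (ip_self Tv) chD chN shN; ring.
Qed.

Lemma hdist_flow Kh v a b : T1 Kh v -> hdist (foot (flow a v)) (foot (flow b v)) = `|a - b|.
Proof. by move=> Tv; rewrite hdistE (cd_flow _ _ Tv) arcosh_ch. Qed.

Lemma hdist_foot_flow Kh v a : T1 Kh v -> hdist (foot v) (foot (flow a v)) = `|a|.
Proof. by move=> Tv; rewrite -{1}(flow0 v) (hdist_flow _ _ Tv) sub0r normrN. Qed.

Lemma exists_vect_to Kh p q : real_subspace Kh -> Kh 0 -> upper Kh p -> upper Kh q ->
  exists v, [/\ T1 Kh v, foot v = p & foot (flow (hdist p q) v) = q].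
Proof.
move=> rK K0 [Kp p0] [Kq q0].
have [e|ne] := eqVneq (hdist p q) 0.
  exists (p, (0, 1)); split => //; last by rewrite e flow0; exact: hdist_eq0.
  by split => //; rewrite normc2 /=; ring.
have h0 : 0 < hdist p q by rewrite lt0r ne hdist_ge0.
have sn : sh (hdist p q) != 0 by rewrite gt_eqF // sh_gt0.
have := ch_hdist p0 q0; have := ch2sh2 (hdist p q).
rewrite /cd normc2 !reimE => h1 h2.
set C := ch (hdist p q) in h1 h2; set S := sh (hdist p q) in h1 sn.
have tn : p.2 != 0 by rewrite gt_eqF.
have un : q.2 != 0 by rewrite gt_eqF.
have key : (reC q.1 - reC p.1) ^+ 2 + (imC q.1 - imC p.1) ^+ 2 + p.2 ^+ 2 + q.2 ^+ 2 =
    2 * p.2 * q.2 * C.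
  by rewrite h2; field; rewrite tn un.
(* The formula of [flow] at time d(p, q) is solved for the direction: the final height determines
   the vertical part, and then the horizontal displacement the other one. *)
exists (p, (((q.2 * S)^-1)%:C%C * (q.1 - p.1), (C - p.2 / q.2) / S)).
have Dv : C - (C - p.2 / q.2) / S * S = p.2 / q.2 by rewrite divfK //; ring.
split => //.
- split => //=; first by apply: real_subspaceZ => //; exact: real_subspaceB.
  rewrite normc2 !reimE.
  have -> : ((q.2 * S)^-1 * (reC q.1 - reC p.1)) ^+ 2 + ((q.2 * S)^-1 * (imC q.1 - imC p.1)) ^+ 2 +
     ((C - p.2 / q.2) / S) ^+ 2 = (((reC q.1 - reC p.1) ^+ 2 + (imC q.1 - imC p.1) ^+ 2 +
       p.2 ^+ 2 + q.2 ^+ 2) + q.2 ^+ 2 * C ^+ 2 - 2 * p.2 * q.2 * C - q.2 ^+ 2) / (q.2 ^+ 2 * S ^+ 2).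
    by field; rewrite sn un.
  rewrite key; have -> : C ^+ 2 = S ^+ 2 + 1 by lra.
  by field; rewrite sn un.
- rewrite [p in (p, _)]surjective_pairing [RHS]surjective_pairing /foot /= -/C -/S Dv.
  congr (_, _); last by field; rewrite tn un.
  rewrite mulrA -rmorphM /=.
  have -> : p.2 * S / (p.2 / q.2) * (q.2 * S)^-1 = 1 by field; rewrite sn un tn.
  by rewrite mul1r addrC subrK.
Qed.

Lemma ip_gap_ge0 Kh v w : T1 Kh v -> T1 Kh w -> 0 <= 1 - ip v w.
Proof. by move=> Tv Tw; have := ip_bound Tv Tw; rewrite ler_norml => /andP[]; lra. Qed.

Lemma cd_equal_time Kh v w (r : R) : T1 Kh v -> T1 Kh w -> foot v = foot w ->
  cd (foot (flow r v)) (foot (flow r w)) = 1 + sh r ^+ 2 * (1 - ip v w).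
Proof. by move=> Tv Tw vw; rewrite (law_of_cosines _ _ Tv Tw) //; have := ch2sh2 r; lra. Qed.

Lemma flow_inj Kh v w s : T1 Kh v -> T1 Kh w -> foot v = foot w -> s != 0 ->
  foot (flow s v) = foot (flow s w) -> v = w.
Proof.
move=> Tv Tw e s0 h; apply: (ip_eq1 Tv Tw e).
have := law_of_cosines s s Tv Tw e; rewrite h (cd_flow _ _ Tw) subrr ch0.
have sn : sh s != 0 by apply: contraNneq s0 => /sh_eq0 ->.
have := ch2sh2 s => h1 h2.
have /eqP : sh s ^+ 2 * (1 - ip v w) = 0 by lra.
by rewrite mulf_eq0 expf_eq0 /= (negbTE sn) /= subr_eq0 => /eqP.
Qed.

Lemma foot_flow_upper Kh v s : real_subspace Kh -> T1 Kh v -> upper Kh (foot (flow s v)).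
Proof. by move=> rK /(T1_flow s rK) []. Qed.

Lemma subr_mul_le (a x c : R) : 0 <= x -> -1 <= c -> a - x * c <= a + x.
Proof. by move=> x0 c0; nra. Qed.

(** The law of cosines at q with a cosine at least -1 gives cosh d(p, r) <= cosh (d(p, q) + d(q,
    r)). *)
Lemma hdist_triangle p q r : 0 < p.2 -> 0 < q.2 -> 0 < r.2 ->
  hdist p r <= hdist p q + hdist q r.
Proof.
move=> p0 q0 r0; have u0 (x : hpoint R) : 0 < x.2 -> upper (setT : set R[i]) x by [].
have [v [Tv ev fv]] := exists_vect_to real_subspace_setT I (u0 _ q0) (u0 _ p0).
have [w [Tw ew fw]] := exists_vect_to real_subspace_setT I (u0 _ q0) (u0 _ r0).
have d1 := hdist_ge0 q0 p0; have d2 := hdist_ge0 q0 r0.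
rewrite (hdist_sym p q) hdist_le // ?addr_ge0 //.
have := law_of_cosines (hdist q p) (hdist q r) Tv Tw; rewrite fv fw ev ew => -> //.
have := ip_bound Tv Tw; rewrite ler_norml chD => /andP[b1 b2].
exact: subr_mul_le (mulr_ge0 (sh_ge0 d1) (sh_ge0 d2)) b1.
Qed.

Lemma vect_to_flow Kh v s : T1 Kh v -> 0 < s -> vect_to (foot v) (foot (flow s v)) = v.
Proof.
move=> /T1_setT Tv s0; rewrite /vect_to (hdist_foot_flow _ Tv) gtr0_norm //.
case: xgetP => [w _ [Tw ew fw]|/(_ v)]; last by case.
by apply: (flow_inj Tw Tv) fw; rewrite ?gt_eqF.
Qed.

(** The two distances force the angle at [foot v] between v and the direction of p to have cosine 1
    or -1, according to the sign of s. This is how isometries are seen to preserve geodesics. *)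
Lemma flow_on_geodesic Kh v p s : T1 Kh v -> 0 < p.2 ->
  hdist (foot v) p = `|s| -> hdist (foot (flow 1 v)) p = `|1 - s| -> p = foot (flow s v).
Proof.
move=> /T1_setT Tv p0 h1 h2; have v0 : 0 < (foot v).2 := T1_gt0 Tv.
have u0 (x : hpoint R) : 0 < x.2 -> upper (setT : set R[i]) x by [].
have [w [Tw ew]] := exists_vect_to real_subspace_setT I (u0 _ v0) (u0 _ p0).
rewrite h1 => fw; have := law_of_cosines 1 `|s| Tv Tw (esym ew).
rewrite fw -ch_hdist // ?(foot_flow_gt0 1 Tv) // h2 !ch_norm chD chN shN.
have s1 : sh 1 != 0 :> R by rewrite gt_eqF // sh_gt0.
have [e0 _|s0] := eqVneq s 0.
  by move: fw; rewrite e0 normr0 !flow0 ew => ->.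
have sn : sh s != 0 by apply: contraNneq s0 => /sh_eq0 ->.
case: (ger0P s) fw => s_ fw h.
  have /(ip_eq1 Tv Tw (esym ew)) -> : ip v w = 1; last by rewrite fw.
  have /eqP : sh 1 * sh s * (1 - ip v w) = 0 by lra.
  rewrite mulf_eq0 => /orP[/eqP z|]; last by rewrite subr_eq0 => /eqP.
  by case/eqP: (mulf_neq0 s1 sn).
have Tf := T1_flip real_subspace_setT Tv.
have /(ip_eq1 Tf Tw (esym ew)) e : ip (flip v) w = 1; last first.
  by rewrite -fw -e flow_flip opprK.
move: h; rewrite ipN shN => h.
have /eqP : sh 1 * sh s * (1 + ip v w) = 0 by lra.
rewrite mulf_eq0 => /orP[/eqP z|]; last by rewrite addr_eq0 => /eqP <-.
by case/eqP: (mulf_neq0 s1 sn).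
Qed.

End Geometry.

(** * The action of PSL2(C) on the half-space and on its boundary *)

Section Action.
Context {R : realType}.
Implicit Types (g h k : PSL2 R) (x y : hpoint R) (Kh : set R[i]).

Lemma conjcD (z w : R[i]) : conjc (z + w) = conjc z + conjc w.
Proof. exact: rmorphD. Qed.
Lemma conjcM (z w : R[i]) : conjc (z * w) = conjc z * conjc w.
Proof. exact: rmorphM. Qed.
Lemma conjcN (z : R[i]) : conjc (- z) = - conjc z.
Proof. exact: rmorphN. Qed.
Lemma conjcV (z : R[i]) : conjc z^-1 = (conjc z)^-1.
Proof. exact: fmorphV. Qed.
Lemma conjcC (a : R) : conjc a%:C%C = a%:C%C.
Proof. by rewrite /= oppr0. Qed.

Definition conjE := (conjcD, conjcN, conjcM, conjcV, @conjcK R, conjcC, @conjc1 R, @conjc0 R).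

Lemma RCD (a b : R) : (a + b)%:C%C = a%:C%C + b%:C%C.
Proof. exact: rmorphD. Qed.
Lemma RCM (a b : R) : (a * b)%:C%C = a%:C%C * b%:C%C.
Proof. exact: rmorphM. Qed.
Lemma RCN (a : R) : (- a)%:C%C = - a%:C%C.
Proof. exact: rmorphN. Qed.
Lemma RCV (a : R) : (a^-1)%:C%C = a%:C%C^-1.
Proof. exact: fmorphV. Qed.
Lemma RCX (a : R) n : (a ^+ n)%:C%C = a%:C%C ^+ n.
Proof. exact: rmorphXn. Qed.
Definition RCE := (RCD, RCM, RCN, RCV, RCX).

Lemma normcC (z : R[i]) : (normc z ^+ 2)%:C%C = z * conjc z.
Proof. by rewrite normc2; case: z => a b /=; apply: complex_eq => /=; ring. Qed.

Lemma ord2P (P : 'I_2 -> Prop) : P 0 -> P 1 -> forall i, P i.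
Proof.
move=> P0 P1 [[|[|i]] hi] //.
  by move: P0; congr P; exact: val_inj.
by move: P1; congr P; exact: val_inj.
Qed.

Lemma det2 (A : 'M[R[i]]_2) : \det A = A 0 0 * A 1 1 - A 0 1 * A 1 0.
Proof.
rewrite (expand_det_row _ 0) big_ord_recl big_ord1 /cofactor !det_mx11 !mxE /=.
rewrite expr0 mul1r expr1 mulN1r mulrN.
by congr (A _ _ * A _ _ - A _ _ * A _ _); exact/val_inj.
Qed.

Lemma mat_det g : mat g 0 0 * mat g 1 1 - mat g 0 1 * mat g 1 0 = 1.
Proof. by have /eqP := valP (repr g); rewrite det2. Qed.

Lemma mat_mul g h : mat (g * h)%g = mat g *m mat h \/ mat (g * h)%g = - (mat g *m mat h).
Proof. by case/orP: (repr_PSL2_pi (SL2_mul (repr g) (repr h))) => /eqP; [left|right]. Qed.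

Lemma mat_one : mat (1%g : PSL2 R) = 1%:M \/ mat (1%g : PSL2 R) = - 1%:M.
Proof. by case/orP: (repr_PSL2_pi (SL2_one R)) => /eqP; [left|right]. Qed.

Lemma mat_eq g h : mat g = mat h \/ mat g = - mat h -> g = h.
Proof.
move=> e; rewrite -(PSL2_pi_repr g) -(PSL2_pi_repr h); apply/PSL2_piP.
by apply/orP; case: e => e; [left|right]; apply/eqP.
Qed.

Lemma mulmx2E (A B : 'M[R[i]]_2) i j : (A *m B) i j = A i 0 * B 0 j + A i 1 * B 1 j.
Proof. by rewrite mxE big_ord_recl big_ord1; congr (_ + A i _ * B _ j); exact/val_inj. Qed.

(** The point [u : v] of the projective line. In homogeneous coordinates the action is linear, so
    [bactM] needs no discussion of poles. *)
Definition bpt (u v : R[i]) : bdry R := if v == 0 then None else Some (u / v).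

Lemma bptZ (a u v : R[i]) : a != 0 -> bpt (a * u) (a * v) = bpt u v.
Proof.
move=> a0; rewrite /bpt mulf_eq0 (negbTE a0) /=; case: eqP => // /eqP v0.
by apply: (congr1 Some); field; rewrite v0 a0.
Qed.

Lemma bpt1 z : bpt z 1 = Some z.
Proof. by rewrite /bpt oner_eq0 divr1. Qed.

Lemma bpt10 : bpt 1 0 = None.
Proof. by rewrite /bpt eqxx. Qed.

Lemma bptP (xi : bdry R) : exists u v : R[i], [/\ xi = bpt u v & (u != 0) || (v != 0)].
Proof.
case: xi => [z|]; first by exists z, 1; rewrite bpt1 oner_eq0 orbT.
by exists 1, 0; rewrite bpt10 oner_eq0.
Qed.

Lemma bact_bpt g (u v : R[i]) : (u != 0) || (v != 0) ->
  bact g (bpt u v) = bpt (mat g 0 0 * u + mat g 0 1 * v) (mat g 1 0 * u + mat g 1 1 * v).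
Proof.
have [-> /=|v0 _] := eqVneq v 0.
  rewrite orbF => u0; rewrite {1}/bpt eqxx /= !mulr0 !addr0 /bpt mulf_eq0 (negbTE u0) orbF.
  case: eqP => // /eqP c0; apply: (congr1 Some); field; rewrite u0 c0 //.
rewrite {1}/bpt (negbTE v0) /= /homography.
have e (p q : R[i]) : p * (u / v) + q = (p * u + q * v) / v by field.
rewrite !e /bpt mulf_eq0 invr_eq0 (negbTE v0) orbF; case: eqP => // /eqP c0.
by apply: (congr1 Some); field; rewrite v0 c0.
Qed.

Lemma bact_nz g (u v : R[i]) : (u != 0) || (v != 0) ->
  (mat g 0 0 * u + mat g 0 1 * v != 0) || (mat g 1 0 * u + mat g 1 1 * v != 0).
Proof.
apply: contraTT; rewrite !negb_or !negbK => /andP[/eqP e1 /eqP e2].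
have d := mat_det g; move: d e1 e2.
move: (mat g 0 0) (mat g 0 1) (mat g 1 0) (mat g 1 1) => a b c d h e1 e2.
have -> : u = 0.
  transitivity (d * (a * u + b * v) - b * (c * u + d * v) + (1 - (a * d - b * c)) * u); first by ring.
  by rewrite e1 e2 h; ring.
have -> : v = 0.
  transitivity (a * (c * u + d * v) - c * (a * u + b * v) + (1 - (a * d - b * c)) * v); first by ring.
  by rewrite e1 e2 h; ring.
by rewrite eqxx.
Qed.

Lemma bactM g h (xi : bdry R) : bact (g * h)%g xi = bact g (bact h xi).
Proof.
have [u [v [-> uv]]] := bptP xi; rewrite !bact_bpt //; last exact: bact_nz.
have [->|->] := mat_mul g h.
  by rewrite !mulmx2E; congr bpt; ring.
rewrite -[RHS](bptZ (a := -1)) ?oppr_eq0 ?oner_eq0 // ![(- (_ *m _)) _ _]mxE !mulmx2E.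
by congr bpt; ring.
Qed.

Lemma bact1 (xi : bdry R) : bact 1%g xi = xi.
Proof.
have [u [v [-> uv]]] := bptP xi; rewrite !bact_bpt //.
have [->|->] := mat_one; rewrite ?mxE /=.
  by rewrite !mul1r !mul0r addr0 add0r.
rewrite -[RHS](bptZ (a := -1)) ?oppr_eq0 ?oner_eq0 //.
by congr bpt; ring.
Qed.

Lemma bactK g : cancel (bact g) (bact g^-1%g).
Proof. by move=> xi; rewrite -bactM mulVg bact1. Qed.

Lemma bactVK g : cancel (bact g^-1%g) (bact g).
Proof. by move=> xi; rewrite -bactM mulgV bact1. Qed.

(** The automorphy factor: the derivative of the homography is the inverse of its square. Its
    modulus does not depend on the sign chosen for the matrix. *)
Definition jac g (z : R[i]) : R[i] := mat g 1 0 * z + mat g 1 1.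

Lemma bact_some g (z w : R[i]) : (bact g (Some z) = Some w) <-> jac g z != 0 /\ homography g z = w.
Proof.
rewrite /= /jac; case: eqP => [_|/eqP n0]; split => //; first by case.
  by case=> <-.
by case=> _ ->.
Qed.

Lemma homography_sub g (z w : R[i]) : jac g z != 0 -> jac g w != 0 ->
  homography g z - homography g w = (z - w) / (jac g z * jac g w).
Proof.
rewrite /homography /jac; have := mat_det g.
move: (mat g 0 0) (mat g 0 1) (mat g 1 0) (mat g 1 1) => a b c d h n1 n2.
have -> : z - w = (z - w) * (a * d - b * c) by rewrite h mulr1.
by field; rewrite n1 n2.
Qed.

Lemma normc_jacM g h z : jac h z != 0 ->
  normc (jac (g * h)%g z) = normc (jac g (homography h z)) * normc (jac h z).
Proof.
rewrite /jac /homography => n0; have nrmN (a : R[i]) : normc (- a) = normc a by exact: normcN.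
have e : (mat g *m mat h) 1 0 * z + (mat g *m mat h) 1 1 =
   (mat g 1 0 * ((mat h 0 0 * z + mat h 0 1) / (mat h 1 0 * z + mat h 1 1)) + mat g 1 1) *
   (mat h 1 0 * z + mat h 1 1) by rewrite !mulmx2E; field.
by rewrite -normcM -e; have [->|->] := mat_mul g h; rewrite ?mxE // -nrmN ?mxE ?mulNr ?opprD ?opprK ?mxE.
Qed.

(** A point (z, t) corresponds to the Hermitian matrix with rows (|z|^2 + t^2, z) and (conj z, 1),
    of determinant t^2. This is its sesquilinear form at the row vectors (p, q) and (u, v); the
    group acts by congruence, up to a real scalar. *)
Definition herm (p q u v : R[i]) x : R[i] :=
  p * conjc u * (x.1 * conjc x.1 + (x.2 ^+ 2)%:C%C) + p * conjc v * x.1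
  + q * conjc u * conjc x.1 + q * conjc v.

Definition hden g x : R := normc (jac g x.1) ^+ 2 + normc (mat g 1 0) ^+ 2 * x.2 ^+ 2.

Lemma hdenE g x : (hden g x)%:C%C = herm (mat g 1 0) (mat g 1 1) (mat g 1 0) (mat g 1 1) x.
Proof.
rewrite /hden RCD normcC (RCM (normc _ ^+ 2)) normcC RCX /jac /herm !conjE RCX; ring.
Qed.

Lemma hactE g x : hact g x =
  (herm (mat g 0 0) (mat g 0 1) (mat g 1 0) (mat g 1 1) x / (hden g x)%:C%C, x.2 / hden g x).
Proof.
case: x => z t; rewrite /hact /hden /jac /herm /=; congr (_ / _, _).
by rewrite !conjE; ring.
Qed.

Lemma hden_gt0 g x : 0 < x.2 -> 0 < hden g x.
Proof.
move=> t0; rewrite /hden lt0r; apply/andP; split; last first.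
  by apply: addr_ge0; [exact: sqr_ge0|apply: mulr_ge0; exact: sqr_ge0].
apply/negP => /eqP h.
have h1 := sqr_ge0 (normc (jac g x.1)).
have h2 : 0 <= normc (mat g 1 0) ^+ 2 * x.2 ^+ 2 by rewrite mulr_ge0 ?sqr_ge0.
have /eqP : normc (jac g x.1) ^+ 2 = 0 by lra.
have /eqP : normc (mat g 1 0) ^+ 2 * x.2 ^+ 2 = 0 by lra.
rewrite mulf_eq0 !sqrf_eq0 (gt_eqF t0) orbF => /eqP /eq0_normc c0 /eqP /eq0_normc.
rewrite /jac c0 mul0r add0r => d0; have := mat_det g; rewrite c0 d0 !mulr0 subrr => /eqP.
by rewrite eq_sym oner_eq0.
Qed.

Lemma hact_gt0 g x : 0 < x.2 -> 0 < (hact g x).2.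
Proof. by move=> x0; rewrite hactE /= divr_gt0 // hden_gt0. Qed.

Lemma realC_neq0 (a : R) : a != 0 -> a%:C%C != 0.
Proof. by apply: contraNneq => /complexI ->. Qed.

(* The Hermitian form of the image point is, up to the scalar [hden g x], the pullback by [g]. *)
Lemma herm_hact g (p q u v : R[i]) x : 0 < x.2 ->
  herm (p * mat g 0 0 + q * mat g 1 0) (p * mat g 0 1 + q * mat g 1 1)
       (u * mat g 0 0 + v * mat g 1 0) (u * mat g 0 1 + v * mat g 1 1) x =
  (hden g x)%:C%C * herm p q u v (hact g x).
Proof.
move=> x0; have N0 := realC_neq0 (lt0r_neq0 (hden_gt0 g x0)).
rewrite hactE {2}/herm [(_, _).1]/= [(_, _).2]/= exprMn exprVn RCM RCV.
have dd : (mat g 0 0 * mat g 1 1 - mat g 0 1 * mat g 1 0) *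
   conjc (mat g 0 0 * mat g 1 1 - mat g 0 1 * mat g 1 0) = 1.
  by rewrite mat_det conjc1 mulr1.
rewrite !conjE (RCX (hden g x)); move: N0 dd; rewrite hdenE /herm !conjE RCX.
case: x x0 => z t _; rewrite [(_, _).1]/= [(_, _).2]/=.
move: (mat g 0 0) (mat g 0 1) (mat g 1 0) (mat g 1 1) => a b c d.
move: (conjc a) (conjc b) (conjc c) (conjc d) (conjc z) (conjc u) (conjc v) (t%:C%C) =>
  a' b' c' d' z' u' v' T; set N := (X in X != 0) => N0 dd.
set num := a * c' * (z * z' + T ^+ 2) + a * d' * z + b * c' * z' + b * d'.
set num' := a' * c * (z * z' + T ^+ 2) + a' * d * z' + b' * c * z + b' * d.
set M := a * a' * (z * z' + T ^+ 2) + a * b' * z + b * a' * z' + b * b'.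
have key : num * num' + T ^+ 2 = N * M.
  rewrite -[T ^+ 2 in LHS]mul1r -dd /N /M /num /num'; ring.
rewrite [RHS](_ : _ = p * u' * ((num * num' + T ^+ 2) / N) + p * v' * num + q * u' * num'
   + q * v' * N); last by rewrite /N /num /num'; field.
rewrite key (_ : N * M / N = M); last by field.
by rewrite /M /num /num' /N; ring.
Qed.

Lemma hden1 g h x : 0 < x.2 -> hden (g * h)%g x = hden g (hact h x) * hden h x.
Proof.
move=> x0; apply: complexI; rewrite RCM mulrC (hdenE g) -herm_hact // hdenE.
have [->|->] := mat_mul g h; rewrite ?[(- (_ *m _)) _ _]mxE ?mulmx2E //.
by rewrite /herm !conjE; ring.
Qed.

Lemma hactM g h x : 0 < x.2 -> hact (g * h)%g x = hact g (hact h x).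
Proof.
move=> x0; have n0 := hden_gt0 h x0; have n1 := hden_gt0 g (hact_gt0 h x0).
rewrite [LHS]hactE [RHS]hactE hden1 //; congr (_, _); last first.
  have -> : (hact h x).2 = x.2 / hden h x by rewrite hactE.
  by field; rewrite !gt_eqF.
rewrite RCM.
have -> : herm (mat (g * h)%g 0 0) (mat (g * h)%g 0 1) (mat (g * h)%g 1 0)
   (mat (g * h)%g 1 1) x = (hden h x)%:C%C *
     herm (mat g 0 0) (mat g 0 1) (mat g 1 0) (mat g 1 1) (hact h x).
  rewrite -herm_hact //.
  have [->|->] := mat_mul g h; rewrite ?[(- (_ *m _)) _ _]mxE ?mulmx2E //.
  by rewrite /herm !conjE; ring.
by field; rewrite !realC_neq0 // gt_eqF.
Qed.

Lemma hact1 x : hact 1%g x = x.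
Proof.
have e0 : (1%:M : 'M[R[i]]_2) 0 0 = 1 by rewrite mxE.
have e1 : (1%:M : 'M[R[i]]_2) 0 1 = 0 by rewrite mxE.
have e2 : (1%:M : 'M[R[i]]_2) 1 0 = 0 by rewrite mxE.
have e3 : (1%:M : 'M[R[i]]_2) 1 1 = 1 by rewrite mxE.
have eN i j : (- (1%:M : 'M[R[i]]_2)) i j = - ((1%:M : 'M[R[i]]_2) i j) by rewrite mxE.
have h : hden 1%g x = 1.
  by apply: complexI; rewrite hdenE /herm; have [->|->] := mat_one;
    rewrite ?eN e2 e3 !conjE; ring.
rewrite hactE h divr1 [RHS]surjective_pairing; congr (_, _); last exact: divr1.
by rewrite /herm; have [->|->] := mat_one;
    rewrite ?eN e0 e1 e2 e3 !conjE; field.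
Qed.

Lemma hactK g x : 0 < x.2 -> hact g^-1%g (hact g x) = x.
Proof. by move=> x0; rewrite -hactM // mulVg hact1. Qed.

Lemma hactVK g x : 0 < x.2 -> hact g (hact g^-1%g x) = x.
Proof. by move=> x0; rewrite -hactM // mulgV hact1. Qed.

(** The right-hand side is the polarised determinant of the Hermitian matrices of x and y.
    Congruence by a matrix of determinant 1 preserves it, whence the invariance of the distance. *)
Lemma cd_herm x y : 0 < x.2 -> 0 < y.2 -> (2 * x.2 * y.2 * cd x y)%:C%C =
  herm 1 0 1 0 x * herm 0 1 0 1 y + herm 1 0 1 0 y * herm 0 1 0 1 x
  - herm 1 0 0 1 x * herm 0 1 1 0 y - herm 0 1 1 0 x * herm 1 0 0 1 y.
Proof.
move=> x0 y0; have -> : 2 * x.2 * y.2 * cd x y = normc (x.1 - y.1) ^+ 2 + x.2 ^+ 2 + y.2 ^+ 2.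
  by rewrite /cd; field; rewrite !gt_eqF.
rewrite !RCD normcC /herm !conjE !RCX.
by ring.
Qed.

Lemma cd_hact g x y : 0 < x.2 -> 0 < y.2 -> cd (hact g x) (hact g y) = cd x y.
Proof.
move=> x0 y0; have gx := hact_gt0 g x0; have gy := hact_gt0 g y0.
have nx := hden_gt0 g x0; have ny := hden_gt0 g y0.
have e : 2 * (hact g x).2 * (hact g y).2 * cd (hact g x) (hact g y) * (hden g x * hden g y) =
   2 * x.2 * y.2 * cd x y; last first.
  have d0 : 2 * x.2 * y.2 != 0 by rewrite !mulf_neq0 ?gt_eqF.
  apply: (mulfI d0); rewrite -e !hactE /=; field; rewrite !gt_eqF //.
apply: complexI; rewrite RCM !cd_herm //.
set X1 := herm 1 0 1 0 (hact g x); set X2 := herm 0 1 0 1 (hact g x).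
set X3 := herm 1 0 0 1 (hact g x); set X4 := herm 0 1 1 0 (hact g x).
set Y1 := herm 1 0 1 0 (hact g y); set Y2 := herm 0 1 0 1 (hact g y).
set Y3 := herm 1 0 0 1 (hact g y); set Y4 := herm 0 1 1 0 (hact g y).
rewrite RCM; set n := (hden g x)%:C%C; set m := (hden g y)%:C%C.
rewrite (_ : _ * (n * m) = (n * X1) * (m * Y2) + (m * Y1) * (n * X2) - (n * X3) * (m * Y4)
   - (n * X4) * (m * Y3)); last by ring.
rewrite -!herm_hact // !(mul1r, mul0r, addr0, add0r).
have dd : (mat g 0 0 * mat g 1 1 - mat g 0 1 * mat g 1 0) *
   conjc (mat g 0 0 * mat g 1 1 - mat g 0 1 * mat g 1 0) = 1.
  by rewrite mat_det conjc1 mulr1.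
set RH := RHS; rewrite -[RH]mul1r -{1}dd /RH /herm !conjE !RCX.
by ring.
Qed.

Lemma hdist_hact g x y : 0 < x.2 -> 0 < y.2 -> hdist (hact g x) (hact g y) = hdist x y.
Proof. by move=> x0 y0; rewrite !hdistE cd_hact. Qed.

End Action.

(** * Topology of C and of the one-point compactification *)

Section ComplexTopology.
Context {R : realType}.

Lemma le_normcB (z w : R[i]) : normc (z - w) = normc (w - z).
Proof. by rewrite -(normcN (z - w)) opprB. Qed.

Lemma normc_abs_re (z : R[i]) : `|reC z| <= normc z.
Proof.
apply: le_of_sqr; first exact: normc_ge0'.
by rewrite normc2 real_normK ?num_real // lerDl sqr_ge0.
Qed.

Lemma normc_abs_im (z : R[i]) : `|imC z| <= normc z.
Proof.
apply: le_of_sqr; first exact: normc_ge0'.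
by rewrite normc2 real_normK ?num_real // lerDr sqr_ge0.
Qed.

Lemma normc_le_reim (z : R[i]) : normc z <= `|reC z| + `|imC z|.
Proof.
apply: le_of_sqr; first by rewrite addr_ge0.
rewrite normc2 sqrrD !real_normK ?num_real // addrAC lerDl.
by rewrite mulrn_wge0 // mulr_ge0.
Qed.

Lemma normcZ (a : R) (z : R[i]) : normc (a%:C%C * z) = `|a| * normc z.
Proof. by rewrite normcM /= expr0n /= addr0 sqrtr_sqr. Qed.

Lemma le_normcD' (z w : R[i]) : normc (z + w) <= normc z + normc w.
Proof. exact: le_normcD. Qed.

(** Balls of [R[i]] have radii in [R[i]] itself. A positive complex number is real, so they are the
    balls of the real-valued [normc]. *)
Lemma nbhsC (z : R[i]) (U : set R[i]) :
  nbhs z U <-> exists2 e : R, 0 < e & forall w, normc (w - z) < e -> U w.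
Proof.
rewrite nbhs_ballP; split => [[e e0 h]|[e e0 h]].
  move: e0 h => /=; rewrite ltcE => /andP[/eqP /= i0 r0] h; exists (complex.Re e) => // w wz.
  apply: h; rewrite -ball_normE; change ((normc (z - w))%:C%C < e).
  by rewrite le_normcB ltcE /= i0 eqxx.
exists e%:C%C; first by rewrite /= ltcR.
by move=> w; rewrite -ball_normE /ball_ /= ltcR le_normcB => /h.
Qed.

Lemma cvgC {T : Type} (F : set_system T) {FF : Filter F} (f : T -> R[i]) (z : R[i]) :
  (f i @[i --> F] --> z) <-> forall e : R, 0 < e -> \forall i \near F, normc (f i - z) < e.
Proof.
split => [h e e0|h U /nbhsC[e e0 hU]].
  have /h : nbhs z [set w | normc (w - z) < e] by apply/nbhsC; exists e.
  by [].
by apply: (filterS _ (h e e0)) => i /hU.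
Qed.

Lemma continuous_reC : continuous (fun z : R[i] => reC z).
Proof.
move=> z; apply/(@cvgrPdist_lt _ _ _ (nbhs z) _) => e e0; apply/nbhsC; exists e => // w h.
apply: le_lt_trans h; rewrite le_normcB.
by have := normc_abs_re (z - w); rewrite !reimE.
Qed.

Lemma continuous_imC : continuous (fun z : R[i] => imC z).
Proof.
move=> z; apply/(@cvgrPdist_lt _ _ _ (nbhs z) _) => e e0; apply/nbhsC; exists e => // w h.
apply: le_lt_trans h; rewrite le_normcB.
by have := normc_abs_im (z - w); rewrite !reimE.
Qed.

Lemma normc_lipschitz (z w : R[i]) : `|normc z - normc w| <= normc (z - w).
Proof.
rewrite ler_norml; apply/andP; split.
  by have := le_normcD' z (w - z); rewrite addrC subrK le_normcB; lra.
by have := le_normcD' w (z - w); rewrite addrC subrK; lra.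
Qed.

Lemma continuous_normc : continuous (fun z : R[i] => normc z).
Proof.
move=> z; apply/(@cvgrPdist_lt _ _ _ (nbhs z) _) => e e0; apply/nbhsC; exists e => // w h.
by apply: le_lt_trans h; rewrite (le_normcB w); exact: normc_lipschitz.
Qed.

Lemma continuous_complex {T : topologicalType} (f : T -> R[i]) :
  continuous (fun x => reC (f x)) -> continuous (fun x => imC (f x)) -> continuous f.
Proof.
move=> h1 h2 x; apply/cvgC => e e0.
have e2 : 0 < e / 2 by rewrite divr_gt0.
have /cvgrPdist_lt /(_ _ e2) k1 := h1 x; have /cvgrPdist_lt /(_ _ e2) k2 := h2 x.
near=> y; rewrite le_normcB (le_lt_trans (normc_le_reim _)) // !reimE.
have : `|reC (f x) - reC (f y)| < e / 2 by near: y.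
have : `|imC (f x) - imC (f y)| < e / 2 by near: y.
by lra.
Unshelve. all: by end_near. Qed.

(** Boxes rather than balls: they are images of products of segments, hence compact, and their
    complements give neighbourhoods of infinity. *)
Definition hbox (M : R) : set (hpoint R) :=
  [set x | [/\ `|reC x.1| <= M, `|imC x.1| <= M & `|x.2| <= M]].

Lemma continuous_fst' {S T : topologicalType} : continuous (@fst S T).
Proof. by move=> x; exact: cvg_fst. Qed.
Lemma continuous_snd' {S T : topologicalType} : continuous (@snd S T).
Proof. by move=> x; exact: cvg_snd. Qed.

Lemma norm_itv (M a : R) : `|a| <= M <-> `[- M, M]%classic a.
Proof. by rewrite /= in_itv /= ler_norml. Qed.

Lemma compact_hbox M : compact (hbox M).
Proof.
pose f (p : R * R * R) : hpoint R := ((p.1.1 +i* p.1.2)%C, p.2).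
have -> : hbox M = f @` ((`[- M, M] `*` `[- M, M]) `*` `[- M, M]).
  apply/seteqP; split => [[[a b] t] [/= /norm_itv h1 /norm_itv h2 /norm_itv h3]|].
    by exists (a, b, t).
  by move=> _ [[[a b] t] [[/= /norm_itv h1 /norm_itv h2] /norm_itv h3] <-].
apply: continuous_compact; last first.
  by apply: compact_setX; [apply: compact_setX|]; exact: segment_compact.
have c : continuous (fun p : R * R * R => (p.1.1 +i* p.1.2)%C).
  apply: continuous_complex => q /=.
    exact: (continuous_comp (@continuous_fst' _ _ q) (@continuous_fst' _ _ q.1)).
  exact: (continuous_comp (@continuous_fst' _ _ q) (@continuous_snd' _ _ q.1)).
by apply: continuous_subspaceT => p; exact: (cvg_pair (c p) (@continuous_snd' _ _ p)).
Qed.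

Lemma closed_hbox M : closed (hbox M).
Proof.
have -> : hbox M = (fun x : hpoint R => reC x.1) @^-1` `[- M, M] `&`
   (fun x : hpoint R => imC x.1) @^-1` `[- M, M] `&` snd @^-1` `[- M, M].
  apply/seteqP; split => x /=; first by case=> /norm_itv h1 /norm_itv h2 /norm_itv h3.
  by case=> -[/norm_itv h1 /norm_itv h2] /norm_itv h3.
have c (f : hpoint R -> R) : continuous f -> closed (f @^-1` `[- M, M]).
  by move=> cf; apply: closed_comp => [x _|]; [exact: cf|exact: interval_closed].
apply: closedI; [apply: closedI|]; apply: c => x.
- exact: (continuous_comp (@continuous_fst' _ _ x) (@continuous_reC x.1)).
- exact: (continuous_comp (@continuous_fst' _ _ x) (@continuous_imC x.1)).
- exact: continuous_snd'.
Qed.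

Definition hsize (x : hpoint R) : R := normc x.1 + `|x.2|.

Lemma continuous_hsize : continuous hsize.
Proof.
move=> x; apply: cvgD.
  exact: (continuous_comp (@continuous_fst' _ _ x) (@continuous_normc x.1)).
by apply: cvg_norm; exact: continuous_snd'.
Qed.

Lemma tends_to_some {T : Type} (F : set_system T) {FF : Filter F} (f : T -> hpoint R) (z : R[i]) :
  tends_to F f (Some z) <->
  forall e : R, 0 < e -> \forall i \near F, normc ((f i).1 - z) < e /\ `|(f i).2| < e.
Proof.
split => [h e e0|h].
  have : nbhs (Some (z, 0 : R) : one_point_compactification (hpoint R))
     (Some @` [set x : hpoint R | normc (x.1 - z) < e /\ `|x.2| < e]).
    apply: one_point_compactification_some_nbhs.
    exists ([set w | normc (w - z) < e], [set t : R | `|t| < e]) => //=; split => /=.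
      by apply/nbhsC; exists e.
    by apply/nbhs_ballP; exists e => //= t; rewrite -ball_normE /ball_ /= sub0r normrN.
  move=> /h hh; apply: (@filterS _ F FF _ _ _ hh) => i /= [x [h1 h2]] [e1]; by rewrite -e1.
move=> U /= [[A B] /= [/nbhsC[e e0 hA] /nbhs_ballP[d /= d0 hB]]] hU.
have m0 : 0 < Num.min e d by rewrite lt_min e0.
apply: filterS (h _ m0) => i; rewrite !lt_min => -[/andP[h1 h2] /andP[h3 h4]].
apply: hU; split => /=; first exact: hA.
by apply: hB; rewrite -ball_normE /ball_ /= sub0r normrN.
Qed.

Lemma tends_to_none {T : Type} (F : set_system T) {FF : Filter F} (f : T -> hpoint R) :
  tends_to F f None <-> forall M : R, \forall i \near F, M < hsize (f i).
Proof.
split => [h M|h U].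
  have : nbhs (None : one_point_compactification (hpoint R))
     (Some @` (~` hbox M) `|` [set None]).
    by exists (hbox M) => //; split; [exact: compact_hbox|exact: closed_hbox].
  move=> /h hh; apply: (@filterS _ F FF _ _ _ hh) => i /= [[x nx [<-]]|//]; apply: contra_notT nx.
  rewrite -leNgt /hsize => hx; have := normc_abs_re x.1; have := normc_abs_im x.1.
  have := normr_ge0 x.2; have := normc_ge0' x.1 => *.
  by split; lra.
move=> [C [cC _] hU].
have : compact (hsize @` C).
  by apply: continuous_compact => //; apply: continuous_subspaceT => x; exact: continuous_hsize.
move=> /compact_bounded [M [_ hM]].
apply: filterS (h (M + 1)) => i hi; apply: hU; left; exists (f i) => // Ci.
have M1 : M < M + 1 by rewrite ltrDl.
have /= h2 := hM _ M1 _ (imageP hsize Ci).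
by have := le_trans (ler_norm _) h2; lra.
Qed.

Lemma tends_to_unique {T : Type} (F : set_system T) {FF : ProperFilter F}
  (f : T -> hpoint R) (xi eta : bdry R) : tends_to F f xi -> tends_to F f eta -> xi = eta.
Proof.
have aux z : tends_to F f (Some z) -> tends_to F f None -> False.
  move=> /tends_to_some/(_ 1 ltr01) h1 /tends_to_none/(_ (normc z + 2)) h2.
  have [i [[k1 k2] k3]] := filter_ex (filterI h1 h2).
  by have := le_normcD' ((f i).1 - z) z; rewrite subrK; move: k3; rewrite /hsize; lra.
case: xi eta => [z|] [w|] // h1 h2; [|by case: (aux z)|by case: (aux w)].
congr Some; apply/eqP; rewrite -subr_eq0 -normr_eq0; apply/negP => /negP n0.
have n1 : 0 < normc (z - w) / 2 by rewrite divr_gt0 // normc_gt0 -normr_eq0.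
move: h1 h2 => /tends_to_some/(_ _ n1) h1 /tends_to_some/(_ _ n1) h2.
have [i [[k1 _] [k2 _]]] := filter_ex (filterI h1 h2).
have := le_normcD' (z - (f i).1) ((f i).1 - w); rewrite addrA subrK (le_normcB z).
by lra.
Qed.

End ComplexTopology.

(** * Endpoints of geodesics *)

Section Endpoints.
Context {R : realType}.
Implicit Types (v w : vect R) (Kh : set R[i]).

(** The limit of the explicit flow, as sinh s / D(s) tends to 1 / (1 - tau); tau = 1 is the upward
    vertical vector. *)
Definition vplus_expl v : bdry R :=
  if v.2.2 == 1 then None else Some (v.1.1 + (v.1.2 / (1 - v.2.2))%:C%C * v.2.1).

Lemma T1_tau_le1 Kh v : T1 Kh v -> v.2.2 <= 1.
Proof.
move=> /T1_norm h; have := sqr_ge0 (reC v.2.1); have := sqr_ge0 (imC v.2.1).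
by move=> *; nra.
Qed.

Lemma T1_tau1 Kh v : T1 Kh v -> v.2.2 = 1 -> v.2.1 = 0.
Proof.
move=> /T1_norm + e; rewrite e => h; have h1 := sqr_ge0 (reC v.2.1).
have h2 := sqr_ge0 (imC v.2.1).
have /eqP : reC v.2.1 ^+ 2 = 0 by lra.
have /eqP : imC v.2.1 ^+ 2 = 0 by lra.
by rewrite !sqrf_eq0 => /eqP e1 /eqP e2; exact: complex_eq.
Qed.

Lemma near_expR_gt (M : R) : \forall s \near +oo, M < expR s.
Proof.
near=> s; apply: lt_le_trans (expR_ge1Dx s); rewrite -ltrBlDl.
near: s; exact/nbhs_pinfty_gt/num_real.
Unshelve. all: by end_near. Qed.

Lemma tends_to_vplus Kh v : T1 Kh v -> tends_to +oo (fun s => foot (flow s v)) (vplus_expl v).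
Proof.
move=> Tv; rewrite /vplus_expl; case: eqP => [e|/eqP n1].
  have z0 := T1_tau1 Tv e; have t0 := T1_gt0 Tv.
  apply/tends_to_none => M; near=> s.
  have -> : foot (flow s v) = (v.1.1, v.1.2 * expR s).
    move: e z0; case: (v) => [[z t] [ze ta]] /= -> ->.
    have -> : ch s - 1 * sh s = (expR s)^-1.
      by rewrite -expRN /ch /sh; lra.
    by rewrite mulr0 addr0 /foot /= invrK.
  rewrite /hsize /= gtr0_norm ?mulr_gt0 ?expR_gt0 //.
  rewrite ltr_wpDl ?normc_ge0' // mulrC -ltr_pdivrMr //.
  near: s; exact: near_expR_gt.
have ta1 : v.2.2 < 1 by rewrite lt_neqAle n1 (T1_tau_le1 Tv).
have t0 := T1_gt0 Tv; have nv := T1_norm Tv.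
have zb : normc v.2.1 <= 1.
  by apply: le_of_sqr => //; rewrite normc2; have := sqr_ge0 v.2.2; lra.
have tb : - 1 <= v.2.2.
  by have := sqr_ge0 (reC v.2.1); have := sqr_ge0 (imC v.2.1); nra.
(* Both coordinates are within 4t / ((1 - tau)^2 e^s) of their limits. *)
apply/tends_to_some => e e0.
pose C := 4 * v.1.2 / (1 - v.2.2) ^+ 2 / e.
near=> s; have sC : C + 1 < expR s by near: s; exact: near_expR_gt.
have D0 := flow_den_gt0 s Tv.
have s0 : 0 < s by near: s; exact/nbhs_pinfty_gt/num_real.
have ey : expR (- s) <= 1 by rewrite -expR0 ler_expR; lra.
have ey0 := expR_gt0 (- s); have exy := expR_mulN s.
have D1 : expR s * (1 - v.2.2) / 2 <= ch s - v.2.2 * sh s.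
  rewrite /ch /sh.
  by nra.
have k1 : 4 * v.1.2 < (1 - v.2.2) ^+ 2 * e * expR s.
  have c0 : 0 < (1 - v.2.2) ^+ 2 * e by rewrite mulr_gt0 // exprn_gt0 // subr_gt0.
  have <- : C * ((1 - v.2.2) ^+ 2 * e) = 4 * v.1.2.
    by rewrite /C; field; rewrite !gt_eqF // subr_gt0.
  by rewrite mulrC ltr_pM2l //; lra.
have d0 : 0 < 1 - v.2.2 by lra.
split; last first.
  have -> : (foot (flow s v)).2 = v.1.2 / (ch s - v.2.2 * sh s) by case: (v) => [[z t] [ze ta]].
  rewrite gtr0_norm ?divr_gt0 // ltr_pdivrMr //.
  have : (1 - v.2.2) ^+ 2 * e * expR s <= 2 * (1 - v.2.2) * e * expR s.
    rewrite ler_pM2r ?expR_gt0 // ler_pM2r // expr2 ler_pM2r //; lra.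
  have : e * (expR s * (1 - v.2.2) / 2) <= e * (ch s - v.2.2 * sh s) by rewrite ler_pM2l.
  by move: k1; lra.
have -> : (foot (flow s v)).1 - (v.1.1 + (v.1.2 / (1 - v.2.2))%:C%C * v.2.1) =
   (- (v.1.2 * expR (- s) / (1 - v.2.2) / (ch s - v.2.2 * sh s)))%:C%C * v.2.1.
  move: d0 D0; case: (v) => [[z t] [ze ta]] /= d0 D0; rewrite opprD addrACA subrr add0r.
  rewrite -mulrBl -rmorphB; congr (_%:C%C * _).
  have -> : expR (- s) = ch s - sh s by rewrite /ch /sh; lra.
  by field; rewrite !gt_eqF.
rewrite normcZ normrN gtr0_norm; last by rewrite !divr_gt0 // mulr_gt0.
apply: (@le_lt_trans _ _ (v.1.2 * expR (- s) / (1 - v.2.2) / (ch s - v.2.2 * sh s))).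
  by rewrite ler_piMr // ltW // !divr_gt0 // mulr_gt0.
rewrite ltr_pdivrMr // ltr_pdivrMr //.
have : e * (expR s * (1 - v.2.2) / 2) * (1 - v.2.2) <= e * (ch s - v.2.2 * sh s) * (1 - v.2.2).
  by rewrite ler_pM2r // ler_pM2l.
have : v.1.2 * expR (- s) <= v.1.2 by rewrite ler_piMr // ltW.
by move: k1; lra.
Unshelve. all: by end_near. Qed.

Lemma vplusE Kh v : T1 Kh v -> vplus v = vplus_expl v.
Proof.
move=> Tv; have h := tends_to_vplus Tv; rewrite /vplus.
case: xgetP => [xi _ h'|/(_ (vplus_expl v))//].
exact: tends_to_unique h' h.
Qed.

Lemma vminusE Kh v : real_subspace Kh -> T1 Kh v -> vminus v = vplus_expl (flip v).
Proof.
move=> rK Tv; have h : tends_to -oo (fun s => foot (flow s v)) (vplus_expl (flip v)).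
  apply/cvgNy_compNP; rewrite /comp /=.
  have := tends_to_vplus (T1_flip rK Tv); rewrite /tends_to.
  by under eq_fun do rewrite flow_flip foot_flip.
rewrite /vminus; case: xgetP => [xi _ h'|/(_ (vplus_expl (flip v)))//].
exact: tends_to_unique h' h.
Qed.

Lemma vplus_flow Kh v s : real_subspace Kh -> T1 Kh v -> vplus (flow s v) = vplus v.
Proof.
move=> rK Tv; rewrite (vplusE (T1_flow s rK Tv)); symmetry; rewrite (vplusE Tv).
have := tends_to_vplus Tv; have := tends_to_vplus (T1_flow s rK Tv).
set xi := vplus_expl _; set eta := vplus_expl _ => h1 h2; apply: tends_to_unique h2 _.
move=> U /h1; rewrite /= => -[M [_ hM]].
exists (M + s); split; first exact: num_real.
move=> t ht; have := hM (t - s); rewrite /= (flowD _ _ Tv) subrK; apply.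
by lra.
Qed.

Lemma vminus_flow Kh v s : real_subspace Kh -> T1 Kh v -> vminus (flow s v) = vminus v.
Proof.
move=> rK Tv; have Tf := T1_flip rK Tv.
rewrite (vminusE rK (T1_flow s rK Tv)) (vminusE rK Tv).
have -> : flip (flow s v) = flow (- s) (flip v) by rewrite flow_flip opprK.
by rewrite -(vplusE (T1_flow _ rK Tf)) -(vplusE Tf) (vplus_flow _ rK Tf).
Qed.

End Endpoints.

(** * The action on unit tangent vectors *)

Section TangentAction.
Context {R : realType}.
Implicit Types (g h k : PSL2 R) (x y : hpoint R) (v w : vect R) (Kh : set R[i]).

(** Closed under field operations and conjugation, not topologically. The instance [setT] also
    occurs, because [vect_to] and [tact] choose their vectors in [T1 setT]. *)
Definition closed_subfield Kh : Prop :=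
  [/\ forall a : R, Kh a%:C%C, forall z w : R[i], Kh z -> Kh w -> Kh (z + w),
      forall z w : R[i], Kh z -> Kh w -> Kh (z * w),
      forall z : R[i], Kh z -> Kh (conjc z) & forall z : R[i], Kh z -> Kh z^-1].

Lemma closed_subfield_real Kh : closed_subfield Kh -> real_subspace Kh.
Proof. by move=> [h1 h2 h3 _ _] a b z w kz kw; apply: h2; apply: h3. Qed.

Lemma closed_subfield0 Kh : closed_subfield Kh -> Kh 0.
Proof. by move=> [h _ _ _ _]; exact: h 0. Qed.

Lemma closed_subfield1 Kh : closed_subfield Kh -> Kh 1.
Proof. by move=> [h _ _ _ _]; exact: h 1. Qed.

Lemma closed_subfield_setT : closed_subfield (setT : set R[i]).
Proof. by []. Qed.

Lemma Khat_closed_subfield (K : fieldExtType rat) : closed_subfield (Khat K : set R[i]).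
Proof.
have [e|ne] := eqVneq (\dim {:K}) 1%N; last first.
  by split => *; rewrite /Khat /= => /eqP; rewrite (negbTE ne).
have hK (z : R[i]) : Khat K z <-> imC z = 0.
  split => [/(_ e)|h _]; rewrite -complexIm; first by move=> [].
  by rewrite h.
split => [a|z w /hK hz /hK hw|z w /hK hz /hK hw|z /hK hz|z /hK hz]; apply/hK => //.
- by rewrite imCD hz hw addr0.
- by move: hz hw; case: z w => a b [c d] /= -> ->; rewrite mulr0 mul0r addr0.
- by move: hz; case: z => a b /= ->; rewrite oppr0.
- by move: hz; case: z => a b /= ->; rewrite mul0r oppr0.
Qed.

Definition matK Kh g := forall i j, Kh (mat g i j).

Lemma matK_setT g : matK setT g.
Proof. by []. Qed.

Lemma upper_hact Kh g x : closed_subfield Kh -> matK Kh g -> upper Kh x -> upper Kh (hact g x).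
Proof.
move=> [kr kD kM kJ kV] kg [kx x0]; split; last exact: hact_gt0.
rewrite hactE /= /herm; apply: (kM _ _ _ (kV _ (kr _))).
have kJg i j : Kh (conjc (mat g i j)) by apply: kJ; exact: kg.
apply: (kD _ _ (kD _ _ (kD _ _ _ _) _) (kM _ _ (kg 0 1) (kJg 1 1))).
- apply: (kM _ _ (kM _ _ (kg 0 0) (kJg 1 0)) (kD _ _ (kM _ _ kx (kJ _ kx)) (kr _))).
- exact: (kM _ _ (kM _ _ (kg 0 0) (kJg 1 1)) kx).
- exact: (kM _ _ (kM _ _ (kg 0 1) (kJg 1 0)) (kJ _ kx)).
Qed.

(** The image geodesic is drawn through the images of the points at times 0 and 1; since g keeps the
    distances to these two, [flow_on_geodesic] places all other images on it. *)
Lemma tact_exists Kh g v : closed_subfield Kh -> matK Kh g -> T1 Kh v ->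
  exists2 w, T1 Kh w & forall s, foot (flow s w) = hact g (foot (flow s v)).
Proof.
move=> cK kg Tv; have rK := closed_subfield_real cK; have K0 := closed_subfield0 cK.
have u s := foot_flow_upper s rK Tv; have ug s := upper_hact cK kg (u s).
have p0 s : 0 < (foot (flow s v)).2 by case: (u s).
have gp0 s : 0 < (hact g (foot (flow s v))).2 by apply: hact_gt0.
have [w [Tw ew fw]] := exists_vect_to rK K0 (ug 0) (ug 1).
move: fw; rewrite hdist_hact // (hdist_flow _ _ Tv) sub0r normrN1 => fw.
exists w => // s; symmetry; apply: (flow_on_geodesic Tw) => //.
  by rewrite ew hdist_hact // (hdist_flow _ _ Tv) sub0r normrN.
by rewrite fw hdist_hact // (hdist_flow _ _ Tv).
Qed.

Lemma flow_unique Kh v w : T1 Kh v -> T1 Kh w ->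
  (forall s, foot (flow s v) = foot (flow s w)) -> v = w.
Proof.
move=> Tv Tw h; apply: (flow_inj Tv Tw (s := 1)); rewrite ?oner_eq0 ?h //.
by have := h 0; rewrite !flow0.
Qed.

Lemma tactP Kh g v : closed_subfield Kh -> matK Kh g -> T1 Kh v ->
  T1 Kh (tact g v) /\ forall s, foot (flow s (tact g v)) = hact g (foot (flow s v)).
Proof.
move=> cK kg Tv; have [w Tw fw] := tact_exists cK kg Tv.
rewrite /tact; case: xgetP => [u _ [Tu fu]|/(_ w)]; last first.
  by case; split => //; exact: T1_setT Tw.
suff -> : u = w by split.
by apply: (flow_unique Tu (T1_setT Tw)) => s; rewrite fu fw.
Qed.

Lemma T1_tact Kh g v : closed_subfield Kh -> matK Kh g -> T1 Kh v -> T1 Kh (tact g v).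
Proof. by move=> cK kg /(tactP cK kg) []. Qed.

Lemma foot_tact Kh g v s : T1 Kh v -> foot (flow s (tact g v)) = hact g (foot (flow s v)).
Proof. by move=> /T1_setT/(tactP closed_subfield_setT (matK_setT g)) []. Qed.

Lemma T1_tact_setT Kh g v : T1 Kh v -> T1 setT (tact g v).
Proof. by move=> /T1_setT/(tactP closed_subfield_setT (matK_setT g)) []. Qed.

Lemma flow_tact Kh g v s : T1 Kh v -> flow s (tact g v) = tact g (flow s v).
Proof.
move=> /T1_setT Tv; have Ts := T1_flow s real_subspace_setT Tv.
apply: (flow_unique (T1_flow s real_subspace_setT (T1_tact_setT g Tv)) (T1_tact_setT g Ts)) => t.
by rewrite (flowD _ _ (T1_tact_setT g Tv)) (foot_tact _ _ Tv) (foot_tact _ _ Ts) (flowD _ _ Tv).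
Qed.

Lemma flip_tact Kh g v : T1 Kh v -> flip (tact g v) = tact g (flip v).
Proof.
move=> /T1_setT Tv; have Tf := T1_flip real_subspace_setT Tv.
apply: (flow_unique (T1_flip real_subspace_setT (T1_tact_setT g Tv)) (T1_tact_setT g Tf)) => t.
by rewrite flow_flip foot_flip (foot_tact _ _ Tv) (foot_tact _ _ Tf) flow_flip foot_flip.
Qed.

End TangentAction.

(** * Integrals of continuous functions over segments *)

Section Integrals.
Context {R : realType}.
Implicit Types (f g F : R -> R) (a b c s L : R).

Local Notation leb := (@lebesgue_measure R).

Definition itg f a b : R := \int[leb]_(t in `[a, b]) f t.

Lemma integrable_cont f a b : continuous f -> leb.-integrable `[a, b] (EFin \o f).
Proof.
move=> cf; apply: continuous_compact_integrable; first exact: segment_compact.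
exact: continuous_subspaceT.
Qed.

Lemma itg_same f a : itg f a a = 0.
Proof. by rewrite /itg set_itv1 Rintegral_set1. Qed.

Lemma itg_split f a b c : continuous f -> a <= b -> b <= c ->
  itg f a c = itg f a b + itg f b c.
Proof.
move=> cf ab bc; have ab' : (BLeft a <= BRight b)%O by rewrite bnd_simp.
have bc' : (BRight b <= BRight c)%O by rewrite bnd_simp.
have := @Rintegral_itvB R f (BLeft a) (BRight c) b (integrable_cont a c cf) ab' bc'.
rewrite Rintegral_itv_obnd_cbnd; first by move=> e; rewrite /itg -e addrC subrK.
apply: (integrableS _ _ _ (integrable_cont b c cf)); rewrite ?measurable_itv //.
exact: subset_itv_oc_cc.
Qed.

Lemma continuous_addr s : continuous (fun t : R => t + s).
Proof. by move=> t; apply: cvgD; [exact: cvg_id|exact: cvg_cst]. Qed.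

Lemma continuous_cst' c : continuous (fun _ : R => c).
Proof. by move=> t; exact: cvg_cst. Qed.

Lemma continuous_subr f g : continuous f -> continuous g -> continuous (fun t => f t - g t).
Proof. by move=> cf cg t; apply: cvgB; [exact: cf|exact: cg]. Qed.

Lemma itg_le f g a b : continuous f -> continuous g ->
  (forall t, a <= t <= b -> f t <= g t) -> itg f a b <= itg g a b.
Proof.
move=> cf cg h; apply: le_Rintegral; rewrite ?measurable_itv //; try exact: integrable_cont.
Qed.

Lemma itgB f g a b : continuous f -> continuous g ->
  itg (fun t => f t - g t) a b = itg f a b - itg g a b.
Proof. by move=> cf cg; apply: RintegralB => //; exact: integrable_cont. Qed.

Lemma itg_cst c a b : a <= b -> itg (fun=> c) a b = c * (b - a).
Proof.
move=> ab; rewrite /itg Rintegral_cst //= lebesgue_measure_itv /= lte_fin.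
by move: ab; rewrite le_eqVlt => /orP[/eqP ->|->] //; rewrite ltxx subrr.
Qed.

Lemma itg_dist f g (e : R -> R) a b : continuous f -> continuous g -> continuous e ->
  (forall t, a <= t <= b -> `|f t - g t| <= e t) -> `|itg f a b - itg g a b| <= itg e a b.
Proof.
move=> cf cg ce h; have cfg := continuous_subr cf cg; have cgf := continuous_subr cg cf.
rewrite ler_norml lerNl opprB -!itgB //; apply/andP; split; apply: itg_le => // t /h.
  by rewrite distrC ler_norml => /andP[].
by rewrite ler_norml => /andP[].
Qed.

Lemma itg_bound f a b M : continuous f -> a <= b ->
  (forall t, a <= t <= b -> `|f t| <= M) -> `|itg f a b| <= M * (b - a).
Proof.
move=> cf ab h; have := itg_dist cf (@continuous_cst' 0) (@continuous_cst' M).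
by move=> /(_ a b); rewrite !itg_cst // mul0r subr0; apply => t /h; rewrite subr0.
Qed.

Lemma itg_FTC f F a b : continuous f -> a <= b ->
  (forall x, a - 1 < x -> is_derive x 1 F (f x)) -> itg f a b = F b - F a.
Proof.
move=> cf; rewrite le_eqVlt => /orP[/eqP -> _|ab h]; first by rewrite itg_same subrr.
have cF x : a - 1 < x -> F y @[y --> x] --> F x.
  move=> /h h'; apply: differentiable_continuous; apply/derivable1_diffP; exact: ex_derive.
have := @continuous_FTC2 _ f F a b ab (continuous_subspaceT cf).
rewrite /itg /Rintegral => -> //=.
  split => [x| |].
  - rewrite in_itv /= => /andP[ax _]; have := h x; rewrite (lt_trans _ ax) ?gtrBl // => /(_ isT) ?.
    exact: ex_derive.
  - by apply: cvg_at_right_filter; apply: cF; rewrite gtrBl.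
  - by apply: cvg_at_left_filter; apply: cF; rewrite (lt_trans _ ab) // gtrBl.
move=> x; rewrite in_itv /= => /andP[ax _]; rewrite derive1E.
by have := h x; rewrite (lt_trans _ ax) ?gtrBl // => /(_ isT) h'; exact: derive_val.
Qed.

Lemma itg_primitive f a0 x : continuous f -> a0 < x -> is_derive x 1 (itg f a0) (f x).
Proof.
move=> cf ax; have xx : x < x + 1 by rewrite ltrDl.
have [d e] := @continuous_FTC1_closed _ f a0 x (x + 1) xx (integrable_cont _ _ cf) ax (cf x).
by split; [exact: d|rewrite -derive1E; exact: e].
Qed.

Lemma itg_shift f s a b : continuous f -> a <= b ->
  itg (fun t => f (t + s)) a b = itg f (a + s) (b + s).
Proof.
(* The primitive starts one unit to the left of the interval, so that it is differentiable at the
   left end too. This is the margin a - 1 in [itg_FTC]. *)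
move=> cf ab; pose P := itg f (a + s - 1).
have cs := @continuous_addr s.
have -> : itg f (a + s) (b + s) = P (b + s) - P (a + s).
  by apply: itg_FTC => //; rewrite ?lerD2r // => x hx; exact: itg_primitive.
apply: (@itg_FTC (fun t => f (t + s)) (fun t => P (t + s))) => //.
  by move=> t; exact: (continuous_comp (cs t) (cf _)).
move=> x ax; have hx : a + s - 1 < x + s by lra.
have hg : is_derive x 1 (fun t : R => t + s) 1.
  by have := is_deriveD (is_derive_id x 1) (is_derive_cst s x 1); rewrite addr0.
have := @is_derive1_comp R P (fun t => t + s) x _ _ (itg_primitive cf hx) hg.
by rewrite mulr1.
Qed.

Lemma itg_rev f L : continuous f -> 0 <= L -> itg (fun t => f (L - t)) 0 L = itg f 0 L.
Proof.
move=> cf L0; pose h t := f (t + L).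
have ch : continuous h.
  by move=> t; exact: (continuous_comp (@continuous_addr L t) (cf _)).
have := @integration_by_substitution_oppr _ h 0 L L0 (continuous_subspaceT ch).
rewrite oppr0 => e.
transitivity (itg h (- L) 0); last first.
  by rewrite itg_shift ?addNr ?add0r // oppr_le0.
rewrite /itg /Rintegral e; congr fine; apply: eq_integral => t _.
by rewrite /= /h addrC.
Qed.

(** The total error along two segments that separate exponentially; what matters is that the bound
    does not depend on the length L. *)
Lemma itg_exp c L : 0 < c -> 0 <= L ->
  itg (fun t => expR (c * (t - L))) 0 L <= c^-1.
Proof.
move=> c0 L0; have cf : continuous (fun t => expR (c * (t - L))).
  have cl : continuous (fun t => c * (t - L)).
    by move=> t; apply: cvgM; [exact: cvg_cst|exact: continuous_addr].
  by move=> t; exact: (continuous_comp (cl t) (@continuous_expR R _)).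
have D (x : R) : is_derive x 1 (fun t => c^-1 * expR (c * (t - L))) (expR (c * (x - L))).
  have hg : is_derive x 1 (fun t : R => c * (t - L)) c.
    have := is_deriveZ c (is_deriveB (is_derive_id x 1) (is_derive_cst L x 1)).
    by rewrite subr0 /GRing.scale /= mulr1.
  have h := is_deriveZ c^-1 (@is_derive1_comp R expR (fun t => c * (t - L)) x _ _
     (is_derive_expR (c * (x - L))) hg).
  apply: (is_derive_eq h); rewrite /GRing.scale /= mulrCA mulVf ?mulr1 //.
  by rewrite gt_eqF.
rewrite (@itg_FTC _ (fun t => c^-1 * expR (c * (t - L)))) // subrr mulr0 expR0 mulr1.
by rewrite lerBlDr lerDl mulr_ge0 // ?expR_ge0 // invr_ge0 ltW.
Qed.

End Integrals.

(** * Hölder potentials: oscillation on fibres and linear growth *)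

Section Holder.
Context {R : realType}.
Variables (Kh : set R[i]) (cK : closed_subfield Kh).
Implicit Types (x y : hpoint R) (u v w : vect R) (F : vect R -> R) (s t : R).

Let rK := closed_subfield_real cK.
Let K0 := closed_subfield0 cK.
Let K1 := closed_subfield1 cK.

(** A bound M on the distances of the footpoints replaces the supremum in [dist_T1], and the
    symmetric interval [-1, 1] makes the condition stable under [flip]. *)
Definition holder_with F (a c : R) : Prop := [/\ 0 < a, a <= 1, 0 < c &
  forall v w M, T1 Kh v -> T1 Kh w -> M <= 1 ->
  (forall s, -1 <= s <= 1 -> hdist (foot (flow s v)) (foot (flow s w)) <= M) ->
  `|F v - F w| <= c * M `^ a].

Lemma dist_T1_le v w M :
  (forall s, 0 <= s <= 1 -> hdist (foot (flow s v)) (foot (flow s w)) <= M) -> dist_T1 v w <= M.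
Proof.
move=> h; apply: ge_sup.
  by exists (hdist (foot (flow 0 v)) (foot (flow 0 w))), 0 => //=; rewrite in_itv /= lexx ler01.
by move=> d [s /=]; rewrite in_itv /= => hs <-; exact: h.
Qed.

Lemma dist_T1_ge0 v w M : T1 Kh v -> T1 Kh w ->
  (forall s, 0 <= s <= 1 -> hdist (foot (flow s v)) (foot (flow s w)) <= M) -> 0 <= dist_T1 v w.
Proof.
move=> Tv Tw h; apply: le_trans (hdist_ge0 (foot_flow_gt0 0 Tv) (foot_flow_gt0 0 Tw)) _.
apply: sup_ubound; last by exists 0 => //=; rewrite in_itv /= lexx ler01.
by exists M => d [s /=]; rewrite in_itv /= => hs <-; exact: h.
Qed.

Lemma holder_holder_with F : holder Kh F -> exists a c, holder_with F a c.
Proof.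
move=> [a [c [/andP[a0 a1] c0 hF]]]; exists a, c; split => // v w M Tv Tw M1 h.
have h' s : 0 <= s <= 1 -> hdist (foot (flow s v)) (foot (flow s w)) <= M.
  by move=> /andP[s0 s1]; apply: h; rewrite s1 andbT; lra.
have d0 := dist_T1_ge0 Tv Tw h'; have d1 := dist_T1_le h'.
apply: (le_trans (hF v w Tv Tw (le_trans d1 M1))).
rewrite ler_pM2l //; apply: ge0_ler_powR; rewrite ?nnegrE //; first exact: ltW.
exact: le_trans d1.
Qed.

Lemma holder_with_flip F a c : holder_with F a c -> holder_with (F \o @flip R) a c.
Proof.
move=> [a0 a1 c0 hF]; split => // v w M Tv Tw M1 h.
apply: hF => //; try exact: T1_flip.
move=> s /andP[s0 s1]; rewrite !flow_flip !foot_flip; apply: h; apply/andP; split; lra.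
Qed.

Lemma holder_withB F a c d : holder_with F a c -> holder_with (fun w => F w - d) a c.
Proof.
move=> [a0 a1 c0 hF]; split => // v w M Tv Tw M1 h.
by rewrite opprB addrA subrK; exact: hF.
Qed.

Variables (F : vect R -> R) (a c : R).
Hypothesis hF : holder_with F a c.

Let a0 : 0 < a. Proof. by case: hF. Qed.
Let c0 : 0 < c. Proof. by case: hF. Qed.

Lemma holder_le v w M : T1 Kh v -> T1 Kh w -> M <= 1 ->
  (forall s, -1 <= s <= 1 -> hdist (foot (flow s v)) (foot (flow s w)) <= M) ->
  `|F v - F w| <= c * M `^ a.
Proof. by case: hF => _ _ _; exact. Qed.

Lemma holder_flow v s t : T1 Kh v -> `|s - t| <= 1 ->
  `|F (flow s v) - F (flow t v)| <= c * `|s - t| `^ a.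
Proof.
move=> Tv h; apply: holder_le => //; try exact: T1_flow.
move=> r _; rewrite !(flowD _ _ Tv) (hdist_flow _ _ Tv).
by rewrite opprD addrACA subrr add0r.
Qed.

Lemma continuous_flow v : T1 Kh v -> continuous (fun t => F (flow t v)).
Proof.
move=> Tv t; apply/(@cvgrPdist_le _ _ _ (nbhs t) _) => e e0.
pose d := Num.min 1 ((e / c) `^ (a^-1)).
have ec : 0 < e / c by rewrite divr_gt0.
have d0 : 0 < d by rewrite lt_min ltr01 /= powR_gt0.
near=> s; have st : `|t - s| <= d.
  near: s; apply/nbhs_ballP; exists d => // s; rewrite -ball_normE /ball_ /=; exact: ltW.
move: st; rewrite le_min => /andP[st1 st2].
apply: (le_trans (holder_flow Tv st1)).
rewrite mulrC -ler_pdivlMr //.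
have -> : e / c = ((e / c) `^ a^-1) `^ a by rewrite -powRrM mulVf ?powRr1 ?gt_eqF // ltW.
by apply: ge0_ler_powR; rewrite ?nnegrE ?powR_ge0 // ltW.
Unshelve. all: by end_near. Qed.

Lemma holder_flow_nat n v s : T1 Kh v -> 0 <= s <= n%:R ->
  `|F (flow s v) - F v| <= c * n%:R.
Proof.
move=> Tv; elim: n s => [|n IH] s /andP[s0 sn].
  by have -> : s = 0 by [lra]; rewrite flow0 subrr normr0 mulr0.
have [s1|s1] := lerP s n%:R.
  apply: (le_trans (IH s _)); first by rewrite s0 s1.
  by rewrite ler_pM2l // ler_nat.
have := IH n%:R; rewrite lexx ler0n => /(_ isT) h.
have h2 : `|F (flow s v) - F (flow n%:R v)| <= c.
  have sn1 : `|s - n%:R| <= 1 by rewrite gtr0_norm ?subr_gt0 //; move: sn; rewrite -natr1; lra.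
  apply: (le_trans (holder_flow Tv sn1)); rewrite ler_piMr ?(ltW c0) //.
  have p1 : (1 : R) `^ a = 1 by rewrite powR1.
  by rewrite -[leRHS]p1; apply: ge0_ler_powR; rewrite ?nnegrE // ltW.
rewrite -natr1 mulrDr mulr1; have := ler_normD (F (flow s v) - F (flow n%:R v)) (F (flow n%:R v) - F v).
rewrite addrA subrK; lra.
Qed.

Lemma ch1_lt : (ch 1 + 1) * 3 <= 10 :> R.
Proof.
have e1 := expR_mulN (1 / 4 : R).
have h1 := expR_ge1Dx (- (1 / 4) : R); have h2 := expR_ge1Dx (1 / 4 : R).
have E : expR 1 = expR (1 / 4) ^+ 4 :> R by rewrite -expRM_natl; congr expR; field.
have E' : expR (- 1) = expR (- (1 / 4)) ^+ 4 :> R by rewrite -expRM_natl; congr expR; field.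
rewrite /ch E E'.
have x0 := expR_gt0 (1 / 4 : R); have y0 := expR_gt0 (- (1 / 4) : R).
set x := expR (1 / 4) in e1 h1 h2 x0 *; set y := expR _ in e1 h1 h2 y0 *.
have x1 : x <= 4 / 3 by nra.
have y1 : y <= 4 / 5 by nra.
have x2 : x ^+ 2 <= 16 / 9 by nra.
have y2 : y ^+ 2 <= 16 / 25 by nra.
have x4 : x ^+ 4 <= 256 / 81 by rewrite (exprM x 2 2); apply: (le_trans (sqr_le (sqr_ge0 x) x2)); lra.
have y4 : y ^+ 4 <= 256 / 625 by rewrite (exprM y 2 2); apply: (le_trans (sqr_le (sqr_ge0 y) y2)); lra.
by lra.
Qed.

(** With cosine at least 7/10 the two geodesics stay within distance 1 on [-1, 1], where the Hölder
    bound applies: sinh^2(1) * 3/10 <= cosh 1 - 1 is [ch1_lt] multiplied by cosh 1 - 1. *)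
Lemma fiber_close v w : T1 Kh v -> T1 Kh w -> foot v = foot w -> 7 / 10 <= ip v w ->
  `|F v - F w| <= c.
Proof.
move=> Tv Tw e h; have p1 : (1 : R) `^ a = 1 by rewrite powR1.
rewrite -[leRHS]mulr1 -[X in c * X]p1; apply: holder_le => // s /andP[s0 s1].
rewrite hdist_le ?(foot_flow_gt0 _ Tv) ?(foot_flow_gt0 _ Tw) //.
rewrite (law_of_cosines _ _ Tv Tw) //.
have chs : ch s <= ch 1 by apply: ch_le; rewrite normr1 ler_norml s0.
have ch0 := ch_gt0 s.
have := ch2sh2 s; have := ch2sh2 (1 : R); have := ch1_lt; have := ch_ge1 (1 : R).
have ib := ip_bound Tv Tw; move: ib; rewrite ler_norml => /andP[_ ib].
have ss : sh s ^+ 2 <= sh 1 ^+ 2 by have := sqr_le (ltW ch0) chs; have := ch2sh2 s; have := ch2sh2 (1 : R); lra.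
have k : sh s ^+ 2 * (1 - ip v w) <= sh 1 ^+ 2 * (1 - ip v w).
  by rewrite ler_wpM2r // subr_ge0.
move=> c1 c3 e1 e2.
have k2 : sh 1 ^+ 2 * (1 - ip v w) <= sh 1 ^+ 2 * (3 / 10).
  by rewrite ler_wpM2l ?sqr_ge0 //; lra.
by nra.
Qed.

(** The normalised bisector. Halving the angle twice brings any two non-opposite vectors within
    reach of [fiber_close]. *)
Lemma fiber_mid v w : T1 Kh v -> T1 Kh w -> foot v = foot w -> -1 < ip v w ->
  exists u, [/\ T1 Kh u, foot u = foot v, ip v u = ip w u, 0 <= ip v u &
                ip v u ^+ 2 = (1 + ip v w) / 2].
Proof.
move=> Tv Tw e h; pose n := Num.sqrt (2 + 2 * ip v w).
have n2 : n ^+ 2 = 2 + 2 * ip v w by rewrite sqr_sqrtr //; lra.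
have n0 : 0 < n by rewrite sqrtr_gt0; lra.
have ev := T1_norm Tv; have ew := T1_norm Tw.
exists (v.1, ((n^-1)%:C%C * (v.2.1 + w.2.1), n^-1 * (v.2.2 + w.2.2))).
have i1 : ip v (v.1, ((n^-1)%:C%C * (v.2.1 + w.2.1), n^-1 * (v.2.2 + w.2.2))) = n / 2.
  rewrite /ip /= !reimE; move: n2; rewrite /ip => n2.
  apply: (mulfI (lt0r_neq0 n0)).
  transitivity (n / n * (reC v.2.1 ^+ 2 + imC v.2.1 ^+ 2 + v.2.2 ^+ 2 +
     (reC v.2.1 * reC w.2.1 + imC v.2.1 * imC w.2.1 + v.2.2 * w.2.2))); first by ring.
  by rewrite ev mulfV ?gt_eqF // mul1r mulrA -expr2 n2; lra.
have i2 : ip w (v.1, ((n^-1)%:C%C * (v.2.1 + w.2.1), n^-1 * (v.2.2 + w.2.2))) = n / 2.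
  rewrite /ip /= !reimE; move: n2; rewrite /ip => n2.
  apply: (mulfI (lt0r_neq0 n0)).
  transitivity (n / n * (reC w.2.1 ^+ 2 + imC w.2.1 ^+ 2 + w.2.2 ^+ 2 +
     (reC v.2.1 * reC w.2.1 + imC v.2.1 * imC w.2.1 + v.2.2 * w.2.2))); first by ring.
  by rewrite ew mulfV ?gt_eqF // mul1r mulrA -expr2 n2; lra.
split => //; rewrite ?i1 ?i2 //; last 2 first.
- by rewrite divr_ge0 // ltW.
- by rewrite expr_div_n n2; field.
case: Tv Tw => [[kv v0] kv1 _] [[kw w0] kw1 _]; split => //=.
  by apply: real_subspaceZ => //; exact: real_subspaceD.
rewrite normc2 !reimE.
have -> : (n^-1 * (reC v.2.1 + reC w.2.1)) ^+ 2 + (n^-1 * (imC v.2.1 + imC w.2.1)) ^+ 2 +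
  (n^-1 * (v.2.2 + w.2.2)) ^+ 2 = ((reC v.2.1 ^+ 2 + imC v.2.1 ^+ 2 + v.2.2 ^+ 2) +
  (reC w.2.1 ^+ 2 + imC w.2.1 ^+ 2 + w.2.2 ^+ 2) + 2 * ip v w) / n ^+ 2.
  by rewrite /ip; field; rewrite gt_eqF.
rewrite ev ew n2 (_ : 1 + 1 + 2 * ip v w = 2 + 2 * ip v w); last by ring.
by rewrite divff // -n2 expf_neq0 // gt_eqF.
Qed.

Lemma ip_sym v w : ip v w = ip w v.
Proof. by rewrite /ip; ring. Qed.

Lemma fiber_half v w : T1 Kh v -> T1 Kh w -> foot v = foot w -> 0 <= ip v w ->
  `|F v - F w| <= 2 * c.
Proof.
move=> Tv Tw e h; have [|u [Tu eu e1 i0 i2]] := fiber_mid Tv Tw e; first by lra.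
have i7 : 7 / 10 <= ip v u by nra.
have h1 := fiber_close Tv Tu (esym eu) i7.
have h2 : `|F u - F w| <= c.
  by apply: fiber_close => //; rewrite ?eu // ip_sym -e1.
have := ler_normD (F v - F u) (F u - F w); rewrite addrA subrK; lra.
Qed.

Lemma fiber_nonanti v w : T1 Kh v -> T1 Kh w -> foot v = foot w -> -1 < ip v w ->
  `|F v - F w| <= 4 * c.
Proof.
move=> Tv Tw e h; have [u [Tu eu e1 i0 i2]] := fiber_mid Tv Tw e h.
have h1 := fiber_half Tv Tu (esym eu) i0.
have h2 : `|F u - F w| <= 2 * c.
  by apply: fiber_half => //; rewrite ?eu // ip_sym -e1.
have := ler_normD (F v - F u) (F u - F w); rewrite addrA subrK; lra.
Qed.

Lemma fiber_osc v w : T1 Kh v -> T1 Kh w -> foot v = foot w -> `|F v - F w| <= 8 * c.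
Proof.
move=> Tv Tw e; have [h|h] := ltrP (-1) (ip v w).
  by apply: (le_trans (fiber_nonanti Tv Tw e h)); have := c0; lra.
have e1 : ip v w = -1.
  by have := ip_bound Tv Tw; rewrite ler_norml => /andP[]; lra.
have wv : w = flip v.
  symmetry; apply: (ip_eq1 (T1_flip rK Tv) Tw); first by rewrite foot_flip.
  by rewrite ipN e1 opprK.
(* Opposite vectors have no bisector, so a third vector u is interposed: the vertical one, or a
   horizontal one when v is vertical. *)
have [u [Tu eu]] : exists u, [/\ T1 Kh u, foot u = foot v & -1 < ip v u < 1].
  have [n|n] := eqVneq (v.2.2 ^+ 2) 1; last first.
    exists (v.1, (0, 1)); split => //.
      by case: Tv => [uv _ _]; split => //=; rewrite expr0n /= addr0 sqrtr0 expr0n /= add0r expr1n.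
    have := T1_norm Tv; have := sqr_ge0 (reC v.2.1); have := sqr_ge0 (imC v.2.1).
    rewrite /ip /= !mulr0 !add0r mulr1 => h1 h2 h3.
    have h4 : v.2.2 ^+ 2 < 1 by rewrite lt_neqAle n; lra.
    by rewrite -ltr_norml -(@ltr_pXn2r _ 2) ?nnegrE // expr1n real_normK // num_real.
  exists (v.1, (1, 0)); split => //.
    by case: Tv => [uv _ _]; split => //; rewrite normc2 /=; ring.
  have := T1_norm Tv; have := sqr_ge0 (reC v.2.1); have := sqr_ge0 (imC v.2.1).
  rewrite /ip /= !mulr0 mulr1 !addr0 => h1 h2 h3.
  have /eqP : reC v.2.1 ^+ 2 = 0 by lra.
  by rewrite sqrf_eq0 => /eqP ->; rewrite ltrN10 ltr01.
move=> /andP[u1 u2]; have h1 := fiber_nonanti Tv Tu (esym eu) u1.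
have h2 : `|F u - F w| <= 4 * c.
  by apply: fiber_nonanti => //; rewrite ?eu // wv ip_sym ipN; lra.
have := ler_normD (F v - F u) (F u - F w); rewrite addrA subrK; lra.
Qed.

(** The Hölder condition only compares vectors at distance at most 1. Chaining it along the segment
    from x0 gives linear growth, which is all that is known far from the orbit. *)
Lemma growth x0 : upper Kh x0 -> exists2 A, 0 <= A &
  forall v, T1 Kh v -> `|F v| <= A + c * hdist x0 (foot v).
Proof.
move=> ux; pose v0 : vect R := (x0, (0, 1)).
have T0 : T1 Kh v0.
  by split => //=; rewrite expr0n /= addr0 sqrtr0 expr0n /= add0r expr1n.
(* 17 = 8 + 8 + 1: one fibre oscillation at each end of the segment, and one unit for rounding its
   length up to an integer. *)
have c0' := c0; exists (`|F v0| + 17 * c) => [|v Tv]; first by rewrite addr_ge0 ?mulr_ge0 // ltW.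
have uv : upper Kh (foot v) by case: Tv.
have [u [Tu eu fu]] := exists_vect_to rK K0 ux uv.
have d0 : 0 <= hdist x0 (foot v) by apply: hdist_ge0; [case: ux|case: uv].
set d := hdist x0 (foot v) in d0 fu *.
have h1 := fiber_osc (T1_flow d rK Tu) Tv fu.
have h3 := fiber_osc Tu T0 eu.
pose n := (Num.truncn d).+1.
have dn : 0 <= d <= n%:R by rewrite d0 /= ltW // truncnS_gt.
have h2 := holder_flow_nat Tu dn.
have nd : n%:R <= d + 1 by rewrite -natr1 lerD2r; by rewrite truncn_le.
have h4 : c * n%:R <= c * (d + 1) by rewrite ler_pM2l.
have t1 := ler_distD (F (flow d u)) (F v) 0; have t2 := ler_distD (F u) (F (flow d u)) 0.
have t3 := ler_distD (F v0) (F u) 0; move: t1 t2 t3; rewrite !subr0 (distrC (F v)).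
by lra.
Qed.

End Holder.

(** * Integrals of the potential over segments and their dependence on the endpoints *)

Section SegmentIntegrals.
Context {R : realType}.
Variables (Kh : set R[i]) (cK : closed_subfield Kh).
Implicit Types (x y : hpoint R) (u v w : vect R) (F : vect R -> R) (s t m e M D A K : R) (g : PSL2 R).

Let rK := closed_subfield_real cK.
Let K0 := closed_subfield0 cK.

Lemma segment_flow F v s : T1 Kh v -> 0 <= s ->
  segment_int F (foot v) (foot (flow s v)) = itg (fun t => F (flow t v)) 0 s.
Proof.
move=> Tv s0; rewrite /segment_int (hdist_foot_flow _ Tv) ger0_norm // -/(itg _ _ _).
move: s0; rewrite le_eqVlt => /orP[/eqP <-|s0]; first by rewrite !itg_same.
by rewrite (vect_to_flow Tv s0).
Qed.

Lemma segment_flow2 F v s t : T1 Kh v -> continuous (fun t => F (flow t v)) -> s <= t ->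
  segment_int F (foot (flow s v)) (foot (flow t v)) = itg (fun t => F (flow t v)) s t.
Proof.
move=> Tv cF st; have := segment_flow F (T1_flow s rK Tv) (s := t - s).
rewrite subr_ge0 => /(_ st); rewrite (flowD _ _ Tv) subrK => ->.
under [X in itg X]eq_fun do rewrite (flowD _ _ Tv).
by rewrite (@itg_shift _ (fun t => F (flow t v))) ?subr_ge0 // add0r subrK.
Qed.

Lemma segment_rev F x y : upper Kh x -> upper Kh y ->
  (forall v, T1 Kh v -> continuous (fun t => F (flow t v))) ->
  segment_int F x y = segment_int (F \o @flip R) y x.
Proof.
move=> ux uy cF; have [v [Tv ev fv]] := exists_vect_to rK K0 ux uy.
have d0 : 0 <= hdist x y by apply: hdist_ge0; [case: ux|case: uy].
set d := hdist x y in d0 fv; have Tw := T1_flip rK (T1_flow d rK Tv).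
have ew : foot (flip (flow d v)) = y by rewrite foot_flip.
have fw : foot (flow d (flip (flow d v))) = x.
  by rewrite flow_flip foot_flip (flowD _ _ Tv) addNr flow0.
have := segment_flow F Tv d0; have := segment_flow (F \o @flip R) Tw d0.
rewrite ev fv ew fw => -> ->.
rewrite -(@itg_rev _ (fun t => F (flow t v))) //; last exact: cF.
congr (itg _ 0 _); apply/funext => t.
by rewrite /comp flow_flip flipK (flowD _ _ Tv) addrC.
Qed.

Lemma segment_hact F g x y : matK Kh g -> upper Kh x -> upper Kh y ->
  (forall v, T1 Kh v -> F (tact g v) = F v) ->
  segment_int F (hact g x) (hact g y) = segment_int F x y.
Proof.
move=> kg ux uy iF; have [v [Tv ev fv]] := exists_vect_to rK K0 ux uy.
have d0 : 0 <= hdist x y by apply: hdist_ge0; [case: ux|case: uy].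
have Tw := T1_tact cK kg Tv.
have := segment_flow F Tw d0; rewrite (foot_tact _ _ Tv) fv.
have := foot_tact g 0 Tv; rewrite !flow0 ev => -> ->.
have := segment_flow F Tv d0; rewrite ev fv => ->.
congr (itg _ 0 _); apply/funext => t.
by rewrite (flow_tact _ _ Tv) iF //; exact: T1_flow.
Qed.

Lemma itgZ (k : R) (f : R -> R) p q : continuous f -> itg (fun t => k * f t) p q = k * itg f p q.
Proof. by move=> cf; apply: RintegralZl => //; exact: integrable_cont. Qed.

Lemma ch_ub s : 0 <= s <= 1 -> ch s - 1 <= 2 * s ^+ 2.
Proof.
move=> /andP[s0 s1]; have e2 := expR_mulN (s / 2).
have h1 := @expR_ge1Dx R (s / 2); have h2 := @expR_ge1Dx R (- (s / 2)).
have es : s = s / 2 + s / 2 by field.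
have -> : ch s - 1 = (expR (s / 2) - expR (- (s / 2))) ^+ 2 / 2.
  rewrite /ch {1 2}es opprD !expRD.
  by move: e2; set x := expR (s / 2); set y := expR _ => xy; lra.
move: e2 h1 h2; set x := expR (s / 2); set y := expR _ => e2 h1 h2.
have k : x - y <= 2 * s.
  have : x * (1 - s / 2) <= 1 by rewrite -[leRHS]e2; apply: ler_wpM2l => //; lra.
  by nra.
have y1 : y <= 1 by rewrite -expR0 ler_expR; lra.
have : (x - y) ^+ 2 <= (2 * s) ^+ 2 by apply: sqr_le => //; lra.
by lra.
Qed.

Variables (F : vect R -> R) (a c : R).
Hypothesis hF : holder_with Kh F a c.

Let a0 : 0 < a. Proof. by case: hF. Qed.
Let c0 : 0 < c. Proof. by case: hF. Qed.

(** The constant produced by [rays_close], where 16^2 = 2 * 128 and e accounts for the times in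
    [-1, 1]. *)
Definition track_cst : R := 16 * expR 1.
Lemma track_cst_gt0 : 0 < track_cst.
Proof. by rewrite mulr_gt0 // expR_gt0. Qed.

Lemma track_cst_ge16 : 16 <= track_cst.
Proof. by rewrite /track_cst ler_peMr //; have := @expR_ge1Dx R 1; lra. Qed.

(* By the law of cosines, rays from a common point that are 2e-close at time m are exponentially
   closer before m. *)
Lemma rays_close v w m e s (u : R) : T1 Kh v -> T1 Kh w -> foot v = foot w ->
  1 / 2 <= m -> 0 <= e -> 2 * e <= 1 ->
  hdist (foot (flow m v)) (foot (flow m w)) <= 2 * e -> 0 <= s -> -1 <= u <= 1 ->
  hdist (foot (flow u (flow s v))) (foot (flow u (flow s w))) <=
    track_cst * e * expR (s - m).
Proof.
move=> Tv Tw vw m2 e0 e1 dm s0 /andP[u0 u1].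
have p0 r : 0 < (foot (flow r v)).2 := foot_flow_gt0 r Tv.
have q0 r : 0 < (foot (flow r w)).2 := foot_flow_gt0 r Tw.
rewrite (flowD _ _ Tv) (flowD _ _ Tw).
have cdE r := cd_equal_time r Tv Tw vw; have om := ip_gap_ge0 Tv Tw.
have h1 : sh m ^+ 2 * (1 - ip v w) <= 8 * e ^+ 2.
  have := dm; rewrite hdist_le ?mulr_ge0 // cdE => h.
  by have := @ch_ub (2 * e); rewrite mulr_ge0 // e1 => /(_ isT); lra.
have h2 : expR m <= 4 * sh m.
  rewrite /sh; have := expR_mulN m; have := expR_gt0 (- m); have := @expR_ge1Dx R m.
  by nra.
have h3 : sh (u + s) ^+ 2 <= (expR 1 * expR s / 2) ^+ 2.
  have k : ch (u + s) <= ch (s + 1).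
    by apply: ch_le; rewrite [leRHS]ger0_norm ?ler_norml; [apply/andP; split|]; lra.
  have k2 : sh (u + s) ^+ 2 <= sh (s + 1) ^+ 2.
    have := ch2sh2 (u + s); have := ch2sh2 (s + 1).
    by have := sqr_le (ltW (ch_gt0 _)) k; lra.
  apply: (le_trans k2); apply: sqr_le; first by apply: sh_ge0; lra.
  by rewrite /sh (addrC s) expRD; have := expR_gt0 (- (1 + s)); lra.
set d := hdist _ _; have d0 : 0 <= d by exact: hdist_ge0.
have d2 : d ^+ 2 <= 8 * (sh (u + s) ^+ 2 * (1 - ip v w)).
  rewrite mulrC -ler_pdivrMr //; apply: (le_trans (ch_lb _)).
  by rewrite /d ch_hdist // cdE addrAC subrr add0r.
have em := expR_gt0 m; have es := expR_gt0 s; have e1' := expR_gt0 (1 : R).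
apply: le_of_sqr; first by rewrite !mulr_ge0 // expR_ge0.
rewrite expRD expRN.
have h4 : expR m ^+ 2 <= 16 * sh m ^+ 2.
  by have := sqr_le (ltW em) h2; rewrite exprMn; lra.
have h5 : expR m ^+ 2 * (1 - ip v w) <= 128 * e ^+ 2.
  have := ler_wpM2r om h4; lra.
have h6 : d ^+ 2 <= 2 * (expR 1 * expR s) ^+ 2 * (1 - ip v w).
  by have := ler_wpM2r om h3; lra.
have -> : (track_cst * e * (expR s / expR m)) ^+ 2 =
   (2 * (expR 1 * expR s) ^+ 2 / expR m ^+ 2) * (128 * e ^+ 2).
  by rewrite /track_cst; field; rewrite gt_eqF.
apply: (le_trans h6).
have -> : 2 * (expR 1 * expR s) ^+ 2 * (1 - ip v w) =
   (2 * (expR 1 * expR s) ^+ 2 / expR m ^+ 2) * (expR m ^+ 2 * (1 - ip v w)).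
  by field; rewrite gt_eqF.
by rewrite ler_wpM2l // divr_ge0 ?sqr_ge0 // mulr_ge0 // sqr_ge0.
Qed.

(** Both segments are cut at the smaller length m. Before m their distance decays exponentially away
    from x, so the Hölder errors have a bounded sum; the pieces after m have total length at most e
    and lie where |F| <= M. *)
Lemma track_small x x' y e M : upper Kh x -> upper Kh x' -> upper Kh y ->
  0 <= e -> track_cst * e <= 1 -> hdist x x' <= e -> 1 <= hdist y x ->
  (forall u, T1 Kh u -> hdist (foot u) x <= 1 -> `|F u| <= M) ->
  `|segment_int F y x - segment_int F y x'| <= c / a * (track_cst * e) `^ a + 2 * e * M.
Proof.
move=> ux ux' uy e0 e1 dxx' L1 hM.
have e16 : 16 * e <= 1 by apply: (le_trans _ e1); rewrite ler_wpM2r // track_cst_ge16.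
have [v [Tv ev fv]] := exists_vect_to rK K0 uy ux.
have [w [Tw ew fw]] := exists_vect_to rK K0 uy ux'.
have [[_ x0] [_ x'0] [_ y0]] := And3 ux ux' uy.
set L := hdist y x in L1 fv; set L' := hdist y x' in fw.
have t1 : L <= L' + e.
  by rewrite /L (le_trans (hdist_triangle y0 x'0 x0)) // lerD2l hdist_sym.
have t2 : L' <= L + e.
  by rewrite /L' (le_trans (hdist_triangle y0 x0 x'0)) // lerD2l.
have L0' : 0 <= L' by exact: hdist_ge0.
pose m := Num.min L L'.
have mL : m <= L by rewrite ge_min lexx.
have mL' : m <= L' by rewrite ge_min lexx orbT.
have m2 : 1 / 2 <= m by rewrite le_min; apply/andP; split; lra.
have mLL : m = L \/ m = L' by rewrite /m minEle; case: ifP; [left|right].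
have Lm : L - m <= e by case: mLL => ->; lra.
have Lm' : L' - m <= e by case: mLL => ->; lra.
have LL : (L - m) + (L' - m) <= e by case: mLL => ->; lra.
have p0 r : 0 < (foot (flow r v)).2 := foot_flow_gt0 r Tv.
have q0 r : 0 < (foot (flow r w)).2 := foot_flow_gt0 r Tw.
have dv r : r <= L -> hdist (foot (flow r v)) x = L - r.
  by move=> h; rewrite -fv (hdist_flow _ _ Tv) distrC ger0_norm // subr_ge0.
have dw r : r <= L' -> hdist (foot (flow r w)) x' = L' - r.
  by move=> h; rewrite -fw (hdist_flow _ _ Tw) distrC ger0_norm // subr_ge0.
have dm : hdist (foot (flow m v)) (foot (flow m w)) <= 2 * e.
  have := hdist_triangle (p0 m) x0 (q0 m); have := hdist_triangle x0 x'0 (q0 m).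
  by rewrite dv // (hdist_sym x') dw //; lra.
have cv := continuous_flow cK hF Tv; have cw := continuous_flow cK hF Tw.
have vw : foot v = foot w by rewrite ev ew.
have -> : segment_int F y x = itg (fun t => F (flow t v)) 0 L.
  by rewrite -{1}ev -fv (segment_flow _ Tv) //; lra.
have -> : segment_int F y x' = itg (fun t => F (flow t w)) 0 L'.
  by rewrite -{1}ew -fw (segment_flow _ Tw).
rewrite (itg_split cv (_ : 0 <= m) mL) ?(itg_split cw (_ : 0 <= m) mL'); [|lra|lra].
have M0 : 0 <= M.
  have := hM (flow L v) (T1_flow L rK Tv); rewrite dv // subrr ler01 => /(_ isT).
  exact: le_trans.
have b1 : `|itg (fun t => F (flow t v)) m L| <= M * (L - m).
  apply: itg_bound => // t /andP[h1 h2]; apply: hM; first exact: T1_flow.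
  by rewrite dv //; lra.
have b2 : `|itg (fun t => F (flow t w)) m L'| <= M * (L' - m).
  apply: itg_bound => // t /andP[h1 h2]; apply: hM; first exact: T1_flow.
  have := hdist_triangle (q0 t) x'0 x0; rewrite dw // (hdist_sym x'); lra.
have b3 : `|itg (fun t => F (flow t v)) 0 m - itg (fun t => F (flow t w)) 0 m| <=
   c / a * (track_cst * e) `^ a.
  have ce : continuous (fun t : R => expR (a * (t - m))).
    have cl : continuous (fun t : R => a * (t - m)).
      by move=> t; apply: cvgM; [exact: cvg_cst|exact: continuous_addr].
    by move=> t; exact: (continuous_comp (cl t) (@continuous_expR R _)).
  have cK' : continuous (fun t : R => c * (track_cst * e) `^ a * expR (a * (t - m))).
    by move=> t; apply: cvgM; [exact: cvg_cst|exact: ce].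
  apply: (le_trans (itg_dist cv cw cK' _)) => [t /andP[h1 h2]|].
    have tm : expR (t - m) <= 1 by rewrite -expR0 ler_expR; lra.
    have k0 : 0 <= track_cst * e by rewrite mulr_ge0 // ltW // track_cst_gt0.
    have -> : c * (track_cst * e) `^ a * expR (a * (t - m)) =
       c * (track_cst * e * expR (t - m)) `^ a.
      by rewrite [in RHS]powRM ?expR_ge0 // mulrA (mulrC a) expRM.
    apply: (holder_le hF); try exact: T1_flow.
      by rewrite (le_trans _ e1) // ler_piMr.
    by move=> u hu; apply: (@rays_close v w m e t u) => //; lra.
  rewrite itgZ // [leRHS]mulrAC; apply: ler_wpM2l; last by apply: itg_exp => //; lra.
  by rewrite mulr_ge0 ?powR_ge0 // ltW.
have b4 : M * (L - m) + M * (L' - m) <= M * e by rewrite -mulrDr ler_wpM2l.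
have -> : forall p q p' q' : R, p + q - (p' + q') = (p - p') + (q - q') by move=> *; ring.
apply: (le_trans (ler_normD _ _)); apply: lerD => //.
apply: (le_trans (ler_normB _ _)); have := mulr_ge0 M0 e0; lra.
Qed.

Lemma segment_bound x y M : upper Kh x -> upper Kh y ->
  (forall v, T1 Kh v -> hdist (foot v) y <= hdist x y -> `|F v| <= M) ->
  `|segment_int F x y| <= M * hdist x y.
Proof.
move=> ux uy hM; have [v [Tv ev fv]] := exists_vect_to rK K0 ux uy.
have d0 : 0 <= hdist x y by apply: hdist_ge0; [case: ux|case: uy].
have := segment_flow F Tv d0; rewrite ev fv => ->.
rewrite -[X in M * X]subr0; apply: itg_bound => //; first exact: (continuous_flow cK hF Tv).
move=> t /andP[t0 t1]; apply: hM; first exact: T1_flow.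
by rewrite -{1}fv (hdist_flow _ _ Tv) distrC ger0_norm; lra.
Qed.

Lemma track_step z z' y e M : upper Kh z -> upper Kh z' -> upper Kh y ->
  0 <= e -> track_cst * e <= 1 -> hdist z z' <= e -> 0 <= M ->
  (forall u, T1 Kh u -> hdist (foot u) z <= 3 -> `|F u| <= M) ->
  `|segment_int F y z - segment_int F y z'| <= (c / a + 4) * (1 + M).
Proof.
move=> uz uz' uy e0 Ce dz M0 hM.
have [[_ z0] [_ z'0] [_ y0]] := And3 uz uz' uy.
have C0 := track_cst_gt0.
have e16 : 16 * e <= 1 by apply: (le_trans _ Ce); rewrite ler_wpM2r // track_cst_ge16.
have ca : 0 <= c / a by rewrite divr_ge0 // ltW.
have hz u (r : R) : T1 Kh u -> r <= 3 -> hdist (foot u) z <= r -> `|F u| <= M.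
  by move=> Tu r3 h; apply: hM => //; exact: le_trans r3.
have cM : c / a + 4 * M <= (c / a + 4) * (1 + M).
  by move: (c / a) ca => k k0; have := mulr_ge0 k0 M0; lra.
have e4 : 2 * e * M <= 4 * M by rewrite ler_wpM2r //; lra.
have [far|near] := lerP 1 (hdist y z).
  apply: le_trans cM; have := @track_small z z' y e M uz uz' uy e0 Ce dz far.
  move=> /(_ (fun u Tu h => hz u 1 Tu (ler_nat _ 1 3) h)) h.
  apply: (le_trans h); apply: lerD => //.
  rewrite ler_piMr //; have p1 : (1 : R) `^ a = 1 by rewrite powR1.
  rewrite -[leRHS]p1; apply: ge0_ler_powR; rewrite ?nnegrE //; first exact: ltW.
  by rewrite mulr_ge0 // ltW.
have dy : hdist y z' <= 2.
  by have := hdist_triangle y0 z0 z'0; lra.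
have dy0 := hdist_ge0 y0 z0; have dy1 := hdist_ge0 y0 z'0.
have b1 : `|segment_int F y z| <= M * hdist y z.
  apply: segment_bound => // v' Tv' h; apply: (hz v' 1) => //; first by rewrite ler1n.
  by apply: (le_trans h); exact: ltW.
have b2 : `|segment_int F y z'| <= M * hdist y z'.
  apply: segment_bound => // v' Tv' h; apply: (hz v' 3) => //.
  have := hdist_triangle (T1_gt0 Tv' : 0 < (foot v').2) z'0 z0.
  by rewrite (hdist_sym z'); lra.
apply: le_trans cM; apply: (le_trans (ler_normB _ _)).
by have := ler_wpM2l M0 (ltW near); have := ler_wpM2l M0 dy; lra.
Qed.

(** The segment from x to x' is cut into n steps short enough for [track_step]. The constant depends
    on D alone; the potential enters only through its bound M near x. *)
Lemma track_end D : 0 <= D -> exists2 K : R, 0 <= K & forall x x' y M,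
  upper Kh x -> upper Kh x' -> upper Kh y -> hdist x x' <= D ->
  (forall u, T1 Kh u -> hdist (foot u) x <= D + 3 -> `|F u| <= M) ->
  `|segment_int F y x - segment_int F y x'| <= K * (1 + M).
Proof.
move=> D0; pose n := (Num.truncn (D * track_cst)).+1.
have nD : D * track_cst < n%:R by exact: truncnS_gt.
have C0 := track_cst_gt0; have C16 := track_cst_ge16.
exists (n%:R * (c / a + 4)); first by rewrite mulr_ge0 // addr_ge0 // divr_ge0 // ltW.
move=> x x' y M ux ux' uy dx hM.
have [[_ x0] [_ x'0] [_ y0]] := And3 ux ux' uy.
have [v [Tv ev fv]] := exists_vect_to rK K0 ux ux'.
set d := hdist x x' in dx fv; have d0 : 0 <= d by exact: hdist_ge0.
have n0 : 0 < n%:R :> R by rewrite ltr0n.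
pose e := d / n%:R; have e0 : 0 <= e by rewrite divr_ge0 // ltW.
have Ce : track_cst * e <= 1.
  rewrite /e mulrA ler_pdivrMr // mul1r mulrC ltW // (le_lt_trans _ nD) //.
  by rewrite ler_wpM2r // ltW.
have e16 : 16 * e <= 1 by apply: (le_trans _ Ce); rewrite ler_wpM2r.
pose z (i : nat) := foot (flow (e * i%:R) v).
have uz i : upper Kh (z i) by apply: foot_flow_upper.
have z0 i : 0 < (z i).2 by case: (uz i).
have dz i : hdist (z i) (z i.+1) <= e.
  by rewrite (hdist_flow _ _ Tv) -mulrBr -natr1 opprD addrA subrr sub0r mulrN1 normrN ger0_norm.
have M0 : 0 <= M.
  have := hM v Tv; rewrite ev hdistxx => h.
  by have /h : 0 <= D + 3; [lra|exact: le_trans (normr_ge0 _)].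
have zx i : (i <= n)%N -> hdist (z i) x <= D.
  move=> i_n; rewrite -ev -{1}(flow0 v) /z (hdist_flow _ _ Tv) subr0 ger0_norm; last first.
    by rewrite mulr_ge0.
  by apply: (le_trans _ dx); rewrite /e mulrAC ler_pdivrMr // ler_wpM2l // ler_nat.
suff H i : (i <= n)%N -> `|segment_int F y x - segment_int F y (z i)| <= i%:R * ((c / a + 4) * (1 + M)).
  have zn : z n = x' by rewrite /z /e divfK ?gt_eqF // fv.
  by have := H n (leqnn n); rewrite zn mulrA.
elim: i => [_|i IH i_n].
  by rewrite mul0r /z mulr0 flow0 ev subrr normr0.
have {}IH := IH (ltnW i_n); have zi := zx i (ltnW i_n).
suff st : `|segment_int F y (z i) - segment_int F y (z i.+1)| <= (c / a + 4) * (1 + M).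
  have := ler_normD (segment_int F y x - segment_int F y (z i))
    (segment_int F y (z i) - segment_int F y (z i.+1)).
  rewrite addrA subrK => h; apply: (le_trans h).
  by rewrite -natr1 mulrDl mul1r; exact: lerD.
apply: (track_step (e := e)) => // u Tu h; apply: hM => //.
have := hdist_triangle (T1_gt0 Tu : 0 < (foot u).2) (z0 i) x0.
by move: zi h; lra.
Qed.

End SegmentIntegrals.

(** * Uniform tracking near the orbit of the base point *)

Section Tracking.
Context {R : realType}.
Variables (Kh : set R[i]) (cK : closed_subfield Kh).
Variables (Gam : set (PSL2 R)) (x0 : hpoint R).
Hypotheses (GK : forall g, Gam g -> matK Kh g) (GV : forall g, Gam g -> Gam g^-1%g).
Hypothesis ux0 : upper Kh x0.
Implicit Types (x y : hpoint R) (v w : vect R) (F : vect R -> R) (D A K : R).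

Definition invariant_under F := forall g v, Gam g -> T1 Kh v -> F (tact g v) = F v.

Lemma invariant_flip F : invariant_under F -> invariant_under (F \o @flip R).
Proof.
move=> iF g v Gg Tv /=; rewrite (flip_tact _ Tv) iF //.
exact: T1_flip (closed_subfield_real cK) Tv.
Qed.

Variables (F : vect R -> R) (a c : R).
Hypotheses (hF : holder_with Kh F a c) (iF : invariant_under F).

Lemma growth_orbit : exists2 A : R, 0 <= A & forall g v, Gam g -> T1 Kh v ->
  `|F v| <= A + c * hdist (hact g x0) (foot v).
Proof.
have [A A0 h] := growth cK hF ux0; exists A => // g v Gg Tv.
have kg := GK (GV Gg); rewrite -(iF (GV Gg) Tv) (le_trans (h _ (T1_tact cK kg Tv))) //.
have -> : foot (tact g^-1%g v) = hact g^-1%g (foot v).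
  by have := foot_tact g^-1%g 0 Tv; rewrite !flow0.
have v0 : 0 < (foot v).2 := T1_gt0 Tv; have p0 : 0 < x0.2 by case: ux0.
by rewrite -(hdist_hact g) ?hact_gt0 // hactVK.
Qed.

(** Near an orbit point the potential is bounded by invariance, even if it is unbounded in the
    cusps. Only the moving endpoint has to be near the orbit; y is arbitrary. *)
Lemma track_orbit_end D : 0 <= D -> exists2 K : R, 0 <= K & forall g x x' y, Gam g ->
  upper Kh x -> upper Kh x' -> upper Kh y -> hdist (hact g x0) x <= D -> hdist x x' <= D ->
  `|segment_int F y x - segment_int F y x'| <= K.
Proof.
move=> D0; have [A A0 hA] := growth_orbit; have [K K0 hK] := track_end cK hF D0.
have c0 : 0 < c by case: hF.
exists (K * (1 + (A + c * (2 * D + 3)))) => [|g x x' y Gg ux ux' uy d1 d2].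
  have D3 : 0 <= 2 * D + 3 by lra.
  by rewrite mulr_ge0 // addr_ge0 // addr_ge0 // mulr_ge0 // ltW.
apply: hK => // u Tu hu; apply: (le_trans (hA g u Gg Tu)); rewrite lerD2l ler_pM2l //.
have gx : 0 < (hact g x0).2 by apply: hact_gt0; case: ux0.
have := hdist_triangle gx (proj2 ux) (T1_gt0 Tu : 0 < (foot u).2).
by rewrite (hdist_sym x); lra.
Qed.

End Tracking.

Section TrackOrbit.
Context {R : realType}.
Variables (Kh : set R[i]) (cK : closed_subfield Kh).
Variables (Gam : set (PSL2 R)) (x0 : hpoint R).
Hypotheses (GK : forall g, Gam g -> matK Kh g) (GV : forall g, Gam g -> Gam g^-1%g).
Hypothesis ux0 : upper Kh x0.
Variables (F : vect R -> R) (a c : R).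
Hypotheses (hF : holder_with Kh F a c) (iF : invariant_under Kh Gam F).

(** The second inequality is the first for the potential composed with [flip], since reversing a
    segment exchanges the two. *)
Lemma track_orbit (D : R) : 0 <= D -> exists2 K : R, 0 <= K & forall g x x' y, Gam g ->
  upper Kh x -> upper Kh x' -> upper Kh y -> hdist (hact g x0) x <= D -> hdist x x' <= D ->
  `|segment_int F y x - segment_int F y x'| <= K /\
  `|segment_int F x y - segment_int F x' y| <= K.
Proof.
move=> D0; have [K1 K10 h1] := track_orbit_end cK GK GV ux0 hF iF D0.
have hF' := holder_with_flip cK hF; have iF' := invariant_flip cK iF.
have [K2 K20 h2] := track_orbit_end cK GK GV ux0 hF' iF' D0.
exists (K1 + K2) => [|g x x' y Gg ux ux' uy d1 d2]; first exact: addr_ge0.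
have cF v : T1 Kh v -> continuous (fun t => F (flow t v)) := fun Tv => continuous_flow cK hF Tv.
split; first by apply: (le_trans (h1 g x x' y _ _ _ _ _ _)) => //; rewrite lerDl.
rewrite !(segment_rev cK (F := F)) //.
by apply: (le_trans (h2 g x x' y _ _ _ _ _ _)) => //; rewrite lerDr.
Qed.

End TrackOrbit.

#[local] Opaque segment_int.

Lemma normB4 {R : realDomainType} (b1 b2 b3 b4 u v : R) : `|b3 - b1| <= u -> `|b4 - b2| <= v ->
  `|b1 + b2 - b3 - b4| <= u + v.
Proof.
move=> h1 h2; rewrite (_ : _ - _ - _ = (b1 - b3) + (b2 - b4)); last by ring.
by apply: (le_trans (ler_normD _ _)); apply: lerD; rewrite distrC.
Qed.

Lemma normB_lt {R : realFieldType} (u v w e : R) : `|w - v| < e / 2 -> `|w - u| < e / 2 -> `|u - v| < e.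
Proof.
rewrite !ltr_norml => /andP[h1 h2] /andP[h3 h4]; apply/andP; split; lra.
Qed.

Lemma ltr_half_sum {R : realFieldType} (x e : R) : x < e / 2 -> x + x < e.
Proof. lra. Qed.

Lemma normB_chain {R : realFieldType} (b1 b2 b3 b4 b5 b6 b7 B : R) :
  `|b3 - b6| <= B -> `|b4 - b5| <= B -> `|b7 - b6| <= B -> `|b1 - b2| <= B -> b2 = b3 + b4 ->
  `|b5 - b1 + b7| <= 4 * B.
Proof.
rewrite !ler_norml => /andP[? ?] /andP[? ?] /andP[? ?] /andP[? ?] ?.
by apply/andP; split; lra.
Qed.

Lemma min_close {R : realFieldType} (m t L D A B : R) : m = t \/ m = L -> L <= t + D -> t <= L + D ->
  B <= D + (L - m) -> A <= t - m + B -> A <= 2 * D.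
Proof. by case=> ->; lra. Qed.

Lemma min_shift {R : realFieldType} (m t' t L D : R) : m = t' \/ m = L -> t' <= L + D -> 0 <= D ->
  t' - t - m <= D - t.
Proof. by case=> ->; lra. Qed.

Lemma le_chain {R : realFieldType} (d a b e f : R) : d <= 1 -> e <= f + d -> f <= a + b ->
  e <= a + 1 + b.
Proof. lra. Qed.

Lemma sh_decay {R : realType} (m s C o d : R) : 0 <= o -> 1 <= m -> 0 <= s -> sh m ^+ 2 * o <= C ->
  d ^+ 2 / 8 <= sh s ^+ 2 * o -> d ^+ 2 <= 32 * C * expR (s - m) ^+ 2.
Proof.
move=> om m1 s0 h1 d2.
have h2 : expR m <= 4 * sh m.
  by rewrite /sh; have := expR_mulN m; have := expR_gt0 (- m); have := @expR_ge1Dx R m; nra.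
have h3 : sh s <= expR s / 2 by rewrite /sh; have := expR_gt0 (- s); lra.
have sh0' : 0 <= sh s := sh_ge0 s0.
have em := expR_gt0 m; have es := expR_gt0 s.
have h4 : expR m ^+ 2 <= 16 * sh m ^+ 2 by have := sqr_le (ltW em) h2; rewrite exprMn; lra.
have h5 : sh s ^+ 2 <= expR s ^+ 2 / 4 by have := sqr_le sh0' h3; lra.
have h6 : expR m ^+ 2 * o <= 16 * C by have := ler_wpM2r om h4; lra.
have h7 := ler_wpM2r om h5.
have -> : expR (s - m) = expR s / expR m by rewrite expRD expRN.
have p : 0 <= 2 * (expR s ^+ 2 / expR m ^+ 2) by rewrite mulr_ge0 // divr_ge0 ?sqr_ge0.
have := ler_wpM2l p h6.
have -> : 2 * (expR s ^+ 2 / expR m ^+ 2) * (expR m ^+ 2 * o) = 2 * expR s ^+ 2 * o.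
  by field; rewrite gt_eqF.
have -> : 2 * (expR s ^+ 2 / expR m ^+ 2) * (16 * C) = 32 * C * (expR s / expR m) ^+ 2.
  by field; rewrite gt_eqF.
by lra.
Qed.

(** * Existence of the Gibbs cocycle and its values along geodesics *)

Section Cocycle.
Context {R : realType}.
Variables (Kh : set R[i]) (cK : closed_subfield Kh).
Variables (Gam : set (PSL2 R)) (x0 : hpoint R).
Hypotheses (GK : forall g, Gam g -> matK Kh g) (GV : forall g, Gam g -> Gam g^-1%g).
Hypotheses (G1 : Gam 1%g) (ux0 : upper Kh x0).
Variables (F : vect R -> R) (a c : R).
Hypotheses (hF : holder_with Kh F a c) (iF : invariant_under Kh Gam F).
Implicit Types (x y p q : hpoint R) (v w : vect R) (s t K D T : R) (xi : bdry R).

Let rK := closed_subfield_real cK.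
Let K0 := closed_subfield0 cK.
Let a0 : 0 < a. Proof. by case: hF. Qed.
Let a1 : a <= 1. Proof. by case: hF. Qed.
Let c0 : 0 < c. Proof. by case: hF. Qed.

Local Notation J := (segment_int F).

Let cF v : T1 Kh v -> continuous (fun t => F (flow t v)) := fun Tv => continuous_flow cK hF Tv.

Lemma segment_add v r s t : T1 Kh v -> r <= s -> s <= t ->
  J (foot (flow r v)) (foot (flow t v)) =
  J (foot (flow r v)) (foot (flow s v)) + J (foot (flow s v)) (foot (flow t v)).
Proof.
move=> Tv rs st; rewrite !(segment_flow2 cK Tv (cF Tv)) //; last exact: le_trans st.
exact: (itg_split (cF Tv)).
Qed.

(** The error of [track_small] at distance K e^(-t) for a potential of linear growth. Half of the
    Hölder exponent is given up to absorb the factor t. *)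
Lemma small_err (A B K : R) : 0 <= A -> 0 <= B -> 0 <= K ->
  exists K' T : R, [/\ 0 <= K', 0 <= T & forall t, T <= t ->
  track_cst * (K * expR (- t)) <= 1 /\
  c / a * (track_cst * (K * expR (- t))) `^ a + 2 * (K * expR (- t)) * (A + c * (B + t))
     <= K' * expR (- (a / 2 * t))].
Proof.
move=> A0 B0 KK; have C0 := @track_cst_gt0 R; set C := track_cst in C0 *.
have CK : 0 <= C * K by rewrite mulr_ge0 // ltW.
have ca : 0 <= c / a by rewrite divr_ge0 // ltW.
exists (c / a * (C * K) `^ a + 2 * K * (A + c * B + 2 * c)), (C * K); split => //.
  apply: addr_ge0; first by rewrite mulr_ge0 // powR_ge0.
  have h1 : 0 <= c * B by rewrite mulr_ge0 // ltW.
  by rewrite mulr_ge0 ?mulr_ge0 // !addr_ge0 // mulr_ge0 // ltW.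
move=> t tC; have t0 : 0 <= t := le_trans CK tC; split.
  have := expR_mulN t; have := @expR_ge1Dx R t; have := expR_gt0 (- t).
  set x := expR (- t); set y := expR t => x0' y1 xy; rewrite mulrA.
  by nra.
have e1 : expR (- t) <= expR (- (a / 2 * t)).
  rewrite ler_expR lerN2 ler_piMl //; have := a1; lra.
have e2 : t * expR (- t) <= 2 * expR (- (a / 2 * t)).
  have h : expR (- t) = expR (- (t / 2)) * expR (- (t / 2)) by rewrite -expRD; congr expR; field.
  have h1 : expR (- (t / 2)) <= expR (- (a / 2 * t)).
    by rewrite ler_expR lerN2; have := ler_wpM2r t0 a1; lra.
  have h2 : t * expR (- (t / 2)) <= 2.
    have := expR_mulN (t / 2); have := @expR_ge1Dx R (t / 2); have := expR_gt0 (- (t / 2)).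
    by set x := expR (- _); set y := expR _ => x0' y1 xy; nra.
  rewrite h mulrA; apply: (@le_trans _ _ (2 * expR (- (t / 2)))).
    by rewrite ler_wpM2r // expR_ge0.
  by rewrite ler_wpM2l.
have e3 : (C * (K * expR (- t))) `^ a <= (C * K) `^ a * expR (- (a / 2 * t)).
  rewrite mulrA powRM ?expR_ge0 // ler_wpM2l ?powR_ge0 // -expRM ler_expR.
  by have := mulr_ge0 (ltW a0) t0; lra.
rewrite (mulrDl (c / a * _)); apply: lerD; first by rewrite -[leRHS]mulrA; apply: ler_wpM2l.
have -> : 2 * (K * expR (- t)) * (A + c * (B + t)) =
  2 * K * ((A + c * B) * expR (- t) + c * (t * expR (- t))) by ring.
rewrite -[leRHS]mulrA; apply: ler_wpM2l; first by rewrite mulr_ge0.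
rewrite (mulrDl (A + c * B)); apply: lerD; first by rewrite ler_wpM2l // addr_ge0 // mulr_ge0 // ltW.
by rewrite -mulrA [leRHS]mulrCA; apply: ler_wpM2l => //; exact: ltW.
Qed.

Let gr := growth cK hF ux0.

(* If q' lies far along the ray v, the geodesic from x to q' passes exponentially close to v_t. *)
Lemma ray_additive v x : T1 Kh v -> upper Kh x ->
  exists K' T : R, [/\ 0 <= K', 0 <= T & forall t t', T <= t -> t + 1 <= t' ->
  `|J x (foot (flow t' v)) - J x (foot (flow t v)) - J (foot (flow t v)) (foot (flow t' v))|
    <= K' * expR (- (a / 2 * t))].
Proof.
move=> Tv ux; have [A A0 hA] := gr; have [_ x_0] := ux; have [_ x00] := ux0.
have v0 : 0 < (foot v).2 := T1_gt0 Tv.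
set D0 := hdist (foot v) x; have D00 : 0 <= D0 by exact: hdist_ge0.
set B := hdist x0 (foot v); have B0 : 0 <= B by exact: hdist_ge0.
pose K := Num.sqrt (32 * ch (2 * D0)) * expR D0.
have KK : 0 <= K by rewrite mulr_ge0 ?sqrtr_ge0 ?expR_ge0.
have B1 : 0 <= B + 1 by lra.
have [K' [T [K'0 T0 hT]]] := small_err A0 B1 KK.
exists (2 * K'), (T + D0 + 1); split => [| |t t' tT tt']; [by rewrite mulr_ge0|lra|].
have tT0 : T <= t by lra.
have [Ct et] := hT t tT0.
have t_0 : 0 <= t by lra.
have t'_0 : 0 <= t' by lra.
set q := foot (flow t v); set q' := foot (flow t' v).
have uq : upper Kh q by exact: foot_flow_upper.
have uq' : upper Kh q' by exact: foot_flow_upper.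
have [[_ q0] [_ q'0]] := (uq, uq').
(* Time is reversed so that u, aimed at the foot of v, and w, aimed at x, start from the same point
   q'; the contraction estimate then applies at time t' - t. *)
pose u := flip (flow t' v); have Tu : T1 Kh u by apply: T1_flip => //; exact: T1_flow.
have fu r : foot (flow r u) = foot (flow (t' - r) v).
  by rewrite flow_flip foot_flip (flowD _ _ Tv) addrC.
have eu : foot u = q' by rewrite foot_flip.
have [w [Tw ew fw]] := exists_vect_to rK K0 uq' ux.
set L := hdist q' x in fw; set s := t' - t.
have L0 : 0 <= L by exact: hdist_ge0.
have dq'v : hdist q' (foot v) = t'.
  by rewrite -(flow0 v) /q' (hdist_flow _ _ Tv) subr0 ger0_norm.
have L1 : L <= t' + D0 by rewrite -dq'v; exact: hdist_triangle.
have L2 : t' <= L + D0 by rewrite -dq'v /D0 (hdist_sym (foot v)); exact: hdist_triangle.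
pose m := Num.min t' L.
have mE : m = t' \/ m = L by rewrite /m minEle; case: ifP; [left|right].
have mt' : m <= t' by rewrite /m ge_min lexx.
have mL : m <= L by rewrite /m ge_min lexx orbT.
have p0 r : 0 < (foot (flow r u)).2 := foot_flow_gt0 r Tu.
have r0 r : 0 < (foot (flow r w)).2 := foot_flow_gt0 r Tw.
have fut : foot (flow t' u) = foot v by rewrite fu subrr flow0.
have dm : hdist (foot (flow m u)) (foot (flow m w)) <= 2 * D0.
  have h1 : hdist (foot (flow m u)) (foot v) = t' - m.
    by rewrite -fut (hdist_flow _ _ Tu) distrC ger0_norm // subr_ge0.
  have h2 : hdist x (foot (flow m w)) = L - m.
    by rewrite -fw (hdist_flow _ _ Tw) ger0_norm // subr_ge0.
  have := hdist_triangle (p0 m) v0 (r0 m); have := hdist_triangle v0 x_0 (r0 m).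
  by rewrite h1 h2 -/D0; exact: min_close mE L1 L2.
have s1 : 1 <= s by rewrite /s; lra.
have sm : s <= m by rewrite /s; case: mE => ->; lra.
have uw : foot u = foot w by rewrite eu ew.
pose qx := foot (flow s w).
have uqx : upper Kh qx by exact: foot_flow_upper.
have fus : foot (flow s u) = q by rewrite fu /s subKr.
have cdE r := cd_equal_time r Tu Tw uw; have om := ip_gap_ge0 Tu Tw.
have dq : hdist q qx <= K * expR (- t).
  have h1 : sh m ^+ 2 * (1 - ip u w) <= ch (2 * D0).
    have := dm; rewrite hdist_le ?mulr_ge0 // cdE => h.
    by have := ch_ge1 (2 * D0); lra.
  have d2 : hdist q qx ^+ 2 / 8 <= sh s ^+ 2 * (1 - ip u w).
    apply: (le_trans (ch_lb _)); rewrite (ch_hdist q0 (r0 s)) -fus cdE (addrC 1) addrK //.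
  have h8 := sh_decay om (le_trans s1 sm) (le_trans ler01 s1) h1 d2.
  have h9 : expR (s - m) <= expR D0 * expR (- t).
    by rewrite -expRD ler_expR; exact: min_shift mE L2 D00.
  apply: (@le_trans _ _ (Num.sqrt (32 * ch (2 * D0)) * expR (s - m))); last first.
    by rewrite /K -mulrA ler_wpM2l // sqrtr_ge0.
  apply: le_of_sqr; first by rewrite mulr_ge0 ?sqrtr_ge0 ?expR_ge0.
  by rewrite exprMn sqr_sqrtr // mulr_ge0 // ltW // ch_gt0.
have Ke0 : 0 <= K * expR (- t) by rewrite mulr_ge0 ?expR_ge0.
have hM v' : T1 Kh v' -> hdist (foot v') q <= 1 -> `|F v'| <= A + c * (B + 1 + t).
  move=> Tv' h; apply: (le_trans (hA v' Tv')); rewrite lerD2l ler_pM2l //.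
  have h1 := hdist_triangle x00 q0 (T1_gt0 Tv' : 0 < (foot v').2).
  have h2 := hdist_triangle x00 v0 q0.
  have h3 : hdist (foot v) q = t by rewrite /q (hdist_foot_flow _ Tv) ger0_norm.
  by move: h1 h2; rewrite h3 -/B (hdist_sym q); exact: le_chain h.
have xq1 : 1 <= hdist x q.
  rewrite -(lerD2l D0); apply: le_trans (hdist_triangle v0 x_0 q0).
  have -> : hdist (foot v) q = t by rewrite /q (hdist_foot_flow _ Tv) ger0_norm.
  by apply: le_trans tT; rewrite -addrA lerDr.
have q'q1 : 1 <= hdist q' q.
  by rewrite /q' /q (hdist_flow _ _ Tv) ger0_norm -/s // (le_trans ler01 s1).
have e1 := track_small cK hF uq uqx ux Ke0 Ct dq xq1 hM.
have hF' := holder_with_flip cK hF.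
have e2 := track_small cK hF' uq uqx uq' Ke0 Ct dq q'q1
   (fun v' Tv' h => hM (flip v') (T1_flip rK Tv') h).
have split_x : J x q' = J x qx + J qx q'.
  pose w' := flip (flow L w); have Tw' : T1 Kh w' by apply: T1_flip => //; exact: T1_flow.
  have fw' r : foot (flow r w') = foot (flow (L - r) w).
    by rewrite flow_flip foot_flip (flowD _ _ Tw) addrC.
  have sL : s <= L := le_trans sm mL.
  have := @segment_add w' 0 (L - s) L Tw'; rewrite !fw' subr0 fw subKr subrr flow0 ew; apply; rewrite ?subr_ge0 // lerBlDr lerDl (le_trans ler01 s1) //.
rewrite split_x (segment_rev cK uqx uq' cF) (segment_rev cK uq uq' cF).
rewrite -mulrA (mulrDl 1 1) mul1r.
by apply: normB4; [exact: le_trans e1 et|exact: le_trans e2 et].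
Qed.

Lemma expR_small (K e : R) : 0 < e -> 0 <= K -> exists T : R, forall t, T <= t ->
  K * expR (- (a / 2 * t)) < e.
Proof.
move=> e0 KK; have b0 : 0 < a / 2 by rewrite divr_gt0.
exists (K / e / (a / 2)) => t ht.
have : K / e <= t * (a / 2) by rewrite -ler_pdivrMr.
rewrite ler_pdivrMr // (mulrC t) => h.
have := expR_mulN (a / 2 * t); have := @expR_ge1Dx R (a / 2 * t); have := expR_gt0 (- (a / 2 * t)).
set x := expR (- _); set y := expR _ => x0' y1 xy.
have : K * x < (e * y) * x.
  rewrite ltr_pM2r //; apply: (le_lt_trans h); rewrite (mulrC e) ltr_pM2r //; lra.
by rewrite -mulrA xy mulr1.
Qed.

Definition ray_diff x y q : R := J y q - J x q.

Lemma ray_diff_cauchy v x y : T1 Kh v -> upper Kh x -> upper Kh y ->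
  cvg (ray_diff x y (foot (flow t v)) @[t --> +oo]).
Proof.
move=> Tv ux uy; have [K1 [T1' [K10 T10 h1]]] := ray_additive Tv ux.
have [K2 [T2' [K20 T20 h2]]] := ray_additive Tv uy.
apply/cauchy_cvgP/cauchy_exP => e e0.
have e4 : 0 < e / 4 by rewrite divr_gt0.
have [S1 hS1] := expR_small e4 K10; have [S2 hS2] := expR_small e4 K20.
pose T := Num.max (Num.max T1' T2') (Num.max S1 S2).
have [TT1 TT2 TS1 TS2] : [/\ T1' <= T, T2' <= T, S1 <= T & S2 <= T].
  by rewrite /T !le_max !lexx ?orbT.
have est t t' : T <= t -> t + 1 <= t' ->
  `|ray_diff x y (foot (flow t' v)) - ray_diff x y (foot (flow t v))| < e / 2.
  move=> tT tt'; have g1 := h1 t t' (le_trans TT1 tT) tt'; have g2 := h2 t t' (le_trans TT2 tT) tt'.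
  have g3 := hS1 t (le_trans TS1 tT); have g4 := hS2 t (le_trans TS2 tT).
  rewrite /ray_diff.
  set q := foot (flow t v) in g1 g2 *; set q' := foot (flow t' v) in g1 g2 *.
  rewrite (_ : _ - _ - (_ - _) = (J y q' - J y q - J q q') - (J x q' - J x q - J q q')); last first.
    by move: (J y q') (J x q') (J y q) (J x q) (J q q') => *; ring.
  apply: (le_lt_trans (ler_normB _ _)); apply: le_lt_trans (lerD g2 g1) _.
  by clear g1 g2 h1 h2; lra.
exists (ray_diff x y (foot (flow T v))).
exists T; split; first exact: num_real.
move=> t tT; rewrite -ball_normE /ball_ /=.
(* [est] needs a gap of at least 1, so the times T and t are compared through t + 1. *)
have tt : T + 1 <= t + 1 by rewrite lerD2r ltW.
exact: normB_lt (est t (t + 1) (ltW tT) (lexx _)) (est T (t + 1) (lexx _) tt).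
Qed.

Definition Kbar : set (bdry R) := [set xi | if xi is Some z then Kh z else True].

(** One model ray for each boundary point, always vertical; the one going to infinity stands above
    [x0] so as to remain over [Kh]. *)
Definition ray_to xi : vect R :=
  if xi is Some z then ((z, 1), (0, -1)) else ((x0.1, 1), (0, 1)).

Lemma T1_ray_to xi : Kbar xi -> T1 Kh (ray_to xi).
Proof.
have [k0 _] := ux0; by case: xi => [z|] kz; split => //=; rewrite ?expr0n /= ?addr0 ?sqrtr0 ?sqrrN ?expr1n ?expr0n /= ?add0r.
Qed.

Lemma foot_ray_to s xi : foot (flow s (ray_to xi)) =
  if xi is Some z then (z, expR (- s)) else (x0.1, expR s).
Proof.
have e1 : ch s + sh s = expR s by rewrite /ch /sh; field.
have e2 : ch s - sh s = expR (- s) by rewrite /ch /sh; field.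
case: xi => [z|]; rewrite /foot /flow /ray_to /= mulr0 addr0.
  by rewrite mulN1r opprK e1 expRN div1r.
by rewrite !mul1r e2 expRN invrK.
Qed.

Lemma vplus_Kbar v : T1 Kh v -> Kbar (vplus v).
Proof.
move=> Tv; rewrite (vplusE Tv) /vplus_expl; case: ifP => // _.
have [kr kD kM _ _] := cK; have [[k1 _] k2 _] := Tv.
by apply: kD => //; apply: kM.
Qed.

Lemma vplus_ray_to xi : Kbar xi -> vplus (ray_to xi) = xi.
Proof.
move=> kx; rewrite (vplusE (T1_ray_to kx)) /vplus_expl; case: xi kx => [z|] kz /=; last by rewrite eqxx.
by rewrite ifF ?mulr0 ?addr0 //; apply/eqP; lra.
Qed.

Lemma hdist_exp (p q : hpoint R) (k e : R) : 0 < p.2 -> 0 < q.2 -> p.2 = q.2 -> 0 <= k -> 0 <= e ->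
  normc (p.1 - q.1) <= k * p.2 * e -> hdist p q <= 2 * k * e.
Proof.
move=> p0 q0 pq k0 e0 h; apply: le_of_sqr; first by rewrite !mulr_ge0.
have := ch_lb (hdist p q); rewrite (ch_hdist p0 q0) /cd -pq subrr expr0n /= addr0 => h1.
have := sqr_le (normc_ge0' _) h; set n := normc _ in h1 *; move: (hdist p q) h1 => d h1 h2.
have h3 : n ^+ 2 / (2 * p.2 * p.2) <= (k * e) ^+ 2 / 2.
  rewrite ler_pdivrMr ?mulr_gt0 //; apply: (le_trans h2); rewrite le_eqVlt; apply/orP; left.
  by apply/eqP; field.
rewrite -mulrA exprMn; move: ((k * e) ^+ 2) h3 => m h3; lra.
Qed.

(** [sg s] is the time at which the vertical ray reaches the height of v_s. At equal heights the
    horizontal distance is O(e^(-s)) times the height, so [hdist_exp] applies. *)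
Lemma ray_compare v : T1 Kh v -> exists (K : R) (sg : R -> R),
  [/\ 0 <= K, sg @ +oo --> +oo & forall s, 0 <= s ->
   hdist (foot (flow s v)) (foot (flow (sg s) (ray_to (vplus v)))) <= K * expR (- s)].
Proof.
move=> Tv; have t0 : 0 < v.1.2 := T1_gt0 Tv.
case: (eqVneq v.2.2 1) => [e1|ne1].
  have z0 := T1_tau1 Tv e1.
  exists (2 * (normc (v.1.1 - x0.1) / v.1.2)), (fun s => ln v.1.2 + s); split.
  - by rewrite mulr_ge0 // divr_ge0 ?normc_ge0' ?ltW.
  - apply/cvgryPge => A; near=> t; rewrite -lerBlDl; near: t; apply: nbhs_pinfty_ge; exact: num_real.
  move=> s s0; rewrite foot_ray_to (vplusE Tv) /vplus_expl e1 eqxx expRD (lnK t0).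
  have -> : foot (flow s v) = (v.1.1, v.1.2 * expR s).
    case: v e1 z0 {Tv t0} => [[z t] [zt ta]] /= -> ->; rewrite mulr0 addr0 mul1r.
    have -> : ch s - sh s = expR (- s) by rewrite /ch /sh; field.
    by rewrite expRN invrK.
  have vx : 0 <= v.1.2 by exact: ltW.
  apply: hdist_exp => //=; rewrite ?mulr_gt0 ?expR_gt0 ?expR_ge0 ?divr_ge0 ?normc_ge0' //.
  have e : expR s * expR (- s) = 1 by rewrite expR_mulN.
  have -> : forall n : R, n / v.1.2 * (v.1.2 * expR s) * expR (- s) = n * (expR s * expR (- s)).
    by move=> n; field; rewrite gt_eqF.
  by rewrite e mulr1 lexx.
have ta1 : v.2.2 < 1 by rewrite lt_neqAle ne1 (T1_tau_le1 Tv).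
have h1 : 0 < 1 - v.2.2 by lra.
pose D s := ch s - v.2.2 * sh s.
have D0 s : 0 < D s by exact: (flow_den_gt0 s Tv).
exists (2 * (normc v.2.1 / (1 - v.2.2))), (fun s => ln (D s / v.1.2)); split.
- by rewrite mulr_ge0 // divr_ge0 ?normc_ge0' ?ltW.
- apply/cvgryPge => A; near=> s.
  rewrite -ler_expR lnK ?posrE ?divr_gt0 // ler_pdivlMr //.
  have h2 : (1 - v.2.2) / 2 * (1 + s) <= D s.
    have t1 : -1 <= v.2.2.
      have := T1_norm (Tv); have := sqr_ge0 (reC v.2.1); have := sqr_ge0 (imC v.2.1).
      move=> *; nra.
    have -> : D s = (1 - v.2.2) / 2 * expR s + (1 + v.2.2) / 2 * expR (- s).
      by rewrite /D /ch /sh; field.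
    have := expR_gt0 (- s); have := @expR_ge1Dx R s.
    move: (expR s) (expR (- s)) => y z y1 z0.
    have : 0 <= (1 + v.2.2) / 2 * z by apply: mulr_ge0 (ltW z0); lra.
    have := ler_wpM2l (divr_ge0 (ltW h1) (ler0n R 2)) y1; lra.
  apply: le_trans h2; rewrite -ler_pdivrMl ?divr_gt0 // -lerBlDl.
  near: s; apply: nbhs_pinfty_ge; exact: num_real.
move=> s s0; rewrite foot_ray_to (vplusE Tv) /vplus_expl (negbTE ne1).
have fE : foot (flow s v) = (v.1.1 + (v.1.2 * sh s / D s)%:C%C * v.2.1, v.1.2 / D s).
  by case: v {Tv t0 ne1 ta1 h1 D0} @D => [[z t] [zt ta]].
rewrite expRN lnK ?posrE ?divr_gt0 // invf_div fE.
have h1' := ltW h1; apply: hdist_exp => //=; rewrite ?divr_gt0 ?expR_ge0 ?divr_ge0 ?normc_ge0' //.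
have -> : forall z b b' : R[i], z + b * v.2.1 - (z + b' * v.2.1) = (b - b') * v.2.1.
  by move=> *; ring.
rewrite -RCN -RCD normcZ.
have -> : v.1.2 * sh s / D s - v.1.2 / (1 - v.2.2) = - (v.1.2 * expR (- s) / (D s * (1 - v.2.2))).
  have := D0 s; rewrite /D => d0; have -> : expR (- s) = ch s - sh s by rewrite /ch /sh; field.
  by field; rewrite !gt_eqF.
have [t0' D0'] := (ltW t0, ltW (D0 s)); rewrite normrN ger0_norm ?divr_ge0 ?mulr_ge0 ?expR_ge0 //.
rewrite le_eqVlt; apply/orP; left; apply/eqP; field; rewrite !gt_eqF //.
Unshelve. all: by end_near. Qed.

(** The defining set of the cocycle asks for the same limit along all rays to the point; otherwise
    [xget] would return its default value. *)
Lemma ray_diff_agree v x y (l : R) : T1 Kh v -> upper Kh x -> upper Kh y ->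
  ray_diff x y (foot (flow t (ray_to (vplus v)))) @[t --> +oo] --> l ->
  ray_diff x y (foot (flow t v)) @[t --> +oo] --> l.
Proof.
move=> Tv ux uy hl; have [K [sg [K0' sgoo hsg]]] := ray_compare Tv.
have [_ x_0] := ux; have [_ y_0] := uy; have [_ x00] := ux0; have v0 : 0 < (foot v).2 := T1_gt0 Tv.
have Tr := T1_ray_to (vplus_Kbar Tv); set r := ray_to _ in Tr hl hsg.
have [A A0 hA] := gr.
set B := hdist x0 (foot v); have B0 : 0 <= B by exact: hdist_ge0.
have B1 : 0 <= B + 1 by lra.
have [K' [T [K'0 T0 hT]]] := small_err A0 B1 K0'.
have dvt t : 0 <= t -> hdist (foot v) (foot (flow t v)) = t.
  by move=> t0; rewrite (hdist_foot_flow _ Tv) ger0_norm.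
have key z t : upper Kh z -> T <= t -> 1 + hdist (foot v) z <= t ->
   `|J z (foot (flow t v)) - J z (foot (flow (sg t) r))| <= K' * expR (- (a / 2 * t)).
  move=> uz Tt zt; have t0 : 0 <= t := le_trans T0 Tt; have [Ct et] := hT t Tt.
  have [_ z0] := uz; apply: le_trans et.
  have uq := foot_flow_upper t rK Tv; have [_ q0] := uq.
  apply: (track_small cK hF uq (foot_flow_upper _ rK Tr) uz) => //.
  - by rewrite mulr_ge0 ?expR_ge0.
  - exact: hsg.
  - by have := hdist_triangle v0 z0 q0; rewrite dvt //; lra.
  move=> v' Tv' h; apply: (le_trans (hA v' Tv')); rewrite lerD2l ler_pM2l //.
  have g1 := hdist_triangle x00 q0 (T1_gt0 Tv' : 0 < (foot v').2).
  have g2 := hdist_triangle x00 v0 q0.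
  by move: g1 g2; rewrite dvt // -/B (hdist_sym (foot (flow t v))); lra.
have d0 : ray_diff x y (foot (flow t v)) - ray_diff x y (foot (flow (sg t) r)) @[t --> +oo] --> 0.
  apply/cvgrPdist_lt => e e0; have e2 : 0 < e / 2 by rewrite divr_gt0.
  have [S hS] := expR_small e2 K'0; near=> t; rewrite sub0r normrN /ray_diff.
  have k1 := key x t ux; have k2 := key y t uy.
  apply: le_lt_trans (_ : K' * expR (- (a / 2 * t)) + K' * expR (- (a / 2 * t)) < e).
    have -> : forall b1 b2 b3 b4 : R, b1 - b2 - (b3 - b4) = (b1 - b3) - (b2 - b4) by move=> *; ring.
    apply: (le_trans (ler_normB _ _)); apply: lerD; [apply: k2|apply: k1]; near: t; apply: nbhs_pinfty_ge; exact: num_real.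
  by apply: ltr_half_sum; apply: hS; near: t; apply: nbhs_pinfty_ge; exact: num_real.
have h2 : ray_diff x y (foot (flow (sg t) r)) @[t --> +oo] --> l.
  exact: (cvg_comp _ _ sgoo hl).
have /(_ _) h3 := cvgD d0 h2; rewrite add0r in h3.
have e : (fun t => ray_diff x y (foot (flow t v))) =
  (fun t => ray_diff x y (foot (flow t v)) - ray_diff x y (foot (flow (sg t) r))) +
  (fun t => ray_diff x y (foot (flow (sg t) r))).
  by apply/funext => t; symmetry; exact: subrK.
by rewrite e; exact: h3.
Unshelve. all: by end_near. Qed.

(** [cocycle] for a general integrand, so that the critical exponent can be absorbed into the
    potential. *)
Definition coc xi x y : R := xget 0 [set l : R | forall v, T1 Kh v -> vplus v = xi ->
   ray_diff x y (foot (flow t v)) @[t --> +oo] --> l].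

Lemma cocP v x y : T1 Kh v -> upper Kh x -> upper Kh y ->
  ray_diff x y (foot (flow t v)) @[t --> +oo] --> coc (vplus v) x y.
Proof.
move=> Tv ux uy; have Tr := T1_ray_to (vplus_Kbar Tv).
have /cvg_ex[l hl] := ray_diff_cauchy Tr ux uy.
rewrite /coc; case: xgetP => [l' _ h|/(_ l)[]]; first exact: h.
by move=> w Tw vw; apply: (ray_diff_agree Tw ux uy); rewrite vw; exact: hl.
Qed.

Lemma coc_dist v x y (b k : R) : T1 Kh v -> upper Kh x -> upper Kh y ->
  (\forall t \near +oo, `|ray_diff x y (foot (flow t v)) - b| <= k) ->
  `|coc (vplus v) x y - b| <= k.
Proof.
move=> Tv ux uy h; have hc := cocP Tv ux uy.
have : `|ray_diff x y (foot (flow t v)) - b| @[t --> +oo] --> `|coc (vplus v) x y - b|.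
  by apply: cvg_norm; apply: cvgB hc (cvg_cst b).
by move=> hl; rewrite -(cvg_lim _ hl) //; apply: limr_le h; apply/cvg_ex; eexists; exact: hl.
Qed.

Lemma coc_bound D : 0 <= D -> exists2 B : R, 0 <= B & forall xi x y, Kbar xi ->
  upper Kh x -> upper Kh y -> hdist x0 x <= D -> hdist x y <= D -> `|coc xi x y| <= B.
Proof.
move=> D0; have [B B0 hB] := track_orbit cK GK GV ux0 hF iF D0.
exists B => // xi x y kxi ux uy h1 h2; have Tr := T1_ray_to kxi.
rewrite -(subr0 (coc _ _ _)) -(vplus_ray_to kxi); apply: coc_dist => //; near=> t.
rewrite subr0 /ray_diff distrC.
have := hB 1%g x y (foot (flow t (ray_to xi))) G1 ux uy (foot_flow_upper _ rK Tr).
by rewrite hact1 => /(_ h1 h2)[].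
Unshelve. all: by end_near. Qed.

Lemma coc_flow D : 0 <= D -> exists2 B : R, 0 <= B & forall v x s, T1 Kh v ->
  upper Kh x -> 0 <= s -> hdist x0 x <= D -> hdist x (foot v) <= D ->
  `|coc (vplus v) x (foot (flow s v)) + J (foot v) (foot (flow s v))| <= B.
Proof.
move=> D0; have [B B0 hB] := track_orbit cK GK GV ux0 hF iF D0.
exists B => // v x s Tv ux s0 h1 h2; have uv : upper Kh (foot v) by case: Tv.
rewrite -[X in _ + X]opprK; apply: coc_dist => //; first exact: foot_flow_upper.
near=> t; have st : s <= t by near: t; apply: nbhs_pinfty_ge; exact: num_real.
have := segment_add Tv s0 st; rewrite flow0 /ray_diff.
have := hB 1%g x (foot v) (foot (flow t v)) G1 ux uv (foot_flow_upper _ rK Tv).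
rewrite hact1 => /(_ h1 h2)[_].
move: (J x _) (J (foot v) (foot (flow t v))) (J (foot v) (foot (flow s v))) (J (foot (flow s v)) _).
move=> b1 b2 b3 b4 h e; rewrite (_ : _ - _ = b2 - b1); last by rewrite e; ring.
by rewrite distrC; exact: h.
Unshelve. all: by end_near. Qed.

Lemma coc_flow_neg D : 0 <= D -> exists2 B : R, 0 <= B & forall v x s, T1 Kh v ->
  upper Kh x -> s <= 0 -> hdist x0 x <= D -> hdist x (foot v) <= D ->
  `|coc (vplus v) x (foot (flow s v)) - J (foot (flow s v)) (foot v)| <= B.
Proof.
move=> D0; have [B B0 hB] := track_orbit cK GK GV ux0 hF iF D0.
exists B => // v x s Tv ux s0 h1 h2; have uv : upper Kh (foot v) by case: Tv.
apply: coc_dist => //; first exact: foot_flow_upper.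
near=> t; have t0 : 0 <= t by near: t; apply: nbhs_pinfty_ge; exact: num_real.
have := segment_add Tv s0 t0; rewrite flow0 /ray_diff.
have := hB 1%g x (foot v) (foot (flow t v)) G1 ux uv (foot_flow_upper _ rK Tv).
rewrite hact1 => /(_ h1 h2)[_].
move: (J x _) (J (foot v) _) (J _ (foot v)) (J (foot (flow s v)) _) => b1 b2 b3 b4 h ->.
rewrite (_ : _ - _ = b2 - b1); last by ring.
by rewrite distrC; exact: h.
Unshelve. all: by end_near. Qed.

(** Seen from x0 and from p, the part of the ray after time s contributes equally, so only the
    initial piece remains. That v_s is near the orbit makes the constant uniform. *)
Lemma coc_near D : 0 <= D -> exists2 B : R, 0 <= B & forall g v p s, Gam g -> T1 Kh v ->
  upper Kh p -> 0 <= s -> hdist x0 (foot v) <= D -> hdist (hact g x0) (foot (flow s v)) <= D ->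
  hdist (foot (flow s v)) p <= D -> `|coc (vplus v) x0 p + J x0 p| <= B.
Proof.
move=> D0; have [B B0 hB] := track_orbit cK GK GV ux0 hF iF D0.
exists (4 * B) => [|g v p s Gg Tv up s0 h1 h2 h3]; first by rewrite mulr_ge0.
have uv : upper Kh (foot v) by case: Tv.
have us := foot_flow_upper s rK Tv; have [_ x00] := ux0.
rewrite -[X in _ + X]opprK; apply: coc_dist => //.
near=> t; have st : s <= t by near: t; apply: nbhs_pinfty_ge; exact: num_real.
have ut := foot_flow_upper t rK Tv.
have := segment_add Tv s0 st; rewrite flow0 /ray_diff opprK.
have := hB 1%g x0 (foot v) (foot (flow t v)) G1 ux0 uv ut.
have := hB 1%g x0 (foot v) p G1 ux0 uv up.
rewrite hact1 hdistxx => /(_ D0 h1)[_ +] /(_ D0 h1)[_ +].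
have [_] := hB g _ p _ Gg us up ut h2 h3; have [+ _] := hB g _ p _ Gg us up uv h2 h3.
move=> k1 k2 k3 k4 e; exact: normB_chain k1 k2 k3 k4 e.
Unshelve. all: by end_near. Qed.

End Cocycle.

(** * Entries of inverses and products, up to sign *)

Section MatrixEntries.
Context {R : realType}.
Implicit Types g h : PSL2 R.

(** The representatives picked by [repr] are not multiplicative, whence an undetermined sign e. *)
Lemma mat_inv g : exists2 e : R[i], e = 1 \/ e = -1 &
  [/\ mat g^-1%g 0 0 = e * mat g 1 1, mat g^-1%g 0 1 = - e * mat g 0 1,
      mat g^-1%g 1 0 = - e * mat g 1 0 & mat g^-1%g 1 1 = e * mat g 0 0].
Proof.
have [e he eM] : exists2 e : R[i], e = 1 \/ e = -1 & mat g^-1%g *m mat g = e%:M.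
  have := mat_mul g^-1%g g; rewrite mulVg => h.
  have h1 := @mat_one R; case: h1 => h1; rewrite h1 in h.
    case: h => h; [exists 1; first by left|exists (-1); first by right]; first by [].
    by rewrite -[LHS]opprK -h raddfN.
  case: h => h; [exists (-1); first by right|exists 1; first by left].
    by rewrite -h raddfN.
  by apply: oppr_inj; rewrite -h.
exists e => //; have := mat_det g.
have E i j : (mat g^-1%g *m mat g) i j = e%:M i j by rewrite eM.
have := E 0 0; have := E 0 1; have := E 1 0; have := E 1 1; rewrite !mulmx2E !mxE /=.
rewrite !mulr1n !mulr0n.
move: (mat g^-1%g 0 0) (mat g^-1%g 0 1) (mat g^-1%g 1 0) (mat g^-1%g 1 1).
move: (mat g 0 0) (mat g 0 1) (mat g 1 0) (mat g 1 1) => a b c d p q r s e11 e10 e01 e00 D.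
split.
- have -> : p = (p * a + q * c) * d - (p * b + q * d) * c + p * (1 - (a * d - b * c)) by ring.
  by rewrite D e00 e01; ring.
- have -> : q = (p * b + q * d) * a - (p * a + q * c) * b + q * (1 - (a * d - b * c)) by ring.
  by rewrite D e00 e01; ring.
- have -> : r = (r * a + s * c) * d - (r * b + s * d) * c + r * (1 - (a * d - b * c)) by ring.
  by rewrite D e10 e11; ring.
- have -> : s = (r * b + s * d) * a - (r * a + s * c) * b + s * (1 - (a * d - b * c)) by ring.
  by rewrite D e10 e11; ring.
Qed.

Lemma mat_mulE g h : exists2 e : R[i], e = 1 \/ e = -1 &
  forall i j, mat (g * h)%g i j = e * (mat g i 0 * mat h 0 j + mat g i 1 * mat h 1 j).
Proof.
have [e|e] := mat_mul g h; [exists 1; first by left|exists (-1); first by right].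
  by move=> i j; rewrite e mulmx2E mul1r.
by move=> i j; rewrite e mxE mulmx2E mulN1r.
Qed.

End MatrixEntries.

(** * Discreteness of the ring of integers *)

Section RingOfIntegers.
Context {R : realType} {K : fieldExtType rat} {iota : {rmorphism K -> R[i]}}.
Hypothesis hK : rational_or_imaginary_quadratic iota.
Implicit Types (x y z : R[i]) (q : rat) (g h k : PSL2 R).

Local Notation O := (ring_of_integers iota).
Local Notation iK := (range iota).

(** By Gauss's lemma the primitive part of (denominator) X - (numerator) divides a monic integral
    polynomial, so its leading coefficient is a unit. *)
Lemma integral_ratr q : integralOver (intr : int -> R[i]) (ratr q) -> exists n : int, q = n%:~R.
Proof.
case=> p mp rp.
have {}rp : root (map_poly (intr : int -> rat) p) q.
  rewrite -(fmorph_root (ratr : rat -> R[i])) -map_poly_comp /=.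
  by rewrite (@eq_map_poly _ _ _ (intr : int -> R[i])) // => n /=; rewrite ratr_int.
pose r : {poly int} := denq q *: 'X - (numq q)%:P.
have dq := denq_neq0 q; have dq' : (denq q)%:~R != 0 :> rat by rewrite intr_eq0.
have er : map_poly (intr : int -> rat) r = (denq q)%:~R *: ('X - q%:P).
  rewrite /r rmorphB /= map_polyZ /= map_polyX map_polyC /= scalerBr; congr (_ - _).
  by rewrite -mul_polyC -polyCM; congr (_%:P); rewrite -[X in _ * X]divq_num_den mulrC divfK.
have : r %| p by rewrite -dvdp_rat_int er dvdpZl // -root_factor_theorem // dvdp_XsubCl.
move=> /dvdpP_int[s ps].
have ls : lead_coef (zprimitive r) * lead_coef s = 1 by rewrite -lead_coefM -ps (monicP mp).
have szr : size r = 2%N.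
  rewrite /r size_polyDl ?size_polyN; last first.
    by rewrite size_scale // size_polyX ltnS size_polyC leq_b1.
  by rewrite size_scale // size_polyX.
have nz : zcontents r != 0 by rewrite zcontents_eq0 -size_poly_eq0 szr.
have szp : size (zprimitive r) = 2%N by rewrite -(size_scale _ nz) -zpolyEprim.
have e1 : denq q = zcontents r * lead_coef (zprimitive r).
  have -> : denq q = r`_1 by rewrite /r coefB coefZ coefX coefC /= mulr1 subr0.
  by rewrite [in LHS](zpolyEprim r) coefZ lead_coefE szp.
have e0 : - numq q = zcontents r * (zprimitive r)`_0.
  have -> : - numq q = r`_0 by rewrite /r coefB coefZ coefX coefC /= mulr0 sub0r.
  by rewrite [in LHS](zpolyEprim r) coefZ.
exists (- (zprimitive r)`_0 * lead_coef s).
have lr0 : (lead_coef s)%:~R * (lead_coef (zprimitive r))%:~R = 1 :> rat.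
  by rewrite -intrM mulrC ls.
have nz' : (zcontents r)%:~R != 0 :> rat by rewrite intr_eq0.
have lz : (lead_coef (zprimitive r))%:~R != 0 :> rat.
  by apply/eqP => z; move: lr0; rewrite z mulr0 => /eqP; rewrite eq_sym oner_eq0.
move: (zcontents r) nz' e0 e1 {nz} => zc nz' e0 e1.
rewrite -[LHS]divq_num_den -[numq q]opprK e0 e1 !rmorphN !rmorphM /= !rmorphN /=.
have -> : (lead_coef s)%:~R = (lead_coef (zprimitive r))%:~R^-1 :> rat.
  by apply: (mulIf lz); rewrite lr0 mulVf.
by field; rewrite nz' lz.
Qed.

Lemma iota_alg q : iota q%:A = ratr q.
Proof. by rewrite -(fmorph_eq_rat (iota \o in_alg K)). Qed.

Lemma int_integral z : O z -> integralOver (intr : int -> R[i]) z.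
Proof.
case=> y [p mp rp] <-; exists p => //.
have : root (map_poly iota (map_poly (intr : int -> K) p)) (iota y) by rewrite fmorph_root.
rewrite -map_poly_comp /= (@eq_map_poly _ _ _ (intr : int -> R[i])) // => n /=.
by rewrite rmorph_int.
Qed.

Lemma int_rat q : O (ratr q) -> exists n : int, q = n%:~R.
Proof. by move=> /int_integral; exact: integral_ratr. Qed.

Lemma integral_conj z : integralOver (intr : int -> R[i]) z -> integralOver (intr : int -> R[i]) (conjc z).
Proof.
case=> p mp rp; exists p => //.
have : root (map_poly (@conjc R) (map_poly (intr : int -> R[i]) p)) (conjc z) by rewrite fmorph_root.
rewrite -map_poly_comp /= (@eq_map_poly _ _ _ (intr : int -> R[i])) // => n /=.
by rewrite rmorph_int.
Qed.

Lemma dim1_rat (y : K) : \dim {:K} = 1%N -> exists q, iota y = ratr q.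
Proof.
move=> d1; have : (1%VS == fullv :> {vspace K})%VS by rewrite eqEdim subvf d1 dimv1.
move=> /eqP e; have := memvf y; rewrite -e => /vlineP[q ->].
by exists q; rewrite -iota_alg.
Qed.

Lemma conj_fixed_Im z : conjc z = z -> 'Im z = 0.
Proof.
move=> e; rewrite -complexIm; case: z e => u v /= [] e; rewrite (_ : v = 0) //; lra.
Qed.

Lemma two_dim_span (y : K) : \dim {:K} = 2%N -> (exists q, iota y = ratr q) \/
  forall u : K, exists a b : rat, iota u = ratr a + ratr b * iota y.
Proof.
move=> d2; have [/vlineP[q ->]|ny] := boolP (y \in 1%VS).
  by left; exists q; rewrite -iota_alg.
right=> u.
have : (1 + <[y]>)%VS == fullv :> {vspace K}.
  rewrite eqEdim subvf /= d2 dimv_disjoint_sum ?dimv1 ?dim_vline.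
    by case: eqP ny => [->|//]; rewrite mem0v.
  apply/eqP; rewrite -subv0; apply/subvP => w; rewrite memv_cap => /andP[/vlineP[a ->] /vlineP[b e]].
  have [b0|nb] := eqVneq b 0; first by rewrite e b0 scale0r mem0v.
  move: ny; have -> : y = (b^-1 * a) *: 1 by rewrite -scalerA e scalerA mulVf // scale1r.
  by rewrite memvZ // mem1v.
move=> /eqP e; have := memvf u; rewrite -e => /memv_addP[_ /vlineP[a ->] [_ /vlineP[b ->] ->]].
by exists a, b; rewrite rmorphD /= iota_alg -mulr_algl rmorphM /= iota_alg.
Qed.

(** Trace and norm are integral over the integers, being built from z and its complex conjugate, and
    rational because K is Q or imaginary quadratic. *)
Lemma int_norm z : O z -> exists m n : int, z + conjc z = m%:~R /\ z * conjc z = n%:~R.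
Proof.
move=> Oz; have iz := int_integral Oz; have [y _ ey] := Oz.
have rat_case q : z = ratr q -> exists m n : int, z + conjc z = m%:~R /\ z * conjc z = n%:~R.
  move=> ez; move: Oz; rewrite ez => /int_rat[n ->].
  exists (n + n), (n * n); rewrite ratr_int.
  have -> : conjc (n%:~R : R[i]) = n%:~R by rewrite rmorph_int.
  by rewrite intrD intrM.
case: hK => [d1|[d2 [x0 ix]]].
  by have [q eq] := dim1_rat y d1; apply: (rat_case q); rewrite -ey.
have [[q eq]|span] := two_dim_span y d2; first by apply: (rat_case q); rewrite -ey.
have [n [s eq]] := span (y ^+ 2); rewrite rmorphXn /= ey addrC in eq.
have cs : conjc (ratr s : R[i]) = ratr s by rewrite fmorph_rat.
have cn : conjc (ratr n : R[i]) = ratr n by rewrite fmorph_rat.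
have eqc : conjc z ^+ 2 = ratr s * conjc z + ratr n.
  by rewrite expr2 -conjcM -expr2 eq conjcD conjcM cs cn.
(* A real z would make the image of all of K real, since K is spanned over Q by 1 and the preimage
   of z; this contradicts [ix]. *)
have [re|nre] := eqVneq z (conjc z).
  have [a [b ex]] := span x0; case/eqP: ix; apply: conj_fixed_Im.
  by rewrite ex ey (conjcD (ratr a)) (conjcM (ratr b)) -re !fmorph_rat.
have sz : z + conjc z = ratr s.
  have : (z - conjc z) * (z + conjc z - ratr s) = 0.
    have -> : (z - conjc z) * (z + conjc z - ratr s) =
      (z ^+ 2 - (ratr s * z + ratr n)) - (conjc z ^+ 2 - (ratr s * conjc z + ratr n)) by ring.
    by rewrite eq eqc !subrr.
  move=> /eqP; rewrite mulf_eq0 subr_eq0 (negbTE nre) /= subr_eq0 => /eqP; exact.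
have nz : z * conjc z = ratr (- n).
  have -> : z * conjc z = (z + conjc z) * z - z ^+ 2 by ring.
  by rewrite sz eq rmorphN /=; ring.
have i1 : integralOver (intr : int -> R[i]) (ratr s) by rewrite -sz; apply: integral_add (integral_conj iz).
have i2 : integralOver (intr : int -> R[i]) (ratr (- n)) by rewrite -nz; apply: integral_mul (integral_conj iz).
have [m em] := integral_ratr i1; have [n' en] := integral_ratr i2.
by exists m, n'; rewrite sz nz em en !ratr_int.
Qed.

Lemma int0 : O 0. Proof. by exists 0; [exact: (integral_nat (intr : int -> K) 0)|rewrite rmorph0]. Qed.
Lemma int1 : O 1. Proof. by exists 1; [exact: (integral_nat (intr : int -> K) 1)|rewrite rmorph1]. Qed.
Lemma intD z w : O z -> O w -> O (z + w).
Proof.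
move=> [x ix <-] [y iy <-]; exists (x + y); last by rewrite rmorphD.
exact: integral_add ix iy.
Qed.
Lemma intN z : O z -> O (- z).
Proof. by move=> [x ix <-]; exists (- x); [exact: integral_opp|rewrite rmorphN]. Qed.
Lemma intM z w : O z -> O w -> O (z * w).
Proof.
move=> [x ix <-] [y iy <-]; exists (x * y); last by rewrite rmorphM.
exact: integral_mul ix iy.
Qed.
Lemma intB z w : O z -> O w -> O (z - w).
Proof. by move=> Oz Ow; apply: intD => //; exact: intN. Qed.
Lemma int_nat n : O n%:R.
Proof. by elim: n => [|n IH]; [exact: int0|rewrite -natr1; apply: intD => //; exact: int1]. Qed.

Lemma normc_int z : O z -> exists n : nat, normc z ^+ 2 = n%:R.
Proof.
move=> /int_norm[_ [n [_ e]]].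
have en : normc z ^+ 2 = n%:~R :> R.
  have := normcC z; rewrite e => h.
  have : ((normc z ^+ 2)%:C%C : R[i]) = (n%:~R)%:C%C by rewrite h rmorph_int.
  by case.
have : 0 <= n%:~R :> R by rewrite -en sqr_ge0.
by rewrite ler0z; case: n en {e} => // n en _; exists n.
Qed.

Lemma normc_int_ge1 z : O z -> z != 0 -> 1 <= normc z.
Proof.
move=> Oz z0; have [n en] := normc_int Oz; have h : 0 < normc z by rewrite normc_gt0.
have n0 : (0 < n)%N by rewrite -(ltr0n R) -en exprn_gt0.
apply: le_of_sqr; first exact: ltW.
by rewrite expr1n en ler1n.
Qed.

Lemma finite_int_disc (B : R) : finite_set (O `&` [set z | normc z <= B]).
Proof.
pose N := (Num.truncn (2 * `|B| + B ^+ 2)).+1.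
have NB : 2 * `|B| + B ^+ 2 < N%:R by exact: truncnS_gt.
(* z is recovered from its trace (shifted by N to become a natural number), its norm and the sign of
   its imaginary part. *)
pose f (p : nat * nat * bool) : R[i] :=
  let m : R := p.1.1%:R - N%:R in let n : R := p.1.2%:R in
  let s := Num.sqrt (n - (m / 2) ^+ 2) in (m / 2 +i* (if p.2 then s else - s))%C.
apply: (@sub_finite_set _ _ (f @` (`I_(N.+1 + N) `*` `I_N.+1 `*` setT))); last first.
  by apply: finite_image; apply: finite_setX => //; apply: finite_setX => //; exact: finite_II.
move=> z [Oz /= zB]; have [m [n [em en]]] := int_norm Oz.
have B0 : 0 <= B := le_trans (normc_ge0' z) zB; rewrite (ger0_norm B0) in NB.
have [k ek] := normc_int Oz.
have rm : 2 * reC z = m%:~R.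
  have : ((2 * reC z)%:C%C : R[i]) = (m%:~R)%:C%C.
    by rewrite rmorph_int -em; case: (z) => u v; rewrite /= /GRing.add /=; congr (_ +i* _)%C; ring.
  by case.
have nz2 : normc z ^+ 2 = reC z ^+ 2 + imC z ^+ 2 by rewrite normc2.
have mN : (0 <= m + N%:Z)%R /\ (m + N%:Z < (N.+1 + N)%:Z)%R.
  have := normc_abs_re z; rewrite ler_norml => /andP[h1 h2].
  have : - (N%:R) <= (m%:~R : R) <= N%:R by apply/andP; split; rewrite -rm; have := sqr_ge0 B; lra.
  rewrite -(rmorph_nat (intr : int -> R)) -rmorphN /= !ler_int => /andP[]; lia.
have [j ej] : exists j : nat, (m + N%:Z)%R = j%:Z.
  by case: mN => + _; case: (m + N%:Z)%R => // j' _; exists j'.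
have kN : (k < N.+1)%N.
  rewrite ltnS -(ler_nat R) -ek ltW //; apply: (le_lt_trans (sqr_le (normc_ge0' z) zB)).
  by lra.
exists (j, k, 0 <= imC z); first by split => //=; split => //=; lia.
have ejR : j%:R - N%:R = 2 * reC z :> R.
  have : (j%:R : R) = m%:~R + N%:R by rewrite pmulrn -ej intrD.
  by rewrite rm => ->; ring.
rewrite /f /= ejR -ek nz2 (mulrC 2) mulfK ?pnatr_eq0 // addrAC subrr add0r sqrtr_sqr.
case: z {Oz zB em en ek rm nz2 mN ej ejR} => u v /=; congr (_ +i* _)%C.
by case: ifPn => [v0|]; [rewrite ger0_norm|rewrite -ltNge => v0; rewrite ltr0_norm // opprK].
Qed.

End RingOfIntegers.

(** * Galois conjugates of quadratic irrationals *)

Section QuadraticIrrationals.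
Context {R : realType} {K : fieldExtType rat} {iota : {rmorphism K -> R[i]}}.
Implicit Types (x y z a b c d : R[i]) (g h k : PSL2 R).

Local Notation O := (ring_of_integers iota).

Definition kfield : set R[i] := range iota.

Lemma kf_int z : O z -> kfield z.
Proof. by case=> y _ <-; exists y. Qed.
Lemma kfD z w : kfield z -> kfield w -> kfield (z + w).
Proof. by move=> [x _ <-] [y _ <-]; exists (x + y); rewrite ?rmorphD. Qed.
Lemma kfM z w : kfield z -> kfield w -> kfield (z * w).
Proof. by move=> [x _ <-] [y _ <-]; exists (x * y); rewrite ?rmorphM. Qed.
Lemma kfN z : kfield z -> kfield (- z).
Proof. by move=> [x _ <-]; exists (- x); rewrite ?rmorphN. Qed.
Lemma kfV z : kfield z -> kfield z^-1.
Proof. by move=> [x _ <-]; exists x^-1; rewrite ?fmorphV. Qed.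
Lemma kf_nat n : kfield n%:R.
Proof. by exists n%:R; rewrite ?rmorph_nat. Qed.

Local Ltac kf := repeat first [assumption | exact: kf_nat | apply: kfM | apply: kfD | apply: kfN].

(* [a] and [b] are the two roots of a quadratic polynomial irreducible over K. *)
Definition conjugates a b : Prop := [/\ kfield (a + b), kfield (a * b) & ~ kfield a].

Lemma conjugates_sym a b : conjugates a b -> conjugates b a.
Proof.
move=> [h1 h2 h3]; split; [by rewrite addrC|by rewrite mulrC|].
by move=> kb; apply: h3; rewrite -(addrK b a); apply: kfD => //; exact: kfN.
Qed.

Lemma conjugates_neq a b : conjugates a b -> a != b.
Proof.
move=> [h1 _ h3]; apply/eqP => e; apply: h3; rewrite -e in h1.
rewrite (_ : a = (a + a) * 2%:R^-1); first by apply: kfM => //; apply: kfV; exact: kf_nat.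
by field.
Qed.

(** If b and b' differed, a would be the quotient of a (b - b') by b - b', both in K. *)
Lemma conjugates_inj a b b' : conjugates a b -> conjugates a b' -> b = b'.
Proof.
move=> [h1 h2 h3] [h1' h2' _].
have k1 : kfield (b - b').
  by rewrite (_ : b - b' = (a + b) + - (a + b')); [apply: kfD => //; exact: kfN|ring].
have k2 : kfield (a * (b - b')).
  by rewrite (_ : a * (b - b') = a * b + - (a * b')); [apply: kfD => //; exact: kfN|ring].
apply/eqP; rewrite -subr_eq0; apply/negPn/negP => n0; apply: h3.
by rewrite -(mulfK n0 a); apply: kfM => //; exact: kfV.
Qed.

Lemma conjugates_poly a b (p : {poly K}) : monic_quadratic_irreducible p ->
  map_poly iota p = ('X - a%:P) * ('X - b%:P) -> conjugates a b.
Proof.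
move=> [mp ip sp] e.
have e0 : iota p`_0 = a * b.
  by rewrite -coef_map e coefM !big_ord_recl big_ord0 /= !coefB !coefX !coefC /= ; ring.
have e1 : iota p`_1 = - (a + b).
  rewrite -coef_map e coefM !big_ord_recl big_ord0 /= !coefB !coefX !coefC /=; ring.
split; first by rewrite -(opprK (a + b)) -e1; apply: kfN; exists p`_1.
  by rewrite -e0; exists p`_0.
case=> y _ ey; case: ip => _ /(_ ('X - y%:P)).
rewrite size_XsubC => /(_ isT); rewrite dvdp_XsubCl.
have -> : root p y.
  rewrite -(fmorph_root iota) e ey rootM root_XsubC eqxx //.
by move=> /(_ isT) /eqp_size; rewrite size_XsubC sp.
Qed.

Lemma conjugates_polyP a b : conjugates a b ->
  exists2 p : {poly K}, monic_quadratic_irreducible p & map_poly iota p = ('X - a%:P) * ('X - b%:P).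
Proof.
move=> ab; have [_ _ nb] := conjugates_sym ab; have [[s _ es] [n _ en] na] := ab.
pose p : {poly K} := 'X^2 - s *: 'X + n%:P.
have sz1 : (size ((- (s *: 'X) + n%:P)%R : {poly K}) < 3)%N.
  rewrite (leq_ltn_trans (size_polyD _ _)) // gtn_max size_polyN.
  rewrite (leq_ltn_trans (size_scale_leq _ _)) ?size_polyX //=.
  by rewrite (leq_ltn_trans (size_polyC_leq1 _)).
have sp : size p = 3%N by rewrite /p -addrA size_polyDl size_polyXn.
have mp : p \is monic.
  by rewrite monicE /p -addrA lead_coefDl ?lead_coefXn // size_polyXn.
have ep : map_poly iota p = ('X - a%:P) * ('X - b%:P).
  rewrite /p rmorphD rmorphB /= map_polyXn map_polyZ /= map_polyX map_polyC /= es en.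
  by rewrite -mul_polyC polyCD polyCM; ring.
exists p => //; split => //; apply: cubic_irreducible; first by rewrite sp.
move=> y; apply/negP => /(rmorph_root iota); rewrite /= ep rootM !root_XsubC.
by case/orP => /eqP e; [apply: na|apply: nb]; rewrite -e; exists y.
Qed.

Lemma galois_conjP a b : conjugates a b -> galois_conj iota a = b.
Proof.
move=> ab; rewrite /galois_conj; case: xgetP => [b' _ [p hp ep]|/(_ b)[]].
  by apply: (@conjugates_inj a) => //; exact: conjugates_poly hp ep.
exact: conjugates_polyP.
Qed.

Lemma quadratic_conjugates a : quadratic_irrational iota a -> conjugates a (galois_conj iota a).
Proof.
move=> [_ [p hp rp]]; have [mp ip sp] := hp.
have /factor_theorem[q eq] := rp.
have sq : size q = 2%N.
  have : size (map_poly iota p) = 3%N by rewrite size_map_poly sp.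
  have q0 : q != 0.
    apply/eqP => z; move: eq; rewrite z mul0r => /eqP; rewrite map_poly_eq0 => /eqP p0.
    by move: sp; rewrite p0 size_poly0.
  by rewrite eq size_mul ?polyXsubC_eq0 // size_XsubC addn2 /= => -[].
have mq : q \is monic.
  have : map_poly iota p \is monic by rewrite map_monic.
  by rewrite eq monicMr // monicXsubC.
have [b eb] : exists b, q = 'X - b%:P.
  exists (- q`_0); apply/polyP => i; rewrite polyCN opprK coefD coefX coefC.
  case: i => [|[|i]] /=; rewrite ?add0r ?addr0 //; last first.
    by rewrite nth_default // sq.
  by move: mq; rewrite monicE lead_coefE sq => /eqP.
have ab : conjugates a b by apply: (conjugates_poly hp); rewrite eq eb mulrC.
by rewrite (galois_conjP ab).
Qed.

Definition kmat g := forall i j, kfield (mat g i j).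

Lemma kmatV g : kmat g -> kmat g^-1%g.
Proof.
move=> kg; have [e he [e00 e01 e10 e11]] := mat_inv g.
have ke : kfield e.
  by case: he => ->; [exact: (kf_nat 1)|apply: kfN; exact: (kf_nat 1)].
by apply: ord2P; apply: ord2P; rewrite ?e00 ?e01 ?e10 ?e11; apply: kfM => //; exact: kfN.
Qed.

Lemma conjugates_jac g a b : kmat g -> conjugates a b -> jac g a != 0.
Proof.
move=> kg [_ _ na]; apply/eqP => e.
have [c0|nc] := eqVneq (mat g 1 0) 0.
  have := mat_det g; rewrite c0; move: e; rewrite /jac c0 mul0r add0r => ->.
  by rewrite !mulr0 subrr => /eqP; rewrite eq_sym oner_eq0.
apply: na; rewrite (_ : a = - mat g 1 1 * (mat g 1 0)^-1).
  by apply: kfM; [apply: kfN|apply: kfV]; exact: kg.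
move: e; rewrite /jac => /eqP; rewrite addr_eq0 => /eqP <-; by field.
Qed.

(** The sum and the product of the images are symmetric in a and b with coefficients in K. So
    conjugation commutes with the action on the orbit. *)
Lemma conjugates_homography g a b : kmat g -> conjugates a b ->
  conjugates (homography g a) (homography g b).
Proof.
move=> kg ab; have n1 := conjugates_jac kg ab; have n2 := conjugates_jac kg (conjugates_sym ab).
have [h1 h2 na] := ab; set w := homography g a.
have ga : bact g (Some a) = Some w by apply/bact_some.
have nkw : ~ kfield w.
  move=> kw; apply: na; have kg' := kmatV kg.
  have : bact g^-1%g (Some w) = Some a by rewrite -ga bactK.
  move=> /bact_some[_ <-]; rewrite /homography.
  by apply: kfM; [|apply: kfV]; apply: kfD; do ?apply: kfM => //; exact: kg'.
move: n1 n2 nkw; rewrite /w /jac /homography.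
have := mat_det g; have := kg 0 0; have := kg 0 1; have := kg 1 0; have := kg 1 1.
move: (mat g 0 0) (mat g 0 1) (mat g 1 0) (mat g 1 1) => p q r s ks kr kq kp pq n1 n2 nkw.
have kn : kfield ((r * a + s) * (r * b + s)).
  rewrite (_ : _ * _ = r * r * (a * b) + r * s * (a + b) + s * s); last by ring.
  by rewrite /kfield; do !apply: kfD; do ?apply: kfM => //; exact: kfM.
split.
- have -> : (p * a + q) / (r * a + s) + (p * b + q) / (r * b + s) =
    (p * r * (a * b) * 2%:R + (p * s + q * r) * (a + b) + q * s * 2%:R) / ((r * a + s) * (r * b + s)).
    by field; rewrite n1 n2.
  apply: kfM; last exact: kfV.
  by kf.
- have -> : (p * a + q) / (r * a + s) * ((p * b + q) / (r * b + s)) =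
    (p * p * (a * b) + p * q * (a + b) + q * q) / ((r * a + s) * (r * b + s)).
    by field; rewrite n1 n2.
  apply: kfM; last exact: kfV.
  by kf.
exact: nkw.
Qed.

End QuadraticIrrationals.

(** * Discreteness of the group; finiteness and separation of the orbit *)

Section ArithmeticOrbit.
Context {R : realType} {K : fieldExtType rat} {iota : {rmorphism K -> R[i]}}.
Hypothesis hK : rational_or_imaginary_quadratic iota.
Variable Gam : set (PSL2 R).
Hypothesis hGam : finite_index_subgroup Gam (PSL2_integers iota).
Implicit Types (x y z r s u : R[i]) (g h k : PSL2 R).

Local Notation O := (ring_of_integers iota).

Lemma fi_closed : group_closed [in Gam]. Proof. by case: hGam. Qed.

Lemma fi_one : Gam 1%g.
Proof. by have [h _] := fi_closed; exact/set_mem. Qed.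

Lemma fi_inv g : Gam g -> Gam g^-1%g.
Proof.
move=> Gg; have [h1 hd] := fi_closed; apply/set_mem.
by have := hd 1%g g h1 (mem_set Gg); rewrite div1g.
Qed.

Lemma fi_mul g h : Gam g -> Gam h -> Gam (g * h)%g.
Proof.
move=> Gg Gh; have [_ hd] := fi_closed; apply/set_mem.
by have := hd g h^-1%g (mem_set Gg) (mem_set (fi_inv Gh)); rewrite invgK.
Qed.

Lemma fi_int g i j : Gam g -> O (mat g i j).
Proof. by case: hGam => h _ _ /h; apply. Qed.

Lemma fi_kmat g : Gam g -> kmat (iota := iota) g.
Proof. by move=> Gg i j; apply: kf_int; exact: fi_int. Qed.

Lemma int_Khat z : O z -> Khat K z.
Proof.
move=> [y _ <-] d1; have [q ->] := dim1_rat (iota := iota) y d1.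
by apply: conj_fixed_Im; rewrite fmorph_rat.
Qed.

Lemma fi_matK g : Gam g -> matK (Khat K) g.
Proof. by move=> Gg i j; apply: int_Khat; exact: fi_int. Qed.

Lemma conjugates_Khat r s : conjugates (iota := iota) r s -> Khat K r -> Khat K s.
Proof.
move=> [[y _ ey] _ _] kr d1; have [q eq] := dim1_rat (iota := iota) y d1.
have -> : s = ratr q - r by rewrite -eq ey addrAC subrr add0r.
by rewrite raddfB /= (kr d1) subr0; apply: conj_fixed_Im; rewrite fmorph_rat.
Qed.

(** By the pigeonhole principle two integer translations lie in the same coset of [Gam]. Their
    quotient provides the large translations that later move the fixed points of gamma0 away. *)
Lemma fi_translation : exists2 m : nat, (0 < m)%N & forall n : nat,
  exists2 p, Gam p & exists2 e : R[i], e = 1 \/ e = -1 &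
   [/\ mat p 0 0 = e, mat p 0 1 = e * (n * m)%:R, mat p 1 0 = 0 & mat p 1 1 = e].
Proof.
have [T [Tm TO]] : exists T : nat -> PSL2 R, (forall n, exists2 e : R[i], e = 1 \/ e = -1 &
    [/\ mat (T n) 0 0 = e, mat (T n) 0 1 = e * n%:R, mat (T n) 1 0 = 0 & mat (T n) 1 1 = e]) /\
    forall n, PSL2_integers iota (T n).
  pose tm (n : nat) : 'M[R[i]]_2 := \matrix_(i, j) (if i == j then 1 else if i == 0 then n%:R else 0).
  have dtm n : \det (tm n) == 1 by rewrite det2 !mxE /= mulr1 mulr0 subr0.
  pose T n : PSL2 R := PSL2_pi (exist _ (tm n) (dtm n) : SL2 R).
  have Tm n : exists2 e : R[i], e = 1 \/ e = -1 & [/\ mat (T n) 0 0 = e, mat (T n) 0 1 = e * n%:R,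
     mat (T n) 1 0 = 0 & mat (T n) 1 1 = e].
    have /orP[/eqP e|/eqP e] := repr_PSL2_pi (exist _ (tm n) (dtm n) : SL2 R); rewrite /mat /T e.
      by exists 1; [left|rewrite !mxE /= mul1r].
    by exists (-1); [right|rewrite !mxE /= mulN1r oppr0].
  have TO n : PSL2_integers iota (T n).
    have [e he [e1 e2 e3 e4]] := Tm n.
    have Oe : O e by case: he => ->; [exact: int1|apply: intN; exact: int1].
    apply: ord2P; apply: ord2P; rewrite ?e1 ?e2 ?e3 ?e4 //; last exact: int0.
    by apply: intM => //; exact: int_nat.
  by exists T; split.
pose f n : set (PSL2 R) := [set (T n * k)%g | k in Gam].
have [i [j [ij eij]]] : exists i j, (i < j)%N /\ f i = f j.
  apply: contrapT => hn; have fi : injective f.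
    move=> i j e; case: (ltngtP i j) => // l; case: hn; first by exists i, j.
    by exists j, i.
  case: hGam => _ _ fin; apply: infinite_nat.
  have -> : [set: nat] = f @^-1` [set [set (g * k)%g | k in Gam] | g in PSL2_integers iota].
    by apply/seteqP; split => // n _; exists (T n).
  by apply: finite_preimage fin => i' j' _ _; exact: fi.
have [k Gk ek] : f j (T i) by rewrite -eij; exists 1%g; [exact: fi_one|rewrite mulg1].
have {}ek : (k^-1 = (T i)^-1 * T j)%g by rewrite -ek invgM -mulgA mulVg mulg1.
have Gk' := fi_inv Gk.
have km : exists2 e : R[i], e = 1 \/ e = -1 & [/\ mat k^-1%g 0 0 = e, mat k^-1%g 0 1 = e * (j - i)%:R,
    mat k^-1%g 1 0 = 0 & mat k^-1%g 1 1 = e].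
  have [e1 h1 [p1 p2 p3 p4]] := Tm i; have [e2 h2 [q1 q2 q3 q4]] := Tm j.
  have [e3 h3 [r1 r2 r3 r4]] := mat_inv (T i); have [e4 h4 E] := mat_mulE (T i)^-1%g (T j).
  exists (e4 * e3 * e1 * e2); last first.
    rewrite ek !E r1 r2 r3 r4 p1 p2 p3 p4 q1 q2 q3 q4 (natrB _ (ltnW ij)).
    by split; ring.
  by case: h1 h2 h3 h4 => -> [] -> [] -> [] ->; rewrite ?(mulN1r, mulrN1, mulr1, opprK); by [left|right].
exists (j - i)%N; first by rewrite subn_gt0.
elim=> [|n [p Gp [e he [e1 e2 e3 e4]]]].
  exists 1%g; first exact: fi_one.
  have h1 := @mat_one R; case: h1 => ->; [exists 1; first by left|exists (-1); first by right];
    by rewrite !mxE /= mul0n mulr0 ?oppr0.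
have [e5 h5 [q1 q2 q3 q4]] := km; have [e6 h6 E] := mat_mulE p k^-1%g.
exists (p * k^-1)%g; first exact: fi_mul.
exists (e6 * e * e5); last first.
  by rewrite !E e1 e2 e3 e4 q1 q2 q3 q4 mulSn natrD; split; ring.
by case: he h5 h6 => -> [] -> [] ->; rewrite ?(mulN1r, mulrN1, mulr1, opprK); by [left|right].
Qed.

Lemma finite_integer_mats (B : R) : finite_set [set g | Gam g /\ forall i j, normc (mat g i j) <= B].
Proof.
have fB := finite_int_disc hK B; set D := _ `&` _ in fB.
pose f g : R[i] * R[i] * R[i] * R[i] := (mat g 0 0, mat g 0 1, mat g 1 0, mat g 1 1).
have fi : injective f.
  move=> g h [e1 e2 e3 e4]; apply: mat_eq; left; apply/matrixP.
  by apply: ord2P; apply: ord2P.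
apply: (@sub_finite_set _ _ (f @^-1` (D `*` D `*` D `*` D))).
  by move=> g [Gg gB]; split => /=; [split; [split|]|]; split => /=; (exact: fi_int) || (exact: gB).
apply: finite_preimage; first by move=> g h _ _; exact: fi.
by do 3 (apply: finite_setX => //).
Qed.

Lemma normc_det2_le (a b c d : R[i]) (B : R) : a * d - b * c = 1 -> 0 <= B ->
  normc a <= B -> normc d <= B -> 1 <= normc c -> normc b <= B ^+ 2 + 1.
Proof.
move=> D B0 a1 d1 c1; have : normc (b * c) <= B ^+ 2 + 1.
  have -> : b * c = a * d - 1 by rewrite -D; ring.
  apply: (le_trans (le_normcD' _ _)); rewrite normcN normc1 lerD2r normcM expr2.
  by apply: ler_pM => //; exact: normc_ge0'.
apply: le_trans; rewrite normcM; apply: ler_peMr => //; exact: normc_ge0'.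
Qed.

Lemma hdist_compare (p q : hpoint R) (D : R) : 0 < p.2 -> 0 < q.2 -> 0 <= D -> hdist p q <= D ->
  p.2 <= 2 * ch D * q.2 /\ normc (p.1 - q.1) <= 2 * ch D * q.2.
Proof.
move=> p0 q0 D0; rewrite hdist_le // /cd; have := ch_ge1 D; move: (ch D) => C C1.
have := normc_ge0' (p.1 - q.1); move: (normc _) p0 q0; move: p.2 q.2 => a b n a0 b0 n0.
rewrite -lerBrDl ler_pdivrMr ?mulr_gt0 // => h.
have h1 := sqr_ge0 n; have h2 := sqr_ge0 (a - b).
have e1 : a <= 2 * C * b.
  rewrite -(ler_pM2l a0); have := sqr_ge0 b; have : 0 <= a * b by rewrite ltW ?mulr_gt0.
  by nra.
split => //; apply: le_of_sqr; first by rewrite !mulr_ge0 //; lra.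
have h3 : n ^+ 2 <= 2 * (C - 1) * b * a by lra.
apply: (le_trans h3).
have h4 : 0 <= 2 * (C - 1) * b by rewrite !mulr_ge0 //; lra.
apply: (le_trans (ler_wpM2l h4 e1)).
rewrite -subr_ge0 (_ : _ - _ = 4 * C * b ^+ 2); last by ring.
by rewrite !mulr_ge0 ?sqr_ge0 //; lra.
Qed.

Lemma low_row_bound (x0 : hpoint R) (D : R) : 0 < x0.2 -> 0 <= D -> exists2 B : R, 0 <= B & forall g,
  hdist x0 (hact g x0) <= D -> normc (mat g 1 0) <= B /\ normc (mat g 1 1) <= B.
Proof.
move=> t0 D0; pose M := 2 * ch D; have M1 : 1 <= M by rewrite /M; have := ch_ge1 D; lra.
have M0 : 0 <= (M + 1) / x0.2 by rewrite divr_ge0 //; [lra|exact: ltW].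
have MB : 0 <= (M + 1) / x0.2 * normc x0.1 by rewrite mulr_ge0 ?normc_ge0'.
exists (M + 1 + (M + 1) / x0.2 + (M + 1) / x0.2 * normc x0.1); first by lra.
move=> g h; have [h1 _] := hdist_compare t0 (hact_gt0 g t0) D0 h.
have N0 := hden_gt0 g t0; have NM : hden g x0 <= M.
  move: h1; rewrite hactE /= -/M mulrA ler_pdivlMr // mulrC ler_pM2r //.
have c1 : normc (mat g 1 0) <= (M + 1) / x0.2.
  rewrite ler_pdivlMr //; apply: le_of_sqr; first by lra.
  rewrite exprMn; have := NM; rewrite /hden; have := sqr_ge0 (normc (jac g x0.1)); nra.
have j1 : normc (jac g x0.1) <= M + 1.
  apply: le_of_sqr; first by lra.
  have : 0 <= normc (mat g 1 0) ^+ 2 * x0.2 ^+ 2 by rewrite mulr_ge0 ?sqr_ge0.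
  have := NM; rewrite /hden; nra.
split; first by lra.
have -> : mat g 1 1 = jac g x0.1 + - (mat g 1 0 * x0.1) by rewrite /jac; ring.
apply: (le_trans (le_normcD' _ _)); rewrite normcN normcM.
have := ler_wpM2r (normc_ge0' x0.1) c1; lra.
Qed.

(** A bounded displacement bounds all four entries of the matrix, and there are finitely many
    integers of bounded modulus. *)
Lemma fi_proper (x0 : hpoint R) (D : R) : 0 < x0.2 ->
  finite_set [set g | Gam g /\ hdist x0 (hact g x0) <= D].
Proof.
move=> t0; have [D0|D0] := ltP D 0.
  apply: (@sub_finite_set _ _ set0) => // g [_ h].
  have := lt_le_trans D0 (hdist_ge0 t0 (hact_gt0 g t0)).
  by move=> /(le_lt_trans h); rewrite ltxx.
have [B B0 hB] := low_row_bound t0 D0.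
pose M := 2 * ch D; have M1 : 1 <= M by rewrite /M; have := ch_ge1 D; lra.
pose B1 := (normc x0.1 + M * x0.2) * B + B * normc x0.1.
have B10 : 0 <= B1 by rewrite addr_ge0 ?mulr_ge0 ?addr_ge0 ?normc_ge0' ?mulr_ge0 ?normc_ge0' //; lra.
apply: sub_finite_set (finite_integer_mats (B + (B ^+ 2 + 1) + B1)) => g [Gg gD]; split => //.
have [c1 d1] := hB g gD.
have a1 : normc (mat g 0 0) <= B.
  have gD' : hdist x0 (hact g^-1%g x0) <= D.
    by rewrite -(hdist_hact g) ?hact_gt0 // hactVK // hdist_sym.
  have [_] := hB _ gD'; have [e he [_ _ _ ->]] := mat_inv g.
  by case: he => ->; rewrite ?mul1r ?mulN1r ?normcN.
have b1 : normc (mat g 0 1) <= B ^+ 2 + 1 + B1.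
  (* For c != 0 the determinant bounds b because |c| >= 1. For c = 0 the map is affine, and b is
     read off from the displacement of x0. *)
  have [c0|nc] := eqVneq (mat g 1 0) 0; last first.
    have := normc_int_ge1 hK (fi_int 1 0 Gg) nc => c2.
    apply: le_trans (_ : _ <= B ^+ 2 + 1) _; last by lra.
    exact: (normc_det2_le (mat_det g) B0 a1 d1 c2).
  have ad : mat g 0 0 * mat g 1 1 = 1 by have := mat_det g; rewrite c0 mulr0 subr0.
  have d0 : mat g 1 1 != 0 by apply/eqP => e; move: ad; rewrite e mulr0 => /eqP; rewrite eq_sym oner_eq0.
  have dN : mat g 1 1 != 0 := d0.
  have e1 : (hact g x0).1 * mat g 1 1 = mat g 0 0 * x0.1 + mat g 0 1.
    case: (x0) => z t /=; rewrite c0 conjc0 !(mulr0, mul0r, add0r, addr0).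
    have -> : normc 0 = 0 :> R by rewrite normc0.
    rewrite expr0n /= mul0r addr0 normcC.
    have cd0 : conjc (mat g 1 1) != 0 by rewrite conjc_eq0.
    by field; rewrite cd0 d0.
  have gD2 := gD; rewrite hdist_sym in gD2.
  have [_ h2] := hdist_compare (hact_gt0 g t0) t0 D0 gD2.
  have h3 : normc (hact g x0).1 <= normc x0.1 + M * x0.2.
    by have := le_normcD' ((hact g x0).1 - x0.1) x0.1; rewrite subrK -/M in h2 *; lra.
  have -> : mat g 0 1 = (hact g x0).1 * mat g 1 1 + - (mat g 0 0 * x0.1) by rewrite e1; ring.
  apply: (le_trans (le_normcD' _ _)); rewrite normcN !normcM.
  have g1 := ler_pM (normc_ge0' _) (normc_ge0' _) h3 d1.
  have g2 := ler_wpM2r (normc_ge0' x0.1) a1.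
  by have := sqr_ge0 B; rewrite /B1; lra.
have := sqr_ge0 B => B2.
by apply: ord2P; apply: ord2P; lra.
Qed.

Lemma normcX z n : normc (z ^+ n) = normc z ^+ n.
Proof. by elim: n => [|n IH]; rewrite ?normc1 // !exprS normcM IH. Qed.

Lemma derive1_homography g z : jac g z != 0 -> derive1 (homography g) z = ((jac g z) ^+ 2)^-1.
Proof.
move=> n0; rewrite /derive1; apply: cvg_lim; first exact: norm_hausdorff.
have cj0 : jac g (h + z) @[h --> (0 : R[i])] --> jac g (0 + z).
  have FF : Filter (nbhs (0 : R[i])) by exact: nbhs_filter.
  have c0 : (fun h : R[i] => h) @ nbhs (0 : R[i]) --> (0 : R[i]) by exact: cvg_id.
  have c1 : (fun h : R[i] => h + z) @ nbhs (0 : R[i]) --> 0 + z.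
    by apply: (@cvgD R[i] R[i]^o _ (nbhs (0 : R[i])) FF _ _ 0 z); [exact: c0|exact: cvg_cst].
  have c2 : (fun h : R[i] => mat g 1 0 * (h + z)) @ nbhs (0 : R[i]) --> mat g 1 0 * (0 + z).
    by apply: (@cvgM R[i] _ (nbhs (0 : R[i])) FF); [exact: cvg_cst|exact: c1].
  by apply: (@cvgD R[i] R[i]^o _ (nbhs (0 : R[i])) FF); [exact: c2|exact: cvg_cst].
rewrite add0r in cj0.
have cj : jac g (h + z) @[h --> (0 : R[i])^'] --> jac g z.
  by apply: cvg_trans cj0; apply: cvg_app; exact: nbhs_dnbhs.
have : (jac g (h + z) * jac g z)^-1 @[h --> (0 : R[i])^'] --> (jac g z * jac g z)^-1.
  apply: cvgV; first by rewrite mulf_neq0.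
  by apply: cvgM => //; exact: cvg_cst.
rewrite -expr2; apply: cvg_trans; apply: near_eq_cvg; near=> h.
have h0 : h != 0 by near: h; exact: nbhs_dnbhs_neq.
have jn : jac g (h + z) != 0.
  near: h; exact: (cvgr_neq0 _ cj n0).
rewrite /= homography_sub // addrK /GRing.scale /=; field; rewrite h0 n0 jn //.
Unshelve. all: by end_near. Qed.

Variables (al : R[i]) (gamma0 : PSL2 R).
Hypothesis hal : quadratic_irrational iota al.
Hypothesis Gg0 : Gam gamma0.
Hypothesis hfix : bact gamma0 (Some al) = Some al.
Hypothesis hexp : 1 < normc (derive1 (homography gamma0) al).

Local Notation conj := (galois_conj iota).
Local Notation ht := (height iota).
Local Notation E := (bdry_orbit Gam [set z | z = al \/ z = conj al]).

(** An orientation of the axis of gamma0, from u' to u. Both are needed, because the orbit set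
    contains the images of both ends. *)
Definition endpoints u u' := u = al /\ u' = conj al \/ u = conj al /\ u' = al.

Lemma endpoints_sym u u' : endpoints u u' -> endpoints u' u.
Proof. by case=> [] [-> ->]; [right|left]. Qed.

Lemma endpoints_conjugates u u' : endpoints u u' -> conjugates (iota := iota) u u'.
Proof.
have h := quadratic_conjugates hal.
by case=> [] [-> ->] //; exact: conjugates_sym.
Qed.

Lemma orbitP r : E r -> exists g u u', [/\ Gam g, endpoints u u', bact g (Some u) = Some r,
   r = homography g u & conj r = homography g u'].
Proof.
move=> [g [u [Gg eu gu]]].
have [u' he] : exists u', endpoints u u'.
  by case: eu => ->; [exists (conj al); left|exists al; right].
exists g, u, u'; split => //; first by have /bact_some[_] := gu.
have /bact_some[_ <-] := gu; apply: galois_conjP.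
exact: conjugates_homography (fi_kmat Gg) (endpoints_conjugates he).
Qed.

Lemma endpoints_jac g u u' : Gam g -> endpoints u u' -> jac g u != 0.
Proof. by move=> Gg /endpoints_conjugates; apply: conjugates_jac; exact: fi_kmat. Qed.

Lemma orbit_homography g u u' : Gam g -> endpoints u u' ->
  E (homography g u) /\ conj (homography g u) = homography g u'.
Proof.
move=> Gg he; split.
  exists g, u; split => //; first by case: he => [] [-> _]; [left|right].
  by apply/bact_some; split => //; exact: endpoints_jac he.
by apply: galois_conjP; exact: conjugates_homography (fi_kmat Gg) (endpoints_conjugates he).
Qed.

Lemma orbit_conjugates r : E r -> conjugates (iota := iota) r (conj r).
Proof.
move=> /orbitP[g [u [u' [Gg he _ -> ->]]]].
exact: conjugates_homography (fi_kmat Gg) (endpoints_conjugates he).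
Qed.

Lemma orbit_conj r : E r -> E (conj r) /\ conj (conj r) = r.
Proof.
move=> Er; have cr := orbit_conjugates Er.
split; last by apply: galois_conjP; exact: conjugates_sym.
have [g [u [u' [Gg he _ _ ->]]]] := orbitP Er.
by have [] := orbit_homography Gg (endpoints_sym he).
Qed.

Lemma orbit_act g r : Gam g -> E r ->
  [/\ jac g r != 0, E (homography g r) & conj (homography g r) = homography g (conj r)].
Proof.
move=> Gg Er; have cr := orbit_conjugates Er; have n0 := conjugates_jac (fi_kmat Gg) cr; split => //.
  case: Er => k [u [Gk eu ku]]; exists (g * k)%g, u; split => //; first exact: fi_mul.
  by rewrite bactM ku; apply/bact_some.
by apply: galois_conjP; exact: conjugates_homography (fi_kmat Gg) cr.
Qed.

Lemma height_gt0 r : E r -> 0 < ht r.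
Proof.
move=> /orbit_conjugates /conjugates_neq ne.
by rewrite /height divr_gt0 // normc_gt0 subr_eq0.
Qed.

(** The fixed-point equation c X^2 + (d - a) X - b = 0 has coefficients in K and the root al outside
    K, so it is c times the minimal polynomial. In particular gamma0 also fixes the conjugate. *)
Lemma gamma_coefs : mat gamma0 1 0 * (al + conj al) = mat gamma0 0 0 - mat gamma0 1 1 /\
  mat gamma0 1 0 * (al * conj al) = - mat gamma0 0 1.
Proof.
have [h1 h2 na] := quadratic_conjugates hal; have kg := fi_kmat Gg0.
have /bact_some[n0] := hfix; move: n0; rewrite /homography /jac.
have := kg 0 0; have := kg 0 1; have := kg 1 0; have := kg 1 1.
move: (mat gamma0 0 0) (mat gamma0 0 1) (mat gamma0 1 0) (mat gamma0 1 1) => p q r s ks kr kq kp n0 e.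
move: (conj al) h1 h2 => be h1 h2.
have e1 : p * al + q = al * (r * al + s) by rewrite -{2}e divfK.
have e2 : (r * (al + be) + s - p) * al = r * (al * be) + q.
  apply/eqP; rewrite -subr_eq0; apply/eqP.
  by rewrite (_ : _ - _ = al * (r * al + s) - (p * al + q)); [rewrite e1 subrr|ring].
have k1 : kfield (iota := iota) (r * (al + be) + s - p).
  by apply: kfD; [apply: kfD => //; apply: kfM|apply: kfN].
have k2 : kfield (iota := iota) (r * (al * be) + q) by apply: kfD => //; apply: kfM.
have z : r * (al + be) + s - p = 0.
  apply/eqP/negPn/negP => nz; apply: na.
  by rewrite -(mulKf nz al) e2 mulrC; apply: kfM => //; exact: kfV.
move: e2; rewrite z mul0r => /esym/eqP; rewrite addr_eq0 => /eqP ->; split => //.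
by apply/eqP; rewrite -subr_eq0 -z; apply/eqP; ring.
Qed.

Lemma normc_jac_lt1 : normc (jac gamma0 al) < 1.
Proof.
have /bact_some[n0 _] := hfix; move: hexp; rewrite derive1_homography // normcV normcX.
have : 0 < normc (jac gamma0 al) by rewrite normc_gt0.
move: (normc _) => x x0; rewrite invf_gt1 ?exprn_gt0 // => h.
by move: h; rewrite expr_lt1 // ltW.
Qed.

(** If c = 0 then a = d by [gamma_coefs], so d^2 = 1 and the derivative at al has modulus 1, against
    the expansion. *)
Lemma gamma_c0 : mat gamma0 1 0 != 0.
Proof.
apply/eqP => c0; have [e1 e2] := gamma_coefs; rewrite c0 !mul0r in e1 e2.
have := normc_jac_lt1; rewrite /jac c0 mul0r add0r.
have d2 : mat gamma0 1 1 ^+ 2 = 1.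
  have := mat_det gamma0; rewrite c0 mulr0 subr0 => <-.
  by rewrite expr2; congr (_ * _); apply/eqP; rewrite -subr_eq0 -opprB -e1 oppr0.
move=> h; have : normc (mat gamma0 1 1) ^+ 2 < 1 by rewrite expr_lt1 // normc_ge0'.
by rewrite -normcX d2 normc1 ltxx.
Qed.

Lemma jac_gamma : jac gamma0 al * jac gamma0 (conj al) = 1.
Proof.
have [e1 e2] := gamma_coefs; rewrite /jac; have := mat_det gamma0.
move: e1 e2; move: (mat gamma0 0 0) (mat gamma0 0 1) (mat gamma0 1 0) (mat gamma0 1 1) (conj al).
move=> p q r s be e1 e2 <-.
have -> : (r * al + s) * (r * be + s) = r * (r * (al * be)) + s * (r * (al + be)) + s * s by ring.
by rewrite e1 e2; ring.
Qed.

Lemma gamma_fix_conj : bact gamma0 (Some (conj al)) = Some (conj al).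
Proof.
apply/bact_some; have n0 : jac gamma0 (conj al) != 0.
  by apply/eqP => z; move: jac_gamma; rewrite z mulr0 => /eqP; rewrite eq_sym oner_eq0.
split => //; rewrite /homography; apply: (mulIf n0); rewrite divfK // /jac.
have [e1 e2] := gamma_coefs.
have -> : mat gamma0 0 0 = mat gamma0 1 0 * (al + conj al) + mat gamma0 1 1 by rewrite e1; ring.
have -> : mat gamma0 0 1 = - (mat gamma0 1 0 * (al * conj al)) by rewrite e2; ring.
by ring.
Qed.

(** The quadratic forms of all orbit points have the same discriminant, so the height is
    proportional to the modulus of the leading coefficient; this is the ratio. It is also the
    minimal possible height, by [orbit_height_ge]. *)
Definition height_unit : R := ht al / normc (mat gamma0 1 0).

Lemma height_unit_gt0 : 0 < height_unit.
Proof.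
rewrite divr_gt0 ?normc_gt0 ?gamma_c0 // /height divr_gt0 // normc_gt0 subr_eq0.
exact: conjugates_neq (quadratic_conjugates hal).
Qed.

(* [C X^2 + B X + D] is the integral form fixed by [g gamma0 g^-1]. *)
Lemma orbit_form r : E r -> exists C B D : R[i], [/\ O C, O B, O D, C != 0 &
  [/\ B = - (C * (r + conj r)), D = C * (r * conj r) & ht r = height_unit * normc C]].
Proof.
move=> Er; have [g [u [u' [Gg he gu er er']]]] := orbitP Er.
have nu := endpoints_jac Gg he; have nu' := endpoints_jac Gg (endpoints_sym he).
have [f1 f2] : mat gamma0 1 0 * (u + u') = mat gamma0 0 0 - mat gamma0 1 1 /\
    mat gamma0 1 0 * (u * u') = - mat gamma0 0 1.
  by have [f1 f2] := gamma_coefs; case: he => [] [-> ->] //; rewrite addrC (mulrC _ al).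
have huu : ht al = 2 / normc (u - u').
  by case: he => [] [-> ->]; rewrite // /height le_normcB.
have Og i j := fi_int i j Gg; have O0 i j := fi_int i j Gg0.
pose c0 := mat gamma0 1 0; pose j1 := jac g u; pose j2 := jac g u'.
pose a := mat g 0 0; pose b := mat g 0 1; pose c := mat g 1 0; pose d := mat g 1 1.
pose C := c0 * (j1 * j2).
pose B := - (c0 * ((a * u + b) * j2 + (a * u' + b) * j1)).
pose D := c0 * ((a * u + b) * (a * u' + b)).
have eC : C = c * c * (- mat gamma0 0 1) + c * d * (mat gamma0 0 0 - mat gamma0 1 1) + c0 * (d * d).
  by rewrite -f1 -f2 /C /j1 /j2 /jac -/c -/d -/c0; ring.
have eB : B = - (a * c * 2%:R * (- mat gamma0 0 1)
   + (a * d + b * c) * (mat gamma0 0 0 - mat gamma0 1 1) + c0 * (b * d * 2%:R)).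
  by rewrite -f1 -f2 /B /j1 /j2 /jac -/c -/d -/c0; ring.
have eD : D = a * a * (- mat gamma0 0 1) + a * b * (mat gamma0 0 0 - mat gamma0 1 1) + c0 * (b * b).
  by rewrite -f1 -f2 /D -/c0; ring.
have On := @int_nat R K iota 2.
exists C, B, D; split.
- by rewrite eC; do !apply: intD; do !apply: intM => //; try exact: Og; try exact: O0;
    try (apply: intN; exact: O0); apply: intB.
- rewrite eB; apply: intN; do !apply: intD; do !apply: intM => //; try exact: Og; try exact: O0;
    try (apply: intN; exact: O0); try (apply: intB; exact: O0).
  by apply: intD; apply: intM; exact: Og.
- by rewrite eD; do !apply: intD; do !apply: intM => //; try exact: Og; try exact: O0;
    try (apply: intN; exact: O0); apply: intB.
- by rewrite mulf_neq0 ?gamma_c0 // mulf_neq0.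
rewrite er' er /homography -/a -/b -[mat g 1 0 * u + _]/j1 -[mat g 1 0 * u' + _]/j2.
have nj1 : j1 != 0 := nu; have nj2 : j2 != 0 := nu'.
split.
- by rewrite /B /C; field; rewrite nj1 nj2.
- by rewrite /D /C; field; rewrite nj1 nj2.
have n3 : normc (u - u') != 0.
  by rewrite gt_eqF // normc_gt0 subr_eq0 (conjugates_neq (endpoints_conjugates he)).
have n4 : normc c0 != 0 by rewrite gt_eqF // normc_gt0 gamma_c0.
have n1 : normc j1 != 0 by rewrite gt_eqF // normc_gt0.
have n2 : normc j2 != 0 by rewrite gt_eqF // normc_gt0.
rewrite /height_unit huu /C !normcM -/c0 /height.
have -> : conj ((a * u + b) / j1) = homography g u' by have := er'; rewrite er.
rewrite -[(a * u + b) / j1]/(homography g u) homography_sub // normcM normcV normcM -/j1 -/j2.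
by field; rewrite n1 n2 n3 n4.
Qed.

Lemma orbit_height_ge r : E r -> height_unit <= ht r.
Proof.
move=> /orbit_form[C [B [D [OC _ _ C0 [_ _ ->]]]]].
have C1 := normc_int_ge1 hK OC C0; rewrite -[leLHS]mulr1.
exact: ler_wpM2l (ltW height_unit_gt0) _ _ C1.
Qed.

Lemma normc_orbit_sub r : E r -> normc (r - conj r) = 2 / ht r.
Proof.
move=> Er; rewrite /height invf_div mulrCA divff ?mulr1 //.
Qed.

Lemma orbit_finite (H rho : R) : finite_set (E `&` [set r | ht r <= H /\ normc r <= rho]).
Proof.
have hu := height_unit_gt0.
pose C1 := H / height_unit; pose D1 := 2 / height_unit + rho.
have f1 := finite_int_disc hK C1; have f2 := finite_int_disc hK (C1 * (rho + D1)).
have f3 := finite_int_disc hK (C1 * (rho * D1)).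
pose T := [set p : R[i] * R[i] * R[i] | [/\ (O `&` [set z | normc z <= C1]) p.1.1,
   (O `&` [set z | normc z <= C1 * (rho + D1)]) p.1.2 & (O `&` [set z | normc z <= C1 * (rho * D1)]) p.2]].
have fT : finite_set T.
  apply: sub_finite_set (finite_setX (finite_setX f1 f2) f3) => -[[p q] w] [h1 h2 h3].
  by split => //; split.
pose S (p : R[i] * R[i] * R[i]) := [set r | p.1.1 != 0 /\ p.1.1 * r ^+ 2 + p.1.2 * r + p.2 = 0].
have fS p : finite_set (S p).
  have [[r0 [n0 e0]]|no] := pselect (exists r, S p r); last first.
    by apply: (@sub_finite_set _ _ set0) => // r hr; case: no; exists r.
  apply: (@sub_finite_set _ _ [set r0; - p.1.2 / p.1.1 - r0]); last by rewrite finite_setU; split; exact: finite_set1.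
  move=> r [_ er]; have : p.1.1 * ((r - r0) * (r - (- p.1.2 / p.1.1 - r0))) = 0.
    rewrite -[RHS](subrr 0) -{1}er -e0; field; exact: n0.
  move=> /eqP; rewrite !mulf_eq0 (negbTE n0) /= !subr_eq0 => /orP[] /eqP ->; by [left|right].
apply: (@sub_finite_set _ _ (\bigcup_(p in T) S p)); last by apply: bigcup_finite => // p _; exact: fS.
move=> r [Er [hr nr]]; have [C [B [D [OC OB OD C0 [eB eD eh]]]]] := orbit_form Er.
have nC : normc C <= C1 by rewrite /C1 ler_pdivlMr // mulrC -eh.
have nr' : normc (conj r) <= D1.
  have -> : conj r = (conj r - r) + r by rewrite subrK.
  apply: (le_trans (le_normcD' _ _)); apply: lerD => //.
  rewrite le_normcB (normc_orbit_sub Er) ler_pM2l // lef_pV2 ?posrE ?height_gt0 //.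
  exact: orbit_height_ge.
have [c0 [r0' r0]] : 0 <= normc C /\ 0 <= normc (conj r) /\ 0 <= normc r by rewrite !normc_ge0'.
have C10 : 0 <= C1 := le_trans c0 nC.
exists (C, B, D).
  split; split => //=.
    rewrite eB normcN normcM; apply: ler_pM => //; first exact: normc_ge0'.
    by apply: (le_trans (le_normcD' _ _)); exact: lerD.
  by rewrite eD !normcM; apply: ler_pM => //; [exact: mulr_ge0|exact: ler_pM].
by split => //=; rewrite eB eD; ring.
Qed.

(** The right-hand side is the modulus of the resultant of the two forms: an algebraic integer,
    nonzero as they have no common root. *)
Lemma resultant_bound (C1 C2 B1 B2 D1 D2 r r' s s' : R[i]) : O C1 -> O C2 -> O B1 -> O B2 -> O D1 -> O D2 ->
  C1 != 0 -> C2 != 0 -> B1 = - (C1 * (r + r')) -> B2 = - (C2 * (s + s')) ->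
  D1 = C1 * (r * r') -> D2 = C2 * (s * s') -> r != s -> r != s' -> r' != s -> r' != s' ->
  1 <= normc C1 ^+ 2 * normc C2 ^+ 2 * (normc (r - s) * normc (r - s') * normc (r' - s) * normc (r' - s')).
Proof.
move=> OC1 OC2 OB1 OB2 OD1 OD2 n1 n2 eB1 eB2 eD1 eD2 n3 n4 n5 n6.
pose Res := (C1 * D2 - C2 * D1) ^+ 2 - (C1 * B2 - C2 * B1) * (B1 * D2 - B2 * D1).
have eR : Res = C1 ^+ 2 * C2 ^+ 2 * ((r - s) * (r - s') * (r' - s) * (r' - s')).
  by rewrite /Res eB1 eB2 eD1 eD2; ring.
have OR : O Res.
  by rewrite /Res expr2; apply: intB; apply: intM; apply: intB; apply: intM.
have R0 : Res != 0 by rewrite eR !mulf_neq0 ?expf_neq0 ?subr_eq0.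
have := normc_int_ge1 hK OR R0; rewrite eR !normcM !expr2 //.
Qed.

Lemma separation_arith (h x y H e a b c : R) : 0 < h -> 0 < x -> 0 < y -> h * x <= H -> h * y <= H ->
  0 <= e -> e * H <= 1 -> e * H <= h ^+ 4 / 144 -> 0 <= a -> 0 <= b -> 0 <= c ->
  a <= e + 2 / (h * y) -> b <= 2 / (h * x) + e -> c <= 2 / (h * x) + e + 2 / (h * y) ->
  x ^+ 2 * y ^+ 2 * (e * a * b * c) < 1.
Proof.
move=> h0 x0 y0 hx hy e0 eH eH' a0 b0 c0 ha hb hc.
pose X := h * x; pose Y := h * y.
have X0 : 0 < X by exact: mulr_gt0.
have Y0 : 0 < Y by exact: mulr_gt0.
have H0 : 0 < H := lt_le_trans X0 hx.
have eX : X * e <= 1 by apply: le_trans eH; rewrite mulrC ler_wpM2l.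
have eY : Y * e <= 1 by apply: le_trans eH; rewrite mulrC ler_wpM2l.
have k1 : Y * a <= 3.
  have := ler_wpM2l (ltW Y0) ha; rewrite mulrDr (_ : Y * (2 / (h * y)) = 2); first lra.
  by rewrite /Y; field; rewrite !gt_eqF.
have k2 : X * b <= 3.
  have := ler_wpM2l (ltW X0) hb; rewrite mulrDr (_ : X * (2 / (h * x)) = 2); first lra.
  by rewrite /X; field; rewrite !gt_eqF.
have k3 : X * Y * c <= 5 * H.
  have := ler_wpM2l (ltW (mulr_gt0 X0 Y0)) hc.
  rewrite (_ : X * Y * (2 / (h * x) + e + 2 / (h * y)) = 2 * Y + Y * (X * e) + 2 * X); last first.
    by rewrite /X /Y; field; rewrite !gt_eqF.
  have := ler_wpM2l (ltW Y0) eX; have hx' : X <= H := hx; have hy' : Y <= H := hy.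
  by lra.
have Xb : 0 <= X * b by exact: mulr_ge0 (ltW X0) b0.
have Ya : 0 <= Y * a by exact: mulr_ge0 (ltW Y0) a0.
have XYc : 0 <= X * Y * c by exact: mulr_ge0 (ltW (mulr_gt0 X0 Y0)) c0.
have k4 : (Y * a) * (X * b) <= 3 * 3 by exact: ler_pM.
have k5 : (Y * a) * (X * b) * (X * Y * c) <= 3 * 3 * (5 * H) by apply: ler_pM => //; exact: mulr_ge0.
have k6 := ler_wpM2l e0 k5.
have h4 : 0 < h ^+ 4 by rewrite exprn_gt0.
rewrite -(ltr_pM2l h4) mulr1.
rewrite (_ : h ^+ 4 * _ = e * ((Y * a) * (X * b) * (X * Y * c))); last by rewrite /X /Y; ring.
by lra.
Qed.

(** If r and s were closer, the three other root differences would be controlled by |r - r'| = 2 /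
    h(r) and |s - s'| = 2 / h(s), and the resultant would be smaller than 1. The case s = r' is
    direct. *)
Lemma orbit_separated : exists2 c : R, 0 < c & forall r s H, E r -> E s -> r <> s ->
  ht r <= H -> ht s <= H -> c / H <= normc (r - s).
Proof.
have hu := height_unit_gt0; set h0 := height_unit in hu.
exists (Num.min 1 (h0 ^+ 4 / 144)) => [|r s H Er Es rs hr hs].
  by rewrite lt_min ltr01 divr_gt0 // exprn_gt0.
have r0 := height_gt0 Er; have s0 := height_gt0 Es; have H0 : 0 < H := lt_le_trans r0 hr.
have rs' : r - s != 0 by rewrite subr_eq0; exact/eqP.
have [e|ne] := eqVneq s (conj r).
  rewrite e (normc_orbit_sub Er); apply: (@le_trans _ _ (1 / H)).
    by rewrite ler_pM2r ?invr_gt0 // ge_min lexx.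
  by apply: ler_pM; rewrite ?invr_ge0 ?(ltW H0) ?ler1n // lef_pV2.
rewrite leNgt; apply/negP => hlt.
have [C1 [B1 [D1 [OC1 OB1 OD1 n1 [eB1 eD1 e1]]]]] := orbit_form Er.
have [C2 [B2 [D2 [OC2 OB2 OD2 n2 [eB2 eD2 e2]]]]] := orbit_form Es.
have [_ rr] := orbit_conj Er; have [_ ss] := orbit_conj Es.
have n3 : r != s by exact/eqP.
have n4 : r != conj s by apply/eqP => e; case/eqP: ne; rewrite e ss.
have n5 : conj r != s by rewrite eq_sym.
have n6 : conj r != conj s by apply/eqP => e; case: rs; rewrite -rr e ss.
have := resultant_bound OC1 OC2 OB1 OB2 OD1 OD2 n1 n2 eB1 eB2 eD1 eD2 n3 n4 n5 n6.
have := normc_orbit_sub Er; have := normc_orbit_sub Es.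
have e3 : ht s = h0 * normc C2 by exact: e2.
have {}e1 : ht r = h0 * normc C1 by exact: e1.
rewrite e1 e3 in hr hs *.
move: (conj r) (conj s) {rr ss ne n4 n5 n6 eB1 eB2 eD1 eD2} => r' s'.
have x0 : 0 < normc C1 by rewrite normc_gt0.
have y0 : 0 < normc C2 by rewrite normc_gt0.
have t1 := le_normcD' (r - s) (s - s'); have t2 := le_normcD' (r' - r) (r - s).
have t3 := le_normcD' ((r' - r) + (r - s)) (s - s').
rewrite (_ : r - s + (s - s') = r - s') in t1; last by ring.
rewrite (_ : r' - r + (r - s) = r' - s) in t2 t3; last by ring.
rewrite (_ : r' - s + (s - s') = r' - s') in t3; last by ring.
rewrite (le_normcB r' r) in t2; move=> es er; rewrite es in t1 t3; rewrite er in t2.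
have t4 := le_trans t3 (lerD t2 (lexx _)).
have eH : normc (r - s) * H < Num.min 1 (h0 ^+ 4 / 144) by rewrite -ltr_pdivlMr.
have := separation_arith hu x0 y0 hr hs (normc_ge0' (r - s)) (le_trans (ltW eH) _)
  (le_trans (ltW eH) _) (normc_ge0' (r - s')) (normc_ge0' (r' - s)) (normc_ge0' (r' - s')) t1 t2 t4.
by rewrite !ge_min !lexx orbT => /(_ isT isT) /lt_le_trans h /h; rewrite ltxx.
Qed.

End ArithmeticOrbit.

(** * Finite measures with real values; a quasi-independent Borel-Cantelli lemma *)

Section RealMeasure.
Context {d : measure_display} {T : measurableType d} {R : realType}.
Variable m : {finite_measure set T -> \bar R}.
Implicit Types (A B : set T).

Definition rm A : R := fine (m A).

Lemma rmK A : measurable A -> (rm A)%:E = m A.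
Proof. by move=> mA; rewrite fineK // fin_num_measure. Qed.

Lemma rm_ge0 A : 0 <= rm A.
Proof. by rewrite fine_ge0. Qed.

Lemma rm0 : rm set0 = 0.
Proof. by rewrite /rm measure0. Qed.

Lemma rm_le A B : measurable A -> measurable B -> A `<=` B -> rm A <= rm B.
Proof. by move=> mA mB AB; rewrite -lee_fin !rmK // le_measure // inE. Qed.

Lemma rmU_le A B : measurable A -> measurable B -> rm (A `|` B) <= rm A + rm B.
Proof.
move=> mA mB; rewrite -lee_fin EFinD !rmK //; last exact: measurableU.
exact: measureU2.
Qed.

Lemma rmU A B : measurable A -> measurable B -> A `&` B = set0 -> rm (A `|` B) = rm A + rm B.
Proof.
move=> mA mB AB; apply: EFin_inj; rewrite EFinD !rmK //; last exact: measurableU.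
exact: measureU.
Qed.

Lemma rmUI A B : measurable A -> measurable B -> rm (A `|` B) + rm (A `&` B) = rm A + rm B.
Proof.
move=> mA mB; have mI := measurableI _ _ mA mB; have mD := measurableD mB mA.
have -> : A `|` B = A `|` (B `\` A) by apply/seteqP; split => x; [move=> [?|?]; [left|have [?|?] := pselect (A x); [left|right]]|move=> [?|[? _]]; [left|right]].
rewrite rmU //; last by apply/seteqP; split => // x [? []].
rewrite -addrA; congr (_ + _); rewrite -rmU //; last by apply/seteqP; split => // x [[? nA] [/nA]].
congr rm; apply/seteqP; split => x; first by move=> [[]|[]].
by move=> Bx; have [?|?] := pselect (A x); [right|left].
Qed.

Lemma rm_bigcup0 (F : nat -> set T) B : (forall n, measurable (F n)) -> (forall n, rm (F n) = 0) ->
  measurable B -> B `<=` \bigcup_n F n -> rm B = 0.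
Proof.
move=> mF F0 mB BF; apply/eqP; rewrite eq_le rm_ge0 andbT -lee_fin rmK //.
have := @measure_sigma_subadditive _ R T m B F mF mB BF; move=> /le_trans; apply.
rewrite eseries0 // => n _ _; transitivity ((rm (F n))%:E); first by rewrite rmK.
by rewrite F0.
Qed.

Section Families.
Context {I : choiceType} (F : I -> set T).
Hypothesis mF : forall i, measurable (F i).

Lemma measurable_bigU (s : seq I) : measurable (\big[setU/set0]_(i <- s) F i).
Proof. by elim/big_ind: _ => //; exact: measurableU. Qed.

Lemma rm_bigU_le (s : seq I) B : measurable B -> B `<=` \big[setU/set0]_(i <- s) F i ->
  rm B <= \sum_(i <- s) rm (F i).
Proof.
move=> mB /(rm_le mB (measurable_bigU s)) h; apply: (le_trans h) => {h mB}.
elim: s => [|i s IH]; first by rewrite !big_nil rm0.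
rewrite !big_cons; apply: (le_trans (rmU_le (mF i) (measurable_bigU s))).
by rewrite lerD2l.
Qed.

Lemma rm_bigU_disj (s : seq I) B : measurable B -> uniq s ->
  (forall i, i \in s -> F i `<=` B) ->
  (forall i j, i \in s -> j \in s -> i != j -> F i `&` F j = set0) ->
  \sum_(i <- s) rm (F i) <= rm B.
Proof.
move=> mB us sB dis; apply: (@le_trans _ _ (rm (\big[setU/set0]_(i <- s) F i))); last first.
  apply: rm_le => //; first exact: measurable_bigU.
  by rewrite -(bigcup_seq s F) => x [i /= /sB]; apply.
elim: s us sB dis => [|i s IH] /= us sB dis; first by rewrite !big_nil rm0.
have /andP[nis us'] := us; rewrite !big_cons rmU //; last first.
- rewrite -(bigcup_seq s F); apply/seteqP; split => // x [Fi [j /= js Fj]].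
  have ij : i != j by apply/eqP => e; move: nis; rewrite e js.
  have := dis i j; rewrite !inE eqxx js orbT => /(_ isT isT ij) e.
  by have : (F i `&` F j) x by []; rewrite e.
- exact: measurable_bigU.
rewrite lerD2l; apply: IH => // [j js|j k js ks]; first by apply: sB; rewrite inE js orbT.
by apply: dis; rewrite inE ?js ?ks orbT.
Qed.

End Families.

(* Second Borel-Cantelli lemma under quasi-independence, by Bonferroni's inequality on blocks
   whose sum is close to [c / (4 C)]. *)
Lemma quasi_independent_limsup (A : nat -> set T) (a : nat -> R) (c C : R) : 0 < c -> 0 < C ->
  (forall n, measurable (A n)) -> (forall n, 0 <= a n) -> (forall n, c * a n <= rm (A n)) ->
  (forall i j, (i < j)%N -> rm (A i `&` A j) <= C * (a i * a j)) ->
  (forall (p : nat) (M : R), exists q, M <= \sum_(p <= i < q) a i) ->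
  forall p, c ^+ 2 / (8 * C) <= rm (\bigcup_(n in [set n | (p <= n)%N]) A n).
Proof.
move=> c0 C0 mA a0 lb ub div p.
have mUn : measurable (\bigcup_(n in [set n | (p <= n)%N]) A n) by apply: bigcup_measurable.
pose s := c / (4 * C); have s0 : 0 < s by rewrite divr_gt0 // mulr_gt0.
have sE : C * s = c / 4 by rewrite /s; field; rewrite gt_eqF.
have target : c ^+ 2 / (8 * C) = c * s / 2 by rewrite /s; field; rewrite gt_eqF.
(* A single term above s suffices. Otherwise the partial sums grow by steps of at most s, so one of
   them lands in [s, 2s], where c S - C S^2 >= c S / 2. *)
have [[n pn hn]|small] := pselect (exists2 n, (p <= n)%N & s < a n).
  rewrite target; apply: (@le_trans _ _ (rm (A n))).
    apply: le_trans (lb n); have := mulr_gt0 c0 s0; have := ltr_pM2l c0 s (a n); rewrite hn; lra.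
  by apply: rm_le => // x Ax; exists n.
have {}small n : (p <= n)%N -> a n <= s.
  by move=> pn; rewrite leNgt; apply/negP => h; apply: small; exists n.
pose S q := \sum_(p <= i < q) a i; pose U q := \big[setU/set0]_(i <- index_iota p q) A i.
have mU q : measurable (U q) by exact: measurable_bigU.
have S0 q : 0 <= S q by apply: sumr_ge0 => i _; exact: a0.
have SS q : (p <= q)%N -> S q.+1 = S q + a q by move=> pq; rewrite /S big_nat_recr.
have US q : (p <= q)%N -> U q.+1 = U q `|` A q.
  move=> pq; rewrite /U /index_iota subSn // -addn1 iotaD big_cat /= big_seq1 subnKC //.
have bonf q : (p <= q)%N -> c * S q - C * S q ^+ 2 <= rm (U q).
  elim: q => [|q IH] pq.
    have -> : S 0%N = 0 by rewrite /S big_geq.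
    by rewrite expr0n /= !mulr0 subr0 rm_ge0.
  move: pq; rewrite leq_eqVlt => /orP[/eqP <-|]; first by rewrite /S big_geq // expr0n /= !mulr0 subr0 rm_ge0.
  rewrite ltnS => pq; rewrite US // SS //.
  have := rmUI (mU q) (mA q).
  have : rm (U q `&` A q) <= C * (S q * a q).
    have mI i : measurable (A i `&` A q) by exact: measurableI.
    apply: le_trans (_ : _ <= \sum_(i <- index_iota p q) rm (A i `&` A q)) _.
      apply: rm_bigU_le => //; first exact: measurableI.
      rewrite /U -(bigcup_seq _ A) -(bigcup_seq _ (fun i => A i `&` A q)) => x [[i /= iq Ai] Aq]; by exists i.
    rewrite /S mulr_suml mulr_sumr big_nat [leRHS]big_nat; apply: ler_sum => i /andP[_ iq].
    exact: ub.
  have := IH pq; have := lb q; have := mulr_ge0 (ltW C0) (sqr_ge0 (a q)).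
  have := mulr_ge0 (ltW C0) (mulr_ge0 (S0 q) (a0 q)).
  move: (rm _) (rm (A q)) (rm (U q)) (rm _) (S q) (a q) => x1 x2 x3 x4 S1 a1; nra.
have [q0 hq0] := div p s.
have ex : exists q, s <= S q by exists q0.
pose q := ex_minn ex; have [hq qmin] : s <= S q /\ forall k, s <= S k -> (q <= k)%N.
  by rewrite /q; case: ex_minnP.
have pq : (p < q)%N.
  by rewrite ltnNge; apply/negP => qp; move: hq; rewrite /S big_geq // leNgt s0.
have S2 : S q <= 2 * s.
  have [k ek] : exists k, q = k.+1 by exists q.-1; rewrite prednK // (leq_trans _ pq).
  have pk : (p <= k)%N by rewrite -ltnS -ek.
  have : S k < s by rewrite ltNge; apply/negP => /qmin; rewrite ek ltnn.
  by rewrite ek SS //; have := small k pk; lra.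
rewrite target; apply: (@le_trans _ _ (rm (U q))); last first.
  apply: rm_le => //; rewrite /U -(bigcup_seq _ A) => x [i /=]; rewrite mem_index_iota => /andP[pi _] Ai.
  by exists i.
apply: le_trans (bonf q (ltnW pq)); move: (S q) hq S2 => x hx x2.
have h1 := ler_wpM2l (ltW C0) x2; have h2 : C * x <= c / 2 by lra.
have h3 := ler_wpM2r (le_trans (ltW s0) hx) h2; have h4 := ler_wpM2l (ltW c0) hx.
by rewrite expr2 mulrA; lra.
Qed.

End RealMeasure.

Section IntegralMonotone.
Local Open Scope ereal_scope.
Context {d : measure_display} {T : measurableType d} {R : realType} (m : {measure set T -> \bar R}).

(* No measurability is needed: the integral of a nonnegative function is a supremum over the
   simple functions below it. *)
Lemma ge0_integral_mono (D D' : set T) (f g : T -> \bar R) : (forall x, D x -> 0 <= f x) ->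
  (forall x, D' x -> 0 <= g x) -> D `<=` D' -> (forall x, D x -> f x <= g x) ->
  \int[m]_(x in D) f x <= \int[m]_(x in D') g x.
Proof.
move=> f0 g0 DD fg; rewrite !ge0_integralE //; apply: ereal_sup_le => _ [h hf <-].
apply: subset_refl => //.
exists h => // x; apply: le_trans (hf x) _.
rewrite /patch; case: ifPn => [/set_mem Dx|nDx]; first by rewrite mem_set ?fg //; exact: DD.
by case: ifPn => [/set_mem /g0|].
Qed.

End IntegralMonotone.

(** * Borel sets of the Riemann sphere *)

Section BoundaryBorel.
Context {R : realType}.
Implicit Types (g : PSL2 R) (xi : bdry R) (A B : set (bdry_borel R)).

Lemma open_bdry_measurable (U : set (bdry R)) : open U -> measurable (U : set (bdry_borel R)).
Proof. by move=> oU; exact: sub_sigma_algebra. Qed.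

Definition bball (r : R[i]) (e : R) : set (bdry R) := Some @` [set z | normc (z - r) < e].

Lemma openC (U : set R[i]) :
  (forall z, U z -> exists2 e : R, 0 < e & forall w, normc (w - z) < e -> U w) -> open U.
Proof. by move=> h; rewrite openE => z /h /nbhsC. Qed.

Lemma open_normc_lt (r : R[i]) (e : R) : open [set z : R[i] | normc (z - r) < e].
Proof.
apply: openC => z /= h; exists (e - normc (z - r)); first by rewrite subr_gt0.
move=> w hw /=; have := le_normcD' (w - z) (z - r); rewrite addrA subrK; lra.
Qed.

Lemma open_bball r e : open (bball r e).
Proof. apply: one_point_compactification_open_some; exact: open_normc_lt. Qed.

Lemma measurable_bball r e : measurable (bball r e : set (bdry_borel R)).
Proof. apply: open_bdry_measurable; exact: open_bball. Qed.

Lemma bballP r e z : bball r e (Some z) <-> normc (z - r) < e.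
Proof. by split => [[w h [<-]]|h] //; exists z. Qed.

Lemma measurable_None : measurable ([set None] : set (bdry_borel R)).
Proof.
rewrite -[X in measurable X]setCK; apply: measurableC; apply: open_bdry_measurable.
rewrite (_ : ~` [set None] = (Some @` setT : set (bdry R))).
  by apply: one_point_compactification_open_some; exact: openT.
by apply/seteqP; split => [[z|] //= h|_ [z _ <-] //]; exists z.
Qed.

Lemma measurable_Some (z : R[i]) : measurable ([set Some z] : set (bdry_borel R)).
Proof.
rewrite (_ : [set Some z] = ~` [set None] `&` ~` (Some @` [set w | w != z] : set (bdry R))).
  apply: measurableI; first exact: measurableC measurable_None.
  apply: measurableC; apply: open_bdry_measurable.
  apply: one_point_compactification_open_some; apply: openC => w /= wz.
  exists (normc (w - z)); first by rewrite normc_gt0 subr_eq0.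
  by move=> u /= hu; apply/eqP => e; move: hu; rewrite e le_normcB ltxx.
apply/seteqP; split => [_ -> /=|[w|] /= [h0 h]]; first by split => // -[w /eqP wz [/wz]].
  2: by case: h0.
by apply: (congr1 Some); apply/eqP/negPn/negP => wz; apply: h; exists w.
Qed.

Lemma continuous_mulC (c z : R[i]) : {for z, continuous (fun w : R[i] => c * w)}.
Proof. by apply: (@cvgM R[i] _ (nbhs z) _); [exact: cvg_cst|exact: cvg_id]. Qed.

Lemma homography_cvg g z : jac g z != 0 -> homography g w @[w --> z] --> homography g z.
Proof.
move=> n0; have FF : Filter (nbhs z) by exact: nbhs_filter.
have c0 : (fun h : R[i] => h) @ nbhs z --> z by exact: cvg_id.
have lin (p q : R[i]) : (fun h : R[i] => p * h + q) @ nbhs z --> p * z + q.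
  apply: (@cvgD R[i] R[i]^o _ (nbhs z) FF); last exact: cvg_cst.
  by apply: (@cvgM R[i] _ (nbhs z) FF); [exact: cvg_cst|exact: c0].
apply: (@cvgM R[i] _ (nbhs z) FF); first exact: lin.
by apply: cvgV; [exact: n0|exact: lin].
Qed.

(** Continuity is checked only at finite points with finite image: up to the two points infinity and
    g^-1 infinity, the preimage of an open set is open. *)
Lemma measurable_bact g : measurable_fun setT (bact g : bdry_borel R -> bdry_borel R).
Proof.
apply: (@measurability _ _ (bdry_borel R) (bdry_borel R) setT (bact g) (@open (bdry R)) erefl) => _ [U oU <-].
rewrite setTI; pose V := [set z | jac g z != 0 /\ U (Some (homography g z))].
have oV : open V.
  rewrite openE => z [n0 Uz].
  have hU : \forall w \near z, U (Some (homography g w)).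
    have nU : nbhs (homography g z) [set w | U (Some w)].
      by apply: one_point_compactification_some_continuous; exact: open_nbhs_nbhs.
    exact: (homography_cvg n0 nU).
  near=> w; split.
    near: w; have := @cvgr_neq0 _ _ _ _ (nbhs_filter z) (jac g) (jac g z).
    apply; last exact: n0.
    apply: (@cvgD R[i] R[i]^o _ (nbhs z) (nbhs_filter z)); last exact: cvg_cst.
    exact: continuous_mulC.
  by near: w.
have mp xi : measurable ([set xi] : set (bdry_borel R)).
  by case: xi => [z|]; [exact: measurable_Some|exact: measurable_None].
pose P := [set xi | (xi = None \/ xi = bact g^-1%g None) /\ U (bact g xi)].
rewrite (_ : _ @^-1` _ = (Some @` V) `|` P).
  apply: measurableU; first by apply: open_bdry_measurable; exact: one_point_compactification_open_some.
  rewrite (_ : P = ([set None] `&` [set _ | U (bact g None)]) `|`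
     ([set bact g^-1%g None] `&` [set _ | U (bact g (bact g^-1%g None))])).
    have mc (Q : Prop) : measurable ([set _ | Q] : set (bdry_borel R)).
      have [q|q] := pselect Q.
        by rewrite (_ : [set _ | Q] = setT) //; apply/seteqP; split.
      by rewrite (_ : [set _ | Q] = set0) //; apply/seteqP; split.
    by apply: measurableU; apply: measurableI.
  apply/seteqP; split => [xi [[->|->] h]|xi [[-> h]|[-> h]]]; [by left|by right| | ].
    by split => //; left.
  by split => //; right.
apply/seteqP; split => [[z|] /= h|xi [[z [n0 Uz] <-]|[_ h]]] //.
- case: eqP h => [e|/eqP n0] h; last by left; exists z.
  right; split; last by rewrite /= e eqxx.
  by right; rewrite (_ : None = bact g (Some z)) ?bactK //= e eqxx.
- by right; split; [left|].
- by rewrite /= ifF //; exact/negbTE.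
Unshelve. all: by end_near. Qed.

Lemma Khat_open_compl (K : fieldExtType rat) (z : R[i]) : ~ Khat K z -> exists2 e : R, 0 < e & forall w, normc (w - z) < e -> ~ Khat K w.
Proof.
move=> nz; have d1 : \dim {:K} = 1%N by apply: contrapT => h; apply: nz.
have kE w : Khat K w <-> imC w = 0.
  by split => [/(_ d1)|h _]; rewrite -complexIm; [move=> []|rewrite h].
exists `|imC z|; first by rewrite normr_gt0; apply/eqP => h; apply: nz; apply/kE.
move=> w hw /kE iw; move: hw; apply/negP; rewrite -leNgt.
by have := normc_abs_im (w - z); rewrite imCD imCN iw sub0r normrN.
Qed.

Lemma Kbar_measurable (K : fieldExtType rat) : measurable (Kbar (Khat K : set R[i]) : set (bdry_borel R)).
Proof.
rewrite -[X in measurable X]setCK; apply: measurableC; apply: open_bdry_measurable.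
rewrite (_ : ~` _ = Some @` [set z : R[i] | ~ Khat K z]).
  by apply: one_point_compactification_open_some; apply: openC => z /Khat_open_compl[e e0 he]; exists e.
apply/seteqP; split => [[z|] h|_ [z nz <-] //]; first by exists z.
by case: h.
Qed.

End BoundaryBorel.

(** * Change of base point for Patterson densities *)

Section PattersonMeasures.
Context {R : realType}.
Variables (Kh : set R[i]) (cK : closed_subfield Kh).
Variables (Gam : set (PSL2 R)) (x0 : hpoint R).
Hypotheses (GK : forall g, Gam g -> matK Kh g) (GV : forall g, Gam g -> Gam g^-1%g).
Hypotheses (G1 : Gam 1%g) (ux0 : upper Kh x0).
Variables (F : vect R -> R) (a c : R).
Hypotheses (hF : holder_with Kh F a c) (iF : invariant_under Kh Gam F).
Variable mu : hpoint R -> {finite_measure set (bdry_borel R) -> \bar R}.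
Hypothesis hmu : patterson_density Kh Gam x0 F mu.
Implicit Types (x y p q : hpoint R) (g h : PSL2 R) (A B : set (bdry_borel R)).

Local Notation G := (fun w => F w - crit_delta Gam x0 F).
Local Notation C := (coc Kh G).

Lemma cocycleE xi x y : cocycle Kh Gam x0 F xi x y = C xi x y.
Proof. by []. Qed.

Lemma pushforward_act g x A : Gam g -> upper Kh x -> measurable A ->
  rm (mu x) (bact g @^-1` A) = rm (mu (hact g x)) A.
Proof. by move=> Gg ux mA; case: hmu => _ h _; rewrite /rm -(h g x A Gg ux mA). Qed.

Lemma cst_integral x A (b : R) : measurable A ->
  (\int[mu x]_(xi in A) b%:E = (b * rm (mu x) A)%:E)%E.
Proof. by move=> mA; rewrite integral_cst // EFinM rmK. Qed.

Lemma rn_le x y A (b : R) : upper Kh x -> upper Kh y -> measurable A ->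
  (forall xi, A xi -> - b <= C xi x y) -> rm (mu x) A <= expR b * rm (mu y) A.
Proof.
move=> ux uy mA h; case: hmu => _ _ /(_ x y A ux uy mA) e.
rewrite -lee_fin rmK // e -cst_integral //; apply: ge0_integral_mono => // xi Axi; rewrite lee_fin ?expR_ge0 //.
by rewrite ler_expR lerNl cocycleE; exact: h.
Qed.

Lemma rn_ge x y A (b : R) : upper Kh x -> upper Kh y -> measurable A ->
  (forall xi, A xi -> C xi x y <= b) -> expR (- b) * rm (mu y) A <= rm (mu x) A.
Proof.
move=> ux uy mA h; case: hmu => _ _ /(_ x y A ux uy mA) e.
rewrite -lee_fin rmK // e -cst_integral //; apply: ge0_integral_mono => // xi Axi; rewrite lee_fin ?expR_ge0 //.
by rewrite ler_expR lerN2 cocycleE; exact: h.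
Qed.

Let hG := holder_withB (crit_delta Gam x0 F) hF.

Lemma invariantB (k : R) : invariant_under Kh Gam (fun w => F w - k).
Proof. by move=> g v Gg Tv; rewrite iF. Qed.

Let iG := invariantB (crit_delta Gam x0 F).

(** The cocycle is known to be bounded at the points of [Kbar], hence the inclusion required of
    A. *)
Lemma null_change x y A : upper Kh x -> upper Kh y -> measurable A -> A `<=` Kbar Kh ->
  rm (mu x) A = 0 -> rm (mu y) A = 0.
Proof.
move=> ux uy mA AK h; pose D := hdist x0 x + hdist x y; have [[_ x00] [_ x_0] [_ y_0]] := And3 ux0 ux uy.
have [d1 d2] : 0 <= hdist x0 x /\ 0 <= hdist x y by rewrite !hdist_ge0.
have D0 : 0 <= D by rewrite addr_ge0.
have [B B0 hB] := coc_bound cK GK GV G1 ux0 hG iG D0.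
apply/eqP; rewrite eq_le rm_ge0 andbT -(pmulr_rle0 _ (expR_gt0 (- B))) -h.
apply: rn_ge => // xi /AK kxi; apply: le_trans (ler_norm _) _.
by apply: hB => //; rewrite /D ?lerDl ?lerDr.
Qed.

Lemma null_act g x A : Gam g -> upper Kh x -> measurable A -> A `<=` Kbar Kh ->
  rm (mu x) A = 0 -> rm (mu x) (bact g @^-1` A) = 0.
Proof.
move=> Gg ux mA AK h; rewrite pushforward_act //; apply: null_change AK h => //.
by apply: upper_hact => //; exact: GK.
Qed.

End PattersonMeasures.

(** * Distances to two boundary points and their distortion *)

Section BoundaryDistance.
Context {R : realType}.
Implicit Types (g : PSL2 R) (xi : bdry R) (z w u : R[i]).

(** Only ratios of two values with the same xi are used. They tend to 1 at infinity, whence the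
    value 1. *)
Definition bdist xi w : R := if xi is Some z then normc (z - w) else 1.

(** The factor k does not depend on w, so the ratio of the distances to two points is multiplied by
    a quotient of [jac] factors, also when xi or its image is infinity. *)
Lemma bdist_act g xi : exists2 k : R, 0 < k & forall w, jac g w != 0 ->
  bdist (bact g xi) (homography g w) = k * bdist xi w / normc (jac g w).
Proof.
case: xi => [z|] /=; rewrite -?[mat g 1 0 * z + _]/(jac g z).
  case: eqP => [j0|/eqP n0].
    have c0 : mat g 1 0 != 0.
      apply/eqP => c0; move: j0; rewrite /jac c0 mul0r add0r => d0.
      by have := mat_det g; rewrite c0 d0 !mulr0 subrr => /eqP; rewrite eq_sym oner_eq0.
    exists (normc (mat g 1 0)) => [|w nw]; first by rewrite normc_gt0.
    have e : jac g w = mat g 1 0 * (w - z) by rewrite -[LHS]subr0 -j0 /jac; ring.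
    by rewrite /= (le_normcB z) -normcM -e divff // gt_eqF // normc_gt0.
  exists (normc (jac g z))^-1 => [|w nw]; first by rewrite invr_gt0 normc_gt0.
  rewrite /= homography_sub // normcM normcV normcM; field.
  by rewrite !gt_eqF // normc_gt0.
case: eqP => [c0|/eqP c0].
  exists (normc (mat g 1 1)) => [|w].
    rewrite normc_gt0; apply/eqP => d0.
    by have := mat_det g; rewrite c0 d0 !mulr0 subrr => /eqP; rewrite eq_sym oner_eq0.
  rewrite /jac c0 mul0r add0r => d0 /=; by rewrite mulr1 divff // gt_eqF // normc_gt0.
exists (normc (mat g 1 0))^-1 => [|w nw]; first by rewrite invr_gt0 normc_gt0.
have e : mat g 0 0 / mat g 1 0 - homography g w = (mat g 1 0 * jac g w)^-1.
  move: nw; rewrite /homography /jac => nw.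
  have -> : (mat g 1 0 * (mat g 1 0 * w + mat g 1 1))^-1 =
    (mat g 0 0 * mat g 1 1 - mat g 0 1 * mat g 1 0) * (mat g 1 0 * (mat g 1 0 * w + mat g 1 1))^-1.
    by rewrite mat_det mul1r.
  by field; rewrite c0 nw.
rewrite /= e normcV normcM mulr1 invfM //.
Qed.

Lemma bdist_ge0 xi w : 0 <= bdist xi w.
Proof. by case: xi => [z|] //=; exact: normc_ge0'. Qed.

Lemma bdist_eq0 xi w : bdist xi w = 0 -> xi = Some w.
Proof.
case: xi => [z|] /= e; last by move/eqP: e; rewrite oner_eq0.
by move/eq0_normc/eqP: e; rewrite subr_eq0 => /eqP ->.
Qed.

Lemma hdist_bound (M : R) : 0 < M -> exists2 D : R, 0 <= D & forall p q : hpoint R,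
  0 < p.2 -> 0 < q.2 -> p.2 <= M * q.2 -> q.2 <= M * p.2 -> normc (p.1 - q.1) <= M * p.2 ->
  hdist p q <= D.
Proof.
move=> M0; pose B := 1 + (M ^+ 3 + 2 * M) / 2.
have B1 : 1 <= B by rewrite /B lerDl divr_ge0 // addr_ge0 ?exprn_ge0 ?mulr_ge0 // ltW.
exists (arcosh B) => [|p q p0 q0 h1 h2 h3]; first exact: arcosh_ge0.
rewrite hdistE; apply: arcosh_le; rewrite ?cd_ge1 // /cd /B lerD2l.
have nn := sqr_le (normc_ge0' _) h3; have := normc_ge0' (p.1 - q.1).
move: (normc _) nn p0 q0 h1 h2; move: p.2 q.2 => x y n nn x0 y0 xy yx n0.
rewrite ler_pdivrMr ?mulr_gt0 //.
have xy0 : 0 < x * y by exact: mulr_gt0.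
have e1 : x ^+ 2 <= M * (x * y) by rewrite expr2 mulrCA ler_pM2l.
have e2 : y ^+ 2 <= M * (x * y) by rewrite expr2 (mulrC x) mulrCA ler_pM2l.
have e3 : n ^+ 2 <= M ^+ 3 * (x * y).
  apply: (le_trans nn); rewrite exprMn (_ : M ^+ 3 * (x * y) = M ^+ 2 * (M * (x * y))); last by ring.
  by apply: ler_wpM2l => //; exact: sqr_ge0.
by nra.
Qed.

End BoundaryDistance.

(** * The axis of a loxodromic element and its images *)

Section Axis.
Context {R : realType}.
Variables (Kh : set R[i]) (cK : closed_subfield Kh).
Variables (Gam : set (PSL2 R)).
Hypotheses (GK : forall g, Gam g -> matK Kh g) (GV : forall g, Gam g -> Gam g^-1%g).
Hypotheses (G1 : Gam 1%g) (GM : forall g h, Gam g -> Gam h -> Gam (g * h)%g).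
Variables (u u' : R[i]) (gam : PSL2 R).
Hypotheses (Ku : Kh u) (Ku' : Kh u') (uu' : u != u') (Ggam : Gam gam).
Hypotheses (Ju : forall g, Gam g -> jac g u != 0) (Ju' : forall g, Gam g -> jac g u' != 0).
Hypotheses (fu : homography gam u = u) (fu' : homography gam u' = u').
Hypotheses (jj : normc (jac gam u) * normc (jac gam u') = 1) (j1 : 1 < normc (jac gam u)).
Implicit Types (g h : PSL2 R) (p q : hpoint R) (xi : bdry R).

Local Notation j g := (normc (jac g u)).
Local Notation j' g := (normc (jac g u')).
Local Notation hg g := (homography g u).
Local Notation hg' g := (homography g u').

(** The highest point of the half-circle from u' to u, a base point lying on the axis. *)
Definition axis_top : hpoint R := ((u + u') / 2, normc (u - u') / 2).
Definition axis_vect : vect R := (axis_top, ((normc (u - u'))^-1%:C%C * (u - u'), 0)).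

Lemma RC_half : ((2^-1 : R)%:C%C) = (2 : R[i])^-1.
Proof. by rewrite RCV rmorph_nat. Qed.

Lemma dist_gt0 : 0 < normc (u - u').
Proof. by rewrite normc_gt0 subr_eq0. Qed.

Lemma j_gt0 g : Gam g -> 0 < j g. Proof. by move=> /Ju; rewrite normc_gt0. Qed.
Lemma j'_gt0 g : Gam g -> 0 < j' g. Proof. by move=> /Ju'; rewrite normc_gt0. Qed.

Lemma upper_axis_top : upper Kh axis_top.
Proof.
have [kr kD kM kJ kV] := cK; split; last by rewrite divr_gt0 // dist_gt0.
rewrite /= -RC_half.
by apply: (kM _ _ (kD _ _ Ku Ku') (kr _)).
Qed.

Lemma T1_axis : T1 Kh axis_vect.
Proof.
have [kr kD kM kJ kV] := cK; split => /=; first exact: upper_axis_top.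
  apply: (kM _ _ (kr _)); apply: (kD _ _ Ku).
  by rewrite (_ : - u' = (-1 : R)%:C%C * u'); [exact: kM _ _ (kr _) Ku'|rewrite RCN mulN1r].
have d0 := dist_gt0.
by rewrite normcZ ger0_norm ?invr_ge0 ?normc_ge0' // mulVf ?gt_eqF // expr1n expr0n /= addr0.
Qed.

Lemma flow_axis s : foot (flow s axis_vect) =
  (((expR s)%:C%C * u + (expR (- s))%:C%C * u') / (expR s + expR (- s))%:C%C,
   normc (u - u') / (expR s + expR (- s))).
Proof.
have e0 := expR_gt0 s; have e0' := expR_gt0 (- s); have d0 := dist_gt0.
have s0 : expR s + expR (- s) != 0 by rewrite gt_eqF // addr_gt0.
rewrite /foot /flow /axis_vect /axis_top /= mul0r subr0 /ch /sh; congr (_, _); last by field.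
have N0 : normc (u - u') != 0 by rewrite gt_eqF.
move: (expR s) (expR (- s)) s0 {e0 e0'} => p q s0; move: (normc (u - u')) N0 {d0} => N N0.
rewrite (_ : N / 2 * ((p - q) / 2) / ((p + q) / 2) = N * ((p - q) * (p + q)^-1 * 2^-1)); last first.
  by field; rewrite s0.
rewrite (RCM N) (RCM (_ * _^-1)) RC_half (RCM (p - q)) (RCV (p + q)) (RCV N).
have h1 : N%:C%C != 0 by exact: realC_neq0.
have h2 := realC_neq0 s0; move: h2; rewrite !RCE => h2.
by field; rewrite h1 h2.
Qed.

(** Compared with [flow_axis]: the image lies on the geodesic from g u' to g u, at time ln (j g / j'
    g) from its top. *)
Lemma hact_axis_top g : Gam g -> hact g axis_top =
  (((j g ^+ 2)%:C%C * hg g + (j' g ^+ 2)%:C%C * hg' g) / (j g ^+ 2 + j' g ^+ 2)%:C%C,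
   normc (u - u') / (j g ^+ 2 + j' g ^+ 2)).
Proof.
move=> Gg; have n1 := Ju Gg; have n2 := Ju' Gg.
have e2 : (axis_top.2 ^+ 2)%:C%C = (u - u') * conjc (u - u') / 4.
  rewrite -[axis_top.2]/(normc (u - u') / 2) (RCX (_ / 2)) (RCM (normc _)) RC_half exprMn -RCX normcC.
  by field.
have e1 : axis_top.1 = (u + u') / 2 by [].
have eN' : hden g axis_top + hden g axis_top = j g ^+ 2 + j' g ^+ 2.
  apply: (@complexI R); rewrite (RCD (hden _ _)) hdenE (RCD (j g ^+ 2)) !normcC /herm e2 e1 /jac !conjE.
  by field.
have eN : hden g axis_top = (j g ^+ 2 + j' g ^+ 2) / 2 by rewrite -eN'; field.
rewrite hactE eN; congr (_, _); last by rewrite /=; field; rewrite gt_eqF // addr_gt0 // exprn_gt0 ?j_gt0 ?j'_gt0.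
have S0 : (j g ^+ 2 + j' g ^+ 2)%:C%C != 0.
  by apply: realC_neq0; rewrite gt_eqF // addr_gt0 // exprn_gt0 ?j_gt0 ?j'_gt0.
have -> : ((j g ^+ 2 + j' g ^+ 2) / 2)%:C%C = (j g ^+ 2 + j' g ^+ 2)%:C%C / 2.
  by rewrite (RCM (_ + _)) RC_half.
suff -> : herm (mat g 0 0) (mat g 0 1) (mat g 1 0) (mat g 1 1) axis_top =
  ((j g ^+ 2)%:C%C * hg g + (j' g ^+ 2)%:C%C * hg' g) / 2.
  by move: (j g ^+ 2 + j' g ^+ 2)%:C%C S0 => S S0; field; exact: S0.
rewrite !normcC /homography /herm e2 e1.
have e3 : jac g u * conjc (jac g u) * ((mat g 0 0 * u + mat g 0 1) / (mat g 1 0 * u + mat g 1 1)) =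
  (mat g 0 0 * u + mat g 0 1) * conjc (jac g u) by move: n1; rewrite /jac => n1; field; exact: n1.
have e4 : jac g u' * conjc (jac g u') * ((mat g 0 0 * u' + mat g 0 1) / (mat g 1 0 * u' + mat g 1 1)) =
  (mat g 0 0 * u' + mat g 0 1) * conjc (jac g u') by move: n2; rewrite /jac => n2; field; exact: n2.
by rewrite e3 e4 /jac !conjE; field.
Qed.

(** Up to a factor 2, the height of the image of the axis point when it lies on the side of g u; see
    [hact_top_near]. It is the radius of its shadow around g u. *)
Definition scale g : R := normc (u - u') / (2 * j g ^+ 2).

Lemma scale_gt0 g : Gam g -> 0 < scale g.
Proof. by move=> Gg; rewrite divr_gt0 ?dist_gt0 // mulr_gt0 // exprn_gt0 // j_gt0. Qed.

Lemma dist_hg g : Gam g -> normc (hg g - hg' g) = normc (u - u') / (j g * j' g).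
Proof. by move=> Gg; rewrite homography_sub ?Ju ?Ju' // normcM normcV normcM. Qed.

Lemma scaleE g : Gam g -> scale g = normc (hg g - hg' g) / 2 * (j' g / j g).
Proof.
move=> Gg; rewrite dist_hg // /scale; have := j_gt0 Gg; have := j'_gt0 Gg => h1 h2.
by field; rewrite !gt_eqF.
Qed.

Lemma hact_top_near g : Gam g -> j' g <= j g ->
  scale g <= (hact g axis_top).2 <= 2 * scale g /\ normc ((hact g axis_top).1 - hg g) <= 2 * scale g.
Proof.
move=> Gg q1; have jg := j_gt0 Gg; have jg' := j'_gt0 Gg; have d0 := dist_gt0.
have S0 : 0 < j g ^+ 2 + j' g ^+ 2 by rewrite addr_gt0 // exprn_gt0.
have jj2 := sqr_le (ltW jg') q1.
rewrite hact_axis_top //= /scale; split.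
  apply/andP; split.
    by rewrite ler_pM2l // lef_pV2 ?posrE ?mulr_gt0 ?exprn_gt0 //; lra.
  rewrite mulrCA ler_pM2l // (_ : 2 * _ = (j g ^+ 2)^-1); last by field; rewrite gt_eqF.
  by rewrite lef_pV2 ?posrE ?exprn_gt0 //; have := sqr_ge0 (j' g); lra.
have Sc : (j g ^+ 2 + j' g ^+ 2)%:C%C != 0 by apply: realC_neq0; rewrite gt_eqF.
rewrite (_ : _ - hg g = (j' g ^+ 2 / (j g ^+ 2 + j' g ^+ 2))%:C%C * (hg' g - hg g)); last first.
  by move: Sc; rewrite !RCE => Sc; field; exact: Sc.
rewrite normcZ ger0_norm ?divr_ge0 ?sqr_ge0 ?(ltW S0) // le_normcB dist_hg //.
rewrite [leLHS](_ : _ = normc (u - u') * (j' g / j g / (j g ^+ 2 + j' g ^+ 2))); last by field; rewrite !gt_eqF.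
rewrite [leRHS](_ : _ = normc (u - u') * (j g ^+ 2)^-1); last by field; rewrite gt_eqF.
rewrite ler_pM2l // ler_pdivrMr // (@le_trans _ _ 1) // ?ler_pdivrMr ?mul1r //.
rewrite mulrDr mulVf ?gt_eqF ?exprn_gt0 // lerDl mulr_ge0 ?invr_ge0 ?sqr_ge0 //.
Qed.

Lemma gpowS n : (gam ^+ n.+1 = gam * gam ^+ n)%g. Proof. exact: expgS. Qed.

Lemma gpow n : [/\ Gam (gam ^+ n)%g, hg (gam ^+ n)%g = u, hg' (gam ^+ n)%g = u',
  j (gam ^+ n)%g = j gam ^+ n & j' (gam ^+ n)%g = j' gam ^+ n].
Proof.
elim: n => [|n [Gn e1 e2 e3 e4]].
  have hj (z : R[i]) : homography (1%g : PSL2 R) z = z /\ normc (jac (1%g : PSL2 R) z) = 1.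
    rewrite /homography /jac; have h1 := @mat_one R; case: h1 => ->; rewrite ?mxE /=.
      by rewrite mul0r mul1r addr0 add0r divr1 normc1.
    by rewrite oppr0 mul0r add0r addr0 mulN1r invrN1 mulrN1 opprK normcN normc1.
  by rewrite expg0 !expr0; have [-> ->] := hj u; have [-> ->] := hj u'.
have GS : Gam (gam ^+ n.+1)%g by rewrite gpowS; exact: GM.
have act (z : R[i]) : jac gam z != 0 -> jac (gam ^+ n)%g z != 0 -> homography (gam ^+ n)%g z = z ->
    homography gam z = z -> jac (gam ^+ n.+1)%g z != 0 -> homography (gam ^+ n.+1)%g z = z.
  move=> n1 n2 e f n3; have : bact (gam ^+ n.+1)%g (Some z) = Some z.
    rewrite gpowS bactM; have -> : bact (gam ^+ n)%g (Some z) = Some z by apply/bact_some.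
    by apply/bact_some.
  by move=> /bact_some[].
split => //; first by apply: act => //; exact: Ju.
- by apply: act => //; exact: Ju'.
- by rewrite gpowS normc_jacM ?Ju // e1 e3 exprS.
- by rewrite gpowS normc_jacM ?Ju' // e2 e4 exprS.
Qed.

Lemma bact_gpow n : bact (gam ^+ n)%g (Some u) = Some u /\ bact (gam ^+ n)%g (Some u') = Some u'.
Proof. by have [Gn e1 e2 _ _] := gpow n; split; apply/bact_some; split => //; [exact: Ju|exact: Ju']. Qed.

Lemma mul_gpow g n : Gam g -> [/\ Gam (g * gam ^+ n)%g, hg (g * gam ^+ n)%g = hg g,
  hg' (g * gam ^+ n)%g = hg' g, j (g * gam ^+ n)%g = j g * j gam ^+ n &
  j' (g * gam ^+ n)%g = j' g * j' gam ^+ n].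
Proof.
move=> Gg; have [Gn e1 e2 e3 e4] := gpow n; have GS := GM Gg Gn; have [b1 b2] := bact_gpow n.
have h (z : R[i]) : jac g z != 0 -> bact (gam ^+ n)%g (Some z) = Some z ->
    homography (g * gam ^+ n)%g z = homography g z.
  move=> nz bz; have : bact (g * gam ^+ n)%g (Some z) = Some (homography g z).
    by rewrite bactM bz; apply/bact_some.
  by move=> /bact_some[].
split => //; first by apply: h => //; exact: Ju.
- by apply: h => //; exact: Ju'.
- by rewrite normc_jacM ?Ju // e1 e3.
- by rewrite normc_jacM ?Ju' // e2 e4.
Qed.

(** The translation length of gam: by [gpow_top] its powers move the top of the axis towards u by
    multiples of it. *)
Definition tlen : R := ln (j gam ^+ 2).

Lemma tlen_gt0 : 0 < tlen.
Proof. by rewrite ln_gt0 // expr_gt1 // ltW // (lt_trans ltr01). Qed.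

Lemma expR_tlen n : expR (n%:R * tlen) = j gam ^+ n.*2.
Proof.
by rewrite expRM_natl /tlen lnK ?posrE ?exprn_gt0 ?(lt_trans ltr01 j1) // -exprM mul2n.
Qed.

Lemma j'_gam : j' gam = (j gam)^-1.
Proof.
have j0 : j gam != 0 by rewrite gt_eqF // (lt_trans ltr01).
by apply: (mulfI j0); rewrite jj divff.
Qed.

Lemma scale_gpow g n : Gam g -> scale (g * gam ^+ n)%g = scale g * expR (- (n%:R * tlen)).
Proof.
move=> Gg; have [_ _ _ e _] := mul_gpow n Gg; rewrite /scale e expRN expR_tlen -mul2n exprMn -exprM (mulnC n).
have jg := j_gt0 Gg; have j0 : 0 < j gam := lt_trans ltr01 j1.
have jn : 0 < j gam ^+ (2 * n) by rewrite exprn_gt0.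
by field; rewrite !gt_eqF.
Qed.

Lemma ratio_gpow g n : Gam g ->
  j (g * gam ^+ n)%g / j' (g * gam ^+ n)%g = j g / j' g * expR (n%:R * tlen).
Proof.
move=> Gg; have [_ _ _ -> ->] := mul_gpow n Gg; rewrite expR_tlen j'_gam -mul2n exprM expr2 exprMn exprVn.
have jg' := j'_gt0 Gg; have j0 : 0 < j gam := lt_trans ltr01 j1.
have jn : 0 < j gam ^+ n by rewrite exprn_gt0.
by field; rewrite !gt_eqF.
Qed.

Lemma gpow_top n : hact (gam ^+ n)%g axis_top = foot (flow (n%:R * tlen) axis_vect).
Proof.
have [Gn e1 e2 e3 e4] := gpow n; rewrite hact_axis_top // flow_axis e1 e2.
have -> : j (gam ^+ n)%g ^+ 2 = expR (n%:R * tlen) by rewrite e3 expR_tlen -exprM muln2.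
have -> // : j' (gam ^+ n)%g ^+ 2 = expR (- (n%:R * tlen)).
by rewrite expRN expR_tlen e4 j'_gam -exprM muln2 exprVn.
Qed.

End Axis.

Lemma normB_chain6 {R : realFieldType} (K b1 b2 b4 b5 b6 b7 b8 b9 b10 : R) :
  `|b2 - b8| <= K -> `|b1 - b7| <= K -> `|b6 - b7| <= K -> `|b4 - b8| <= K -> `|b5 - b10| <= K ->
  `|b10 - b9| <= K -> b6 = b4 + b5 -> `|b1 - b2 - b9| <= 6 * K.
Proof.
rewrite !ler_norml => /andP[? ?] /andP[? ?] /andP[? ?] /andP[? ?] /andP[? ?] /andP[? ?] ?.
by apply/andP; split; lra.
Qed.

(** * The shadow lemma for images of the axis *)

Section Shadows.
Context {R : realType}.
Variables (Kh : set R[i]) (cK : closed_subfield Kh).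
Variables (Gam : set (PSL2 R)) (x0 : hpoint R).
Hypotheses (GK : forall g, Gam g -> matK Kh g) (GV : forall g, Gam g -> Gam g^-1%g).
Hypotheses (G1 : Gam 1%g) (GM : forall g h, Gam g -> Gam h -> Gam (g * h)%g).
Hypothesis ux0 : upper Kh x0.
Variables (F : vect R -> R) (a c : R).
Hypotheses (hF : holder_with Kh F a c) (iF : invariant_under Kh Gam F).
Variable mu : hpoint R -> {finite_measure set (bdry_borel R) -> \bar R}.
Hypothesis hmu : patterson_density Kh Gam x0 F mu.
Variables (u u' : R[i]) (gam : PSL2 R).
Hypotheses (Ku : Kh u) (Ku' : Kh u') (uu' : u != u') (Ggam : Gam gam).
Hypotheses (Ju : forall g, Gam g -> jac g u != 0) (Ju' : forall g, Gam g -> jac g u' != 0).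
Hypotheses (fu : homography gam u = u) (fu' : homography gam u' = u').
Hypotheses (jj : normc (jac gam u) * normc (jac gam u') = 1) (j1 : 1 < normc (jac gam u)).
Variable hmax : R.
Hypothesis hmaxP : forall g, Gam g -> normc (homography g u - homography g u') <= hmax.
Hypothesis translations : forall B : R, exists2 p, Gam p & exists2 t : R[i], B < normc t &
  forall z : R[i], bact p (Some z) = Some (z + t).
(** The set on which lower bounds hold: [Kbar] itself in the convergence case, the badly
    approximable points in the divergence case. *)
Variable N : set (bdry_borel R).
Hypotheses (mN : measurable N) (NK : N `<=` Kbar Kh) (MK : measurable (Kbar Kh : set (bdry_borel R))).
Hypotheses (iN : forall g xi, Gam g -> N (bact g xi) <-> N xi) (N0 : 0 < rm (mu x0) N).
Implicit Types (g h : PSL2 R) (p q : hpoint R) (xi : bdry R) (z : R[i]) (rho : R).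

Local Notation j g := (normc (jac g u)).
Local Notation j' g := (normc (jac g u')).
Local Notation hg g := (homography g u).
Local Notation hg' g := (homography g u').
Local Notation G := (fun w => F w - crit_delta Gam x0 F).
Local Notation J := (segment_int G).
Local Notation x1 := (axis_top u u').
Local Notation sc g := (scale u u' g).
Local Notation ell := (tlen u gam).
Local Notation I g := (J x0 (hact g x1)).

Let rK := closed_subfield_real cK.
Let hG := holder_withB (crit_delta Gam x0 F) hF.
Let iG : invariant_under Kh Gam G := invariantB iF _.
Let ux1 : upper Kh x1 := upper_axis_top cK Ku Ku' uu'.
Let x00 : 0 < x0.2. Proof. by case: ux0. Qed.
Let x10 : 0 < x1.2. Proof. by case: ux1. Qed.
Let ugx g p : Gam g -> upper Kh p -> upper Kh (hact g p) := fun Gg up => upper_hact cK (GK Gg) up.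
Let cG v : T1 Kh v -> continuous (fun t => G (flow t v)) := fun Tv => continuous_flow cK hG Tv.
Let d0 : 0 < normc (u - u') := dist_gt0 uu'.

Lemma hmax_gt0 : 0 < hmax.
Proof. by apply: lt_le_trans (hmaxP G1); rewrite (dist_hg Ju Ju' G1) divr_gt0 // mulr_gt0 // normc_gt0 ?Ju ?Ju'. Qed.

Lemma scale_le g : Gam g -> j' g <= j g -> sc g <= hmax.
Proof.
move=> Gg q1; have jg : 0 < j g by rewrite normc_gt0 Ju.
rewrite (scaleE Ju Ju' Gg); apply: le_trans (hmaxP Gg); rewrite -mulrA ler_piMr ?normc_ge0' //.
have : j' g / j g <= 1 by rewrite ler_pdivrMr // mul1r.
have : 0 <= j' g / j g by rewrite divr_ge0 ?normc_ge0'.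
move: (_ / _) => x x_0 x_1; lra.
Qed.

(** The descending vertical geodesic starts at height [hmax], which bounds all relevant scales, so
    that the times [depth g] are nonnegative. *)
Definition vertical z : vect R := flow (- ln hmax) (ray_to x0 (Some z)).

Lemma T1_vertical z : Kh z -> T1 Kh (vertical z).
Proof. by move=> kz; apply: T1_flow => //; exact: (T1_ray_to cK ux0 (xi := Some z)). Qed.

Lemma foot_vertical z s : Kh z -> foot (flow s (vertical z)) = (z, hmax * expR (- s)).
Proof.
move=> kz; rewrite (flowD _ _ (T1_ray_to cK ux0 (xi := Some z) kz)) foot_ray_to opprD opprK expRD lnK ?posrE ?hmax_gt0 //.
by rewrite mulrC.
Qed.

Lemma vplus_vertical z : Kh z -> vplus (vertical z) = Some z.
Proof.
move=> kz; have kz' : Kbar Kh (Some z) by [].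
by rewrite /vertical (vplus_flow _ rK (T1_ray_to cK ux0 kz')) (vplus_ray_to cK ux0 kz').
Qed.

Definition depth g : R := ln (hmax / sc g).

Lemma depth_ge0 g : Gam g -> j' g <= j g -> 0 <= depth g.
Proof.
move=> Gg q1; have s0 := scale_gt0 uu' Ju Gg.
by rewrite ln_ge0 // ler_pdivlMr // mul1r scale_le.
Qed.

(** At time [depth g] the vertical geodesic is at height [sc g] above z. There it is near the image
    by g of the axis point, hence near the orbit, as uniform tracking requires. *)
Lemma vertical_near rho C0 : 0 <= rho -> 0 <= C0 -> exists2 D : R, 0 <= D & forall g z, Gam g ->
  j' g <= j g -> Kh z -> normc z <= rho -> normc (z - hg g) <= C0 * sc g ->
  [/\ hdist x0 (foot (vertical z)) <= D, hdist (hact g x0) (foot (flow (depth g) (vertical z))) <= D &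
      hdist (foot (flow (depth g) (vertical z))) (hact g x1) <= D].
Proof.
move=> r0 C00; have h0 := hmax_gt0.
have M1 : 0 < C0 + 2 by lra.
have [D1 D10 hD1] := hdist_bound M1.
pose M := x0.2 / hmax + hmax / x0.2 + (normc x0.1 + rho) / x0.2.
have t1 : 0 < x0.2 / hmax by rewrite divr_gt0.
have t2 : 0 < hmax / x0.2 by rewrite divr_gt0.
have t3 : 0 <= (normc x0.1 + rho) / x0.2 by rewrite divr_ge0 ?addr_ge0 ?normc_ge0' // ltW.
have M0 : 0 < M by rewrite /M; lra.
have [D2 D20 hD2] := hdist_bound M0.
have d01 : 0 <= hdist x0 x1 by exact: hdist_ge0.
exists (D1 + D2 + hdist x0 x1) => [|g z Gg q1 kz zr zg]; first by rewrite !addr_ge0.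
have s0 := scale_gt0 uu' Ju Gg.
have ev : foot (flow (depth g) (vertical z)) = (z, sc g).
  rewrite foot_vertical // /depth; congr (_, _); move: (sc g) s0 => s s0.
  by rewrite expRN lnK ?posrE ?divr_gt0 //; field; rewrite !gt_eqF.
have ev0 : foot (vertical z) = (z, hmax).
  by have := foot_vertical 0 kz; rewrite flow0 oppr0 expR0 mulr1.
have [/andP[n1 n2] n3] := hact_top_near uu' Ju Ju' Gg q1.
have p10 : 0 < (hact g x1).2 by exact: hact_gt0.
have k1 : hdist (foot (flow (depth g) (vertical z))) (hact g x1) <= D1.
  rewrite ev; have M2 : 1 <= C0 + 2 by lra.
  apply: (hD1 (z, sc g)) => //; rewrite ?[(z, _).1]/= ?[(z, _).2]/=.
  - by apply: (le_trans n1); rewrite ler_peMl // ltW.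
  - by apply: (le_trans n2); rewrite ler_pM2r // lerDr.
  move: (hact g x1).1 n3 => y n3.
  rewrite (_ : z - y = (z - hg g) - (y - hg g)); last by ring.
  by apply: (le_trans (le_normcD' _ _)); rewrite normcN mulrDl; exact: lerD.
have k2 : hdist x0 (foot (vertical z)) <= D2.
  have f1 : x0.2 / hmax * hmax = x0.2 by rewrite divfK // gt_eqF.
  have f2 : hmax / x0.2 * x0.2 = hmax by rewrite divfK // gt_eqF.
  have f3 : (normc x0.1 + rho) / x0.2 * x0.2 = normc x0.1 + rho by rewrite divfK // gt_eqF.
  rewrite ev0; apply: (hD2 x0 (z, hmax)) => //; rewrite ?[(z, _).1]/= ?[(z, _).2]/=.
  - by rewrite -[leLHS]f1; apply: ler_wpM2r; [exact: ltW|rewrite /M; lra].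
  - by rewrite -[leLHS]f2; apply: ler_wpM2r; [exact: ltW|rewrite /M; lra].
  apply: (le_trans (le_normcD' _ _)); rewrite normcN.
  apply: (@le_trans _ _ (normc x0.1 + rho)); first by rewrite lerD2l.
  by rewrite -[leLHS]f3; apply: ler_wpM2r; [exact: ltW|rewrite /M; lra].
have gx : hdist (hact g x0) (hact g x1) = hdist x0 x1 by exact: hdist_hact.
have k3 : hdist (hact g x0) (foot (flow (depth g) (vertical z))) <= hdist x0 x1 + D1.
  have q10 : 0 < (foot (flow (depth g) (vertical z))).2 by rewrite ev.
  apply: (le_trans (hdist_triangle (hact_gt0 g x00) p10 q10)); rewrite gx lerD2l.
  by rewrite hdist_sym.
move: k1 k2 k3 d01; move: (hdist _ _) (hdist _ _) (hdist _ _) (hdist x0 x1) => e1 e2 e3 e4 k1 k2 k3 k4.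
by split; lra.
Qed.

Lemma shadow_cocycle rho C0 : 0 <= rho -> 0 <= C0 -> exists2 B : R, 0 <= B & forall g z, Gam g ->
  j' g <= j g -> Kh z -> normc z <= rho -> normc (z - hg g) <= C0 * sc g ->
  `|coc Kh G (Some z) x0 (hact g x1) + I g| <= B.
Proof.
move=> r0 C00; have [D D0 hD] := vertical_near r0 C00.
have [B B0 hB] := coc_near cK GK GV G1 ux0 hG iG D0; exists B => // g z Gg q1 kz zr zg.
have [k1 k2 k3] := hD g z Gg q1 kz zr zg.
rewrite -(vplus_vertical kz); apply: (hB g _ _ (depth g)) => //.
- exact: T1_vertical.
- exact: ugx.
- exact: depth_ge0.
Qed.

Definition period : R := J x1 (hact gam x1).

Lemma axis_sum n : J x1 (hact (gam ^+ n)%g x1) = n%:R * period.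
Proof.
have T0 := T1_axis cK Ku Ku' uu'; have l0 := tlen_gt0 j1.
have gp := gpow_top G1 GM uu' Ggam Ju Ju' fu fu' jj j1.
elim: n => [|n IH].
  have := segment_flow2 cK T0 (cG T0) (lexx 0); rewrite itg_same flow0.
  by rewrite mul0r expg0 hact1.
have e0 : x1 = foot (flow 0 (axis_vect u u')) by rewrite flow0.
rewrite gp {1}e0 (@segment_add _ _ cK _ _ _ hG _ 0 (n%:R * ell) (n.+1%:R * ell) T0); last 2 first.
- by rewrite mulr_ge0 // ltW.
- by rewrite ler_pM2r // ler_nat.
rewrite -e0 -!gp IH -natr1 mulrDl mul1r; congr (_ + _).
have -> : (gam ^+ n.+1 = gam ^+ n * gam)%g by rewrite expgSr.
rewrite hactM //; have [Gn _ _ _ _] := gpow G1 GM Ggam Ju Ju' fu fu' n.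
by rewrite (segment_hact cK (GK Gn) ux1 (ugx Ggam ux1)) // => v Tv; exact: iG.
Qed.

(** The images of the axis point by g and by g gam^n are both near the vertical geodesic ending at g
    u. Between them the integral is n periods, by invariance. *)
Lemma shadow_shift rho : 0 <= rho -> exists2 B : R, 0 <= B & forall g n, Gam g ->
  j' g <= j g -> normc (hg g) <= rho -> Kh (hg g) -> `|I (g * gam ^+ n)%g - I g - n%:R * period| <= B.
Proof.
move=> r0; have [D D0 hD] := vertical_near r0 (lexx 0).
have [K K0 hK] := track_orbit cK GK GV ux0 hG iG D0; exists (6 * K) => [|g n Gg q1 gr kg]; first by rewrite mulr_ge0.
have z0 : normc (hg g - hg g) <= 0 by rewrite subrr normc0.
have [GS eS eS' jS jS'] := mul_gpow G1 GM Ggam Ju Ju' fu fu' n Gg.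
have l0 := tlen_gt0 j1.
have jn : 1 <= j gam ^+ n by apply: exprn_ege1; exact: ltW.
have qS : j' (g * gam ^+ n)%g <= j (g * gam ^+ n)%g.
  rewrite jS jS'; apply: ler_pM; rewrite ?exprn_ge0 ?normc_ge0' //; apply: le_trans jn.
  apply: exprn_ile1; first exact: normc_ge0'.
  by rewrite (j'_gam jj j1) invf_le1 ?(ltW j1) // (lt_trans ltr01).
have s0 := scale_gt0 uu' Ju Gg.
have z1 : normc (hg g - hg g) <= 0 * sc g by rewrite mul0r subrr normc0.
have z2 : normc (hg g - hg (g * gam ^+ n)%g) <= 0 * sc (g * gam ^+ n)%g by rewrite mul0r eS subrr normc0.
have [k1 k2 k3] := hD g _ Gg q1 kg gr z1; have [_ k5 k6] := hD _ _ GS qS kg gr z2.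
set v := vertical (hg g) in k1 k2 k3 k5 k6; have Tv : T1 Kh v by exact: T1_vertical.
have uv : upper Kh (foot v) by case: Tv.
have sS : depth (g * gam ^+ n)%g = depth g + n%:R * ell.
  rewrite /depth (scale_gpow G1 GM Ggam Ju Ju' fu fu' j1 n Gg); have h0 := hmax_gt0.
  have e0 := expR_gt0 (n%:R * ell); move: (sc g) s0 => s s0.
  rewrite (_ : hmax / _ = hmax / s * expR (n%:R * ell)); last by rewrite expRN; field; rewrite !gt_eqF.
  by rewrite lnM ?posrE ?divr_gt0 // expRK.
have dg := depth_ge0 Gg q1.
have ss : depth g <= depth (g * gam ^+ n)%g by rewrite sS lerDl mulr_ge0 // ltW.
have := @segment_add _ _ cK _ _ _ hG v 0 _ _ Tv dg ss; rewrite flow0.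
set vs := foot (flow (depth g) v) in k2 k3 *; set vt := foot (flow (depth (g * gam ^+ n)%g) v) in k5 k6 *.
have us : upper Kh vs by exact: foot_flow_upper.
have ut : upper Kh vt by exact: foot_flow_upper.
have ug := ugx Gg ux1; have ug' := ugx GS ux1.
have := hK 1%g x0 (foot v) (hact (g * gam ^+ n)%g x1) G1 ux0 uv ug'.
have := hK 1%g x0 (foot v) (hact g x1) G1 ux0 uv ug.
rewrite hact1 hdistxx => /(_ D0 k1)[_ e1] /(_ D0 k1)[_ e2].
have [e3 _] := hK _ _ _ (foot v) GS ut ug' uv k5 k6.
have [e4 _] := hK _ _ _ (foot v) Gg us ug uv k2 k3.
have [_ e5] := hK _ _ _ vt Gg us ug ut k2 k3.
have [e6 _] := hK _ _ _ (hact g x1) GS ut ug' ug k5 k6.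
have e7 : J (hact g x1) (hact (g * gam ^+ n)%g x1) = n%:R * period.
  have [Gn _ _ _ _] := gpow G1 GM Ggam Ju Ju' fu fu' n.
  rewrite hactM // (segment_hact cK (GK Gg) ux1 (ugx Gn ux1)) ?axis_sum // => w Tw; exact: iG.
rewrite e7 in e6.
by move=> e; exact: (normB_chain6 e1 e2 e3 e4 e5 e6 e).
Qed.

(** The base point is changed from x0 to the image by g of the axis point, where the cocycle is
    -I(g) up to a constant; equivariance gives that measure the total mass seen from the axis point
    itself. *)
Lemma shadow_upper rho C0 : 0 <= rho -> 0 <= C0 -> exists2 C : R, 0 < C & forall (g : PSL2 R) (A : set (bdry_borel R)), Gam g ->
  j' g <= j g -> normc (hg g) <= rho -> measurable A -> A `<=` (Kbar Kh : set (bdry_borel R)) ->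
  A `<=` (bball (hg g) (C0 * sc g) : set (bdry_borel R)) ->
  rm (mu x0) A <= C * expR (I g).
Proof.
move=> r0 C00; have h0 := hmax_gt0.
have r1 : 0 <= rho + C0 * hmax by rewrite addr_ge0 // mulr_ge0 // ltW.
have [B B0 hB] := shadow_cocycle r1 C00.
exists (expR B * (rm (mu x1) setT + 1)) => [|g A Gg q1 gr mA AK Ab].
  by rewrite mulr_gt0 ?expR_gt0 // ltr_wpDl // rm_ge0.
have ug := ugx Gg ux1.
have : rm (mu x0) A <= expR (B + I g) * rm (mu (hact g x1)) A.
  apply: (rn_le hmu) => // -[z|] hz; last by have [] := Ab _ hz.
  have /bballP zb := Ab _ hz; have kz : Kh z := AK _ hz.
  have zr : normc z <= rho + C0 * hmax.
    rewrite -(subrK (hg g) z); apply: (le_trans (le_normcD' _ _)); rewrite addrC; apply: lerD => //.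
    by apply: (le_trans (ltW zb)); rewrite ler_wpM2l // scale_le.
  by have := hB g z Gg q1 kz zr (ltW zb); rewrite ler_norml => /andP[]; lra.
move=> /le_trans; apply; rewrite expRD -mulrA mulrA [leRHS]mulrAC.
apply: ler_pM; rewrite ?mulr_ge0 ?expR_ge0 ?rm_ge0 //.
rewrite -(pushforward_act hmu Gg ux1 mA); apply: le_trans (_ : rm (mu x1) setT <= _); last by rewrite lerDl.
by apply: rm_le => //; rewrite -[X in measurable X]setTI; exact: measurable_bact.
Qed.

Lemma shadow_lower rho C0 : 0 <= rho -> 0 <= C0 -> exists2 c : R, 0 < c & forall (g : PSL2 R) (A : set (bdry_borel R)), Gam g ->
  j' g <= j g -> normc (hg g) <= rho -> measurable A -> A `<=` (Kbar Kh : set (bdry_borel R)) ->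
  A `<=` (bball (hg g) (C0 * sc g) : set (bdry_borel R)) ->
  c * expR (I g) * rm (mu x1) (bact g @^-1` A) <= rm (mu x0) A.
Proof.
move=> r0 C00; have h0 := hmax_gt0.
have r1 : 0 <= rho + C0 * hmax by rewrite addr_ge0 // mulr_ge0 // ltW.
have [B B0 hB] := shadow_cocycle r1 C00.
exists (expR (- B)) => [|g A Gg q1 gr mA AK Ab]; first exact: expR_gt0.
have ug := ugx Gg ux1.
rewrite (pushforward_act hmu Gg ux1 mA) -expRD -[- B + _]opprK.
apply: (rn_ge hmu) => // -[z|] hz; last by have [] := Ab _ hz.
have /bballP zb := Ab _ hz; have kz : Kh z := AK _ hz.
have zr : normc z <= rho + C0 * hmax.
  rewrite -(subrK (hg g) z); apply: (le_trans (le_normcD' _ _)); rewrite addrC; apply: lerD => //.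
  by apply: (le_trans (ltW zb)); rewrite ler_wpM2l // scale_le.
by have := hB g z Gg q1 kz zr (ltW zb); rewrite ler_norml => /andP[]; lra.
Qed.

(** By [bdist_act] the ratio of the distances of g xi to g u and g u' is known; the factor 4 leaves
    room for the triangle inequality. *)
Lemma shadow_incl g xi : Gam g -> j' g <= j g -> 4 * bdist xi u < bdist xi u' ->
  bball (hg g) (1 * sc g) (bact g xi).
Proof.
move=> Gg q1 hx; have [k k0 hk] := bdist_act g xi.
have jg : 0 < j g by rewrite normc_gt0 Ju.
have jg' : 0 < j' g by rewrite normc_gt0 Ju'.
have b1 : 4 * bdist (bact g xi) (hg g) * j g < bdist (bact g xi) (hg' g) * j' g.
  rewrite !hk ?Ju ?Ju' // -mulrA !mulfVK ?gt_eqF // mulrCA ltr_pM2l //.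
case: (bact g xi) b1 => [z|] /= b1; last first.
  by move: b1; rewrite mul1r mulr1; have := q1; lra.
apply/bballP; rewrite mul1r (scaleE Ju Ju' Gg).
have t := le_normcD' (z - hg g) (hg g - hg' g); rewrite addrA subrK in t.
move: b1 t; have := normc_ge0' (z - hg g); have := normc_ge0' (hg g - hg' g).
move: (normc (z - hg g)) (normc (z - hg' g)) (normc (hg g - hg' g)) (j g) (j' g) jg jg' q1 => A B D p q p0 q0 qp D0 A0 h t.
rewrite mulrA ltr_pdivlMr //; have h1 := ler_wpM2r (ltW q0) t; have h2 := ler_wpM2l A0 qp.
have h3 : 4 * A * p < A * q + D * q by lra.
have h4 : 0 < D * q.
  rewrite lt_neqAle mulr_ge0 ?(ltW q0) // andbT eq_sym; apply/eqP => e; rewrite e in h3.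
  have := mulr_ge0 A0 (ltW p0); lra.
by lra.
Qed.

Definition inner (k : R) : set (bdry R) := Some @` [set z | k * normc (z - u) < normc (z - u')].

Lemma open_inner k : 0 <= k -> open (inner k).
Proof.
move=> k0; apply: one_point_compactification_open_some; apply: openC => z /= h.
exists ((normc (z - u') - k * normc (z - u)) / (k + 1)) => [|w].
  by rewrite divr_gt0 // ?subr_gt0 //; lra.
rewrite ltr_pdivlMr; last by lra.
have := le_normcD' (w - z) (z - u); have := le_normcD' (z - w) (w - u').
rewrite !addrA !subrK (le_normcB z w) => h1 h2 h3.
have := ler_wpM2l k0 h2; lra.
Qed.

Lemma innerP k xi : 1 <= k -> inner k xi <-> k * bdist xi u < bdist xi u'.
Proof.
move=> k1; case: xi => [z|]; split => [[w h [<-]]|h] //=; first by exists z.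
by move: h; rewrite /= mulr1 ltNge k1.
Qed.

(** A fundamental domain for the powers of gam outside the fixed points, since gam multiplies the
    ratio of the distances to u' and u by [j gam ^+ 2]. The 4 is that of [shadow_incl]. *)
Definition shell : set (bdry_borel R) := inner 4 `\` inner (4 * j gam ^+ 2).

Let lam1 : 1 <= j gam ^+ 2. Proof. by apply: exprn_ege1; exact: ltW. Qed.

Lemma shellP xi : shell xi <-> 4 * bdist xi u < bdist xi u' <= 4 * j gam ^+ 2 * bdist xi u.
Proof.
have l4 : 1 <= 4 * j gam ^+ 2 by have := lam1; lra.
have k4 : 1 <= 4 :> R by rewrite ler1n.
split => [[/(innerP _ k4) h1 h2]|/andP[h1 h2]].
  by rewrite h1 /= leNgt; apply/negP => /(innerP _ l4).
by split; [exact/innerP|move=> /(innerP _ l4); rewrite ltNge h2].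
Qed.

Lemma measurable_shell : measurable shell.
Proof.
by apply: measurableD; apply: open_bdry_measurable; apply: open_inner; have := lam1; lra.
Qed.

Lemma bdist_gpow n xi : exists2 k : R, 0 < k &
  bdist (bact (gam ^+ n)%g xi) u = k * bdist xi u / j gam ^+ n /\
  bdist (bact (gam ^+ n)%g xi) u' = k * bdist xi u' * j gam ^+ n.
Proof.
have [Gn e1 e2 e3 e4] := gpow G1 GM Ggam Ju Ju' fu fu' n.
have [k k0 hk] := bdist_act (gam ^+ n)%g xi; exists k => //.
rewrite -{1}e1 hk ?Ju // e3; split => //.
by rewrite -{1}e2 hk ?Ju' // e4 (j'_gam jj j1) exprVn invrK.
Qed.

Lemma shell_gpow n xi : shell (bact (gam ^+ n)%g xi) <->
  4 * bdist xi u < bdist xi u' * j gam ^+ n.*2 <= 4 * j gam ^+ 2 * bdist xi u.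
Proof.
have jn : 0 < j gam ^+ n by rewrite exprn_gt0 // (lt_trans ltr01).
have [k k0 [e1 e2]] := bdist_gpow n xi.
rewrite shellP e1 e2 -addnn exprD; move: (j gam ^+ n) (j gam ^+ 2) jn => X L X0.
move: (bdist xi u) (bdist xi u') => A B.
rewrite -(ltr_pM2l (divr_gt0 X0 k0) (4 * _)) -(ler_pM2l (divr_gt0 X0 k0) (k * B * X)).
rewrite (_ : X / k * (4 * (k * A / X)) = 4 * A); last by field; rewrite !gt_eqF.
rewrite (_ : X / k * (k * B * X) = B * (X * X)); last by field; rewrite !gt_eqF.
rewrite (_ : X / k * (4 * L * (k * A / X)) = 4 * L * A); last by field; rewrite !gt_eqF.
by [].
Qed.

Lemma shell_cover xi : bdist xi u != 0 -> bdist xi u' != 0 ->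
  exists n, shell (bact (gam ^+ n)%g xi) \/ exists2 eta, shell eta & bact (gam ^+ n)%g eta = xi.
Proof.
move=> n1 n2; have A0 : 0 < bdist xi u by rewrite lt0r n1 bdist_ge0.
have B0 : 0 < bdist xi u' by rewrite lt0r n2 bdist_ge0.
have l0 := tlen_gt0 j1; have jg0 : 0 < j gam := lt_trans ltr01 j1.
have expl n : expR (n%:R * ell) = j gam ^+ n.*2 by apply: expR_tlen.
pose X := bdist xi u' / (4 * bdist xi u); have X0 : 0 < X by rewrite divr_gt0 // mulr_gt0.
have eX : bdist xi u' = X * (4 * bdist xi u) by rewrite /X divfK // gt_eqF // mulr_gt0.
have [Xle|Xgt] := leP X 1.
  have lX : 0 <= - ln X / ell by rewrite divr_ge0 ?(ltW l0) // oppr_ge0 ln_le0.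
  have [n [t1 t2]] : exists n : nat, - ln X < n%:R * ell /\ n%:R * ell <= - ln X + ell.
    exists (Num.truncn (- ln X / ell)).+1; split; first by rewrite -ltr_pdivrMr // truncnS_gt.
    by rewrite -natr1 mulrDl mul1r lerD2r -ler_pdivlMr // truncn_le.
  exists n; left; apply/shell_gpow.
  have u1 : 1 < X * j gam ^+ n.*2.
    have : expR 0 < expR (ln X + n%:R * ell) by rewrite ltr_expR; lra.
    by rewrite expR0 expRD lnK // expl.
  have u2 : X * j gam ^+ n.*2 <= j gam ^+ 2.
    rewrite -expl -[X in X * _](lnK X0) -expRD (_ : j gam ^+ 2 = expR ell); last first.
      by rewrite /tlen lnK // posrE exprn_gt0.
    by rewrite ler_expR; lra.
  move: u1 u2 eX A0; move: (j gam ^+ n.*2) (j gam ^+ 2) (bdist xi u) (bdist xi u') => p q A B u1 u2 -> A0.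
  have A4 : 0 < 4 * A by rewrite mulr_gt0.
  have := ltr_pM2r A4 1 (X * p); have := ler_pM2r A4 (X * p) q; rewrite u1 u2 => v1 v2.
  by apply/andP; split; lra.
have lX0 : 0 < ln X by rewrite ln_gt0.
pose m := Num.truncn (ln X / ell).
have lX : 0 <= ln X / ell by rewrite divr_ge0 ?(ltW l0) // ltW.
have [n [t1 t2]] : exists n : nat, n%:R * ell < ln X /\ ln X <= (n%:R + 1) * ell.
  have s1 : ln X / ell < m.+1%:R by exact: truncnS_gt.
  have s2 : m%:R <= ln X / ell by rewrite truncn_le.
  rewrite ltr_pdivrMr // -natr1 in s1; rewrite ler_pdivlMr // in s2.
  have [e|ne] := eqVneq (m%:R * ell) (ln X); last by exists m; split; [rewrite lt_neqAle ne|exact: ltW].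
  have m0 : (0 < m)%N by rewrite lt0n; apply/eqP => z; move: e; rewrite z mul0r => z'; move: lX0; rewrite -z' ltxx.
  have em : m.-1%:R + 1 = m%:R :> R by rewrite natr1 prednK.
  by exists m.-1; rewrite -e -em; split; lra.
exists n; right; pose eta := bact (gam ^+ n)%g^-1%g xi; exists eta; last by rewrite /eta bactVK.
apply/shellP; have [k k0 []] := bdist_gpow n eta; rewrite /eta bactVK -/eta => e1 e2.
have u1 : j gam ^+ n.*2 < X by rewrite -expl -[X in _ < X](lnK X0) ltr_expR.
have u2 : X <= j gam ^+ 2 * j gam ^+ n.*2.
  rewrite -expl -[X in X <= _](lnK X0) (_ : j gam ^+ 2 = expR ell); last first.
    by rewrite /tlen lnK // posrE exprn_gt0.
  by rewrite -expRD ler_expR; lra.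
have jn : 0 < j gam ^+ n by rewrite exprn_gt0.
rewrite -addnn exprD in u1 u2; rewrite e1 e2 in eX A0.
move: (j gam ^+ n) (j gam ^+ 2) jn u1 u2 eX A0 => Y L Y0 u1 u2.
move: (bdist eta u) (bdist eta u') => A B eX A0.
have kA : 0 < A by move: A0; rewrite pmulr_lgt0 ?invr_gt0 // pmulr_rgt0.
have eB : B = X * 4 * A / (Y * Y).
  have kY : k * Y != 0 by rewrite mulf_neq0 // gt_eqF.
  apply: (mulIf kY); rewrite (_ : B * (k * Y) = k * B * Y); last by ring.
  by rewrite eX; field; rewrite !gt_eqF.
have YY : 0 < Y * Y by rewrite mulr_gt0.
rewrite eB ltr_pdivlMr // ler_pdivrMr //.
have A4 : 0 < 4 * A by rewrite mulr_gt0.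
have := ltr_pM2r A4 (Y * Y) X; have := ler_pM2r A4 X (L * (Y * Y)); rewrite u1 u2 => v1 v2.
by apply/andP; split; lra.
Qed.

(** Otherwise all translates of this set by powers of gam are null, so N carries mass only at u and
    u'. A large translation of the group carries N at these two points into the null rest, so N is
    null. *)
Lemma shell_pos : 0 < rm (mu x1) (N `&` shell).
Proof.
rewrite lt0r rm_ge0 andbT; apply/eqP => z0.
have mS := measurable_shell; have mNS := measurableI _ _ mN mS.
have mbact g (A : set (bdry_borel R)) : measurable A -> measurable (bact g @^-1` A : set (bdry_borel R)).
  by move=> mA; rewrite -[X in measurable X]setTI; exact: measurable_bact.
have gp n : Gam (gam ^+ n)%g by have [] := gpow G1 GM Ggam Ju Ju' fu fu' n.
have NSK : N `&` shell `<=` Kbar Kh by move=> xi [/NK].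
have null1 n : rm (mu x1) (bact (gam ^+ n)%g @^-1` (N `&` shell)) = 0.
  exact: (null_act cK GK GV G1 ux0 hF iF hmu (gp n) ux1 mNS NSK z0).
have null2 n : rm (mu x1) (bact (gam ^+ n)^-1%g @^-1` (N `&` shell)) = 0.
  exact: (null_act cK GK GV G1 ux0 hF iF hmu (GV (gp n)) ux1 mNS NSK z0).
pose P : set (bdry_borel R) := [set Some u] `|` [set Some u'].
have mP : measurable P by apply: measurableU; exact: measurable_Some.
have NP : rm (mu x1) (N `\` P) = 0.
  pose U n : set (bdry_borel R) :=
    (bact (gam ^+ n)%g @^-1` (N `&` shell)) `|` (bact (gam ^+ n)^-1%g @^-1` (N `&` shell)).
  have mU n : measurable (U n) by apply: measurableU; exact: mbact.
  have U0 n : rm (mu x1) (U n) = 0.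
    apply/eqP; rewrite eq_le rm_ge0 andbT; apply: (le_trans (rmU_le _ (mbact _ _ mNS) (mbact _ _ mNS))).
    by rewrite -[leRHS]addr0; apply: lerD; [rewrite (null1 n)|rewrite (null2 n)].
  apply: (rm_bigcup0 mU U0 (measurableD mN mP)) => xi [Nxi nP].
    have n1 : bdist xi u != 0 by apply/eqP => /bdist_eq0 e; apply: nP; left.
    have n2 : bdist xi u' != 0 by apply/eqP => /bdist_eq0 e; apply: nP; right.
    have [n [h|[eta h e]]] := shell_cover n1 n2; exists n => //.
      by left; split => //; apply/iN.
    right; split; first by apply/iN => //; exact: GV.
    by rewrite /= -e bactK.
have [p Gp [t ht ep]] := translations (normc (u - u')).
have NPp : rm (mu x1) (bact p @^-1` (N `&` P)) = 0.
  apply/eqP; rewrite eq_le rm_ge0 andbT -NP; apply: rm_le.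
  - exact: mbact (measurableI _ _ mN mP).
  - exact: measurableD.
  move=> xi [Nx Px]; split; first by apply/(iN _ Gp).
  have tz (w w' : R[i]) : w + t = w' -> normc (w' - w) = normc t by move=> <-; rewrite addrAC subrr add0r.
  move=> [e|e]; move: Px; rewrite e ep => -[[/tz e']|[/tz e']]; move: ht; rewrite -e' ?ltxx // ?subrr ?normc0.
  - by rewrite ltNge normc_ge0'.
  - by rewrite le_normcB ltxx.
  - by rewrite ltNge normc_ge0'.
have NP0 : rm (mu x1) (N `&` P) = 0.
  have := NPp; rewrite (pushforward_act hmu Gp ux1 (measurableI _ _ mN mP)) => h.
  apply: (null_change cK GK GV G1 ux0 hF iF hmu (ugx Gp ux1) ux1 (measurableI _ _ mN mP) _ h).
  by move=> xi [/NK].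
have : rm (mu x0) N = 0.
  apply: (null_change cK GK GV G1 ux0 hF iF hmu ux1 ux0 mN NK).
  apply/eqP; rewrite eq_le rm_ge0 andbT -[leRHS]addr0 -{1}NP0 -NP.
  apply: le_trans (rmU_le _ (measurableI _ _ mN mP) (measurableD mN mP)).
  apply: rm_le => //; first by apply: measurableU; [exact: measurableI|exact: measurableD].
  by move=> xi Nx; have [Px|Px] := pselect (P xi); [left|right].
by move=> e; move: N0; rewrite e ltxx.
Qed.

Lemma lower_ball rho : 0 <= rho -> exists2 c : R, 0 < c & forall g, Gam g ->
  j' g <= j g -> normc (hg g) <= rho -> c * expR (I g) <= rm (mu x0) (N `&` bball (hg g) (sc g)).
Proof.
move=> r0; have [k k0 hk] := shadow_lower r0 ler01; have sp := shell_pos.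
exists (k * rm (mu x1) (N `&` shell)) => [|g Gg q1 gr]; first exact: mulr_gt0.
have mA : measurable (N `&` bball (hg g) (sc g) : set (bdry_borel R)).
  by apply: measurableI => //; exact: measurable_bball.
have e1 : 1 * sc g = sc g by rewrite mul1r.
have s1 : (N `&` bball (hg g) (sc g) : set (bdry_borel R)) `<=` Kbar Kh by move=> xi [/NK].
have s2 : (N `&` bball (hg g) (sc g) : set (bdry_borel R)) `<=` bball (hg g) (1 * sc g).
  by rewrite e1 => xi [].
apply: le_trans (hk g _ Gg q1 gr mA s1 s2).
rewrite mulrAC; apply: ler_wpM2l; first by rewrite mulr_ge0 ?expR_ge0 // ltW.
apply: rm_le.
- by apply: measurableI => //; exact: measurable_shell.
- by rewrite -[X in measurable X]setTI; exact: measurable_bact.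
move=> xi [Nx /shellP/andP[h1 _]]; split; first exact/iN.
by have := shadow_incl Gg q1 h1; rewrite e1.
Qed.

(** If the period were nonnegative, the pairwise disjoint images of [N] in the shell by the powers
    of gam would all have mass bounded below, against finiteness of the measure. *)
Lemma period_lt0 : period < 0.
Proof.
rewrite ltNge; apply/negP => P0; have sp := shell_pos; have mS := measurable_shell.
have mNS := measurableI _ _ mN mS.
have r0 := normc_ge0' u; have [k k0 hk] := shadow_lower r0 ler01.
have Khg : Kh (hg 1%g) by rewrite (_ : hg 1%g = u) //; have [_ e _ _ _] := gpow G1 GM Ggam Ju Ju' fu fu' 0; rewrite expg0 in e.
have gp n := gpow G1 GM Ggam Ju Ju' fu fu' n.
pose A n : set (bdry_borel R) := bact (gam ^+ n)^-1%g @^-1` (N `&` shell).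
have mA n : measurable (A n) by rewrite -[X in measurable X]setTI; exact: measurable_bact.
have jn n : 1 <= j gam ^+ n by apply: exprn_ege1; exact: ltW.
have qn n : j' (gam ^+ n)%g <= j (gam ^+ n)%g.
  have [_ _ _ -> ->] := gp n; apply: le_trans (jn n).
  apply: exprn_ile1; first exact: normc_ge0'.
  by rewrite (j'_gam jj j1) invf_le1 ?(ltW j1) // (lt_trans ltr01).
have [D D0 hD] : exists2 D : R, 0 <= D & forall n, - D <= I (gam ^+ n)%g.
  have d01 : 0 <= hdist x0 x1 by exact: hdist_ge0.
  have [K K0 hK] := track_orbit cK GK GV ux0 hG iG d01.
  exists K => // n; have [Gn _ _ _ _] := gp n.
  have := hK 1%g x0 x1 (hact (gam ^+ n)%g x1) G1 ux0 ux1 (ugx Gn ux1).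
  rewrite hact1 hdistxx => /(_ d01 (lexx _))[_]; rewrite axis_sum ler_norml => /andP[h _].
  have : 0 <= n%:R * period by rewrite mulr_ge0.
  by move: h; move: (J x0 _) (n%:R * period) => x y; lra.
pose e := k * expR (- D) * rm (mu x1) (N `&` shell).
have e0 : 0 < e by rewrite !mulr_gt0 ?expR_gt0.
have lb n : e <= rm (mu x0) (A n).
  have [Gn en _ _ _] := gp n.
  apply: le_trans (hk (gam ^+ n)%g (A n) Gn (qn n) _ (mA n) _ _).
  - rewrite /e -!mulrA; apply: ler_wpM2l; first exact: ltW.
    apply: ler_pM; rewrite ?expR_ge0 ?rm_ge0 ?ler_expR //.
    apply: rm_le => //; first by rewrite -[X in measurable X]setTI; exact: measurable_bact.
    by move=> xi h; rewrite /A /= bactK.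
  - by rewrite en.
  - by move=> xi [Nx _]; apply: NK; move: Nx; apply: (iffLR (iN _ (GV Gn))).
  - move=> xi [_ /shellP/andP[s1 _]].
    by have := shadow_incl Gn (qn n) s1; rewrite bactVK.
have disj i' j0 : (i' < j0)%N -> A i' `&` A j0 = set0.
  move=> ij; apply/seteqP; split => // xi [[_ si] [_ sj]].
  have jg0 : 0 < j gam := lt_trans ltr01 j1.
  pose eta := bact (gam ^+ j0)^-1%g xi.
  have e1 : bact (gam ^+ i')^-1%g xi = bact (gam ^+ (j0 - i'))%g eta.
    have -> : xi = bact (gam ^+ i')%g (bact (gam ^+ (j0 - i'))%g eta).
      by rewrite -bactM -expgnDr subnKC ?(ltnW ij) // /eta bactVK.
    by rewrite bactK.
  move: si; rewrite e1 => /shell_gpow/andP[_ h2]; move: sj; rewrite -/eta => /shellP/andP[h3 _].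
  have L0 : 0 < j gam ^+ 2 by rewrite exprn_gt0.
  have m1 : j gam ^+ 2 <= j gam ^+ (j0 - i').*2.
    by rewrite ler_eXn2l // -muln2 (leq_mul (_ : 1 <= j0 - i')%N (leqnn 2)) // subn_gt0.
  have B0 : 0 < bdist eta u' by apply: le_lt_trans h3; rewrite mulr_ge0 // bdist_ge0.
  have h4 := le_trans (ler_wpM2l (ltW B0) m1) h2.
  move: h4; rewrite (_ : 4 * j gam ^+ 2 * bdist eta u = 4 * bdist eta u * j gam ^+ 2); last by ring.
  by rewrite ler_pM2r // => h4; have := lt_le_trans h3 h4; rewrite ltxx.
pose n := (Num.truncn (rm (mu x0) setT / e)).+1.
have h1 : rm (mu x0) setT < n%:R * e by rewrite -ltr_pdivrMr // truncnS_gt.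
have h2 : \sum_(0 <= i < n) rm (mu x0) (A i) <= rm (mu x0) setT.
  apply: rm_bigU_disj => //; first exact: iota_uniq.
  move=> i' j0 _ _; case: (ltngtP i' j0) => // ij _; first exact: disj.
  by rewrite setIC; exact: disj.
have h3 : n%:R * e <= \sum_(0 <= i < n) rm (mu x0) (A i).
  have -> : n%:R * e = \sum_(0 <= i < n) e by rewrite sumr_const_nat subn0 mulr_natl.
  by apply: ler_sum => i _; exact: lb.
by have := lt_le_trans h1 (le_trans h3 h2); rewrite ltxx.
Qed.

Definition kap : R := - period / ell.

Lemma kap_gt0 : 0 < kap.
Proof. by rewrite /kap divr_gt0 ?(tlen_gt0 j1) // oppr_gt0 period_lt0. Qed.

Lemma expR_period n : expR (n%:R * period) = expR (- (n%:R * ell)) `^ kap.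
Proof.
rewrite -expRM /kap; congr expR; have := tlen_gt0 j1 => l0.
by field; rewrite gt_eqF.
Qed.

(** Right multiplication by powers of gam slides the image of the axis point along the geodesic from
    g u' to g u; it is brought within one period of the top. *)
Lemma normalized g : Gam g -> exists g1, [/\ Gam g1, hg g1 = hg g, hg' g1 = hg' g, j' g1 <= j g1 &
  j g1 <= j gam ^+ 2 * j' g1].
Proof.
move=> Gg; have jg : 0 < j g by rewrite normc_gt0 Ju.
have jg' : 0 < j' g by rewrite normc_gt0 Ju'.
have l0 := tlen_gt0 j1; have jg0 : 0 < j gam := lt_trans ltr01 j1.
have eL : expR ell = j gam ^+ 2 by rewrite /tlen lnK // posrE exprn_gt0.
have fin g1 : Gam g1 -> hg g1 = hg g -> hg' g1 = hg' g -> 1 <= j g1 / j' g1 <= expR ell ->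
    exists g1, [/\ Gam g1, hg g1 = hg g, hg' g1 = hg' g, j' g1 <= j g1 & j g1 <= j gam ^+ 2 * j' g1].
  move=> G1' e1 e2; have jg1 : 0 < j' g1 by rewrite normc_gt0 Ju'.
  by rewrite ler_pdivlMr // ler_pdivrMr // mul1r eL => /andP[h1 h2]; exists g1.
pose q := j g / j' g; have q0 : 0 < q by rewrite divr_gt0.
have [q1|q1] := leP 1 q.
  have [n [t1 t2]] : exists n : nat, n%:R * ell <= ln q /\ ln q <= n%:R * ell + ell.
    have lq : 0 <= ln q / ell by rewrite divr_ge0 ?ln_ge0 // ltW.
    exists (Num.truncn (ln q / ell)); split; first by rewrite -ler_pdivlMr // truncn_le.
    have : ln q / ell < (Num.truncn (ln q / ell)).+1%:R by exact: truncnS_gt.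
    by rewrite ltr_pdivrMr // -natr1 mulrDl mul1r => /ltW.
  have [Gn _ _ _ _] := gpow G1 GM Ggam Ju Ju' fu fu' n.
  pose g1 := (g * (gam ^+ n)^-1)%g; have Gg1 : Gam g1 := GM Gg (GV Gn).
  have eg : (g1 * gam ^+ n)%g = g by rewrite /g1 -mulgA mulVg mulg1.
  have [_ e1 e2 _ _] := mul_gpow G1 GM Ggam Ju Ju' fu fu' n Gg1.
  have e3 := ratio_gpow G1 GM Ggam Ju Ju' fu fu' jj j1 n Gg1; rewrite eg -/q in e1 e2 e3.
  apply: (fin g1) => //; have e4 : j g1 / j' g1 = q * expR (- (n%:R * ell)).
    by rewrite e3 -mulrA expR_mulN mulr1.
  have e5 : j g1 / j' g1 = expR (ln q - n%:R * ell) by rewrite e4 expRD lnK.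
  have u0 : expR 0 <= expR (ln q - n%:R * ell) by rewrite ler_expR; lra.
  by rewrite expR0 in u0; rewrite e5 u0 ler_expR; lra.
have [n [t1 t2]] : exists n : nat, - ln q <= n%:R * ell /\ n%:R * ell <= - ln q + ell.
  have lq : 0 <= - ln q / ell by rewrite divr_ge0 ?oppr_ge0 ?ln_le0 // ltW.
  exists (Num.truncn (- ln q / ell)).+1; split; first by rewrite ltW // -ltr_pdivrMr // truncnS_gt.
  by rewrite -natr1 mulrDl mul1r lerD2r -ler_pdivlMr // truncn_le.
have [GS e1 e2 _ _] := mul_gpow G1 GM Ggam Ju Ju' fu fu' n Gg.
apply: (fin (g * gam ^+ n)%g) => //; rewrite (ratio_gpow G1 GM Ggam Ju Ju' fu fu' jj j1 n Gg) -/q.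
have e5 : q * expR (n%:R * ell) = expR (ln q + n%:R * ell) by rewrite expRD lnK.
have u0 : expR 0 <= expR (ln q + n%:R * ell) by rewrite ler_expR; lra.
by rewrite expR0 in u0; rewrite e5 u0 ler_expR; lra.
Qed.

(* The shadow lemma, applied along the geodesic with endpoints [r = g u] and [r' = g u']: vertical
   geodesics ending in B(r, y) follow it for a time about [- ln (y / |r - r'|)]. *)
Lemma shadow_balls rho C0 : 0 <= rho -> 1 <= C0 -> exists c C : R, [/\ 0 < c, 0 < C & forall g, Gam g ->
  normc (hg g) <= rho -> exists2 w : R, 0 < w & forall y : R, 0 < y ->
  y <= C0 * normc (hg g - hg' g) ->
  rm (mu x0) (Kbar Kh `&` bball (hg g) y) <= C * (w * (y / normc (hg g - hg' g)) `^ kap) /\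
  c * (w * (y / normc (hg g - hg' g)) `^ kap) <= rm (mu x0) (N `&` bball (hg g) y)].
Proof.
move=> r0 C01; have k0 := kap_gt0; have l0 := tlen_gt0 j1.
have jg0 : 0 < j gam := lt_trans ltr01 j1.
have L0 : 0 < j gam ^+ 2 by rewrite exprn_gt0.
have eL : expR ell = j gam ^+ 2 by rewrite /tlen lnK // posrE exprn_gt0.
pose L := j gam ^+ 2; have L1 : 1 <= L := lam1.
have C00 : 0 <= C0 * (2 * L) by rewrite !mulr_ge0 // ltW // (lt_le_trans ltr01).
have [C1 C10 hC1] := shadow_upper r0 C00.
have [c1 c10 hc1] := lower_ball r0.
have [B B0 hB] := shadow_shift r0.
pose M := (2 * L) `^ kap; have M0 : 0 < M by rewrite powR_gt0 // mulr_gt0.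
have m2 : 0 < expR B by exact: expR_gt0.
pose C := C1 * expR B * expR (- period) * M.
pose c' := c1 * expR (- B) * expR period / C0 `^ kap.
have C0k : 0 < C0 `^ kap by rewrite powR_gt0 // (lt_le_trans ltr01).
exists c', C; split.
- by rewrite divr_gt0 // !mulr_gt0 ?expR_gt0.
- by rewrite !mulr_gt0 ?expR_gt0.
move=> g0 Gg0 g0r; have [g [Gg e1 e2 q1 q2]] := normalized Gg0; rewrite -e1 -e2 in g0r *.
have kg : Kh (hg g).
  have [kr kD kM kJ kV] := cK; have kk := GK Gg.
  have kl i : Kh (mat g i 0 * u + mat g i 1) by exact: (kD _ _ (kM _ _ (kk _ _) Ku) (kk _ _)).
  exact: (kM _ _ (kl 0) (kV _ (kl 1))).
have jg : 0 < j g by rewrite normc_gt0 Ju.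
have jg' : 0 < j' g by rewrite normc_gt0 Ju'.
have S0 := scale_gt0 uu' Ju Gg; have eS := scaleE Ju Ju' Gg.
set S := sc g in S0 eS; set d := normc (hg g - hg' g) in eS *.
have d_0 : 0 < d by rewrite /d (dist_hg Ju Ju' Gg) divr_gt0 // mulr_gt0.
have Sd : S <= d.
  rewrite eS -mulrA ler_piMr ?(ltW d_0) //.
  have : j' g / j g <= 1 by rewrite ler_pdivrMr // mul1r.
  have : 0 <= j' g / j g by rewrite divr_ge0 // ltW.
  by move: (j' g / j g) => x x_0 x_1; lra.
have dS : d <= 2 * L * S.
  have h : 1 <= L * (j' g / j g) by rewrite mulrA ler_pdivlMr // mul1r.
  rewrite eS; move: (j' g / j g) h => x h; rewrite (_ : 2 * L * _ = d * (L * x)); last by field.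
  by apply: ler_peMr => //; exact: ltW.
exists (expR (I g)); first exact: expR_gt0.
move=> y y0 yd; have yk0 : 0 < (y / d) `^ kap by rewrite powR_gt0 // divr_gt0.
have mKb : measurable (Kbar Kh `&` bball (hg g) y : set (bdry_borel R)).
  by apply: measurableI => //; exact: measurable_bball.
have mNb (z : R) : measurable (N `&` bball (hg g) z : set (bdry_borel R)).
  by apply: measurableI => //; exact: measurable_bball.
have sh3 (b1 b2 b3 b4 b5 b6 : R) : b1 * b2 * b3 * b4 * (b5 * b6) = b1 * (b2 * b5 * (b3 * (b4 * b6))) by ring.
have sh4 (b1 b2 b3 b4 b5 b6 : R) : b1 * b2 * b3 * b4 * (b5 * b6) = b1 * b5 * (b2 * b3 * (b4 * b6)) by ring.
have sh1 (b1 b2 b3 b4 b5 b6 : R) : b1 * b2 * b3 / b4 * (b5 * b6) = b1 * b5 * (b2 * b3 * (b6 / b4)) by ring.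
have sh2 (b1 b2 b3 b4 b5 b6 : R) : b1 * b2 * b3 / b4 * (b5 * b6) = b1 * (b2 * b5 * (b3 * b6)) / b4 by ring.
have mono (p q : R) : 0 <= p -> p <= q -> p `^ kap <= q `^ kap.
  by move=> p0 pq; rewrite ge0_ler_powR ?nnegrE ?(ltW k0) // (le_trans p0).
have bmono (z z' : R) : z <= z' -> (bball (hg g) z : set (bdry_borel R)) `<=` bball (hg g) z'.
  by move=> zz [w|] /=; [move=> /bballP h; apply/bballP; exact: lt_le_trans zz|case].
have P1 : expR period <= 1 by rewrite -expR0 ler_expR ltW // period_lt0.
have P2 : 1 <= expR (- period) by rewrite -expR0 ler_expR oppr_ge0 ltW // period_lt0.
have B1 : 1 <= expR B.
  by apply: le_trans (expR_ge1Dx B); rewrite lerDl.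
have B2 : expR (- B) <= 1 by rewrite expRN invf_le1.
(* Radii above S are comparable with S, because y <= C0 d and d <= 2 L S: one shadow at g gives both
   bounds. *)
have [yS|Sy] := leP y S; last first.
  have X1 : 1 <= M * (y / d) `^ kap.
    have yd0 : 0 <= y / d by rewrite divr_ge0 // ltW.
    have L20 : 0 <= 2 * L by rewrite mulr_ge0 // (le_trans ler01 L1).
    rewrite /M -(powRM _ L20 yd0).
    have p1 : (1 : R) `^ kap = 1 by rewrite powR1.
    rewrite -[leLHS]p1; apply: mono => //; rewrite mulrA ler_pdivlMr // mul1r.
    by apply: (le_trans dS); apply: ler_wpM2l (ltW Sy).
  have X2 : (y / d) `^ kap <= C0 `^ kap.
    by apply: mono; rewrite ?divr_ge0 ?ler_pdivrMr // ltW.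
  split.
    apply: (@le_trans _ _ (C1 * expR (I g))).
      apply: (hC1 g) => //.
      move=> xi [_]; apply: bmono; apply: (le_trans yd).
      by rewrite -mulrA; apply: ler_wpM2l => //; exact: le_trans ler01 C01.
    rewrite /C sh4.
    apply: ler_peMr; first by rewrite mulr_ge0 ?expR_ge0 // ltW.
    by apply: (mulr_ege1 (mulr_ege1 B1 P2) X1).
  apply: (@le_trans _ _ (c1 * expR (I g))); last first.
    apply: (le_trans (hc1 g Gg q1 g0r)); apply: rm_le => // xi [Nx bx]; split => //.
    by apply: bmono bx; exact: ltW.
  rewrite /c' sh1; apply: ler_piMr; first by rewrite mulr_ge0 ?expR_ge0 // ltW.
  have q3 : expR (- B) * expR period <= 1 by apply: mulr_ile1; rewrite ?expR_ge0.
  have q4 : (y / d) `^ kap / C0 `^ kap <= 1 by rewrite ler_pdivrMr // mul1r.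
  by apply: mulr_ile1 => //; rewrite ?divr_ge0 ?powR_ge0 // mulr_ge0 ?expR_ge0.
(* Smaller radii are compared with the scales of g gam^k: k = n for the upper bound, k = n + 1 for
   the lower bound, at the cost of one period. *)
have [n [n1 n2]] : exists n : nat, S * expR (- (n.+1%:R * ell)) < y /\ y <= S * expR (- (n%:R * ell)).
  have Sy0 : 0 < S / y by rewrite divr_gt0.
  have lS : 0 <= ln (S / y) / ell by rewrite divr_ge0 ?(ltW l0) // ln_ge0 // ler_pdivlMr // mul1r.
  have t1 : ln (S / y) / ell < (Num.truncn (ln (S / y) / ell)).+1%:R by exact: truncnS_gt.
  have t2 : (Num.truncn (ln (S / y) / ell))%:R <= ln (S / y) / ell by rewrite truncn_le.
  exists (Num.truncn (ln (S / y) / ell)); move: (Num.truncn _) t1 t2 => n.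
  rewrite ltr_pdivrMr // ler_pdivlMr // => t1 t2.
  have {}t1 : S / y < expR (n.+1%:R * ell) by rewrite -[ltLHS](lnK Sy0) ltr_expR.
  have {}t2 : expR (n%:R * ell) <= S / y by rewrite -[leRHS](lnK Sy0) ler_expR.
  rewrite !expRN ltr_pdivrMr ?expR_gt0 // ler_pdivlMr ?expR_gt0 //.
  by move: t1 t2; rewrite ltr_pdivrMr // ler_pdivlMr // mulrC (mulrC _ y) => -> ->.
have [Gn en _ jn jn'] := mul_gpow G1 GM Ggam Ju Ju' fu fu' n Gg.
have [Gm em _ jm jm'] := mul_gpow G1 GM Ggam Ju Ju' fu fu' n.+1 Gg.
have qq k : j' g * j' gam ^+ k <= j g * j gam ^+ k.
  have jk : 1 <= j gam ^+ k by apply: exprn_ege1; exact: ltW.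
  apply: ler_pM; rewrite ?exprn_ge0 ?normc_ge0' //; apply: le_trans jk.
  apply: exprn_ile1; first exact: normc_ge0'.
  by rewrite (j'_gam jj j1) invf_le1 ?(ltW j1) // (lt_trans ltr01).
have sn := scale_gpow G1 GM Ggam Ju Ju' fu fu' j1 n Gg; rewrite -/S in sn.
have sm := scale_gpow G1 GM Ggam Ju Ju' fu fu' j1 n.+1 Gg; rewrite -/S in sm.
have yS0 : 0 <= y / S by rewrite divr_ge0 // ltW.
have nP : expR (n%:R * period) = expR (- period) * expR (n.+1%:R * period).
  by rewrite -expRD -natr1 mulrDl mul1r addrCA addNr addr0.
have C1L : 1 <= C0 * (2 * L).
  by apply: mulr_ege1 => //; rewrite (le_trans L1) // ler_peMl ?ler1n // (le_trans ler01 L1).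
split.
  apply: (@le_trans _ _ (C1 * expR (I (g * gam ^+ n)%g))).
    apply: (hC1 (g * gam ^+ n)%g) => //; rewrite ?jn ?jn' ?en //.
    move=> xi [_]; apply: bmono; rewrite sn; apply: (le_trans n2); apply: ler_peMl => //.
    by rewrite mulr_ge0 ?expR_ge0 // ltW.
  have := hB g n Gg q1 g0r kg; rewrite ler_norml => /andP[_ h].
  have h1 : expR (I (g * gam ^+ n)%g) <= expR B * expR (I g) * expR (n%:R * period).
    by rewrite -!expRD ler_expR addrAC -!lerBlDr.
  have h2 : expR (n.+1%:R * period) <= M * (y / d) `^ kap.
    have yd0 : 0 <= y / d by rewrite divr_ge0 // ltW.
    have L20 : 0 <= 2 * L by rewrite mulr_ge0 // (le_trans ler01 L1).
    rewrite expR_period /M -(powRM _ L20 yd0); apply: mono; first exact: expR_ge0.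
    apply: (@le_trans _ _ (y / S)); first by rewrite ler_pdivlMr // mulrC ltW.
    rewrite mulrCA; apply: ler_wpM2l; first exact: ltW.
    by rewrite ler_pdivlMr // mulrC ler_pdivrMr.
  rewrite /C sh3.
  rewrite ler_pM2l //; apply: (le_trans h1); rewrite nP.
  apply: ler_wpM2l; first by rewrite mulr_ge0 ?expR_ge0.
  by apply: ler_wpM2l; [exact: expR_ge0|].
apply: (@le_trans _ _ (c1 * expR (I (g * gam ^+ n.+1)%g))); last first.
  have := hc1 (g * gam ^+ n.+1)%g Gm; rewrite jm jm' em sm => /(_ (qq _) g0r) /le_trans; apply.
  by apply: rm_le => // xi [Nx bx]; split => //; apply: bmono bx; exact: ltW.
have := hB g n.+1 Gg q1 g0r kg; rewrite ler_norml => /andP[h _].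
have h1 : expR (- B) * expR (I g) * expR (n.+1%:R * period) <= expR (I (g * gam ^+ n.+1)%g).
  by rewrite -!expRD ler_expR addrAC -!lerBrDr.
have h2 : expR period * (y / d) `^ kap <= expR (n.+1%:R * period).
  rewrite -natr1 mulrDl mul1r expRD mulrC; apply: ler_wpM2r; first exact: expR_ge0.
  rewrite expR_period; apply: mono; first by rewrite divr_ge0 // ltW.
  apply: (@le_trans _ _ (y / S)); last by rewrite ler_pdivrMr // mulrC.
  by apply: ler_wpM2l; [exact: ltW|rewrite lef_pV2 ?posrE].
rewrite /c' sh2.
have C1k : 1 <= C0 `^ kap.
  have p1 : (1 : R) `^ kap = 1 by rewrite powR1.
  by rewrite -[leLHS]p1; exact: mono.
rewrite ler_pdivrMr //; apply: (@le_trans _ _ (c1 * expR (I (g * gam ^+ n.+1)%g))); last first.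
  by apply: ler_peMr => //; rewrite mulr_ge0 ?expR_ge0 // ltW.
rewrite ler_pM2l //; apply: le_trans h1.
by apply: ler_wpM2l => //; rewrite mulr_ge0 ?expR_ge0.
Qed.

End Shadows.

(** * Slowly varying functions; the integral compared with a series *)

Section SlowVariation.
Context {R : realType}.
Variable phi : R -> R.
Hypothesis hslow : slowly_varying (fun t => phi (expR t)).

Local Notation f := (fun t => phi (expR t)).
Local Notation leb := (@lebesgue_measure R).

Lemma slow_gt0 t : 0 <= t -> 0 < phi (expR t).
Proof. by case: hslow => h _ _; exact: h. Qed.

(** A distance at most n B is covered by n steps of length at most B, so A^n works. *)
Lemma slow_scale (L : R) : 0 <= L -> exists2 A, 1 <= A & forall x y, 0 <= x -> 0 <= y ->
  `|x - y| <= L -> f y <= A * f x.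
Proof.
move=> L0; case: hslow => _ _ [A [B [B0 A1 hA]]].
have step n : forall x y, 0 <= x -> 0 <= y -> `|x - y| <= n%:R * B -> f y <= A ^+ n * f x.
  elim: n => [|n IH] x y x0 y0.
    by rewrite mul0r normr_le0 subr_eq0 => /eqP ->; rewrite expr0 mul1r.
  move=> h; pose z := x + (y - x) * (n%:R / n.+1%:R).
  have n0 : 0 < n.+1%:R :> R by [].
  have q0 : 0 <= n%:R / n.+1%:R :> R by rewrite divr_ge0.
  have q1 : n%:R / n.+1%:R <= 1 :> R by rewrite ler_pdivrMr // mul1r ler_nat.
  have z0 : 0 <= z.
    have -> : z = x * (1 - n%:R / n.+1%:R) + y * (n%:R / n.+1%:R) by rewrite /z; ring.
    by rewrite addr_ge0 // mulr_ge0 // subr_ge0.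
  have xz : `|x - z| <= n%:R * B.
    have -> : x - z = (x - y) * (n%:R / n.+1%:R) by rewrite /z; ring.
    rewrite normrM (ger0_norm q0) mulrA ler_pdivrMr //.
    rewrite [leRHS](_ : _ = (n.+1%:R * B) * n%:R); last by ring.
    by apply: ler_wpM2r.
  have zy : `|z - y| <= B.
    have -> : z - y = (x - y) / n.+1%:R.
      rewrite /z -natr1; field; rewrite natr1; exact: lt0r_neq0.
    rewrite normrM normfV (ger0_norm (ltW n0)) ler_pdivrMr //.
    by rewrite [leRHS]mulrC.
  rewrite exprS -mulrA; apply: le_trans (hA _ _ z0 y0 zy) _.
  by rewrite ler_pM2l ?(lt_le_trans ltr01) // IH.
have [n hn] : exists n : nat, L <= n%:R * B.
  exists (Num.Def.archi_bound (L / B)).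
  by rewrite -ler_pdivrMr // ltW // archi_boundP // divr_ge0 // ltW.
exists (A ^+ n); first exact: exprn_ege1.
by move=> x y x0 y0 xy; apply: step => //; exact: le_trans hn.
Qed.

Variables (k : R) (L : nat).
Hypotheses (k0 : 0 <= k) (L0 : (0 < L)%N).

(** On each such interval dt / t has mass L, so the integral over it is comparable with one term.
    The step L is 1 for convergence and large for divergence, where it separates the levels. *)
Let I n : set R := `[expR (n * L)%:R, expR (n.+1 * L)%:R[%classic.
Let g t := phi t `^ k / t.
Local Notation term n := (f (n * L)%:R `^ k).

Let g_ge0 t : 0 < t -> 0 <= g t.
Proof. by move=> t0; rewrite /g divr_ge0 ?powR_ge0 // ltW. Qed.

Let I_gt0 n t : I n t -> 0 < t.
Proof. by rewrite /I /= in_itv /= => /andP[h _]; exact: lt_le_trans (expR_gt0 _) h. Qed.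

Let bigcup_I : \bigcup_n I n = (`[1%R, +oo[ : set R)%classic.
Proof.
have L1 : 0 < L%:R :> R by rewrite ltr0n.
apply/seteqP; split=> t.
  case=> n _; rewrite /I /= !in_itv /= andbT => /andP[h _]; apply: le_trans h.
  by rewrite -(expR0 R) ler_expR.
rewrite /= in_itv /= andbT => t1; have t0 : 0 < t by exact: lt_le_trans t1.
exists (Num.truncn (ln t / L%:R)) => //; rewrite /I /= in_itv /=.
have l0 : 0 <= ln t / L%:R by rewrite divr_ge0 // ?ln_ge0 // ltW.
have /andP[h1 h2] := truncn_itv l0.
apply/andP; split.
  by rewrite -[leRHS](lnK t0) ler_expR natrM -ler_pdivlMr.
by rewrite -[ltLHS](lnK t0) ltr_expR natrM -ltr_pdivrMr.
Qed.

Let trivIset_I : trivIset setT I.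
Proof.
apply/trivIsetP => i j _ _; wlog ij : i j / (i < j)%N.
  move=> h; rewrite neq_ltn => /orP[ij|ij]; first by apply: h => //; rewrite neq_ltn ij.
  by rewrite setIC; apply: h => //; rewrite neq_ltn ij.
move=> _; apply/seteqP; split=> // t []; rewrite /I /= !in_itv /= => /andP[_ h1] /andP[h2 _].
have := le_lt_trans h2 h1; rewrite ltr_expR ltr_nat ltn_pmul2r // ltnS leqNgt ij //.
Qed.

Let measurable_g : measurable_fun (\bigcup_n I n) g.
Proof.
rewrite bigcup_I.
(* Measurability is given for phi composed with exp only, so the integrand is rewritten through ln
   t. *)
apply: (@eq_measurable_fun _ _ _ _ _ (fun t => (f (ln t)) `^ k * expR (- ln t))).
  move=> t /set_mem; rewrite /= in_itv /= andbT => t1; have t0 : 0 < t by exact: lt_le_trans t1.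
  by rewrite expRN lnK.
apply: measurable_funM; last first.
  apply: (measurableT_comp (@measurable_expR R)); apply: measurable_funN.
  exact: measurable_funS (@measurable_ln R).
apply: (measurableT_comp (@measurable_powR R k)).
have [_ mf _] := hslow.
apply: (measurable_comp _ _ mf); first exact: measurable_itv.
  move=> _ [t /= + <-]; rewrite /= !in_itv /= !andbT; exact: ln_ge0.
exact: measurable_funS (@measurable_ln R).
Qed.

Let J : \bar R := (\int[leb]_(t in (`[1%R, +oo[ : set R)) (g t)%:E)%E.

Let J_sum : J = (\sum_(0 <= i <oo) \int[leb]_(t in I i) (g t)%:E)%E.
Proof.
rewrite /J -bigcup_I; apply: ge0_integral_bigcup => //.
- by move=> n; exact: measurable_itv.
- exact/measurable_EFinP.
by move=> t [n _ /I_gt0 t0]; rewrite lee_fin g_ge0.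
Qed.

Let leb_I n : leb (I n) = (expR (n.+1 * L)%:R - expR (n * L)%:R)%:E.
Proof.
rewrite /I lebesgue_measure_itv /= lte_fin ltr_expR ltr_nat ltn_pmul2r // ltnSn.
by rewrite -EFinB.
Qed.

Let expL n : expR (n.+1 * L)%:R = expR L%:R * expR (n * L)%:R :> R.
Proof. by rewrite mulSn natrD expRD. Qed.

Let g_bounds : exists2 A : R, 1 <= A & forall n t, I n t ->
  term n / A / expR (n.+1 * L)%:R <= g t <= A * term n / expR (n * L)%:R.
Proof.
have [A A1 hA] := slow_scale (ler0n R L).
have A0 : 0 < A by exact: lt_le_trans A1.
exists (A `^ k); first by rewrite -(powRr0 A) ler_powR.
move=> n t It; have t0 := I_gt0 It.
move: It; rewrite /I /= in_itv /= => /andP[h1 h2].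
have t1 : 0 <= ln t by rewrite ln_ge0 // (le_trans _ h1) // -(expR0 R) ler_expR.
have n0 : 0 <= (n * L)%:R :> R by [].
have d1 : (n * L)%:R <= ln t by rewrite -ler_expR lnK.
have d2 : ln t <= (n * L)%:R + L%:R.
  by rewrite -natrD addnC -mulSn -ler_expR lnK // ltW.
have d3 : `|(n * L)%:R - ln t| <= L%:R by rewrite ler_norml; apply/andP; split; lra.
have d4 : `|ln t - (n * L)%:R| <= L%:R by rewrite distrC.
have := hA _ _ n0 t1 d3; have := hA _ _ t1 n0 d4; rewrite lnK // => b1 b2.
have p0 : 0 < phi t by have := slow_gt0 t1; rewrite lnK.
have q0 := slow_gt0 n0.
apply/andP; split.
  apply: ler_pM; rewrite ?divr_ge0 ?invr_ge0 ?powR_ge0 ?expR_ge0 //.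
    rewrite ler_pdivrMr ?powR_gt0 // mulrC -powRM ?(ltW p0) ?(ltW A0) //.
    by rewrite ge0_ler_powR // nnegrE ?mulr_ge0 ?ltW.
  by rewrite lef_pV2 ?posrE ?expR_gt0 // ltW.
apply: ler_pM; rewrite ?invr_ge0 ?powR_ge0 ?(ltW t0) //.
  rewrite -powRM ?(ltW q0) ?(ltW A0) //.
  by rewrite ge0_ler_powR // nnegrE ?mulr_ge0 ?ltW.
by rewrite lef_pV2 ?posrE ?expR_gt0.
Qed.

Let integral_I : exists2 A : R, 0 < A & forall n,
  ((term n / A)%:E <= \int[leb]_(t in I n) (g t)%:E <= (A * term n)%:E)%E.
Proof.
have [A A1 hA] := g_bounds.
have A0 : 0 < A by exact: lt_le_trans A1.
have e1 : 1 < expR L%:R :> R by rewrite expR_gt1 ltr0n.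
set e : R := expR L%:R in e1 *.
have e0 : 0 < e - 1 by rewrite subr_gt0.
have p1 : 0 < A * e by rewrite mulr_gt0 // (lt_trans ltr01).
have p2 : 0 < A * e / (e - 1) by rewrite divr_gt0.
exists (A * e / (e - 1) + A * e); first exact: addr_gt0.
move=> n; set x := term n; set y : R := expR (n * L)%:R.
have x0 : 0 <= x := powR_ge0 _ _.
have y0 : 0 < y := expR_gt0 _.
have ny : (leb (I n)) = (e * y - y)%:E by rewrite leb_I expL.
have g0 t : I n t -> (0 <= (g t)%:E)%E by move=> /I_gt0 t0; rewrite lee_fin g_ge0.
have bnd t : I n t -> x / A / (e * y) <= g t <= A * x / y.
  by move=> It; have := hA n t It; rewrite expL.
have ic (b : \bar R) : (\int[leb]_(t in I n) cst b t = b * leb (I n))%E by apply: integral_cst; exact: measurable_itv.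
apply/andP; split.
  apply: (@le_trans _ _ (\int[leb]_(t in I n) (cst (x / A / (e * y))%:E) t)%E); last first.
    apply: ge0_integral_mono => // t It.
      by rewrite lee_fin divr_ge0 ?divr_ge0 ?mulr_ge0 ?(ltW A0) ?(ltW y0) // ltW // (lt_trans ltr01).
    by rewrite lee_fin; have /andP[] := bnd t It.
  rewrite ic ny -EFinM lee_fin.
  rewrite [leRHS](_ : _ = x / (A * e / (e - 1))).
    by apply: ler_wpM2l => //; rewrite lef_pV2 ?posrE ?addr_gt0 // lerDl ltW.
  by field; rewrite ?lt0r_neq0 // (lt_trans ltr01).
apply: (@le_trans _ _ (\int[leb]_(t in I n) (cst (A * x / y)%:E) t)%E).
  apply: ge0_integral_mono => // t It.
    by rewrite lee_fin divr_ge0 ?mulr_ge0 ?(ltW A0) ?(ltW y0).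
  by rewrite lee_fin; have /andP[] := bnd t It.
rewrite ic ny -EFinM lee_fin.
rewrite [leLHS](_ : _ = A * (e - 1) * x).
  apply: ler_wpM2r => //; apply: (@le_trans _ _ (A * e)); last by rewrite lerDr ltW.
  by rewrite ler_pM2l // lerBlDr lerDl.
by field; rewrite lt0r_neq0.
Qed.

Lemma series_bounded : (J < +oo)%E -> exists M : R, forall q, \sum_(0 <= i < q) term i <= M.
Proof.
have [A A0 hA] := integral_I => h.
exists (A * fine J) => q.
have J0 : (0 <= J)%E by apply: integral_ge0 => t; rewrite /= in_itv /= andbT => t1; rewrite lee_fin g_ge0 // (lt_le_trans _ t1).
rewrite -ler_pdivrMl // mulrC -lee_fin fineK ?ge0_fin_numE //.
rewrite mulr_suml -sumEFin J_sum; apply: le_trans; last first.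
  apply: (nneseries_lim_ge q) => n _ _; apply: integral_ge0 => t /I_gt0 t0.
  by rewrite lee_fin g_ge0.
by apply: lee_sum => i _; have /andP[] := hA i.
Qed.

Lemma integral_bounded (M : R) : (forall q, \sum_(0 <= i < q) term i <= M) -> (J < +oo)%E.
Proof.
have [A A0 hA] := integral_I => h.
rewrite J_sum; apply: (@le_lt_trans _ _ (A * M)%:E); last exact: ltry.
apply: lime_le.
  apply: is_cvg_nneseries => n _ _; apply: integral_ge0 => t /I_gt0 t0.
  by rewrite lee_fin g_ge0.
apply: nearW => q; apply: (@le_trans _ _ (\sum_(0 <= i < q) (A * term i)%:E)%E).
  by apply: lee_sum => i _; have /andP[] := hA i.
by rewrite sumEFin lee_fin -mulr_sumr ler_pM2l.
Qed.

End SlowVariation.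

(** * Exponential growth rates as upper limits *)

Section GrowthRates.
Context {R : realType}.

(** The lower bound is asked for arbitrarily large n only, because an annulus need not contain an
    element of the cyclic group. *)
Lemma limn_esup_rate (u : nat -> \bar R) (l C : R) : 0 <= C ->
  (forall n, (0 < n)%N -> (u n <= (l + C / n%:R)%:E)%E) ->
  (forall p, exists2 n, (p < n)%N & ((l - C / n%:R)%:E <= u n)%E) -> limn_esup u = l%:E.
Proof.
move=> C0 up lo.
have small (e : R) : 0 < e -> exists p : nat, forall n, (p < n)%N -> C / n%:R <= e.
  move=> e0; exists (Num.Def.archi_bound (C / e)) => n pn.
  have n0 : 0 < n%:R :> R by rewrite ltr0n (leq_ltn_trans _ pn).
  rewrite ler_pdivrMr // mulrC -ler_pdivrMr //.
  apply: ltW; apply: (lt_trans (archi_boundP _)); first by rewrite divr_ge0 // ltW.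
  by rewrite ltr_nat.
apply/eqP; rewrite eq_le; apply/andP; split.
  apply/lee_addgt0Pr => e e0; have [p hp] := small e e0.
  apply: (@le_trans _ _ (ereal_sup (u @` [set n | (p < n)%N]))).
    by apply: ereal_inf_lbound; exists [set n | (p < n)%N] => //; exists p.+1.
  apply: ge_ereal_sup => _ [n /= pn <-].
  apply: le_trans (up n _) _; first exact: leq_ltn_trans pn.
  by rewrite -EFinD lee_fin lerD2l hp.
apply: le_ereal_inf_tmp => _ [V [p _ pV] <-].
apply/lee_subgt0Pr => e e0; have [q hq] := small e e0.
have [n pn h] := lo (p + q)%N.
apply: (@le_trans _ _ (u n)).
  apply: le_trans h; rewrite -EFinB lee_fin lerD2l lerN2 hq //.
  by rewrite (leq_ltn_trans _ pn) // leq_addl.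
apply: ereal_sup_ubound; exists n => //; apply: pV => /=.
by apply: ltnW; rewrite (leq_ltn_trans _ pn) // leq_addr.
Qed.

Lemma growth_rate_ext (S T : nat -> \bar R) : S =1 T ->
  limn_esup (fun n => ((n%:R^-1)%:E * lne (S n))%E) = limn_esup (fun n => ((n%:R^-1)%:E * lne (T n))%E).
Proof. by move=> /funext ->. Qed.

Lemma lne_le_rate (S : \bar R) (n : nat) (l C : R) : (0 < n)%N -> (0 <= S)%E ->
  (S <= (expR (l * n%:R + C))%:E)%E -> ((n%:R^-1)%:E * lne S <= (l + C / n%:R)%:E)%E.
Proof.
move=> n0 S0 h; have n0' : 0 < n%:R :> R by rewrite ltr0n.
have -> : (l + C / n%:R)%:E = ((n%:R^-1)%:E * lne (expR (l * n%:R + C))%:E)%E.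
  rewrite lne_EFin ?expR_gt0 // expRK -EFinM; congr EFin; field; exact: lt0r_neq0.
rewrite lee_pmul2l // ?lte_fin ?invr_gt0 //.
by rewrite lee_lne // in_itv /= ?S0 ?leey // lee_fin expR_ge0.
Qed.

Lemma lne_ge_rate (S : \bar R) (n : nat) (l C : R) : (0 < n)%N ->
  ((expR (l * n%:R - C))%:E <= S)%E -> ((l - C / n%:R)%:E <= (n%:R^-1)%:E * lne S)%E.
Proof.
move=> n0 h; have n0' : 0 < n%:R :> R by rewrite ltr0n.
have e0 : (0 <= (expR (l * n%:R - C))%:E)%E by rewrite lee_fin expR_ge0.
have -> : (l - C / n%:R)%:E = ((n%:R^-1)%:E * lne (expR (l * n%:R - C))%:E)%E.
  rewrite lne_EFin ?expR_gt0 // expRK -EFinM; congr EFin; field; exact: lt0r_neq0.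
rewrite lee_pmul2l // ?lte_fin ?invr_gt0 //.
by rewrite lee_lne // in_itv /= ?e0 ?(le_trans e0 h) ?leey.
Qed.

Lemma esum_le_size (T : choiceType) (S : set T) (s : seq T) (f : T -> R) (B : R) : 0 <= B ->
  (forall i, S i -> i \in s) -> (forall i, S i -> f i <= B) ->
  (\esum_(i in S) (f i)%:E <= ((size s)%:R * B)%:E)%E.
Proof.
move=> B0 Ss fB; apply: ge_ereal_sup => _ [X [/finite_seqP[t Xt] XS] <-].
have -> : X = [set` undup t] by apply/seteqP; split=> i; rewrite Xt /= mem_undup.
have hX i : i \in undup t -> S i by rewrite mem_undup => it; apply: XS; rewrite Xt.
rewrite -fsbig_seq ?undup_uniq // sumEFin lee_fin.
apply: (@le_trans _ _ (\sum_(i <- undup t) B)).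
  by rewrite big_seq [leRHS]big_seq; apply: ler_sum => i /hX /fB.
rewrite big_const_seq count_predT iter_addr_0 -[leLHS]mulr_natl; apply: ler_wpM2r; rewrite ?ler_nat //.
by apply: uniq_leq_size; [exact: undup_uniq|move=> i /hX /Ss].
Qed.

Lemma esum_ge_term (T : choiceType) (S : set T) (f : T -> \bar R) i : S i -> (forall j, (0 <= f j)%E) ->
  (f i <= \esum_(j in S) f j)%E.
Proof.
move=> Si f0; apply: esum_ge; exists [set i]; last by rewrite fsbig_set1.
by split => //; move=> _ ->.
Qed.

Lemma norm_chain (b1 b2 b3 K D : R) : `|b1 - b2| <= K -> `|b2 - b3| <= K -> 0 <= D ->
  `|b1 - b3| <= 2 * K + 2 * D.
Proof. by rewrite !ler_norml => /andP[? ?] /andP[? ?] ?; apply/andP; split; lra. Qed.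

Lemma upper_arith (J d ml k kap delta n B : R) : 0 <= B -> 0 <= ml -> kap <= k -> `|J + ml * k| <= B ->
  `|d - ml| <= B -> n - 1 < d <= n ->
  J + delta * d <= (delta - kap) * n + (`|kap| + `|delta| + 1) * (B + 1).
Proof.
rewrite !ler_norml => B0 m0 kk /andP[_ h1] /andP[h2 h3] /andP[h4 h5].
have e1 : ml * kap <= ml * k by exact: ler_wpM2l.
have e2 : kap * (n - ml) <= `|kap| * (B + 1).
  apply: le_trans (ler_norm _) _; rewrite normrM; apply: ler_wpM2l => //.
  by rewrite ler_norml; apply/andP; split; lra.
have e3 : delta * (d - n) <= `|delta| * (B + 1).
  apply: le_trans (ler_norm _) _; rewrite normrM; apply: ler_wpM2l => //.
  by rewrite ler_norml; apply/andP; split; lra.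
lra.
Qed.

Lemma lower_arith (J d ml kap delta n B : R) : 0 <= B -> `|J + ml * kap| <= B ->
  `|d - ml| <= B -> n - 1 < d <= n ->
  (delta - kap) * n - (`|kap| + `|delta| + 1) * (B + 1) <= J + delta * d.
Proof.
rewrite !ler_norml => B0 /andP[h1 _] /andP[h2 h3] /andP[h4 h5].
have e2 : kap * (ml - n) <= `|kap| * (B + 1).
  apply: le_trans (ler_norm _) _; rewrite normrM; apply: ler_wpM2l => //.
  by rewrite ler_norml; apply/andP; split; lra.
have e3 : delta * (n - d) <= `|delta| * (B + 1).
  apply: le_trans (ler_norm _) _; rewrite normrM; apply: ler_wpM2l => //.
  by rewrite ler_norml; apply/andP; split; lra.
lra.
Qed.

End GrowthRates.

(** * Critical exponents: reversal of the potential, powers of one element *)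

Section CriticalExponents.
Context {R : realType}.
Variables (Kh : set R[i]) (cK : closed_subfield Kh).
Variables (Gam : set (PSL2 R)) (x0 : hpoint R).
Hypotheses (GK : forall g, Gam g -> matK Kh g) (GV : forall g, Gam g -> Gam g^-1%g).
Hypotheses (G1 : Gam 1%g) (GM : forall g h, Gam g -> Gam h -> Gam (g * h)%g).
Hypothesis ux0 : upper Kh x0.
Variables (F : vect R -> R) (a c : R).
Hypotheses (hF : holder_with Kh F a c) (iF : invariant_under Kh Gam F).
Implicit Types (g h : PSL2 R).

Let x00 : 0 < x0.2. Proof. by case: ux0. Qed.
Let rK := closed_subfield_real cK.
Let K0 := closed_subfield0 cK.
Let ugx g p : Gam g -> upper Kh p -> upper Kh (hact g p) := fun Gg up => upper_hact cK (GK Gg) up.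

(** The sum is reindexed by inversion: the reversed segment from x0 to g x0, translated by g^-1, is
    the segment from x0 to g^-1 x0. *)
Lemma critical_exponent_flip :
  critical_exponent Gam (F \o @flip R) x0 x0 = critical_exponent Gam F x0 x0.
Proof.
have hF' := holder_with_flip cK hF; have iF' := invariant_flip cK iF.
have inv (n : nat) g : Gam g /\ (n%:R - 1 < hdist x0 (hact g x0) <= n%:R)%R ->
    Gam g^-1%g /\ (n%:R - 1 < hdist x0 (hact g^-1%g x0) <= n%:R)%R.
  move=> [Gg h]; split; first exact: GV.
  have -> : hdist x0 (hact g^-1%g x0) = hdist x0 (hact g x0).
    by rewrite hdist_sym -(hdist_hact g) ?hact_gt0 // hactVK.
  by [].
apply: growth_rate_ext => n.
rewrite (@reindex_esum R _ _ [set g | Gam g /\ (n%:R - 1 < hdist x0 (hact g x0) <= n%:R)%R] _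
  (fun g => g^-1%g)).
  apply: eq_esum => g [Gg _]; congr ((expR _)%:E).
  rewrite [RHS](segment_rev cK ux0 (ugx Gg ux0)); last by move=> v Tv; exact: (continuous_flow cK hF Tv).
  rewrite -[X in _ = segment_int _ _ X](hactVK g x00) (segment_hact cK) //; [exact: GK|apply: ugx => //; exact: GV|].
  by move=> v Tv; exact: iF'.
split => //; first by move=> g; exact: inv.
- by move=> g h _ _ /(congr1 (fun x => x^-1%g)); rewrite !invgK.
- move=> g hg; exists g^-1%g; first exact: inv.
  by rewrite invgK.
Qed.

Lemma segment_intB (k : R) p q : upper Kh p -> upper Kh q ->
  segment_int (fun w => F w - k) p q = segment_int F p q - k * hdist p q.
Proof.
move=> up uq; have p0 : 0 < p.2 by case: up.
have q0 : 0 < q.2 by case: uq.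
have [v [Tv ev fv]] := exists_vect_to rK K0 up uq.
have s0 := hdist_ge0 p0 q0; set s := hdist p q in fv s0 *.
rewrite -ev -fv !(segment_flow _ Tv) //.
have -> : k * s = itg (fun=> k) 0 s by rewrite itg_cst // subr0.
by apply: itgB => //; [exact: (continuous_flow cK hF Tv)|exact: continuous_cst'].
Qed.

Variables (u u' : R[i]) (gam : PSL2 R).
Hypotheses (Ku : Kh u) (Ku' : Kh u') (uu' : u != u') (Ggam : Gam gam).
Hypotheses (Ju : forall g, Gam g -> jac g u != 0) (Ju' : forall g, Gam g -> jac g u' != 0).
Hypotheses (fu : homography gam u = u) (fu' : homography gam u' = u').
Hypotheses (jj : normc (jac gam u) * normc (jac gam u') = 1) (j1 : 1 < normc (jac gam u)).

Local Notation delta := (crit_delta Gam x0 F).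
Local Notation G := (fun w => F w - delta).
Local Notation J := (segment_int G).
Local Notation x1 := (axis_top u u').

Let hG := holder_withB delta hF.
Let iG : invariant_under Kh Gam G := invariantB iF _.
Let ux1 : upper Kh x1 := upper_axis_top cK Ku Ku' uu'.
Let x10 : 0 < x1.2. Proof. by case: ux1. Qed.

Lemma power_growth : exists2 B : R, 0 <= B & forall n,
  `|J x0 (hact (gam ^+ n)%g x0) - n%:R * J x1 (hact gam x1)| <= B /\
  `|hdist x0 (hact (gam ^+ n)%g x0) - n%:R * tlen u gam| <= B.
Proof.
pose D := hdist x0 x1; have D0 : 0 <= D by exact: hdist_ge0.
have [K Kp hK] := track_orbit cK GK GV ux0 hG iG D0.
exists (2 * K + 2 * D) => [|n]; first by rewrite addr_ge0 // mulr_ge0.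
have [Gn _ _ _ _] := gpow G1 GM Ggam Ju Ju' fu fu' n.
set g := (gam ^+ n)%g in Gn *.
have dg : hdist (hact g x0) (hact g x1) = D by rewrite hdist_hact.
split.
  have d1 p : hdist p p <= D by rewrite hdistxx.
  have d2 : hdist (hact g x0) (hact g x1) <= D by rewrite dg.
  have d3 : hdist (hact 1%g x0) x0 <= D by rewrite hact1.
  have [h1 _] := hK g (hact g x0) (hact g x1) x0 Gn (ugx Gn ux0) (ugx Gn ux1) ux0 (d1 _) d2.
  have [_ h2] := hK 1%g x0 x1 (hact g x1) G1 ux0 ux1 (ugx Gn ux1) d3 (lexx _).
  have <- : J x1 (hact g x1) = n%:R * J x1 (hact gam x1).
    exact: (axis_sum cK x0 GK G1 GM hF iF Ku Ku' uu' Ggam Ju Ju' fu fu' jj j1).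
  exact: norm_chain h1 h2 D0.
have e : hdist x1 (hact g x1) = n%:R * tlen u gam.
  rewrite /g (gpow_top G1 GM uu' Ggam Ju Ju' fu fu' jj j1).
  by rewrite (hdist_foot_flow _ (T1_axis cK Ku Ku' uu')) ger0_norm // mulr_ge0 // ltW // tlen_gt0.
have g00 := hact_gt0 g x00; have g10 := hact_gt0 g x10.
have t1 := hdist_triangle x00 x10 g00; have t2 := hdist_triangle x10 g10 g00.
have t3 := hdist_triangle x10 x00 g10; have t4 := hdist_triangle x00 g00 g10.
rewrite -e; move: t1 t2 t3 t4; rewrite (hdist_sym x1 x0) (hdist_sym (hact g x1)) dg -/D.
move=> t1 t2 t3 t4; rewrite ler_norml; apply/andP; split; lra.
Qed.

End CriticalExponents.

(** * The critical exponent of a cyclic loxodromic group *)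

Section CyclicCriticalExponent.
Context {R : realType}.
Variables (Kh : set R[i]) (cK : closed_subfield Kh).
Variables (Gam : set (PSL2 R)) (x0 : hpoint R).
Hypotheses (GK : forall g, Gam g -> matK Kh g) (GV : forall g, Gam g -> Gam g^-1%g).
Hypotheses (G1 : Gam 1%g) (GM : forall g h, Gam g -> Gam h -> Gam (g * h)%g).
Hypothesis ux0 : upper Kh x0.
Variables (F : vect R -> R) (a c : R).
Hypotheses (hF : holder_with Kh F a c) (iF : invariant_under Kh Gam F).
Implicit Types (g h : PSL2 R).

Let x00 : 0 < x0.2. Proof. by case: ux0. Qed.
Let rK := closed_subfield_real cK.
Let K0 := closed_subfield0 cK.
Let ugx g p : Gam g -> upper Kh p -> upper Kh (hact g p) := fun Gg up => upper_hact cK (GK Gg) up.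

Variables (u u' : R[i]) (gam : PSL2 R).
Hypotheses (Ku : Kh u) (Ku' : Kh u') (uu' : u != u') (Ggam : Gam gam).
Hypotheses (Ju : forall g, Gam g -> jac g u != 0) (Ju' : forall g, Gam g -> jac g u' != 0).
Hypotheses (fu : homography gam u = u) (fu' : homography gam u' = u').
Hypotheses (jj : normc (jac gam u) * normc (jac gam u') = 1) (j1 : 1 < normc (jac gam u)).

Local Notation delta := (crit_delta Gam x0 F).
Local Notation G := (fun w => F w - delta).
Local Notation J := (segment_int G).
Local Notation x1 := (axis_top u u').

Lemma inverse_axis : [/\ homography gam^-1%g u' = u', homography gam^-1%g u = u,
  normc (jac gam^-1%g u') * normc (jac gam^-1%g u) = 1 & normc (jac gam^-1%g u') = normc (jac gam u)].
Proof.
have inv w : jac gam w != 0 -> homography gam w = w ->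
   homography gam^-1%g w = w /\ normc (jac gam^-1%g w) * normc (jac gam w) = 1.
  move=> jw fw; have bw : bact gam (Some w) = Some w by apply/bact_some.
  have /bact_some[_ ->] : bact gam^-1%g (Some w) = Some w by rewrite -{1}bw bactK.
  split => //; rewrite -{1}fw -normc_jacM // mulVg /jac.
  by have [->|->] := @mat_one R; rewrite !mxE /= ?oppr0 mul0r add0r ?normcN normc1.
have [-> e1] := inv u (Ju Ggam) fu; have [-> e2] := inv u' (Ju' Ggam) fu'.
have j0 : 0 < normc (jac gam u) by rewrite normc_gt0 Ju.
have j0' : 0 < normc (jac gam u') by rewrite normc_gt0 Ju'.
have e3 : normc (jac gam^-1%g u') = normc (jac gam u).
  by apply: (mulIf (lt0r_neq0 j0')); rewrite e2 jj.
by split => //; rewrite e3 mulrC.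
Qed.

Local Notation k := (kap Gam x0 F u u' gam).
Local Notation k' := (kap Gam x0 F u' u gam^-1%g).

(** An annulus of displacement n contains boundedly many powers. Those with positive exponents
    contribute about e^((delta - k) n), those with negative exponents the same with k', and the
    larger contribution wins. *)
Lemma critical_exponent_cyclic :
  critical_exponent (cyclic_subgroup gam) F x0 x0 = (delta - Num.min k k')%:E.
Proof.
have [fv' fv jv ev] := inverse_axis.
have jv1 : 1 < normc (jac gam^-1%g u') by rewrite ev.
have [B1 B10 hB1] := power_growth cK GK GV G1 GM ux0 hF iF Ku Ku' uu' Ggam Ju Ju' fu fu' jj j1.
have [B2 B20 hB2] : exists2 B : R, 0 <= B & forall n,
    `|J x0 (hact (gam^-1 ^+ n)%g x0) - n%:R * J (axis_top u' u) (hact gam^-1%g (axis_top u' u))| <= B /\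
    `|hdist x0 (hact (gam^-1 ^+ n)%g x0) - n%:R * tlen u' gam^-1%g| <= B.
  have u'u : u' != u by rewrite eq_sym.
  exact: (power_growth cK GK GV G1 GM ux0 hF iF Ku' Ku u'u (GV Ggam) Ju' Ju fv' fv jv jv1).
pose B := B1 + B2; have B0 : 0 <= B by rewrite addr_ge0.
set ell := tlen u gam; have l0 : 0 < ell := tlen_gt0 j1.
have el' : tlen u' gam^-1%g = ell by rewrite /tlen ev.
pose pw (b : bool) n : PSL2 R := if b then (gam ^+ n)%g else (gam ^- n)%g.
pose kk (b : bool) := if b then k else k'.
pose d g := hdist x0 (hact g x0).
have pwG b n : Gam (pw b n).
  have [Gn _ _ _ _] := gpow G1 GM Ggam Ju Ju' fu fu' n.
  by case: b => //; exact: GV.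
have key b n : `|J x0 (hact (pw b n) x0) + n%:R * ell * kk b| <= B /\ `|d (pw b n) - n%:R * ell| <= B.
  have kE (P : R) : n%:R * ell * (- P / ell) = - (n%:R * P).
    by field; exact: lt0r_neq0.
  have B1B : B1 <= B by rewrite lerDl.
  have B2B : B2 <= B by rewrite lerDr.
  have k1 : k = - J x1 (hact gam x1) / ell by [].
  have k2 : k' = - J (axis_top u' u) (hact gam^-1%g (axis_top u' u)) / ell by rewrite /kap el'.
  case: b; rewrite /pw /kk ?k1 ?k2 kE /d.
    by have [h1 h2] := hB1 n; split; [exact: le_trans h1 B1B|exact: le_trans h2 B1B].
  rewrite -expVgn.
  by have [h1 h2] := hB2 n; rewrite el' in h1 h2 *; split; [exact: le_trans h1 B2B|exact: le_trans h2 B2B].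
set kap := Num.min k k'.
pose C1 := (`|kap| + `|delta| + 1) * (B + 1).
have segE g : Gam g -> segment_int F x0 (hact g x0) = J x0 (hact g x0) + delta * d g.
  by move=> Gg; rewrite (segment_intB cK hF) ?subrK //; exact: ugx.
pose S (n : nat) := [set g | cyclic_subgroup gam g /\ (n%:R - 1 < hdist x0 (hact g x0) <= n%:R)%R].
have cyc g : cyclic_subgroup gam g -> exists b n, g = pw b n.
  by move=> [n [->|->]]; [exists true, n|exists false, n].
have upper_term n b m : (n%:R - 1 < d (pw b m) <= n%:R)%R ->
    segment_int F x0 (hact (pw b m) x0) <= (delta - kap) * n%:R + C1.
  have kb : kap <= kk b by rewrite /kap /kk; case: b; rewrite ge_min lexx ?orbT.
  rewrite segE //; have [] := key b m; apply: upper_arith => //; first by rewrite mulr_ge0 // ltW.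
have lower_term n b m : kk b = kap -> (n%:R - 1 < d (pw b m) <= n%:R)%R ->
    (delta - kap) * n%:R - C1 <= segment_int F x0 (hact (pw b m) x0).
  by move=> kb; rewrite segE //; have [] := key b m; rewrite kb; exact: lower_arith.
(* The power of exponent m has displacement m ell up to B, so the exponents met in one annulus lie
   among M consecutive integers; the two signs explain the factor 2 in 2 * M. *)
pose M := (Num.truncn ((2 * B + 1) / ell)).+2.
have M1 : 1 <= (2 * M)%:R :> R by rewrite ler1n.
have C10 : 0 <= C1 by rewrite mulr_ge0 ?addr_ge0.
apply: (@limn_esup_rate _ _ _ (C1 + ln (2 * M)%:R)).
- by rewrite addr_ge0 // ln_ge0.
- move=> n n0; apply: lne_le_rate => //.
    by apply: esum_ge0 => g _; rewrite lee_fin expR_ge0.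
  pose m0 := Num.truncn ((n%:R - 1 - B) / ell).
  pose s := [seq pw true m | m <- iota m0 M] ++ [seq pw false m | m <- iota m0 M].
  apply: (@le_trans _ _ ((size s)%:R * expR ((delta - kap) * n%:R + C1))%:E).
    apply: esum_le_size; first exact: expR_ge0.
      move=> g [/cyc[b [m ->]] hm].
      have mi : m \in iota m0 M.
        have [_ h] := key b m; rewrite mem_iota.
        move: h; rewrite ler_norml => /andP[h1 h2]; move: hm => /andP[h3 h4].
        have g1 : (n%:R - 1 - B) / ell < m%:R by rewrite ltr_pdivrMr //; move: h2 h3; rewrite -/(d _); lra.
        have g2 : m%:R <= (n%:R - 1 - B) / ell + (2 * B + 1) / ell.
          by rewrite -mulrDl ler_pdivlMr //; move: h1 h4; rewrite -/(d _); lra.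
        have t1 := truncnS_gt ((n%:R - 1 - B) / ell); rewrite -/m0 in t1.
        have t2 := truncnS_gt ((2 * B + 1) / ell).
        apply/andP; split; last first.
          rewrite -(ltr_nat R) /M natrD; apply: (le_lt_trans g2).
          by move: t1 t2; rewrite -!natr1 => t1 t2; lra.
        rewrite leqNgt; apply/negP => lm.
        have : m0%:R <= (n%:R - 1 - B) / ell.
          rewrite truncn_le //; case: (lerP 0 ((n%:R - 1 - B) / ell)) => // neg.
          have : (0 < m0)%N by exact: leq_ltn_trans lm.
          by rewrite truncn_gt0 => /le_lt_trans /(_ neg); rewrite ltr10.
        by move=> /le_lt_trans /(_ g1); rewrite ltr_nat ltnNge (ltnW lm).
      rewrite mem_cat; case: b {hm} => //; apply/orP; [left|right]; exact: map_f.
    by move=> g [/cyc[b [m ->]] hm]; rewrite ler_expR; exact: upper_term hm.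
  rewrite size_cat !size_map size_iota addnn -mul2n lee_fin addrA [expR (_ + ln _)]expRD.
  by rewrite lnK ?posrE ?(lt_le_trans ltr01) // mulrC.
move=> p.
have [b kb] : exists b, kk b = kap.
  by rewrite /kk /kap; case: (leP k k') => h; [exists true|exists false].
pose m := (Num.truncn ((p%:R + B) / ell)).+1.
have [_ hd] := key b m.
have dp : p%:R < d (pw b m).
  have t := truncnS_gt ((p%:R + B) / ell); rewrite -/m ltr_pdivrMr // in t.
  by move: hd; rewrite ler_norml => /andP[h _]; lra.
have ex : exists n : nat, d (pw b m) <= n%:R.
  by exists (Num.truncn (d (pw b m))).+1; exact/ltW/truncnS_gt.
pose n := ex_minn ex; have hn : n%:R - 1 < d (pw b m) <= n%:R /\ (p < n)%N.
  rewrite /n; case: ex_minnP => q hq hmin; split; last by rewrite -(ltr_nat R) (lt_le_trans dp).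
  rewrite hq andbT ltrBlDr; case: q hq hmin => [|q] hq hmin.
    by rewrite ltr_wpDl // (le_trans _ (ltW dp)).
  rewrite -natr1 ltrD2r ltNge; apply/negP => /hmin; by rewrite ltnn.
case: hn => hn pn; exists n => //; have n0 : (0 < n)%N by exact: leq_ltn_trans pn.
apply: lne_ge_rate => //; apply: (@le_trans _ _ (expR ((delta - kap) * n%:R - C1))%:E).
  by rewrite lee_fin ler_expR lerD2l lerN2 lerDl ln_ge0.
have Sg : S n (pw b m) by split => //; exists m; case: (b); [left|right].
apply: le_trans (esum_ge_term Sg _); first by rewrite lee_fin ler_expR lower_term.
by move=> g; rewrite lee_fin expR_ge0.
Qed.

End CyclicCriticalExponent.

Lemma normc_triangle {R : realType} (r z s : R[i]) : normc (r - s) <= normc (r - z) + normc (z - s).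
Proof. by have := le_normcD' (r - z) (z - s); rewrite addrA subrK. Qed.

Lemma Kbar_bact {R : realType} (Kh : set R[i]) g (xi : bdry R) : closed_subfield Kh -> matK Kh g ->
  Kbar Kh xi -> Kbar Kh (bact g xi).
Proof.
move=> [_ kD kM _ kV] kg; case: xi => [z|] /= kz; case: ifP => //= _.
  have kl i : Kh (mat g i 0 * z + mat g i 1) := kD _ _ (kM _ _ (kg i 0) kz) (kg i 1).
  exact: kM (kl 0) (kV _ (kl 1)).
exact: kM (kg 0 0) (kV _ (kg 1 0)).
Qed.

Lemma expR_nat_ge1 {R : realType} (n : nat) : 1 <= expR n%:R :> R.
Proof. by rewrite -(expR0 R) ler_expR. Qed.

(** * Hopf coordinates of unit tangent vectors *)

Section HopfCoordinates.
Context {R : realType}.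
Variables (Kh : set R[i]) (cK : closed_subfield Kh).
Variable x0 : hpoint R.
Hypothesis ux0 : upper Kh x0.
Implicit Types (v w : vect R) (u z : R[i]).

Let rK := closed_subfield_real cK.
Let K0 := closed_subfield0 cK.
Let x00 : 0 < x0.2. Proof. by case: ux0. Qed.

(** Along a geodesic the cosine of the distance to x0 is a multiple of a translated cosh, so there
    is exactly one nearest point and [hopf_time] is well defined. *)
Lemma geodesic_dist v : T1 Kh v -> exists (k s0 : R), 0 < k /\
  forall s, cd x0 (foot (flow s v)) = k * ch (s - s0).
Proof.
move=> Tv; have uv : upper Kh (foot v) by rewrite -(flow0 v); exact: foot_flow_upper.
have [w [Tw ew fw]] := exists_vect_to rK K0 uv ux0.
set d := hdist _ _ in fw.
have hs s : cd x0 (foot (flow s v)) = ch s * ch d - sh s * (sh d * ip v w).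
  by rewrite cd_sym -fw (law_of_cosines s d Tv Tw (esym ew)) mulrA.
set P := ch d in hs; set Q := sh d * ip v w in hs.
have QP : `|Q| < P.
  rewrite /Q normrM; apply: le_lt_trans (abs_sh_lt_ch d).
  by rewrite -[leRHS]mulr1; apply: ler_wpM2l => //; exact: (ip_bound Tv Tw).
move: QP; rewrite ltr_norml => /andP[q1 q2].
have p1 : 0 < P - Q by rewrite subr_gt0.
have p2 : 0 < P + Q by lra.
(* tanh s0 = Q / P, which turns P cosh s - Q sinh s into a multiple of cosh (s - s0). *)
pose s0 := ln ((P + Q) / (P - Q)) / 2.
have e0 : expR s0 * expR s0 = (P + Q) / (P - Q).
  rewrite -expRD (_ : s0 + s0 = ln ((P + Q) / (P - Q))) ?lnK ?posrE ?divr_gt0 // /s0; by field.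
exists ((P - Q) * expR s0), s0; split; first by rewrite mulr_gt0 // expR_gt0.
move=> s; rewrite hs chD chN shN.
have e1 : (P - Q) * (expR s0 * expR s0) = P + Q by rewrite e0 mulrCA divff ?mulr1 // gt_eqF.
have e2 := expR_mulN s0; clearbody P Q; rewrite /ch /sh.
move: (expR s) (expR (- s)) (expR s0) (expR (- s0)) e1 e2 => x y z t e1 e2.
have -> : (P - Q) * z * ((x + y) / 2 * ((z + t) / 2) + (x - y) / 2 * - ((z - t) / 2)) =
  (P - Q) * (z * t) * x / 2 + (P - Q) * (z * z) * y / 2 by field.
by rewrite e1 e2; field.
Qed.

Lemma hdist_le_cd (p q p' q' : hpoint R) : 0 < p.2 -> 0 < q.2 -> 0 < p'.2 -> 0 < q'.2 ->
  (hdist p q <= hdist p' q') = (cd p q <= cd p' q').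
Proof. by move=> *; rewrite hdist_le // ?hdist_ge0 // ch_hdist. Qed.

Lemma nearest_unique v s t : T1 Kh v ->
  (forall r, hdist x0 (foot (flow s v)) <= hdist x0 (foot (flow r v))) ->
  (forall r, hdist x0 (foot (flow t v)) <= hdist x0 (foot (flow r v))) -> s = t.
Proof.
move=> Tv; have [k [s0 [kp hk]]] := geodesic_dist Tv.
suff h r : (forall r', hdist x0 (foot (flow r v)) <= hdist x0 (foot (flow r' v))) -> r = s0.
  by move=> /h -> /h ->.
move=> /(_ s0); rewrite hdist_le_cd ?(foot_flow_gt0 _ Tv) // !hk ler_pM2l // subrr.
by move=> /ch_le_inv; rewrite normr0 normr_le0 subr_eq0 => /eqP.
Qed.

Lemma hopf_timeP v : T1 Kh v ->
  forall s, hdist x0 (foot (flow (- hopf_time x0 v) v)) <= hdist x0 (foot (flow s v)).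
Proof.
move=> Tv; have [k [s0 [kp hk]]] := geodesic_dist Tv.
apply: (@xgetPex _ 0 [set t : R | forall s, hdist x0 (foot (flow (- t) v)) <= hdist x0 (foot (flow s v))]).
exists (- s0) => s; rewrite opprK hdist_le_cd ?(foot_flow_gt0 _ Tv) // !hk ler_pM2l // subrr.
by apply: ch_le; rewrite normr0.
Qed.

Lemma hopf_time_eq v t : T1 Kh v ->
  (forall s, hdist x0 (foot (flow (- t) v)) <= hdist x0 (foot (flow s v))) -> hopf_time x0 v = t.
Proof.
move=> Tv ht; apply: oppr_inj; exact: nearest_unique Tv (hopf_timeP Tv) ht.
Qed.

Lemma hopf_time_flow v s : T1 Kh v -> hopf_time x0 (flow s v) = hopf_time x0 v + s.
Proof.
move=> Tv; apply: hopf_time_eq; first exact: T1_flow.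
by move=> r; rewrite !(flowD _ _ Tv) opprD subrK; exact: hopf_timeP.
Qed.

Lemma vplus_axis u u' : Kh u -> Kh u' -> u != u' ->
  vplus (axis_vect u u') = Some u /\ vminus (axis_vect u u') = Some u'.
Proof.
move=> Ku Ku' ne; have Ta := T1_axis cK Ku Ku' ne.
have d0 := dist_gt0 ne; have dn : (normc (u - u'))%:C%C != 0 by apply: realC_neq0; exact: lt0r_neq0.
rewrite (vplusE Ta) (vminusE rK Ta) /vplus_expl /= oppr0 eq_sym oner_eq0 addr0 divr1.
by rewrite !RCM RC_half RCV; split; congr Some; field.
Qed.

Lemma vminus_flip v : T1 Kh v -> vminus v = vplus (flip v).
Proof. by move=> Tv; rewrite (vminusE rK Tv) (vplusE (T1_flip rK Tv)). Qed.

(** At its highest point the direction of the geodesic is horizontal, and there the endpoints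
    determine the vector. *)
Lemma axis_unique v u u' : T1 Kh v -> vplus v = Some u -> vminus v = Some u' -> u != u' /\
  exists s, flow s v = axis_vect u u'.
Proof.
move=> Tv ev ev'.
have t1 : v.2.2 != 1 by apply/eqP => e; move: ev; rewrite (vplusE Tv) /vplus_expl e eqxx.
have t2 : v.2.2 != -1.
  by apply/eqP => e; move: ev'; rewrite (vminusE rK Tv) /vplus_expl /= e opprK eqxx.
have tl := T1_tau_le1 Tv; have tl' := T1_tau_le1 (T1_flip rK Tv); rewrite /= in tl'.
have a1 : 0 < 1 - v.2.2 by rewrite subr_gt0 lt_neqAle t1.
have a2 : 0 < 1 + v.2.2.
  by rewrite -[v.2.2]opprK subr_gt0 lt_neqAle tl' andbT eqr_oppLR.
(* The time of the highest point: tanh s = tau. *)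
pose s := ln ((1 + v.2.2) / (1 - v.2.2)) / 2.
have e0 : expR s * expR s = (1 + v.2.2) / (1 - v.2.2).
  rewrite -expRD (_ : s + s = ln ((1 + v.2.2) / (1 - v.2.2))) ?lnK ?posrE ?divr_gt0 // /s; by field.
have w0 : (flow s v).2.2 = 0.
  have -> : (flow s v).2.2 = (v.2.2 * ch s - sh s) / (ch s - v.2.2 * sh s) by case: (v) => [[? ?] [? ?]].
  rewrite (_ : v.2.2 * ch s - sh s = 0) ?mul0r //.
  have e1 := expR_mulN s; have E0 := expR_gt0 s; rewrite /ch /sh.
  move: (expR s) (expR (- s)) e0 e1 E0 => x y e0 e1 x0'.
  have e2 : x * x * (1 - v.2.2) = 1 + v.2.2 by rewrite e0 divfK // gt_eqF.
  apply: (mulfI (lt0r_neq0 x0')); rewrite mulr0.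
  have -> : x * (v.2.2 * ((x + y) / 2) - (x - y) / 2) =
     ((1 + v.2.2) * (x * y) - x * x * (1 - v.2.2)) / 2 by field.
  by rewrite e1 e2; ring.
suff [ne e] : u != u' /\ flow s v = axis_vect u u' by split => //; exists s.
have Tw := T1_flow s rK Tv; have := T1_norm Tw; have tw := T1_gt0 Tw.
have := vplus_flow s rK Tv; have := vminus_flow s rK Tv.
rewrite ev ev' (vplusE Tw) (vminusE rK Tw) /vplus_expl.
move: (flow s v) w0 tw {Tw} => [[z t] [ze ta]] /= -> tw.
rewrite oppr0 eq_sym oner_eq0 addr0 subr0 !divr1 => -[<-] [<-] n1.
have tn : t%:C%C != 0 by apply: realC_neq0; exact: lt0r_neq0.
have nze : normc ze = 1.
  have : normc ze ^+ 2 = 1 by rewrite normc2; move: n1; rewrite expr0n addr0.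
  by move=> e1; apply/eqP; rewrite -(eqrXn2 (n := 2)) ?normc_ge0' // expr1n e1.
have dE : z + t%:C%C * ze - (z + t%:C%C * - ze) = (t + t)%:C%C * ze by rewrite RCD; ring.
have nE : normc (z + t%:C%C * ze - (z + t%:C%C * - ze)) = t + t.
  by rewrite dE normcZ nze mulr1 ger0_norm // addr_ge0 // ltW.
have tt : 0 < t + t by rewrite addr_gt0.
split; first by rewrite -subr_eq0 -normc_gt0 nE.
rewrite /axis_vect /axis_top nE dE.
congr (_, _, (_, _)).
- by rewrite mulrN addrACA subrr addr0; field.
- by field.
- by rewrite mulrA -RCM mulVf ?mul1r // gt_eqF.
Qed.

End HopfCoordinates.

(** * Borel sets of tangent vectors *)

Section VectBorel.
Context {R : realType}.
Implicit Types (v w : vect R) (f g : vect R -> R).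

Lemma continuous_addv f g : continuous f -> continuous g -> continuous (fun v => f v + g v).
Proof. by move=> cf cg v; apply: cvgD; [exact: cf|exact: cg]. Qed.

Lemma continuous_mulv f g : continuous f -> continuous g -> continuous (fun v => f v * g v).
Proof. by move=> cf cg v; apply: cvgM; [exact: cf|exact: cg]. Qed.

Lemma continuous_oppv f : continuous f -> continuous (fun v => - f v).
Proof. by move=> cf v; apply: cvgN; exact: cf. Qed.

Lemma continuous_cstv (k : R) : continuous (fun _ : vect R => k).
Proof. by move=> v; exact: cvg_cst. Qed.

Lemma continuous_compv (T U W : topologicalType) (h : T -> U) (k : U -> W) :
  continuous h -> continuous k -> continuous (k \o h).
Proof. by move=> ch ck x; apply: continuous_comp; [exact: ch|exact: ck]. Qed.

Lemma continuous_coord : [/\ continuous (fun v => reC v.1.1), continuous (fun v => imC v.1.1),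
  continuous (fun v => v.1.2) & [/\ continuous (fun v => reC v.2.1), continuous (fun v => imC v.2.1) &
  continuous (fun v => v.2.2)]].
Proof.
have c1 : continuous (fun v : vect R => v.1) := continuous_fst'.
have c2 : continuous (fun v : vect R => v.2) := continuous_snd'.
have c3 : continuous (fun p : hpoint R => p.1) := continuous_fst'.
have c4 : continuous (fun p : hpoint R => p.2) := continuous_snd'.
have c13 := continuous_compv c1 c3; have c23 := continuous_compv c2 c3.
have re := @continuous_reC R; have im := @continuous_imC R.
split; [exact: continuous_compv c13 re|exact: continuous_compv c13 im|exact: continuous_compv c1 c4|split].
- exact: continuous_compv c23 re.
- exact: continuous_compv c23 im.
- exact: continuous_compv c2 c4.
Qed.

Lemma closed_lev f g : continuous f -> continuous g -> closed [set v | f v <= g v].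
Proof.
move=> cf cg; rewrite (_ : [set v | f v <= g v] = (fun v => g v + - f v) @^-1` [set x : R | 0 <= x]).
  apply: preimage_closed; last exact: closed_ge.
  by move=> v _; exact: (continuous_addv cg (continuous_oppv cf)).
by apply/seteqP; split => v /=; rewrite subr_ge0.
Qed.

Lemma borel_open (A : set (vect R)) : open A -> <<s @open (vect R) >> A.
Proof. exact: sub_gen_smallest. Qed.

Lemma borelI (A B : set (vect R)) : <<s @open (vect R) >> A -> <<s @open (vect R) >> B ->
  <<s @open (vect R) >> (A `&` B).
Proof. exact: (@measurableI _ (g_sigma_algebraType (@open (vect R)))). Qed.

Lemma borelC (A : set (vect R)) : <<s @open (vect R) >> A -> <<s @open (vect R) >> (~` A).
Proof. exact: (@measurableC _ (g_sigma_algebraType (@open (vect R)))). Qed.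

Lemma borel_closed (A : set (vect R)) : closed A -> <<s @open (vect R) >> A.
Proof. move=> cA; rewrite -[A]setCK; apply: borelC; apply: borel_open. exact: (closed_openC cA). Qed.

Variables (Kh : set R[i]) (cK : closed_subfield Kh) (clK : closed Kh).
Let rK := closed_subfield_real cK.

Lemma borel_height : <<s @open (vect R) >> [set v | 0 < v.1.2].
Proof.
have [_ _ c3 _] := continuous_coord.
rewrite (_ : [set v | 0 < v.1.2] = ~` [set v | v.1.2 <= 0]).
  apply: borelC; apply: borel_closed. exact: (closed_lev c3 (@continuous_cstv 0)).
by apply/seteqP; split => v /=; [rewrite ltNge => /negP|move=> /negP; rewrite -ltNge].
Qed.

Lemma borel_T1 : <<s @open (vect R) >> (T1 Kh).
Proof.
have [c1 c2 c3 [c4 c5 c6]] := continuous_coord.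
have closedK (k : vect R -> R[i]) : continuous k -> <<s @open (vect R) >> [set v | Kh (k v)].
  by move=> ck; apply: borel_closed; apply: preimage_closed => // v _; exact: ck.
pose n v := reC v.2.1 * reC v.2.1 + imC v.2.1 * imC v.2.1 + v.2.2 * v.2.2.
have cn : continuous n.
  exact: (continuous_addv (continuous_addv (continuous_mulv c4 c4) (continuous_mulv c5 c5)) (continuous_mulv c6 c6)).
have -> : T1 Kh = [set v | 0 < v.1.2] `&` ([set v | Kh v.1.1] `&` ([set v | Kh v.2.1] `&`
    ([set v | n v <= 1] `&` [set v | 1 <= n v]))).
  apply/seteqP; split => v.
    move=> Tv; have e : n v = 1 by rewrite /n -!expr2; exact: (T1_norm Tv).
    by case: Tv => -[Kv v0] Kz _; rewrite /= e.
  move=> [v0 [Kz [Kze [/= n1 n2]]]]; split => //; rewrite normc2 !expr2.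
  by apply/eqP; rewrite eq_le n1 n2.
have cz : continuous (fun v : vect R => v.1.1).
  exact: (continuous_compv (@continuous_fst' (hpoint R) (hpoint R)) (@continuous_fst' R[i] R)).
have cze : continuous (fun v : vect R => v.2.1).
  exact: (continuous_compv (@continuous_snd' (hpoint R) (hpoint R)) (@continuous_fst' R[i] R)).
apply: borelI; first exact: borel_height.
apply: borelI; first exact: (closedK (fun v => v.1.1) cz).
apply: borelI; first exact: (closedK (fun v => v.2.1) cze).
by apply: borelI; apply: borel_closed; [exact: (closed_lev cn (@continuous_cstv 1))|exact: (closed_lev (@continuous_cstv 1) cn)].
Qed.

Lemma cd_le_poly (p q : hpoint R) (C : R) : 0 < p.2 -> 0 < q.2 ->
  (cd p q <= C) = (normc (p.1 - q.1) ^+ 2 + (p.2 - q.2) ^+ 2 <= (C - 1) * (2 * p.2 * q.2)).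
Proof. by move=> p0 q0; rewrite /cd -lerBrDl ler_pdivrMr // !mulr_gt0. Qed.

Lemma hdist_ge_poly (p q : hpoint R) (D : R) : 0 < p.2 -> 0 < q.2 -> 0 <= D ->
  (D <= hdist p q) = ((ch D - 1) * (2 * p.2 * q.2) <= normc (p.1 - q.1) ^+ 2 + (p.2 - q.2) ^+ 2).
Proof.
move=> p0 q0 D0; have d0 := hdist_ge0 p0 q0.
have -> : (D <= hdist p q) = (ch D <= cd p q).
  rewrite -ch_hdist //; apply/idP/idP => [h|/ch_le_inv]; first by apply: ch_le; rewrite !ger0_norm.
  by rewrite !ger0_norm.
by rewrite /cd -lerBlDl ler_pdivlMr // !mulr_gt0.
Qed.

(** On [T1 Kh] the denominator of the flow is positive; after multiplication by its square the
    condition is an inequality between continuous functions of the coordinates. *)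
Lemma borel_flow_ball (x0 : hpoint R) (s D : R) : 0 < x0.2 -> 0 <= D ->
  <<s @open (vect R) >> (T1 Kh `&` [set v | hdist x0 (foot (flow s v)) <= D]).
Proof.
move=> x00 D0; have [c1 c2 c3 [c4 c5 c6]] := continuous_coord.
pose Dn v := ch s - v.2.2 * sh s.
pose p1 v := Dn v * (reC x0.1 - reC v.1.1) - v.1.2 * sh s * reC v.2.1.
pose p2 v := Dn v * (imC x0.1 - imC v.1.1) - v.1.2 * sh s * imC v.2.1.
pose p3 v := Dn v * x0.2 - v.1.2.
pose Q v := (ch D - 1) * (2 * x0.2 * (v.1.2 * Dn v)).
pose A := continuous_addv; pose M := continuous_mulv; pose O := continuous_oppv; pose k := @continuous_cstv.
have cD : continuous Dn := A _ _ (k _) (O _ (M _ _ c6 (k _))).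
have cp1 : continuous p1 := A _ _ (M _ _ cD (A _ _ (k _) (O _ c1))) (O _ (M _ _ (M _ _ c3 (k _)) c4)).
have cp2 : continuous p2 := A _ _ (M _ _ cD (A _ _ (k _) (O _ c2))) (O _ (M _ _ (M _ _ c3 (k _)) c5)).
have cp3 : continuous p3 := A _ _ (M _ _ cD (k _)) (O _ c3).
have cP : continuous (fun v => p1 v * p1 v + p2 v * p2 v + p3 v * p3 v) :=
  A _ _ (A _ _ (M _ _ cp1 cp1) (M _ _ cp2 cp2)) (M _ _ cp3 cp3).
have cQ : continuous Q := M _ _ (k _) (M _ _ (k _) (M _ _ c3 cD)).
have e v : T1 Kh v -> (hdist x0 (foot (flow s v)) <= D) =
    (p1 v * p1 v + p2 v * p2 v + p3 v * p3 v <= Q v).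
  move=> Tv; have f0 := foot_flow_gt0 s Tv; rewrite hdist_le // cd_le_poly //.
  have := flow_den_gt0 s Tv; rewrite -/(Dn v) => d0.
  have d2 : 0 < Dn v ^+ 2 by rewrite exprn_gt0.
  have ef : foot (flow s v) = (v.1.1 + (v.1.2 * sh s / Dn v)%:C%C * v.2.1, v.1.2 / Dn v).
    by rewrite /Dn; case: (v) => [[? ?] [? ?]].
  rewrite -(ler_pM2r d2) ef /= normc2 !reimE /p1 /p2 /p3 /Q.
  have dn := lt0r_neq0 d0; move: (Dn v) dn => d dn.
  by congr (_ <= _); field.
have -> : T1 Kh `&` [set v | hdist x0 (foot (flow s v)) <= D] =
    T1 Kh `&` [set v | p1 v * p1 v + p2 v * p2 v + p3 v * p3 v <= Q v].
  by apply/seteqP; split => v [Tv] /=; rewrite e.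
by apply: borelI; [exact: borel_T1|apply: borel_closed; exact: closed_lev].
Qed.

Lemma borel_far (Gam : set (PSL2 R)) (x0 : hpoint R) (D : R) : 0 < x0.2 -> 0 <= D ->
  <<s @open (vect R) >> (T1 Kh `&` [set v | forall g : PSL2 R, Gam g -> D <= hdist (hact g x0) (foot v)]).
Proof.
move=> x00 D0; have [c1 c2 c3 _] := continuous_coord.
pose P (p : hpoint R) v := (reC p.1 - reC v.1.1) * (reC p.1 - reC v.1.1) +
  (imC p.1 - imC v.1.1) * (imC p.1 - imC v.1.1) + (p.2 - v.1.2) * (p.2 - v.1.2).
pose Q (p : hpoint R) v := (ch D - 1) * (2 * p.2 * v.1.2).
pose A := continuous_addv; pose M := continuous_mulv; pose O := continuous_oppv; pose k := @continuous_cstv.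
have sub (q : R) h : continuous h -> continuous (fun v => q - h v) := fun ch => A _ _ (k q) (O _ ch).
have cP p : continuous (P p) := A _ _ (A _ _ (M _ _ (sub _ _ c1) (sub _ _ c1))
  (M _ _ (sub _ _ c2) (sub _ _ c2))) (M _ _ (sub _ _ c3) (sub _ _ c3)).
have cQ p : continuous (Q p) := M _ _ (k _) (M _ _ (k _) c3).
have -> : T1 Kh `&` [set v | forall g : PSL2 R, Gam g -> D <= hdist (hact g x0) (foot v)] =
    T1 Kh `&` \bigcap_(g in Gam) [set v | Q (hact g x0) v <= P (hact g x0) v].
  have e v (g : PSL2 R) : T1 Kh v -> (D <= hdist (hact g x0) (foot v)) = (Q (hact g x0) v <= P (hact g x0) v).
    move=> Tv; have v0 : 0 < (foot v).2 := T1_gt0 Tv; have g0 := hact_gt0 g x00.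
    by rewrite hdist_ge_poly // /P /Q normc2 !reimE !expr2.
  by apply/seteqP; split => v [Tv hv]; split => // g Gg; [rewrite /= -e //|rewrite e //]; exact: hv.
apply: borelI; first exact: borel_T1.
apply: borel_closed; apply: closed_bigI => g _; exact: (closed_lev (cQ _) (cP _)).
Qed.

End VectBorel.

Lemma counting_le_size {T : choiceType} {R : realType} (t0 : T) (A : set T) (s : seq T) :
  (forall i, A i -> i \in s) -> (counting A <= (size s)%:R%:E :> \bar R)%E.
Proof.
move=> As; have sub : A `<=` nth t0 s @` `I_(size s).
  by move=> i /As si; exists (index i s); rewrite /= ?index_mem ?nth_index.
have fA : finite_set A by apply: sub_finite_set sub _; exact/finite_image/finite_II.
rewrite /counting asboolT // lee_fin ler_nat; apply: geq_card_fset_set.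
exact: card_le_trans (subset_card_le sub) (card_image_le _ _).
Qed.

(** At time T the geodesic from z' to z is at height about e^(-T) and at horizontal distance at most
    a multiple of e^(-T) from z, uniformly for endpoints neither close nor far apart. *)
Lemma axis_vertical {R : realType} (dmin dmax c : R) : 0 < dmin -> dmin <= dmax -> 0 <= c ->
  exists2 D : R, 0 <= D & forall (z z' : R[i]) T n, dmin <= normc (z - z') -> normc (z - z') <= dmax ->
  `|T - n| <= c -> 0 <= n -> hdist (z, expR (- n)) (foot (flow T (axis_vect z z'))) <= D.
Proof.
move=> d0 dd c0; pose C := expR c; have C1 : 1 <= C by rewrite /C -(expR0 R) ler_expR.
have C0 : 0 < C by exact: expR_gt0.
have dm0 : 0 < dmax by exact: lt_le_trans dd.
have C2 : 0 < 1 + C ^+ 2 by rewrite addr_gt0 // exprn_gt0.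
pose M1 := C * (1 + C ^+ 2) / dmin; pose M2 := dmax * C ^+ 2.
have M10 : 0 < M1 by rewrite divr_gt0 // mulr_gt0.
have M20 : 0 < M2 by rewrite mulr_gt0 // exprn_gt0.
have [D D0 hD] := hdist_bound (addr_gt0 M10 M20).
exists D => // z z' T n h1 h2 h3 n0.
have ne : z != z' by rewrite -subr_eq0 -normc_gt0 (lt_le_trans d0).
rewrite (flow_axis ne); set Dl := normc _ in h1 h2 *.
have X0 := expR_gt0 T; have Y0 := expR_gt0 (- T); have XY := expR_mulN T; have E0 := expR_gt0 (- n).
move: h3; rewrite ler_norml => /andP[t1 t2].
have y1 : expR (- T) <= C * expR (- n) by rewrite /C -expRD ler_expR; lra.
have y2 : expR (- n) <= C * expR (- T) by rewrite /C -expRD ler_expR; lra.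
have y3 : expR (- T) <= C by rewrite /C ler_expR; lra.
have Dl0 : 0 < Dl by exact: lt_le_trans h1.
have S0 : 0 < expR T + expR (- T) by rewrite addr_gt0.
have e1 : z - ((expR T)%:C%C * z + (expR (- T))%:C%C * z') / (expR T + expR (- T))%:C%C =
    (expR (- T) / (expR T + expR (- T)))%:C%C * (z - z').
  have sn : (expR T)%:C%C + (expR (- T))%:C%C != 0 :> R[i] by rewrite -RCD; apply: realC_neq0; exact: lt0r_neq0.
  by rewrite !RCE; field.
move: e1 X0 Y0 XY E0 y1 y2 y3 S0 {t1 t2}.
move: (expR T) (expR (- T)) (expR (- n)) => X Y e e1 X0 Y0 XY E0 y1 y2 y3 S0.
have s1 : (X + Y)^-1 <= Y.
  by rewrite -[leLHS]mul1r ler_pdivrMr // mulrDr [Y * X]mulrC XY lerDl mulr_ge0 // ltW.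
have s2 : Y / (1 + C ^+ 2) <= (X + Y)^-1.
  rewrite ler_pdivrMr // -ler_pdivrMl ?invr_gt0 // invrK mulrC mulrDr [Y * X]mulrC XY lerD2l expr2.
  by apply: ler_pM => //; exact: ltW.
have M1M : M1 <= M1 + M2 by rewrite lerDl ltW.
have M2M : M2 <= M1 + M2 by rewrite lerDr ltW.
apply: hD => //=; first by rewrite divr_gt0.
- apply: (@le_trans _ _ (M1 * (Dl / (X + Y)))); last by rewrite ler_pM2r // divr_gt0.
  apply: (@le_trans _ _ (M1 * (dmin * (Y / (1 + C ^+ 2))))); last first.
    rewrite ler_pM2l //; apply: ler_pM => //; [exact: ltW|by rewrite divr_ge0 // ltW].
  rewrite (_ : M1 * _ = C * Y) // /M1; field; rewrite !gt_eqF //.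
- apply: (@le_trans _ _ (M2 * e)); last by rewrite ler_pM2r.
  apply: (@le_trans _ _ (dmax * Y)); first by apply: ler_pM => //; rewrite ?invr_ge0; exact: ltW.
  rewrite /M2 -mulrA ler_pM2l //; apply: (le_trans y1).
  by rewrite ler_pM2r // expr2 ler_peMr // ltW.
- apply: (@le_trans _ _ (M2 * e)); last by rewrite ler_pM2r.
  rewrite e1 normcZ -/Dl ger0_norm ?divr_ge0 ?(ltW Y0) ?(ltW S0) //.
  apply: (@le_trans _ _ (C * Y * dmax)).
    apply: ler_pM => //; rewrite ?divr_ge0 ?(ltW Y0) ?(ltW S0) ?(ltW Dl0) //.
    by apply: ler_pM => //; rewrite ?invr_ge0; exact: ltW.
  rewrite /M2 mulrC -[leRHS]mulrA ler_pM2l // expr2 -mulrA ler_pM2l //.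
Qed.

(** * Sets of vectors and of boundary points that leave the orbit *)

Section ReturningSets.
Context {R : realType}.
Variables (Kh : set R[i]) (cK : closed_subfield Kh) (clK : closed Kh).
Variables (Gam : set (PSL2 R)) (x0 : hpoint R).
Hypothesis x00 : 0 < x0.2.
Implicit Types (v w : vect R) (u z : R[i]) (g : PSL2 R).

Lemma top_near u u' : Kh u -> Kh u' -> u != u' -> exists2 D : R, 0 <= D & forall z z',
  normc (z - u) < normc (u - u') / 4 -> normc (z' - u') < normc (u - u') / 4 ->
  [/\ normc (u - u') / 2 <= normc (z - z'), normc (z - z') <= 2 * normc (u - u') &
  hdist x0 (axis_top z z') <= D].
Proof.
move=> Ku Ku' ne; have d0 := dist_gt0 ne; set d := normc (u - u') in d0 *.
pose S := normc x0.1 + normc u + d.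
have S0 : 0 < S by rewrite ltr_wpDl // addr_ge0 // normc_ge0'.
pose M := 4 * x0.2 / d + d / x0.2 + S / x0.2.
have m1 : 0 < 4 * x0.2 / d by rewrite divr_gt0 // mulr_gt0.
have m2 : 0 < d / x0.2 by rewrite divr_gt0.
have m3 : 0 < S / x0.2 by rewrite divr_gt0.
have M0 : 0 < M by rewrite !addr_gt0.
have [D D0 hD] := hdist_bound M0; exists D => // z z'; rewrite -/d => h1 h2.
have t1 := normc_triangle z u z'; have t2 := normc_triangle u u' z'.
have t3 := normc_triangle u z u'; have t4 := normc_triangle z z' u'.
rewrite (le_normcB u z) in t3; rewrite (le_normcB u' z') in t2; rewrite -/d in t2 t3.
have b1 : d / 2 <= normc (z - z') by lra.
have b2 : normc (z - z') <= 2 * d by lra.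
split => //; apply: hD => //=; first by rewrite divr_gt0 // (lt_le_trans _ b1) // divr_gt0.
- apply: (@le_trans _ _ (4 * x0.2 / d * (d / 4))).
    by rewrite (_ : 4 * x0.2 / d * (d / 4) = x0.2) //; field; exact: lt0r_neq0.
  apply: ler_pM; [exact: ltW|by rewrite divr_ge0 // ltW| |lra].
  by rewrite /M -addrA lerDl addr_ge0 // ltW.
- apply: (@le_trans _ _ (d / x0.2 * x0.2)); first by rewrite divfK ?gt_eqF //; lra.
  by rewrite ler_pM2r // /M addrAC lerDr addr_ge0 // ltW.
- apply: (@le_trans _ _ (S / x0.2 * x0.2)); last by rewrite ler_pM2r // /M lerDr addr_ge0 // ltW.
  rewrite divfK ?gt_eqF //.
  have e : x0.1 - (z + z') / 2 = x0.1 - u - ((2^-1 : R)%:C%C * (z - u) + (2^-1 : R)%:C%C * (z' - u)).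
    by rewrite RC_half; field.
  have n1 := le_normcD' (x0.1 - u) (- ((2^-1 : R)%:C%C * (z - u) + (2^-1 : R)%:C%C * (z' - u))).
  have n2 := le_normcD' ((2^-1 : R)%:C%C * (z - u)) ((2^-1 : R)%:C%C * (z' - u)).
  have n3 := le_normcD' x0.1 (- u).
  have n4 := normc_triangle z' u' u; rewrite (le_normcB u' u) -/d in n4.
  have nN (y : R[i]) : normc (- y) = normc y by exact: normcN.
  rewrite e /S; move: n1 n2; rewrite nN !normcZ ger0_norm ?invr_ge0 // => n1 n2.
  move: n3; rewrite nN => n3; lra.
Qed.

(** Vectors that were near x0 at time -n and are now far from the whole orbit, that is, high in a
    cusp. *)
Definition returning (D1 D2 : R) (n : nat) : set (vect R) := [set v | [/\ T1 Kh v,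
  hdist x0 (foot (flow (- n%:R) v)) <= D1 & forall g, Gam g -> D2 <= hdist (hact g x0) (foot v)]].

(** The boundary counterpart of [returning]: endpoints of vertical geodesics that are high in a cusp
    at height e^(-n). *)
Definition escaping (D : R) (n : nat) : set (bdry_borel R) := [set xi | exists2 z : R[i], xi = Some z &
  forall g, Gam g -> D <= hdist (hact g x0) (z, expR (- n%:R))].

Lemma borel_returning D1 D2 n : 0 <= D1 -> 0 <= D2 -> <<s @open (vect R) >> (returning D1 D2 n).
Proof.
move=> D10 D20.
have -> : returning D1 D2 n = (T1 Kh `&` [set v | hdist x0 (foot (flow (- n%:R) v)) <= D1]) `&`
   (T1 Kh `&` [set v | forall g, Gam g -> D2 <= hdist (hact g x0) (foot v)]).
  by apply/seteqP; split => v [] // [Tv h1] [_ h2].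
by apply: borelI; [exact: borel_flow_ball|exact: borel_far].
Qed.

Lemma measurable_escaping D n : 0 <= D -> measurable (escaping D n).
Proof.
move=> D0; pose p g : hpoint R := hact g x0; pose e : R := expR (- n%:R).
have e0 : 0 < e by exact: expR_gt0.
pose O : set R[i] := [set z | exists2 g, Gam g & hdist (p g) (z, e) < D].
have -> : escaping D n = ~` [set None] `&` ~` (Some @` O).
  apply/seteqP; split => [xi [z -> h]|[z|] [hN hO]]; last by case: hN.
    split => // -[z' [g Gg] + [ez]]; rewrite ez ltNge; apply/negP.
    by rewrite negbK; exact: h.
  exists z => // g Gg; rewrite leNgt; apply/negP => h; apply: hO; exists z => //.
  by exists g.
apply: measurableI; first by apply: measurableC; exact: measurable_None.
apply: measurableC; apply: open_bdry_measurable; apply: one_point_compactification_open_some.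
have -> : O = \bigcup_(g in Gam) [set z | hdist (p g) (z, e) < D].
  by apply/seteqP; split => z [g Gg h]; exists g.
apply: bigcup_open => g Gg.
have g0 : 0 < (p g).2 by exact: hact_gt0.
pose K := (ch D - 1) * (2 * (p g).2 * e) - ((p g).2 - e) ^+ 2.
have -> : [set z | hdist (p g) (z, e) < D] = [set z | normc (z - (p g).1) ^+ 2 < K].
  by apply/seteqP; split => z /=; rewrite [hdist _ _ < _]ltNge hdist_ge_poly //= -ltNge (le_normcB z) /K ltrBrDr.
have [K0|K0] := leP K 0.
  rewrite (_ : [set z | _] = set0); first exact: open0.
  apply/seteqP; split => // z /= h; have := le_lt_trans (sqr_ge0 _) (lt_le_trans h K0).
  by rewrite ltxx.
rewrite (_ : [set z | _] = [set z | normc (z - (p g).1) < Num.sqrt K]); first exact: open_normc_lt.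
have e1 z : (normc (z - (p g).1) ^+ 2 < K) = (normc (z - (p g).1) < Num.sqrt K).
  by rewrite -ltr_sqrt // sqrtr_sqr ger0_norm // normc_ge0'.
by apply/seteqP; split => z /=; rewrite e1.
Qed.

End ReturningSets.

(** * A lower bound for the Gibbs density *)

Section GibbsNonEscape.
Context {R : realType}.
Variables (Kh : set R[i]) (cK : closed_subfield Kh) (clK : closed Kh).
Variables (Gam : set (PSL2 R)) (x0 : hpoint R).
Hypotheses (GK : forall g, Gam g -> matK Kh g) (GV : forall g, Gam g -> Gam g^-1%g).
Hypotheses (G1 : Gam 1%g) (GM : forall g h, Gam g -> Gam h -> Gam (g * h)%g).
Hypothesis ux0 : upper Kh x0.
Hypothesis proper : forall D : R, finite_set [set g | Gam g /\ hdist x0 (hact g x0) <= D].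
Variables (F : vect R -> R) (a c : R).
Hypotheses (hF : holder_with Kh F a c) (iF : invariant_under Kh Gam F).
Hypothesis dflip : crit_delta Gam x0 (F \o @flip R) = crit_delta Gam x0 F.
Implicit Types (v w : vect R) (u z : R[i]) (g : PSL2 R).

Local Notation G := (fun w => F w - crit_delta Gam x0 F).
Local Notation J := (segment_int G).
Let rK := closed_subfield_real cK.
Let K0 := closed_subfield0 cK.
Let x00 : 0 < x0.2. Proof. by case: ux0. Qed.
Let hG := holder_withB (crit_delta Gam x0 F) hF.
Let iG : invariant_under Kh Gam G := invariantB iF _.

(** The forward cocycle is minus the integral over the segment from w_0 to w_t, the backward one is
    plus the same integral; the main terms cancel, so the density is bounded below uniformly in
    t. *)
Lemma gibbs_density (D : R) : 0 <= D -> exists2 B : R, 0 <= B & forall w t, T1 Kh w -> 0 <= t ->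
  hdist x0 (foot w) <= D ->
  - B <= cocycle Kh Gam x0 (F \o @flip R) (vminus w) x0 (foot (flow t w)) +
         cocycle Kh Gam x0 F (vplus w) x0 (foot (flow t w)).
Proof.
move=> D0; have [B B0 hB] := coc_flow cK GK GV G1 ux0 hG iG D0.
have [B' B0' hB'] := coc_flow_neg cK GK GV G1 ux0 (holder_with_flip cK hG) (invariant_flip cK iG) D0.
exists (B + B') => [|w t Tw t0 dw]; first exact: addr_ge0.
have d0 : hdist x0 x0 <= D by rewrite hdistxx.
have Tf := T1_flip rK Tw.
have h1 := hB w x0 t Tw ux0 t0 d0 dw.
have := hB' (flip w) x0 (- t) Tf ux0; rewrite oppr_le0 foot_flip => /(_ t0 d0 dw).
rewrite flow_flip opprK !foot_flip -(vminus_flip cK Tw).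
have uw : upper Kh (foot w) by rewrite -(flow0 w); exact: foot_flow_upper.
rewrite -(segment_rev cK uw (foot_flow_upper t rK Tw)); last first.
  by move=> v Tv; exact: (continuous_flow cK hG Tv).
have -> : cocycle Kh Gam x0 (F \o @flip R) (vminus w) x0 (foot (flow t w)) =
    coc Kh (G \o @flip R) (vminus w) x0 (foot (flow t w)) by rewrite /cocycle dflip.
rewrite cocycleE; move: h1; move: (coc _ _ _ _ _) (coc _ _ _ _ _) (J _ _) => k1 k2 k3.
by rewrite !ler_norml => /andP[h1 _] /andP[h2 _]; lra.
Qed.

End GibbsNonEscape.

Lemma unit_step {R : realType} (n t : R) : n <= t -> t <= n + 1 -> `|- t - - n| <= 1.
Proof. by move=> h1 h2; rewrite ler_norml; apply/andP; split; lra. Qed.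

Lemma time_step {R : realType} (n t T D : R) : n <= t -> t <= n + 1 -> `|T - t| <= 2 * D ->
  `|T - n| <= 1 + 2 * D.
Proof.
by move=> h1 h2; rewrite !ler_norml => /andP[q1 q2]; apply/andP; split; lra.
Qed.

(** * Lower bound of the lifted Gibbs measure by a product *)

Section LiftLower.
Context {R : realType}.
Variables (Kh : set R[i]) (cK : closed_subfield Kh).
Variables (Gam : set (PSL2 R)) (x0 : hpoint R) (F : vect R -> R).
Hypothesis ux0 : upper Kh x0.
Variables mu mu' : hpoint R -> {finite_measure set (bdry_borel R) -> \bar R}.
Hypothesis MK : measurable (Kbar Kh : set (bdry_borel R)).
Implicit Types (v w : vect R) (u z : R[i]) (g : PSL2 R).
Let rK := closed_subfield_real cK.
Let x00 : 0 < x0.2. Proof. by case: ux0. Qed.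

Local Notation density p q := (cocycle Kh Gam x0 (F \o @flip R) p.1.1 x0 q + cocycle Kh Gam x0 F p.1.2 x0 q).
Hypothesis density_ge : forall D, 0 <= D -> exists2 B : R, 0 <= B & forall w t, T1 Kh w -> 0 <= t ->
  hdist x0 (foot w) <= D -> - B <= cocycle Kh Gam x0 (F \o @flip R) (vminus w) x0 (foot (flow t w)) +
         cocycle Kh Gam x0 F (vplus w) x0 (foot (flow t w)).

Lemma hopf_near_axis v z z' (D : R) : Kh z -> Kh z' -> z != z' -> hdist x0 (axis_top z z') <= D ->
  T1 Kh v -> vplus v = Some z -> vminus v = Some z' ->
  hdist x0 (foot (flow (- hopf_time x0 v) v)) <= D /\
  exists2 T, `|T - hopf_time x0 v| <= 2 * D & foot v = foot (flow T (axis_vect z z')).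
Proof.
move=> Kz Kz' ne hD Tv ev ev'; have [_ [s hs]] := axis_unique cK Tv ev ev'.
have Ta := T1_axis cK Kz Kz' ne.
have et : foot (flow s v) = axis_top z z' by rewrite hs.
have h1 : hdist x0 (foot (flow (- hopf_time x0 v) v)) <= D.
  by apply: le_trans (hopf_timeP cK ux0 Tv s) _; rewrite et.
split=> //; exists (- s); last by rewrite -hs (flowD _ _ Tv) addNr flow0.
have t0 : 0 < (axis_top z z').2 by rewrite -et; exact: (foot_flow_gt0 _ Tv).
have f0 := foot_flow_gt0 (- hopf_time x0 v) Tv.
have := hdist_flow (- hopf_time x0 v) s Tv; rewrite et => e.
have tr := hdist_triangle f0 x00 t0; rewrite e in tr.
have -> : - s - hopf_time x0 v = - hopf_time x0 v - s by rewrite addrC.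
apply: (le_trans tr); rewrite hdist_sym; lra.
Qed.

(** In Hopf coordinates, a box with past endpoint near u', escaping future endpoint near u and time
    in [n, n + 1] is contained in [returning]. Its product measure is the product of the two
    masses. *)
Lemma lift_lower u u' : Kh u -> Kh u' -> u != u' -> exists D1 D3 c : R, [/\ 0 <= D1, 0 <= D3, 0 < c &
  forall (n : nat) D2, 0 <= D2 ->
  ((c * (rm (mu' x0) (Kbar Kh `&` bball u' (normc (u - u') / 4)) *
    rm (mu x0) (Kbar Kh `&` bball u (normc (u - u') / 4) `&` escaping Gam x0 (D2 + D3) n)))%:E <=
   gibbs_lift Kh Gam x0 F mu' mu (returning Kh Gam x0 D1 D2 n))%E].
Proof.
move=> Ku Ku' ne; have [D D0 hD] := top_near x00 Ku Ku' ne.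
have d0 := dist_gt0 ne; set d := normc (u - u') in d0 hD *.
have d20 : 0 < d / 2 by rewrite divr_gt0.
have dd : d / 2 <= 2 * d by rewrite ler_pdivrMr // -mulrA [d * 2]mulrC mulrA ler_peMl ?(ltW d0) //; lra.
have D20 : 0 <= 1 + 2 * D by lra.
have [D3 D30 hD3] := axis_vertical d20 dd D20.
have [B B0 hB] := density_ge D0.
(* The 1 pays for times ranging over [n, n + 1]; D3 compares the vector with the vertical geodesic
   over its endpoint. *)
exists (D + 1), D3, (expR (- B)); split => //; [lra|exact: expR_gt0|].
move=> n D2 D20'; set V := Kbar Kh `&` bball u' _; set W := _ `&` escaping _ _ _ _.
have mV : measurable (V : set (bdry_borel R)) by apply: measurableI => //; exact: measurable_bball.
have mW : measurable (W : set (bdry_borel R)).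
  apply: measurableI; last by apply: measurable_escaping => //; exact: addr_ge0.
  by apply: measurableI => //; exact: measurable_bball.
pose I : set R := `[n%:R, n.+1%:R]%classic.
pose P : set (bdry_borel R * bdry_borel R * R) := (V `*` W) `*` I.
have key p v : P p -> T1 Kh v -> hopf x0 v = p -> returning Kh Gam x0 (D + 1) D2 n v /\
    - B <= density p (foot v).
  case: p => -[xi' xi] t [[/= [Kxi' b'] [[Kxi b] esc]] It] Tv [em ep et].
  case: xi' Kxi' b' em => [z'|] Kz' b' em; last by case: b'.
  case: xi Kxi b esc ep => [z|] Kz b esc ep; last by case: b.
  move/bballP: b' => b'; move/bballP: b => b; have [h1 h2 h3] := hD z z' b b'.
  have nz : z != z' by rewrite -subr_eq0 -normc_gt0 (lt_le_trans d20 h1).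
  have [k1 [T k2 k3]] := hopf_near_axis Kz Kz' nz h3 Tv ep em; rewrite et in k1 k2.
  have /andP[i1 i2] : n%:R <= t <= n.+1%:R by move: It; rewrite /I /= in_itv.
  have t0 : 0 <= t by apply: le_trans i1.
  have i3 : t <= n%:R + 1 by move: i2; rewrite -[n.+1%:R]natr1.
  have n0 : 0 <= n%:R :> R by [].
  have ev : flow t (flow (- t) v) = v by rewrite (flowD _ _ Tv) subrr flow0.
  have fv0 : 0 < (foot v).2 by exact: (T1_gt0 Tv).
  split; last first.
    have Tw := T1_flow (- t) rK Tv.
    have := hB (flow (- t) v) t Tw t0 k1; rewrite ev.
    by rewrite (vminus_flow (- t) rK Tv) (vplus_flow (- t) rK Tv) em ep.
  split => // [|g Gg].
    have f1 := foot_flow_gt0 (- t) Tv; have f2 := foot_flow_gt0 (- n%:R) Tv.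
    have tr := hdist_triangle x00 f1 f2; rewrite (hdist_flow _ _ Tv) in tr.
    exact: le_trans tr (lerD k1 (unit_step i1 i3)).
  have [y ey hy] := esc; case: ey => ey; rewrite -ey in hy.
  have hy' := hy g Gg; have g0 := hact_gt0 g x00.
  have e0 : 0 < (z, expR (- n%:R) : R).2 by exact: expR_gt0.
  have ab : `|T - n%:R| <= 1 + 2 * D.
    exact: time_step i1 i3 k2.
  have k4 := hD3 z z' T n%:R h1 h2 ab n0; rewrite -k3 in k4.
  have tr := hdist_triangle g0 fv0 e0; rewrite hdist_sym in k4.
  by rewrite -(lerD2r D3); exact: le_trans hy' (le_trans tr (lerD (lexx _) k4)).
have inhabited p : P p -> exists v, T1 Kh v /\ hopf x0 v = p.
  case: p => -[xi' xi] t [[/= [Kxi' b'] [[Kxi b] esc]] It].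
  case: xi' Kxi' b' => [z'|] Kz' b'; last by case: b'.
  case: xi Kxi b esc => [z|] Kz b esc; last by case: b.
  move/bballP: b' => b'; move/bballP: b => b; have [h1 h2 h3] := hD z z' b b'.
  have nz : z != z' by rewrite -subr_eq0 -normc_gt0 (lt_le_trans d20 h1).
  have Ta := T1_axis cK Kz Kz' nz; have [ep em] := vplus_axis cK Kz Kz' nz.
  exists (flow (t - hopf_time x0 (axis_vect z z')) (axis_vect z z')); split; first exact: T1_flow.
  rewrite /hopf (vminus_flow _ rK Ta) (vplus_flow _ rK Ta) (hopf_time_flow cK ux0 _ Ta) ep em.
  by rewrite addrC subrK.
have mP : measurable (P : set (bdry_borel R * bdry_borel R * R)).
  apply: measurableX; last exact: measurable_itv.
  exact: measurableX.
rewrite /gibbs_lift.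
apply: (@le_trans _ _ (\int[mu' x0 \x mu x0 \x (@lebesgue_measure R)]_(p in P) (expR (- B))%:E)%E).
  have mI : measurable I by exact: measurable_itv.
  have leI : lebesgue_measure I = 1%E :> \bar R.
    by rewrite lebesgue_measure_itv /= lte_fin ltr_nat ltnSn -EFinB -[n.+1%:R]natr1 addrC addKr.
  have e1 := product_measure1E (mu' x0) (mu x0) mV mW.
  have e2 := product_measure1E (mu' x0 \x mu x0)%E (@lebesgue_measure R) (measurableX mV mW) mI.
  rewrite integral_cst //.
  rewrite [X in (_ <= _ * X)%E](_ : _ = ((mu' x0 V * mu x0 W) * 1)%E); last by rewrite -leI -e1; exact: e2.
  rewrite mule1 -(rmK (mu' x0) mV) -(rmK (mu x0) mW) -!EFinM; exact: lexx.
apply: ge0_integral_mono => [p _|p _|p Pp|p Pp]; try by rewrite lee_fin expR_ge0.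
- have [v [Tv hv]] := inhabited p Pp; have [h1 _] := key p v Pp Tv hv.
  by exists v.
- have [T' h'] : T1 Kh (hopf_inv Kh x0 p) /\ hopf x0 (hopf_inv Kh x0 p) = p.
    exact: (@xgetPex _ (x0, (0, 1)) [set v | T1 Kh v /\ hopf x0 v = p] (inhabited p Pp)).
  by have [_ h2] := key p _ Pp T' h'; rewrite lee_fin ler_expR.
Qed.

End LiftLower.

(** * Smallness of the far part of the quotient *)

Section QuotientEscape.
Context {R : realType}.
Variables (Kh : set R[i]) (cK : closed_subfield Kh) (clK : closed Kh).
Variables (Gam : set (PSL2 R)) (x0 : hpoint R) (F : vect R -> R).
Hypotheses (GK : forall g, Gam g -> matK Kh g) (GV : forall g, Gam g -> Gam g^-1%g).
Hypotheses (G1 : Gam 1%g) (GM : forall g h, Gam g -> Gam h -> Gam (g * h)%g).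
Hypothesis x00 : 0 < x0.2.
Hypothesis proper : forall D : R, finite_set [set g | Gam g /\ hdist x0 (hact g x0) <= D].
Variables mu mu' : hpoint R -> {finite_measure set (bdry_borel R) -> \bar R}.
Variable mF : {measure set (quotient_T1 Kh Gam) -> \bar R}.
Hypothesis hmF : gibbs_measure x0 F mu' mu mF.
Hypothesis hmF_fin : (mF (T1 Kh) < +oo)%E.
Implicit Types (v w : vect R) (u z : R[i]) (g : PSL2 R).

Definition far (D : R) : set (vect R) :=
  T1 Kh `&` [set v | forall g, Gam g -> D <= hdist (hact g x0) (foot v)].

Lemma foot_tact0 g v : T1 Kh v -> foot (tact g v) = hact g (foot v).
Proof. by move=> Tv; have := foot_tact g 0 Tv; rewrite !flow0. Qed.

Lemma far_tact D g v : Gam g -> T1 Kh v -> far D (tact g v) <-> far D v.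
Proof.
move=> Gg Tv; have Tg := T1_tact cK (GK Gg) Tv; have v0 : 0 < (foot v).2 := T1_gt0 Tv.
split=> -[_ h]; split=> // h' Gh'.
  have := h _ (GM Gg Gh'); rewrite (foot_tact0 g Tv) hactM //.
  by rewrite hdist_hact //; exact: hact_gt0.
rewrite (foot_tact0 g Tv); have := h _ (GM (GV Gg) Gh').
have g0 : 0 < (hact (g^-1 * h')%g x0).2 by exact: hact_gt0.
have -> : hact h' x0 = hact g (hact (g^-1 * h')%g x0) by rewrite -hactM // mulgA mulgV mul1g.
by rewrite (hdist_hact g g0 v0).
Qed.

Lemma measurable_far D : 0 <= D -> measurable (far D : set (quotient_T1 Kh Gam)).
Proof.
move=> D0; apply: sub_sigma_algebra; split; first exact: borel_far.
by move=> g v; exact: far_tact.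
Qed.

Lemma measurable_T1 : measurable (T1 Kh : set (quotient_T1 Kh Gam)).
Proof.
apply: sub_sigma_algebra; split; first exact: borel_T1.
by move=> g v Gg Tv; split => // _; exact: T1_tact cK (GK Gg) Tv.
Qed.

(** If g and g0 both bring the point of v at time -n within D1 of x0, then g g0^-1 displaces x0 by
    at most 2 D1. Proper discontinuity bounds the count, independently of n. *)
Lemma returning_count D1 : exists M : nat, forall D2 n v, 0 <= D2 -> T1 Kh v ->
  (counting [set g | Gam g /\ returning Kh Gam x0 D1 D2 n (tact g v)] <=
   (cst M%:R%:E \_ (far D2)) v :> \bar R)%E.
Proof.
have /finite_seqP[s hs] := proper (D1 + D1); exists (size s) => D2 n v D20 Tv.
have farP g : Gam g -> returning Kh Gam x0 D1 D2 n (tact g v) -> far D2 v.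
  by move=> Gg [T h1 h2]; apply/(far_tact D2 Gg Tv).
rewrite /patch; case: ifPn => [_|/negP nf]; last first.
  by apply: (@counting_le_size _ R 1%g _ [::]) => g [Gg /(farP _ Gg)] /mem_set.
have [[g0 [Gg0 [_ h0 _]]]|ng] := pselect (exists g, Gam g /\ returning Kh Gam x0 D1 D2 n (tact g v)); last first.
  apply: (@le_trans _ _ 0%E); last by rewrite lee_fin.
  by apply: (@counting_le_size _ R 1%g _ [::]) => g hg; case: ng; exists g.
rewrite /cst -(size_map (fun k : PSL2 R => (k * g0)%g) s).
apply: (@counting_le_size _ R 1%g) => g [Gg [_ h1 _]].
have f0 := foot_flow_gt0 (- n%:R) Tv.
rewrite !(foot_tact _ _ Tv) in h0 h1.
apply/mapP; exists (g * g0^-1)%g; last by rewrite -mulgA mulVg mulg1.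
have : [set` s] (g * g0^-1)%g; last by [].
rewrite -hs; split; first exact: GM Gg (GV Gg0).
have gp0 : 0 < (hact g (foot (flow (- n%:R) v))).2 by exact: hact_gt0.
have gx0 : 0 < (hact (g * g0^-1)%g x0).2 by exact: hact_gt0.
apply: le_trans (hdist_triangle x00 gp0 gx0) (lerD h1 _).
rewrite hactM // hdist_hact //; last exact: hact_gt0.
rewrite -(hactK g0 f0) hdist_hact //; last exact: hact_gt0.
by rewrite hdist_sym.
Qed.

Lemma far_cvg : (fun k : nat => mF (far k%:R)) @ \oo --> 0%E.
Proof.
have -> : 0%E = mF (\bigcap_k far k%:R).
  rewrite (_ : \bigcap_k _ = set0) ?measure0 //; apply/seteqP; split => // v hv.
  have [k hk] : exists k : nat, hdist x0 (foot v) < k%:R.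
    by exists (Num.truncn (hdist x0 (foot v))).+1; exact: truncnS_gt.
  by have [_ /(_ 1%g G1)] := hv k I; rewrite hact1 leNgt hk.
apply: nonincreasing_cvg_mu => [|k||k l kl].
- apply: le_lt_trans hmF_fin; apply: le_measure; rewrite ?inE //.
  + exact: measurable_far.
  + exact: measurable_T1.
  + exact: subIsetl.
- exact: measurable_far.
- by apply: bigcap_measurable => // k _; exact: measurable_far.
- apply/subsetPset => v [Tv hv]; split => // g Gg.
  by apply: le_trans (hv g Gg); rewrite ler_nat.
Qed.

(** The lift is the integral of the count, at most M times the measure of the far part; the latter
    decreases to 0 because the Gibbs measure is finite. *)
Lemma quotient_escape D1 eps : 0 <= D1 -> 0 < eps -> exists2 D2 : R, 0 <= D2 &
  forall n, (gibbs_lift Kh Gam x0 F mu' mu (returning Kh Gam x0 D1 D2 n) <= eps%:E)%E.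
Proof.
move=> D10 eps0; have [M hM] := returning_count D1.
have M0 : 0 < eps / M.+1%:R by rewrite divr_gt0.
have [k hk] : exists k : nat, (mF (far k%:R) <= (eps / M.+1%:R)%:E)%E.
  have /fine_cvgP[fk /cvgr0_norm_lt/(_ _ M0)hc] := far_cvg.
  near \oo => k; exists k; have h1 : mF (far k%:R) \is a fin_num by near: k.
  have h2 : `|fine (mF (far k%:R))| < eps / M.+1%:R by near: k.
  by rewrite -(fineK h1) lee_fin; apply: le_trans (ler_norm _) (ltW h2).
have k0 : 0 <= k%:R :> R by [].
exists k%:R => // n.
have bR : <<s @open (vect R) >> (returning Kh Gam x0 D1 k%:R n) by exact: borel_returning.
have rT : returning Kh Gam x0 D1 k%:R n `<=` T1 Kh by move=> v [].
rewrite (hmF bR rT).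
apply: (@le_trans _ _ (\int[mF]_(v in T1 Kh) (cst M%:R%:E \_ (far k%:R)) v)%E).
  apply: ge0_integral_mono => // v Tv; last exact: hM.
    by rewrite /counting; case: ifP => _; rewrite ?leey // lee_fin.
  by rewrite /patch; case: ifP => // _; rewrite lee_fin.
rewrite -integral_mkcondr (_ : T1 Kh `&` far k%:R = far k%:R); last by rewrite /far setIA setIid.
rewrite integral_cst; last exact: measurable_far.
apply: (@le_trans _ _ (M%:R%:E * (eps / M.+1%:R)%:E)%E); first by apply: lee_wpmul2l => //; rewrite lee_fin.
by rewrite -EFinM lee_fin mulrA ler_pdivrMr // mulrC ler_pM2l // ler_nat; exact: leqnSn.
Unshelve. all: by end_near.
Qed.

End QuotientEscape.

(** * Patterson measures charge the boundary of the half-space over K *)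

Section SupportInKbar.
Context {R : realType} {K : fieldExtType rat}.
Local Notation Kb := (Kbar (Khat K) : set (bdry_borel R)).

Lemma closed_Khat : closed (Khat K : set R[i]).
Proof.
rewrite -[X in closed X]setCK; apply: open_closedC; apply: openC => z /Khat_open_compl[e e0 he].
by exists e.
Qed.

Variables (Gam : set (PSL2 R)) (x0 : hpoint R).
Hypotheses (GK : forall g, Gam g -> matK (Khat K) g) (ux0 : upper (Khat K) x0).

Lemma limit_set_Kbar : limit_set Gam x0 `<=` Kb.
Proof.
move=> [z|] // [s Gs /tends_to_some h]; apply: contrapT => /Khat_open_compl[e e0 he].
have [n [h1 _]] := filter_ex (h e e0).
by apply: (he _ h1); have [] := upper_hact (Khat_closed_subfield K) (GK (Gs n)) ux0.
Qed.

Lemma rational_ball (z : R[i]) (e : R) : 0 < e -> exists a b q : rat,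
  normc (z - (ratr a +i* ratr b)%C) < ratr q /\
  forall w : R[i], normc (w - (ratr a +i* ratr b)%C) < ratr q -> normc (w - z) < e.
Proof.
move=> e0; have l (x : R) : x - e / 8 < x + e / 8 by lra.
have [a] := rat_in_itvoo (l (reC z)); have [b] := rat_in_itvoo (l (imC z)).
have l2 : e / 4 < e / 2 by lra.
have [q] := rat_in_itvoo l2; rewrite !in_itv /= => /andP[q1 q2] /andP[b1 b2] /andP[a1 a2].
exists a, b, q; set y := (_ +i* _)%C.
have h : normc (z - y) < ratr q.
  apply: le_lt_trans (normc_le_reim _) _; rewrite reCD reCN imCD imCN /y /=.
  have n1 : `|reC z - ratr a| < e / 8 by rewrite ltr_norml; apply/andP; split; lra.
  have n2 : `|imC z - ratr b| < e / 8 by rewrite ltr_norml; apply/andP; split; lra.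
  lra.
split => // w hw; have t := normc_triangle w y z; rewrite (le_normcB z y) in h; lra.
Qed.

Variables (F : vect R -> R) (mu : hpoint R -> {finite_measure set (bdry_borel R) -> \bar R}).
Hypothesis hmu : patterson_density (Khat K) Gam x0 F mu.

(** The measures live on the whole Riemann sphere. Outside [Kbar] every point has a null
    neighbourhood, as the limit set lies in [Kbar]; if [Kbar] were null too, countably many null
    sets would cover the sphere. *)
Lemma patterson_Kbar_gt0 : 0 < rm (mu x0) Kb.
Proof.
rewrite lt0r rm_ge0 andbT; apply/eqP => Kb0; have [/(_ _ ux0)[m0 sup] _ _] := hmu.
pose B (t : rat * rat * rat) : set (bdry_borel R) := bball (ratr t.1.1 +i* ratr t.1.2)%C (ratr t.2).
(* Index 0 is [Kbar]; the others enumerate the balls with rational data, those of positive mass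
   being replaced by the empty set. *)
pose F' n : set (bdry_borel R) := if n is n'.+1 then
  (if @unpickle (rat * rat * rat)%type n' is Some t then (if rm (mu x0) (B t) == 0 then B t else set0) else set0)
  else Kb.
have mF' n : measurable (F' n).
  rewrite /F'; case: n => [|n]; first exact: Kbar_measurable.
  by case: unpickle => // t; case: ifP => // _; exact: measurable_bball.
have F0 n : rm (mu x0) (F' n) = 0.
  rewrite /F'; case: n => [|n] //.
  by case: unpickle => [t|]; [case: ifP => [/eqP //|_]|]; exact: rm0.
apply: m0; rewrite -(rmK (mu x0) measurableT); congr EFin.
apply: (rm_bigcup0 (m := mu x0) mF' F0 measurableT) => xi _.
have [Kxi|nK] := pselect (Kb xi); first by exists 0%N.
case: xi nK => [z|] nK; last by case: nK.
have : ~ msupport (mu x0) (Some z) by rewrite sup => /limit_set_Kbar.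
move=> /existsNP[U /not_implyP[oU /not_implyP[Uz nU]]].
have U0 : mu x0 U = 0%E.
  by apply/eqP; rewrite eq_le measure_ge0 andbT leNgt; apply/negP.
have /nbhsC[e e0 he] : nbhs z (Some @^-1` U).
  by apply: one_point_compactification_some_continuous; exact: open_nbhs_nbhs.
have [a [b [q [h1 h2]]]] := rational_ball z e0.
have BU : B (a, b, q) `<=` U by move=> _ [w hw <-]; apply: he; exact: h2.
exists (pickle (a, b, q)).+1; first exact: I.
rewrite /F' pickleK.
have -> : rm (mu x0) (B (a, b, q)) = 0.
  apply/eqP; rewrite eq_le rm_ge0 andbT.
  apply: le_trans (rm_le (mu x0) (measurable_bball _ _) (open_bdry_measurable oU) BU) _.
  by rewrite /rm U0.
by rewrite eqxx; apply/bballP.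
Qed.

End SupportInKbar.

Lemma inv_scale_le {R : realType} (x y h : R) : 0 < x -> x <= y -> 0 < h -> (y * h)^-1 <= (x * h)^-1.
Proof.
move=> x0 xy h0; rewrite lef_pV2 ?ler_pM2r // posrE mulr_gt0 //; exact: lt_le_trans xy.
Qed.

(** * Inequalities for transporting approximations by the group *)

Section TransportEstimates.
Context {R : realType}.
Variables J : R.
Hypothesis J0 : 0 < J.
Let J2 : 0 < J ^+ 2. Proof. by rewrite exprn_gt0. Qed.

Lemma modulus_window (p b : R) : `|p - J| <= b -> b <= J / 2 -> J / 2 <= p /\ p <= 2 * J.
Proof. by move=> h1 h2; have := le_trans h1 h2; rewrite ler_norml => /andP[p1 p2]; split; lra. Qed.

Lemma modulus_product (p q : R) : J / 2 <= p -> p <= 2 * J -> J / 2 <= q -> q <= 2 * J ->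
  J ^+ 2 / 4 <= p * q /\ p * q <= 4 * J ^+ 2.
Proof.
move=> p1 p2 q1 q2; have J20 : 0 <= J / 2 by rewrite divr_ge0 // ltW.
have p0 : 0 <= p by exact: le_trans p1. have q0 : 0 <= q by exact: le_trans q1.
have -> : J ^+ 2 / 4 = J / 2 * (J / 2) by field.
have -> : 4 * J ^+ 2 = 2 * J * (2 * J) by ring.
by split; apply: ler_pM.
Qed.

Lemma ln_window (m lo hi : R) : 0 < lo -> lo <= m -> m <= hi -> `|ln m| <= `|ln lo| + `|ln hi|.
Proof.
move=> l0 h1 h2; have m0 : 0 < m by exact: lt_le_trans h1.
have h0 : 0 < hi by exact: lt_le_trans h2.
have l1 : ln lo <= ln m by rewrite ler_ln.
have l2 : ln m <= ln hi by rewrite ler_ln.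
have a1 := ler_norm (- ln lo); have a2 := ler_norm (ln hi); rewrite normrN in a1.
have a3 := normr_ge0 (ln lo); have a4 := normr_ge0 (ln hi).
by rewrite ler_norml; apply/andP; split; lra.
Qed.

Lemma transport_le (s s' h m p k l A : R) : 0 < s -> 0 < s' -> 0 < h -> 0 < m -> 0 < k -> 0 < l ->
  s <= A * s' -> m <= 4 * J ^+ 2 -> J / 2 <= p -> 8 * A * l <= k ->
  s / (k * h) / (J * p) <= s' / (l * (h * m)).
Proof.
move=> s0 s0' h0 m0 k0 l0 ss m4 jp kl; have p0 : 0 < p by apply: lt_le_trans jp; rewrite divr_gt0.
rewrite ler_pdivlMr ?mulr_gt0 //.
have -> : s / (k * h) / (J * p) * (l * (h * m)) = s / k * (m / (J * p)) * l by field; rewrite !gt_eqF.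
have mJ : m / (J * p) <= 8.
  rewrite ler_pdivrMr ?mulr_gt0 //; apply: (le_trans m4).
  by have := ler_wpM2l (ltW J0) jp; rewrite expr2; lra.
apply: (@le_trans _ _ (s / k * 8 * l)); first by rewrite ler_pM2r // ler_pM2l // divr_gt0.
have -> : s / k * 8 * l = s * (8 * l) / k by field; rewrite gt_eqF.
rewrite ler_pdivrMr //; apply: (@le_trans _ _ (A * s' * (8 * l))); first by rewrite ler_pM2r // mulr_gt0.
have -> : A * s' * (8 * l) = s' * (8 * A * l) by ring.
by rewrite ler_pM2l.
Qed.

Lemma level_requirements (A cc S l : R) : 1 <= A -> 0 <= cc -> 0 < l ->
  S = 1 + 6 * cc / J + 4 * l / J ^+ 2 + 8 * A * l ->
  [/\ 1 <= S, 6 * cc / J <= S, 4 * l / J ^+ 2 <= S & 8 * A * l <= S].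
Proof.
move=> A1 c0 l0 ->; have A0 : 0 < A by exact: lt_le_trans A1.
have s1 : 0 <= 6 * cc / J by rewrite divr_ge0 ?mulr_ge0 // ltW.
have s2 : 0 <= 4 * l / J ^+ 2 by rewrite divr_ge0 ?mulr_ge0 // ltW.
have s3 : 0 <= 8 * A * l by rewrite !mulr_ge0 // ltW.
by split; lra.
Qed.

End TransportEstimates.

Lemma ratio_balanced {R : realType} (x y m : R) : 0 <= m -> `|x - m| <= m / 2 -> `|y - m| <= m / 2 ->
  x <= 3 * y.
Proof. by move=> m0; rewrite !ler_norml => /andP[h1 h2] /andP[h3 h4]; lra. Qed.

(** * Inequalities for images of the axis seen near their top *)

Section BalancedEstimates.
Context {R : realType}.
Variables (a b d C e E : R).
Hypotheses (a0 : 0 < a) (b0 : 0 < b) (d0 : 0 < d) (C0 : 0 < C) (E0 : 0 < E) (Ee : E * e = 1).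
Hypotheses (q1 : a <= 3 * b) (q2 : b <= 3 * a).
Let S0 : 0 < a ^+ 2 + b ^+ 2. Proof. by rewrite addr_gt0 // exprn_gt0. Qed.

Lemma weighted_sub (r r' : R[i]) : ((a ^+ 2)%:C%C * r + (b ^+ 2)%:C%C * r') / (a ^+ 2 + b ^+ 2)%:C%C - r =
  (b ^+ 2 / (a ^+ 2 + b ^+ 2))%:C%C * (r' - r).
Proof.
have Sc : (a ^+ 2 + b ^+ 2)%:C%C != 0 by apply: realC_neq0; rewrite gt_eqF.
by move: Sc; rewrite !RCE => Sc; field; exact: Sc.
Qed.

Lemma balanced_gap : d / (a ^+ 2 + b ^+ 2) <= C * e ->
  b ^+ 2 / (a ^+ 2 + b ^+ 2) * (d / (a * b)) <= 3 * (C * e).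
Proof.
move=> h; rewrite (_ : _ * _ = b / a * (d / (a ^+ 2 + b ^+ 2))); last by field; rewrite !gt_eqF.
by apply: ler_pM => //; rewrite ?divr_ge0 ?(ltW b0) ?(ltW a0) ?(ltW d0) ?(ltW S0) // ler_pdivrMr.
Qed.

Lemma balanced_lower : d / (a ^+ 2 + b ^+ 2) <= C * e -> E / (4 * C) <= 2 * (a * b) / d.
Proof.
rewrite ler_pdivrMr // => h; rewrite ler_pdivrMr ?mulr_gt0 // mulrAC ler_pdivlMr //.
have h1 := ler_wpM2l (ltW E0) h; rewrite (_ : E * (C * e * _) = E * e * (C * (a ^+ 2 + b ^+ 2))) in h1; last by ring.
rewrite Ee mul1r in h1; apply: (le_trans h1).
have h2 := ler_wpM2l (ltW a0) q1; have h3 := ler_wpM2l (ltW b0) q2; have h4 := mulr_gt0 a0 b0.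
have : a ^+ 2 + b ^+ 2 <= 8 * (a * b) by rewrite !expr2; lra.
by move=> h5; have := ler_wpM2l (ltW C0) h5; lra.
Qed.

Lemma balanced_upper : e <= C * (d / (a ^+ 2 + b ^+ 2)) -> 2 * (a * b) / d <= 4 * C * E.
Proof.
rewrite mulrA ler_pdivlMr // => h; rewrite ler_pdivrMr //.
have h1 := ler_wpM2l (ltW E0) h; rewrite mulrA Ee mul1r in h1.
have h2 := sqr_ge0 (a - b); have h3 : 0 <= E * (C * d) by rewrite !mulr_ge0 // ltW.
have e2 : (a - b) ^+ 2 = a ^+ 2 + b ^+ 2 - 2 * (a * b) by ring.
have e3 : 4 * C * E * d = 4 * (E * (C * d)) by ring.
by rewrite e3; lra.
Qed.
End BalancedEstimates.

(** * The truncated rate function *)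

Section Rate.
Context {R : realType} (phi : R -> R).
Hypotheses (hphi : forall t : R, 0 <= t -> 0 < phi t).
Hypothesis hslow : slowly_varying (fun t => phi (expR t)).

(** Truncation keeps radius times height bounded, as the ball estimates require, and it preserves
    both slow variation and divergence. *)
Definition rate (t : R) : R := Num.min (phi t) 1.

Lemma rate_gt0 t : 0 <= t -> 0 < rate t.
Proof. by move=> t0; rewrite lt_min ltr01 andbT; exact: hphi. Qed.

Lemma rate_le1 t : rate t <= 1.
Proof. by rewrite ge_min lexx orbT. Qed.

Lemma rate_slow (A s t : R) : 1 <= A -> phi s <= A * phi t -> rate s <= A * rate t.
Proof.
move=> A1 h; have A0 : 0 < A by exact: lt_le_trans A1.
by rewrite /rate minr_pMr ?(ltW A0) // le_min mulr1 !ge_min h A1 orbT.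
Qed.

Lemma rate_scale (L : R) : 0 <= L -> exists2 A, 1 <= A & forall s t, 1 <= s -> 1 <= t ->
  `|ln s - ln t| <= L -> rate s <= A * rate t.
Proof.
move=> /(slow_scale hslow)[A A1 hA]; exists A => // s t s1 t1 st; apply: rate_slow => //.
have s0 : 0 < s by exact: lt_le_trans s1. have t0 : 0 < t by exact: lt_le_trans t1.
by have := hA _ _ (ln_ge0 t1) (ln_ge0 s1); rewrite !lnK // distrC => /(_ st).
Qed.

Variables (k : R) (L : nat).
Hypotheses (k0 : 0 <= k) (L0 : (0 < L)%N).

Local Notation b i := (rate (expR (i * L)%:R) `^ k).

Lemma rate_series_diverges : (\int[lebesgue_measure]_(t in (`[1%R, +oo[ : set R)) (phi t `^ k / t)%:E)%E = +oo%E ->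
  forall (p : nat) (M : R), exists q, M <= \sum_(p <= i < q) b i.
Proof.
move=> Joo p M; apply: contrapT => hn.
have hM q : \sum_(p <= i < q) b i <= M by rewrite leNgt; apply/negP => h; apply: hn; exists q; exact: ltW.
have b0 i : 0 <= b i by exact: powR_ge0.
(* Otherwise infinitely many truncated terms equal 1 and the partial sums are already unbounded.
   From i0 on, truncation changes nothing. *)
have [i0 hi0] : exists i0 : nat, forall i, (i0 <= i)%N -> phi (expR (i * L)%:R) < 1.
  apply: contrapT => hi.
  have big i0 : exists2 i, (i0 <= i)%N & b i = 1.
    have [i hi'] : exists i, ~ ((i0 <= i)%N -> phi (expR (i * L)%:R) < 1).
      by apply/existsNP => h; apply: hi; exists i0.
    move/not_implyP: hi' => [h1 h2]; exists i => //.
    move/negP: h2; rewrite -leNgt => h2.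
    by rewrite /rate min_r // powR1.
  have grow (m : nat) : exists2 q, (p <= q)%N & m%:R <= \sum_(p <= i < q) b i.
    elim: m => [|m [q pq IH]]; first by exists p => //; rewrite big_geq.
    have [i qi bi] := big q; exists i.+1; first by rewrite (leq_trans pq) // (leq_trans qi).
    rewrite big_nat_recr /=; last exact: leq_trans qi.
    rewrite bi -natr1 lerD2r; apply: (le_trans IH).
    by rewrite [leRHS](big_cat_nat pq qi) /= lerDl; apply: sumr_ge0 => *; exact: b0.
  have [q _ hq] := grow (Num.truncn `|M|).+1.
  have := le_lt_trans (ler_norm M) (truncnS_gt `|M|).
  by move=> /lt_le_trans /(_ hq); rewrite ltNge hM.
pose i1 := maxn i0 p.
pose T := \sum_(0 <= i < i1) phi (expR (i * L)%:R) `^ k.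
have f0 i : 0 <= phi (expR (i * L)%:R) `^ k by exact: powR_ge0.
have bnd q : \sum_(0 <= i < q) phi (expR (i * L)%:R) `^ k <= T + M.
  have M0 : 0 <= M by have := hM p; rewrite big_geq.
  have [qi|iq] := leqP q i1.
    apply: (@le_trans _ _ T); last by rewrite lerDl.
    by rewrite /T [leRHS](big_cat_nat (leq0n q) qi) /= lerDl; apply: sumr_ge0.
  rewrite (big_cat_nat (leq0n i1) (ltnW iq)) /= lerD2l.
  apply: le_trans (hM q); rewrite [leRHS](big_cat_nat (leq_maxr i0 p) (ltnW iq)) /= -[leLHS]add0r.
  apply: lerD; first by apply: sumr_ge0.
  rewrite big_nat [leRHS]big_nat; apply: ler_sum => i /andP[h1 h2].
  by rewrite /rate min_l // ltW // hi0 // (leq_trans (leq_maxl i0 p)).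
by have := integral_bounded hslow k0 L0 bnd; rewrite Joo ltxx.
Qed.

End Rate.

Lemma powR_window {R : realType} (k C t z : R) : 0 <= k -> 0 < C -> 0 < t -> C^-1 <= z -> z <= C ->
  (t * z) `^ k <= C `^ k * t `^ k /\ C^-1 `^ k * t `^ k <= (t * z) `^ k.
Proof.
move=> k0 C0 t0 z1 z2; have C1 : 0 < C^-1 by rewrite invr_gt0.
have z0 : 0 < z by exact: lt_le_trans z1.
rewrite powRM ?(ltW t0) ?(ltW z0) // ![t `^ k * _]mulrC.
by split; apply: ler_wpM2r; rewrite ?powR_ge0 //; apply: ge0_ler_powR; rewrite ?nnegrE // ltW.
Qed.

Lemma fine_radius {R : realType} (k0 A C2 l e s s' h q : R) : 0 < A -> 0 < C2 -> 0 < l -> 0 < h -> 0 < e -> 0 < s ->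
  0 < k0 -> k0 <= (A * C2 * l)^-1 -> s <= A * s' -> e * h <= C2 -> q = k0 * s ->
  q * e <= s' / (l * h).
Proof.
move=> A0 C0 l0 h0 e0 s0 k00 kk ss eh ->; rewrite ler_pdivlMr ?mulr_gt0 //.
have -> : k0 * s * e * (l * h) = k0 * l * s * (e * h) by ring.
have s0' : 0 < s' by rewrite -(pmulr_rgt0 _ A0); exact: lt_le_trans ss.
apply: (@le_trans _ _ (k0 * l * s * C2)); first by apply: ler_wpM2l => //; rewrite !mulr_ge0 // ltW.
apply: (@le_trans _ _ (k0 * (A * C2 * l) * s')).
  have -> : k0 * l * s * C2 = k0 * l * C2 * s by ring.
  have -> : k0 * (A * C2 * l) * s' = k0 * l * C2 * (A * s') by ring.
  by apply: ler_wpM2l => //; rewrite !mulr_ge0 // ltW.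
have h1 : 0 < A * C2 * l by rewrite !mulr_gt0.
by rewrite ler_piMl ?(ltW s0') // -ler_pdivlMr // mul1r.
Qed.

Lemma mulr_swap {R : comNzRingType} (x y z t : R) : x * y * (z * t) = x * (z * (y * t)).
Proof. by rewrite -mulrA (mulrCA y). Qed.

Lemma ln_ratio {R : realType} (C t h : R) : 0 < C -> 0 < h -> expR t / C <= h -> h <= C * expR t ->
  `|t - ln h| <= ln C.
Proof.
move=> C0 h0 h1 h2; have e0 := expR_gt0 t.
have l1 : t - ln C <= ln h.
  by rewrite -[t]expRK -ln_div ?posrE // ler_ln ?posrE // ?divr_gt0 // expRK.
have l2 : ln h <= ln C + t by rewrite -[X in _ + X]expRK -lnM ?posrE // ler_ln ?posrE // mulr_gt0.
by rewrite ler_norml; apply/andP; split; lra.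
Qed.

(** * Quasi-independence of the unions of balls at different levels *)

Section QuasiIndependentLevels.
Context {R : realType} (m : {finite_measure set (bdry_borel R) -> \bar R}).
Variables (Kb N : set (bdry_borel R)).
Hypotheses (mK : measurable Kb) (mN : measurable N) (NK : N `<=` Kb).
(** [s n] is the list of centres of level n, [e n] the size of the level (inverse to the heights of
    its centres), [q n] the radius of the balls relative to this size, and [B] half the relative
    separation. *)
Variables (k c C c1 W B : R) (w : R[i] -> R) (e q : nat -> R) (s : nat -> seq R[i]).
Hypotheses (c0 : 0 < c) (C0 : 0 < C) (c10 : 0 < c1) (W0 : 0 < W) (B0 : 0 < B).
Hypotheses (w0 : forall r, 0 < w r) (e0 : forall n, 0 < e n) (us : forall n, uniq (s n)).
Hypothesis balls : forall n r, r \in s n -> forall y, 0 < y -> y <= 3 * B * e n ->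
  rm m (Kb `&` bball r y) <= C * (w r * (y / e n) `^ k) /\
  c * (w r * (y / e n) `^ k) <= rm m (N `&` bball r y).
Hypothesis separated : forall i j r r', (i <= j)%N -> r \in s i -> r' \in s j -> (i < j)%N || (r != r') ->
  2 * B * e j <= normc (r - r').
Hypothesis mass : forall n, c1 <= \sum_(r <- s n) w r <= W.
Hypotheses (q0 : forall n, 0 < q n) (qB : forall n, q n <= B).

Local Notation y n := (q n * e n).
Definition level_union (n : nat) : set (bdry_borel R) :=
  \big[setU/set0]_(r <- s n) (N `&` bball r (y n)).

Let mNb r t : measurable (N `&` bball r t : set (bdry_borel R)).
Proof. by apply: measurableI => //; exact: measurable_bball. Qed.
Let mKb r t : measurable (Kb `&` bball r t : set (bdry_borel R)).
Proof. by apply: measurableI => //; exact: measurable_bball. Qed.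
Let y0 n : 0 < y n. Proof. exact: mulr_gt0. Qed.
Let yB n : y n <= B * e n. Proof. by rewrite ler_pM2r. Qed.
Let yE n : y n / e n = q n. Proof. by rewrite mulfK // gt_eqF. Qed.
Let Be0 n : 0 < B * e n. Proof. exact: mulr_gt0. Qed.
Let B3 n : B * e n <= 3 * B * e n.
Proof. by have := Be0 n; rewrite -mulrA; move: (B * e n) => z; lra. Qed.

Lemma measurable_level_union n : measurable (level_union n).
Proof. by apply: measurable_bigU => r; exact: mNb. Qed.

Lemma level_ball_disjoint n t r r' : t <= B * e n -> r \in s n -> r' \in s n -> r != r' ->
  (N `&` bball r t) `&` (N `&` bball r' t) = set0.
Proof.
move=> tB rs rs' nr; apply/seteqP; split=> // xi [[_ b1] [_ b2]].
case: xi b1 b2 => [z|] b1 b2; last by case: b1.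
move/bballP: b1 => b1; move/bballP: b2 => b2.
have h : (n < n)%N || (r != r') by rewrite nr orbT.
have sp := separated (leqnn n) rs rs' h.
have t1 := normc_triangle r z r'; rewrite (le_normcB r z) in t1.
suff : false by []. rewrite -(ltxx (2 * B * e n)); apply: (le_lt_trans sp); apply: (le_lt_trans t1).
apply: lt_le_trans (ltrD b1 b2) _; rewrite -mulrA; move: tB; move: (B * e n) => z'; lra.
Qed.

Lemma level_union_ge n : c * c1 * q n `^ k <= rm m (level_union n).
Proof.
apply: (@le_trans _ _ (\sum_(r <- s n) rm m (N `&` bball r (y n)))).
  apply: (@le_trans _ _ (\sum_(r <- s n) c * (w r * q n `^ k))).
    rewrite -mulr_sumr -mulr_suml -mulrA ler_pM2l //; apply: ler_wpM2r; first exact: powR_ge0.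
    by have /andP[] := mass n.
  rewrite big_seq [leRHS]big_seq; apply: ler_sum => r rs.
  by have [_] := balls rs (y0 n) (le_trans (yB n) (B3 n)); rewrite yE.
apply: (rm_bigU_disj m (F := fun r => N `&` bball r (y n)) (fun r => mNb r _)) => //.
- exact: measurable_level_union.
- by move=> r rs xi h; rewrite /level_union -bigcup_seq; exists r.
- by move=> r r' rs rs' nr; apply: level_ball_disjoint (yB n) rs rs' nr.
Qed.

Let close i j r r' := normc (r - r') < y i + y j.

(* The points of level j close to r are 2 B e_j-separated, hence their balls of radius B e_j are
   disjoint and contained in a ball of radius 3 y_i around r. *)
Lemma close_weights i j r : (i < j)%N -> r \in s i ->
  \sum_(r' <- s j | close i j r r') w r' <= C / c * (3 / B) `^ k * (w r * q i `^ k).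
Proof.
move=> ij ri; rewrite -big_filter; set t := [seq r' <- s j | close i j r r'].
have tP r' : r' \in t -> r' \in s j /\ B * e j <= y i.
  rewrite mem_filter => /andP[cl rj]; split => //.
  have h : (i < j)%N || (r != r') by rewrite ij.
  have sp := separated (ltnW ij) ri rj h; have yj := yB j; rewrite /close in cl.
  move: sp yj cl; rewrite -mulrA; move: (B * e j) (y i) (y j) (normc _) => a1 a2 a3 a4; lra.
have Bk : 0 < B `^ k by exact: powR_gt0.
have [t0|[r1 r1t]] : t = [::] \/ exists r1, r1 \in t.
  by case: (t) => [|r1 t']; [left|right; exists r1; rewrite mem_head].
  by rewrite t0 big_nil !mulr_ge0 ?powR_ge0 ?invr_ge0 // ltW.
have [_ Bei] := tP r1 r1t.
have ut : uniq t by rewrite filter_uniq.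
have b3 : 0 < 3 * y i by rewrite mulr_gt0.
have b3' : 3 * y i <= 3 * B * e i by rewrite -mulrA ler_pM2l.
have [up _] := balls ri b3 b3'; rewrite -mulrA yE in up.
have low : c * B `^ k * \sum_(r' <- t) w r' <= rm m (Kb `&` bball r (3 * y i)).
  apply: (@le_trans _ _ (\sum_(r' <- t) rm m (N `&` bball r' (B * e j)))).
    rewrite mulr_sumr big_seq [leRHS]big_seq; apply: ler_sum => r' /tP[rj _].
    have [_] := balls rj (Be0 j) (B3 j); rewrite mulfK ?gt_eqF //.
    by rewrite -mulrA [w r' * _]mulrC.
  apply: (rm_bigU_disj m (F := fun r' => N `&` bball r' (B * e j)) (fun r' => mNb r' _)) => //.
  - move=> r' r't xi [Nxi b]; split; first exact: NK.
    case: xi Nxi b => [z|] Nxi b; last by case: b.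
    move/bballP: b => b; apply/bballP; move: r't; rewrite mem_filter => /andP[cl _].
    have t1 := normc_triangle z r' r; rewrite (le_normcB r' r) in t1.
    have yj := yB j; rewrite /close in cl.
    move: t1 b cl yj Bei; move: (B * e j) (y i) (y j) (normc _) (normc _) (normc _) => a1 a2 a3 a4 a5 a6; lra.
  - move=> r' r'' /tP[h1 _] /tP[h2 _] nr; exact: level_ball_disjoint (lexx _) h1 h2 nr.
have cB : 0 < c * B `^ k by exact: mulr_gt0.
rewrite -(ler_pM2l cB); apply: (le_trans low); apply: (le_trans up).
have qi := ltW (q0 i); have B00 := ltW B0.
rewrite powRM // powRM ?invr_ge0 // -(powR_inv1 B00) -powRrM mulN1r powRN.
by rewrite le_eqVlt; apply/orP; left; apply/eqP; field; rewrite !gt_eqF.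
Qed.

(** A point of both unions lies in a ball of level j whose centre is close to a centre of level i.
    Exchanging the sums, [close_weights] bounds what each centre of level i catches. *)
Lemma level_union_quasi_independent i j : (i < j)%N ->
  rm m (level_union i `&` level_union j) <= C * (C / c) * (3 / B) `^ k * W * (q i `^ k * q j `^ k).
Proof.
move=> ij; pose t := [seq r' <- s j | has (fun r => close i j r r') (s i)].
have mI : measurable (level_union i `&` level_union j) by apply: measurableI; exact: measurable_level_union.
have sub : level_union i `&` level_union j `<=` \big[setU/set0]_(r' <- t) (Kb `&` bball r' (y j)).
  rewrite /level_union -!bigcup_seq => xi [[r ri [_ b1]] [r' rj [Nxi b2]]].
  case: xi Nxi b1 b2 => [z|] Nxi b1 b2; last by case: b1.
  exists r'; last by split; [exact: NK|].
  rewrite /= mem_filter; apply/andP; split; last by [].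
  apply/hasP; exists r; first by []. move/bballP: b1 => b1; move/bballP: b2 => b2.
  have t1 := normc_triangle r z r'; rewrite (le_normcB r z) in t1.
  exact: le_lt_trans t1 (ltrD b1 b2).
apply: (le_trans (rm_bigU_le m (F := fun r' => Kb `&` bball r' (y j)) (fun r' => mKb r' _) mI sub)).
have D0 : 0 <= C / c * (3 / B) `^ k by rewrite mulr_ge0 ?powR_ge0 // divr_ge0 // ltW.
apply: (@le_trans _ _ (\sum_(r' <- t) C * (w r' * q j `^ k))).
  rewrite big_seq [leRHS]big_seq; apply: ler_sum => r'; rewrite mem_filter => /andP[_ rj].
  by have [+ _] := balls rj (y0 j) (le_trans (yB j) (B3 j)); rewrite yE.
rewrite -mulr_sumr -mulr_suml.
have -> : C * (C / c) * (3 / B) `^ k * W * (q i `^ k * q j `^ k) =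
  C * (C / c * (3 / B) `^ k * (W * q i `^ k) * q j `^ k) by ring.
rewrite ler_pM2l //; apply: ler_wpM2r; first exact: powR_ge0.
apply: (@le_trans _ _ (\sum_(r' <- s j) \sum_(r <- s i | close i j r r') w r')).
  rewrite big_filter big_mkcond; apply: ler_sum => r' _; case: ifPn => [/hasP[r ri cl]|_].
    by rewrite (big_rem r ri) /= cl lerDl; apply: sumr_ge0 => *; exact: ltW.
  by apply: sumr_ge0 => *; exact: ltW.
have -> : \sum_(r' <- s j) \sum_(r <- s i | close i j r r') w r' =
    \sum_(r <- s i) \sum_(r' <- s j | close i j r r') w r'.
  under eq_bigr do rewrite big_mkcond; rewrite exchange_big /=.
  by apply: eq_bigr => r _; rewrite [RHS]big_mkcond.
apply: (@le_trans _ _ (\sum_(r <- s i) C / c * (3 / B) `^ k * (w r * q i `^ k))).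
  by rewrite big_seq [leRHS]big_seq; apply: ler_sum => r ri; exact: close_weights.
rewrite -mulr_sumr -mulr_suml; apply: ler_wpM2l => //; apply: ler_wpM2r; first exact: powR_ge0.
by have /andP[] := mass i.
Qed.

Hypothesis div : forall (p : nat) (M : R), exists n, M <= \sum_(p <= i < n) q i `^ k.

Lemma level_limsup_ge p : (c * c1) ^+ 2 / (8 * (C * (C / c) * (3 / B) `^ k * W)) <=
  rm m (\bigcup_(n in [set n | (p <= n)%N]) level_union n).
Proof.
apply: (quasi_independent_limsup (a := fun n => q n `^ k)) => //.
- exact: mulr_gt0.
- by rewrite !mulr_gt0 ?invr_gt0 // powR_gt0 // divr_gt0.
- exact: measurable_level_union.
- by move=> n; exact: powR_ge0.
- exact: level_union_ge.
- exact: level_union_quasi_independent.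
Qed.

End QuasiIndependentLevels.

(** * Approximation by the orbit: measures of balls, convergence and divergence *)

Section OrbitApproximation.
Context {R : realType} {K : fieldExtType rat} {iota : {rmorphism K -> R[i]}}.
Hypothesis hK : rational_or_imaginary_quadratic iota.
Variable Gam : set (PSL2 R).
Hypothesis hGam : finite_index_subgroup Gam (PSL2_integers iota).
Variables (al : R[i]) (gamma0 : PSL2 R).
Hypothesis hal : quadratic_irrational iota al.
Hypothesis Gg0 : Gam gamma0.
Hypothesis hfix : bact gamma0 (Some al) = Some al.
Hypothesis hexp : 1 < normc (derive1 (homography gamma0) al).
Variable x0 : hpoint R.
Hypothesis ux0 : upper (Khat K) x0.
Variable phi : R -> R.
Hypotheses (hphi : forall t : R, 0 <= t -> 0 < phi t).
Hypothesis hslow : slowly_varying (fun t => phi (expR t)).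
Implicit Types (r u : R[i]) (g h : PSL2 R).

Local Notation conj := (galois_conj iota).
Local Notation ht := (height iota).
Local Notation E := (bdry_orbit Gam [set z | z = al \/ z = conj al]).
Local Notation ends := (endpoints (iota := iota) al).
Local Notation Kb := (Kbar (Khat K) : set (bdry_borel R)).

Let cK : closed_subfield (Khat K : set R[i]) := @Khat_closed_subfield R K.
Let GK g : Gam g -> matK (Khat K) g := @fi_matK _ _ _ _ hGam g.
Let GV g : Gam g -> Gam g^-1%g := @fi_inv _ _ _ _ hGam g.
Let G1 : Gam 1%g := fi_one hGam.
Let GM g h : Gam g -> Gam h -> Gam (g * h)%g := @fi_mul _ _ _ _ hGam g h.
Let mK : measurable Kb := @Kbar_measurable R K.
Let Kal : Khat K al. Proof. by case: hal. Qed.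
Let Kal' : Khat K (conj al) := conjugates_Khat (quadratic_conjugates hal) Kal.
Let ht0 r : E r -> 0 < ht r := @height_gt0 _ _ _ _ hGam _ hal r.
Let hU r : E r -> height_unit (iota := iota) al gamma0 <= ht r := @orbit_height_ge _ _ _ hK _ hGam _ _ hal Gg0 hfix hexp r.
Let U0 : 0 < height_unit (iota := iota) al gamma0 := height_unit_gt0 hGam hal Gg0 hfix hexp.

Let ends_Khat u u' : ends u u' -> Khat K u /\ Khat K u'.
Proof. by case=> [] [-> ->]. Qed.

Let ends_neq u u' : ends u u' -> u != u'.
Proof. by move=> he; exact: conjugates_neq (endpoints_conjugates hal he). Qed.

Let ends_jac u u' g : ends u u' -> Gam g -> jac g u != 0.
Proof. by move=> he Gg; exact: (endpoints_jac hGam hal Gg he). Qed.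

Let ends_jac' u u' g : ends u u' -> Gam g -> jac g u' != 0.
Proof. by move=> he; exact: ends_jac (endpoints_sym he). Qed.

Lemma Kbar_invariant g (xi : bdry R) : Gam g -> Kb (bact g xi) <-> Kb xi.
Proof.
move=> Gg; split; last exact: Kbar_bact cK (GK Gg).
by move=> /(Kbar_bact cK (GK (GV Gg))); rewrite bactK.
Qed.

(** The set of approximants is the union of the orbits of the two endpoints; each is studied with
    its own exponent. *)
Definition orbit_of u : set R[i] := [set r | exists2 g, Gam g & r = homography g u].

Lemma orbit_of_sub u u' r : ends u u' -> orbit_of u r -> E r.
Proof. by move=> he [g Gg ->]; have [] := orbit_homography hGam hal Gg he. Qed.

Lemma orbit_cases r : E r -> orbit_of al r \/ orbit_of (conj al) r.
Proof.
move=> /(orbitP hGam hal)[g [u [u' [Gg [[-> _]|[-> _]] _ -> _]]]]; first by left; exists g.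
by right; exists g.
Qed.

(* The element of [gamma0^Z] attracting to [u]. *)
Definition attractor u : PSL2 R := if u == al then gamma0^-1%g else gamma0.

Lemma al_neq : al != conj al.
Proof. exact: conjugates_neq (quadratic_conjugates hal). Qed.

Lemma attractorP u u' : ends u u' -> [/\ Gam (attractor u), homography (attractor u) u = u,
  homography (attractor u) u' = u' & normc (jac (attractor u) u) * normc (jac (attractor u) u') = 1 /\
  1 < normc (jac (attractor u) u)].
Proof.
have h0 : ends al (conj al) by left.
have h1 : ends (conj al) al by right.
have f0 : homography gamma0 al = al by have /bact_some[] := hfix.
have f1 : homography gamma0 (conj al) = conj al.
  by have /bact_some[] := gamma_fix_conj hGam hal Gg0 hfix.
have jj : normc (jac gamma0 (conj al)) * normc (jac gamma0 al) = 1.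
  by rewrite mulrC -normcM (jac_gamma hGam hal Gg0 hfix) normc1.
have j1 : 1 < normc (jac gamma0 (conj al)).
  have l1 := normc_jac_lt1 hfix hexp.
  have p0 : 0 < normc (jac gamma0 al) by rewrite normc_gt0 (ends_jac h0).
  by rewrite -(ltr_pM2r p0) jj mul1r.
case=> [] [-> ->]; rewrite /attractor.
  rewrite eqxx; have [e1 e2 e3 e4] := inverse_axis Gg0 (fun g => ends_jac h1) (fun g => ends_jac h0) f1 f0 jj.
  by split => //; [exact: GV|rewrite e3 e4].
by rewrite eq_sym (negbTE al_neq).
Qed.

Lemma orbit_shell u u' rho (h1 h2 : R) : ends u u' -> exists2 s : seq R[i], uniq s &
  forall r, r \in s <-> [/\ orbit_of u r, normc r <= rho, h1 <= ht r & ht r <= h2].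
Proof.
move=> he; have fin : finite_set [set r | [/\ orbit_of u r, normc r <= rho, h1 <= ht r & ht r <= h2]].
  apply: sub_finite_set (orbit_finite hK hGam hal Gg0 hfix hexp h2 rho) => r /= [Er nr _ hr].
  by split => //; exact: (orbit_of_sub he Er).
have [s hs] : exists s : seq R[i], [set r | [/\ orbit_of u r, normc r <= rho, h1 <= ht r & ht r <= h2]] = [set` s].
  exact/finite_seqP.
exists (undup s); first exact: undup_uniq.
move=> r; rewrite mem_undup; split => h.
  by have : [set` s] r by []; rewrite -hs.
by have : [set` s] r by rewrite -hs.
Qed.

Lemma translation_large (B : R) : exists2 p, Gam p & exists2 t : R[i], B <= normc t &
  forall z : R[i], [/\ homography p z = z + t, normc (jac p z) = 1 & jac p z != 0].
Proof.
have [m m0 hm] := fi_translation hGam; pose n := (Num.truncn `|B|).+1.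
have [p Gp [e he [e1 e2 e3 e4]]] := hm n; exists p => //; exists (n * m)%:R.
  have -> : ((n * m)%:R : R[i]) = ((n * m)%:R)%:C%C * 1 by rewrite mulr1 rmorph_nat.
  rewrite normcZ normc1 mulr1 ger0_norm //; apply: le_trans (ler_norm _) _.
  apply: ltW; apply: lt_le_trans (truncnS_gt _) _.
  by rewrite ler_nat leq_pmulr.
have e0 : e != 0 by case: he => ->; rewrite ?oppr_eq0 oner_neq0.
move=> z; rewrite /homography /jac e1 e2 e3 e4 mul0r add0r; split => //.
  by rewrite -mulrDr mulrC mulKf.
by case: he => ->; rewrite ?normcN normc1.
Qed.

(* If [g^-1 oo] is close to [u] or [u'], translating them away first keeps both denominators
   comparable. *)
Lemma balanced_translate u u' : exists2 p, Gam p & forall g, Gam g -> exists h, [/\ h = 1%g \/ h = p,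
  normc (jac (g * h)%g u) <= 3 * normc (jac (g * h)%g u') &
  normc (jac (g * h)%g u') <= 3 * normc (jac (g * h)%g u)].
Proof.
pose S := 1 + normc u + normc u'.
have u0 := normc_ge0' u; have u0' := normc_ge0' u'.
have S0 : 0 < S by rewrite /S; lra.
have [p Gp [t ht hp]] := translation_large (2 * (2 * S + S)).
exists p => // g Gg; set cc := mat g 1 0; set dd := mat g 1 1.
have near (y m : R[i]) : normc (y - m) <= normc m / 2 -> `|normc y - normc m| <= normc m / 2.
  by apply: le_trans; exact: normc_lipschitz.
have [hc|hc] := leP (normc cc * (2 * S)) (normc dd).
  have h z : normc z <= S -> `|normc (jac (g * 1)%g z) - normc dd| <= normc dd / 2.
    move=> zS; apply: near; rewrite mulg1 /jac addrK normcM.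
    have := ler_wpM2l (normc_ge0' cc) zS; rewrite -/cc; lra.
  have h1 : normc u <= S by rewrite /S; lra.
  have h2 : normc u' <= S by rewrite /S; lra.
  exists 1%g; split; [by left|..]; exact: ratio_balanced (normc_ge0' dd) (h _ _) (h _ _).
have h z : normc z <= S -> `|normc (jac (g * p)%g z) - normc (cc * t)| <= normc (cc * t) / 2.
  move=> zS; have [e1 e2 e3] := hp z; rewrite (normc_jacM g e3) e1 e2 mulr1; apply: near.
  have -> : jac g (z + t) - cc * t = cc * z + dd by rewrite /jac -/cc -/dd; ring.
  apply: (le_trans (le_normcD' _ _)); rewrite !normcM.
  have := ler_wpM2l (normc_ge0' cc) zS; have := ler_wpM2l (normc_ge0' cc) ht; lra.
have h1 : normc u <= S by rewrite /S; lra.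
have h2 : normc u' <= S by rewrite /S; lra.
exists p; split; [by right|..]; exact: ratio_balanced (normc_ge0' (cc * t)) (h _ _) (h _ _).
Qed.

(** With balanced denominators, the image of the axis point is near the top of the geodesic between
    k u and k u', so its height e^(-s) is comparable with the diameter 2 / h(k u), and k u is at
    distance O(e^(-s)) from x. *)
Lemma orbit_near u u' D : ends u u' -> 0 <= D -> exists2 C : R, 1 <= C & forall (x : R[i]) s g, Gam g ->
  hdist (hact g x0) (x, expR (- s)) <= D -> exists r, [/\ orbit_of u r,
   normc (x - r) <= C * expR (- s), expR s / C <= ht r & ht r <= C * expR s].
Proof.
move=> he D0.
have J0 g := ends_jac (g := g) he; have J1 g := ends_jac' (g := g) he.
have ne := ends_neq he.
have d0 := dist_gt0 ne; have [_ x00] := ux0.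
have t0 : 0 < (axis_top u u').2 by rewrite divr_gt0.
have [p Gp hp] := balanced_translate u u'.
pose D1 := hdist (axis_top u u') x0 + hdist (hact p x0) x0 + D.
have a0 := hdist_ge0 t0 x00; have b0 := hdist_ge0 (hact_gt0 p x00) x00.
have D10 : 0 <= D1 by rewrite /D1; lra.
pose C := 2 * ch D1; have C1 : 1 <= C by rewrite /C; have := ch_ge1 D1; lra.
have C0 : 0 < C by lra.
exists (4 * C) => [|x s g Gg hD]; first by lra.
have [h [hh q1 q2]] := hp g Gg; have Gh : Gam h by case: hh => ->.
have Ggh := GM Gg Gh; set k := (g * h)%g in q1 q2 Ggh *.
exists (homography k u).
have e0 : 0 < (x, expR (- s) : R).2 by exact: expR_gt0.
have k0 := hact_gt0 k t0.
have hD1 : hdist (hact k (axis_top u u')) (x, expR (- s)) <= D1.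
  apply: le_trans (hdist_triangle k0 (hact_gt0 k x00) e0) _; rewrite hdist_hact // /D1 -addrA lerD2l.
  apply: le_trans (hdist_triangle (hact_gt0 k x00) (hact_gt0 g x00) e0) (lerD _ hD).
  rewrite /k hactM // (hdist_hact g (hact_gt0 h x00) x00).
  by case: hh => ->; rewrite ?hact1 ?hdistxx.
have [c1 c2] := hdist_compare k0 e0 D10 hD1.
have hD1' : hdist (x, expR (- s)) (hact k (axis_top u u')) <= D1 by rewrite hdist_sym.
have [c3 _] := hdist_compare e0 k0 D10 hD1'.
have [Ek ec] := orbit_homography hGam hal Ggh he.
have eh : ht (homography k u) = 2 * (normc (jac k u) * normc (jac k u')) / normc (u - u').
  have := normc_orbit_sub Ek; rewrite ec (dist_hg J0 J1 Ggh) => e.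
  have j1 := j_gt0 J0 Ggh; have j2 := j_gt0 J1 Ggh.
  have h0 := ht0 Ek.
  have -> : ht (homography k u) = 2 / (2 / ht (homography k u)) by field; exact: lt0r_neq0.
  rewrite -e; field; rewrite !gt_eqF //.
have jk := j_gt0 J0 Ggh; have jk' := j_gt0 J1 Ggh.
rewrite -/C in c1 c2 c3; move: c1 c2 c3; rewrite (hact_axis_top J0 J1 Ggh) /= => c1 c2 c3.
split; first by exists k.
- have t1 := normc_triangle x (((normc (jac k u) ^+ 2)%:C%C * homography k u + (normc (jac k u') ^+ 2)%:C%C * homography k u') /
      (normc (jac k u) ^+ 2 + normc (jac k u') ^+ 2)%:C%C) (homography k u).
  rewrite le_normcB in c2; apply: (le_trans t1).
  have S0 : 0 < normc (jac k u) ^+ 2 + normc (jac k u') ^+ 2 by rewrite addr_gt0 // exprn_gt0.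
  rewrite (weighted_sub jk jk') normcZ ger0_norm; last by rewrite divr_ge0 ?sqr_ge0 // ltW.
  rewrite (le_normcB (homography k u')) (dist_hg J0 J1 Ggh) (_ : 4 * C * expR (- s) = C * expR (- s) + 3 * (C * expR (- s))); last by ring.
  apply: (lerD c2); exact: (balanced_gap jk jk' d0 q2 c1).
- rewrite eh; exact: (balanced_lower jk jk' d0 C0 (expR_gt0 s) (expR_mulN s) q1 q2 c1).
- rewrite eh; exact: (balanced_upper jk jk' d0 C0 (expR_gt0 s) (expR_mulN s) c3).
Qed.

(* The factor [1 / k.+1] makes the limsup set [good] below the set where the lower limit is 0. *)
Definition approximable (k : nat) : set (bdry_borel R) :=
  \bigcup_(r in [set r | E r /\ k%:R <= ht r]) bball r (rate phi (ht r) / (k.+1%:R * ht r)).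

Definition good : set (bdry_borel R) := \bigcap_k approximable k.

Lemma measurable_approximable k : measurable (approximable k).
Proof. by apply: open_bdry_measurable; apply: bigcup_open => r _; exact: open_bball. Qed.

Lemma measurable_good : measurable good.
Proof. by apply: bigcapT_measurable => k; exact: measurable_approximable. Qed.

Lemma approximable_le k l : (k <= l)%N -> approximable l `<=` approximable k.
Proof.
move=> kl xi [r [Er lr] b]; have r0 := ht0 Er.
have kr : k%:R <= ht r by apply: le_trans lr; rewrite ler_nat.
exists r => //; case: xi b => [z|] b; last by case: b.
move/bballP: b => b; apply/bballP; apply: (lt_le_trans b).
apply: ler_wpM2l; first exact: ltW (rate_gt0 hphi (ltW r0)).
by apply: inv_scale_le; rewrite ?ler_nat.
Qed.

Lemma height_act g r : Gam g -> E r -> [/\ E (homography g r), jac g r != 0 &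
  ht (homography g r) = ht r * (normc (jac g r) * normc (jac g (conj r)))].
Proof.
move=> Gg Er; have h0 := ht0 Er.
have [n0 Eg ec] := orbit_act hGam hal Gg Er; split => //.
have n1 : jac g (conj r) != 0.
  by have [Ec _] := orbit_conj hGam hal Er; have [] := orbit_act hGam hal Gg Ec.
have := normc_orbit_sub Eg; rewrite ec homography_sub // normcM normcV normcM (normc_orbit_sub Er) => e.
have g0 := ht0 Eg; move: n0 n1; rewrite -!normc_gt0 => n0 n1.
rewrite -[LHS]invrK -[(ht (homography g r))^-1](mulKf (lt0r_neq0 (ltr0n _ 2))) -e.
by field; rewrite !gt_eqF.
Qed.

Section Action.
Variables (g : PSL2 R) (Gg : Gam g) (x : R[i]).
Local Notation J := (normc (jac g x)).
Local Notation cc := (normc (mat g 1 0)).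

Lemma jac_near r e : normc (x - r) <= e -> `|normc (jac g r) - J| <= cc * e.
Proof.
move=> h; apply: le_trans (normc_lipschitz _ _) _.
have -> : jac g r - jac g x = mat g 1 0 * (r - x) by rewrite /jac; ring.
by rewrite normcM le_normcB; apply: ler_wpM2l => //; exact: normc_ge0'.
Qed.

Lemma approximableP k : approximable k (Some x) -> exists r, [/\ E r, k%:R <= ht r,
  normc (x - r) < rate phi (ht r) / (k.+1%:R * ht r), normc (x - r) <= (k.+1%:R * ht r)^-1 &
  normc (x - conj r) <= 3 / ht r].
Proof.
move=> [r [Er kr] /bballP b]; have r0 := ht0 Er.
have b1 : normc (x - r) <= (k.+1%:R * ht r)^-1.
  apply: (le_trans (ltW b)); rewrite -[leRHS]mul1r ler_pM2r ?rate_le1 //.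
  by rewrite invr_gt0 mulr_gt0.
exists r; split => //.
have t := normc_triangle x r (conj r); rewrite (normc_orbit_sub Er) in t.
have b2 : (k.+1%:R * ht r)^-1 <= (ht r)^-1.
  by rewrite -[in leRHS](mul1r (ht r)); apply: inv_scale_le; rewrite ?ler1n.
have e : 3 / ht r = (ht r)^-1 + 2 / ht r by field; exact: lt0r_neq0.
by rewrite e; apply: (le_trans t); rewrite lerD2r; exact: le_trans b2.
Qed.

(** If g sent x to infinity, [jac] would be tiny at a close approximant and at its conjugate, and
    the image would have height below the minimal one. So a good x is never sent to infinity. *)
Lemma good_jac : good (Some x) -> jac g x != 0.
Proof.
move=> gx; rewrite -normc_gt0 lt0r normc_ge0' andbT; apply/eqP => J0.
have u0 := U0; have hu := hU; set U := height_unit _ _ in u0 hu.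
pose k := Num.truncn (3 * cc ^+ 2 / (U * U)).
have hk : 3 * cc ^+ 2 / (U * U) < k.+1%:R by exact: truncnS_gt.
have [r [Er kr _ b1 b2]] := approximableP (gx k I).
have r0 := ht0 Er; have rU := hu _ Er.
have [Eg _ eh] := height_act Gg Er; have := hu _ Eg.
rewrite eh leNgt => /negP; apply.
have j1 := jac_near b1; have j2 := jac_near b2; rewrite J0 !subr0 !ger0_norm ?normc_ge0' // in j1 j2.
have j12 := ler_pM (normc_ge0' _) (normc_ge0' _) j1 j2.
have U2 : 0 < U * U by exact: mulr_gt0.
have k0 : 0 < k.+1%:R :> R by [].
apply: (@le_lt_trans _ _ (3 * cc ^+ 2 / k.+1%:R / ht r)).
  apply: (@le_trans _ _ (ht r * (cc * (k.+1%:R * ht r)^-1 * (cc * (3 / ht r))))); first by rewrite ler_pM2l.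
  by rewrite le_eqVlt; apply/orP; left; apply/eqP; field; rewrite !gt_eqF.
rewrite ltr_pdivrMr // ltr_pdivrMr //.
move: hk; rewrite ltr_pdivrMr // => /lt_le_trans; apply.
by rewrite mulrC ler_pM2r // ler_pM2l.
Qed.

(** Near x the action multiplies distances by about |jac|^-2 and heights by about |jac|^2. Slow
    variation bounds the change of the rate, and a larger index k pays for all constants. *)
Lemma good_act : good (Some x) -> good (bact g (Some x)).
Proof.
move=> gx; have nx := good_jac gx; have J0 : 0 < J by rewrite normc_gt0.
have -> : bact g (Some x) = Some (homography g x) by apply/bact_some.
move=> l _; have J2 : 0 < J ^+ 2 by rewrite exprn_gt0.
have L0 : 0 <= `|ln (J ^+ 2 / 4)| + `|ln (4 * J ^+ 2)| by rewrite addr_ge0.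
have [A A1 hA] := rate_scale hslow L0; have A0 : 0 < A by exact: lt_le_trans A1.
have c0 := normc_ge0' (mat g 1 0).
have l0 : 0 < l.+1%:R :> R by [].
pose S := 1 + 6 * cc / J + 4 * l.+1%:R / J ^+ 2 + 8 * A * l.+1%:R.
have [S1 S2 S3 S4] := level_requirements J0 A1 c0 l0 (erefl S).
(* S gathers what is asked of k: [jac] within a factor 2 of its value at x, image height at least l
   + 1, and the constant of [transport_le]. *)
pose k := (Num.truncn S).+1; have hk : S <= k%:R by exact: ltW (truncnS_gt _).
have [r [Er kr b b1 b2]] := approximableP (gx k I).
have r0 := ht0 Er; have [Eg nr eh] := height_act Gg Er.
have Sr : S <= ht r by exact: le_trans kr.
have r1 : 1 <= ht r by exact: le_trans Sr.
have c3 : cc * (3 / ht r) <= J / 2.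
  rewrite mulrA ler_pdivrMr // mulrAC ler_pdivlMr //.
  have := le_trans S2 Sr; rewrite ler_pdivrMr // [ht r * J]mulrC => h.
  by rewrite (_ : cc * 3 * 2 = 6 * cc) //; ring.
have b3 : (k.+1%:R * ht r)^-1 <= 3 / ht r.
  apply: (@le_trans _ _ (ht r)^-1); last by rewrite ler_peMl ?invr_ge0 ?(ltW r0) // ler1n.
  by rewrite -[in leRHS](mul1r (ht r)); apply: inv_scale_le; rewrite ?ler1n.
have c4 := le_trans (ler_wpM2l c0 b3) c3.
have j1 := jac_near b1; have [m1 m2] := modulus_window j1 c4.
have [m3 m4] := modulus_window (jac_near b2) c3.
have [m5 m6] := modulus_product J0 m1 m2 m3 m4.
set m := normc (jac g r) * normc (jac g (conj r)) in m5 m6 eh.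
have J4 : 0 < J ^+ 2 / 4 by rewrite divr_gt0.
have m0 : 0 < m by exact: lt_le_trans m5.
have hl : l.+1%:R <= ht (homography g r).
  rewrite eh (_ : l.+1%:R = 4 * l.+1%:R / J ^+ 2 * (J ^+ 2 / 4)); last by field; rewrite gt_eqF.
  apply: ler_pM; [by rewrite divr_ge0 // ltW|exact: ltW|exact: le_trans Sr|exact: m5].
have h1 : 1 <= ht (homography g r) by apply: le_trans hl; rewrite ler1n.
have rr : rate phi (ht r) <= A * rate phi (ht (homography g r)).
  apply: hA; [exact: r1|exact: h1|].
  rewrite eh lnM; [|by rewrite posrE|by rewrite posrE].
  by rewrite opprD addrA subrr sub0r normrN; exact: ln_window.
exists (homography g r).
  by split; [exact: Eg|apply: le_trans hl; rewrite ler_nat].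
apply/bballP; rewrite (homography_sub nx nr) normcM normcV normcM.
have jr0 : 0 < normc (jac g r) by rewrite normc_gt0.
apply: (@lt_le_trans _ _ (rate phi (ht r) / (k.+1%:R * ht r) / (J * normc (jac g r)))).
  by rewrite ltr_pM2r // invr_gt0 mulr_gt0.
have rg := rate_gt0 hphi (ltW (lt_le_trans ltr01 h1)).
rewrite eh in rr rg *.
apply: (transport_le J0 (rate_gt0 hphi (ltW r0)) rg r0 m0 (ltr0Sn _ _) l0 rr m6 m1).
by apply: (le_trans S4); apply: (le_trans hk); rewrite ler_nat.
Qed.

End Action.

Lemma good_liminf x : good (Some x) ->
  limf_einf (fun r : R[i] => (ht r / phi (ht r) * normc (x - r))%:E) (frechet E) = 0%E.
Proof.
move=> gx; rewrite limf_einfE; apply/eqP; rewrite eq_le; apply/andP; split; last first.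
  apply: le_trans (ereal_sup_ubound _); last first.
    by exists E => //; rewrite /frechet /= setDv; exact: finite_set0.
  apply: le_ereal_inf_tmp => _ [r Er <-]; have r0 := ht0 Er.
  by rewrite lee_fin mulr_ge0 ?normc_ge0' // divr_ge0 // ltW // hphi // ltW.
apply: ge_ereal_sup => _ [A /finite_seqP[s hs] <-]; apply/lee_addgt0Pr => e e0; rewrite add0e.
(* An approximant of height above H cannot be one of the finitely many excluded points, and an index
   above 1 / e makes the quotient at most e. *)
pose H : R := \sum_(r <- s) `|ht r|; pose k := (Num.truncn (H + e^-1)).+1.
have H0 : 0 <= H by apply: sumr_ge0 => r _; exact: normr_ge0.
have hk : H + e^-1 < k%:R by exact: truncnS_gt.
have ei : 0 < e^-1 by rewrite invr_gt0.
have [r [Er kr b _ _]] := approximableP (gx k I).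
have r0 := ht0 Er; have p0 := hphi (ltW r0).
have rA : A r.
  apply: contrapT => nA; have : [set` s] r by rewrite -hs.
  move=> /= rs; have : `|ht r| <= H.
    rewrite /H (big_rem r rs) /= lerDl; apply: sumr_ge0 => *; exact: normr_ge0.
  have := ler_norm (ht r); lra.
apply: (@le_trans _ _ (ht r / phi (ht r) * normc (x - r))%:E).
  by apply: ereal_inf_lbound; exists r.
rewrite lee_fin; apply: (@le_trans _ _ (ht r / phi (ht r) * (phi (ht r) / (k.+1%:R * ht r)))).
  apply: ler_wpM2l; first exact: ltW (divr_gt0 r0 p0).
  apply: (le_trans (ltW b)); apply: ler_wpM2r; last by rewrite /rate ge_min lexx.
  by rewrite invr_ge0 mulr_ge0 // ltW.
have -> : ht r / phi (ht r) * (phi (ht r) / (k.+1%:R * ht r)) = k.+1%:R^-1 by field; rewrite !gt_eqF.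
have k1 : e^-1 <= k.+1%:R by rewrite -natr1; lra.
by rewrite -[leRHS]invrK lef_pV2 ?posrE.
Qed.

(** * Patterson measure of balls around orbit points *)

Section Density.
Variables (F : vect R -> R) (a c : R).
Hypotheses (hF : holder_with (Khat K) F a c) (iF : invariant_under (Khat K) Gam F).
Variable mu : hpoint R -> {finite_measure set (bdry_borel R) -> \bar R}.
Hypothesis hmu : patterson_density (Khat K) Gam x0 F mu.

Definition exponent u : R := kap Gam x0 F u (if u == al then conj al else al) (attractor u).

Lemma exponentE u u' : ends u u' -> exponent u = kap Gam x0 F u u' (attractor u).
Proof.
by rewrite /exponent; case=> [] [-> ->]; rewrite ?eqxx // eq_sym (negbTE al_neq).
Qed.

Lemma crit_delta_cyclic :
  crit_delta (cyclic_subgroup gamma0) x0 F = crit_delta Gam x0 F - Num.min (exponent al) (exponent (conj al)).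
Proof.
have h0 : ends al (conj al) by left.
have h1 : ends (conj al) al by right.
have [_ f1 f0 [jj j1]] := attractorP h1.
rewrite (exponentE h0) (exponentE h1) [in LHS]/crit_delta minC.
have e : attractor (conj al) = gamma0 by rewrite /attractor eq_sym (negbTE al_neq).
have e' : attractor al = gamma0^-1%g by rewrite /attractor eqxx.
rewrite e in f1 f0 jj j1 *; rewrite e'.
have n10 : conj al != al by rewrite eq_sym al_neq.
have J0 g := ends_jac (g := g) h0; have J1 g := ends_jac (g := g) h1.
by rewrite (critical_exponent_cyclic cK GK GV G1 GM ux0 hF iF Kal' Kal n10 Gg0 J1 J0 f1 f0 jj j1).
Qed.

Section Balls.
Variable N : set (bdry_borel R).
Hypotheses (mN : measurable N) (NK : N `<=` Kb).
Hypotheses (iN : forall g xi, Gam g -> N (bact g xi) <-> N xi) (N0 : 0 < rm (mu x0) N).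

Lemma orbit_balls u u' rho C0 : ends u u' -> 0 <= rho -> 1 <= C0 -> 0 < exponent u /\
  exists (c C : R) (w : R[i] -> R), [/\ 0 < c, 0 < C, forall r, 0 < w r &
    forall r, orbit_of u r -> normc r <= rho -> forall y, 0 < y -> y * ht r <= C0 ->
    rm (mu x0) (Kb `&` bball r y) <= C * (w r * (y * ht r) `^ exponent u) /\
    c * (w r * (y * ht r) `^ exponent u) <= rm (mu x0) (N `&` bball r y)].
Proof.
move=> he rho0 C01; rewrite (exponentE he).
have [Ga fu fu' [jj j1]] := attractorP he.
have [Ku Ku'] := ends_Khat he; have uu' := ends_neq he.
have J0 g := ends_jac (g := g) he; have J1 g := ends_jac' (g := g) he.
have hE g : Gam g -> normc (homography g u - homography g u') = 2 / ht (homography g u) /\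
    E (homography g u).
  move=> Gg; have [Er <-] := orbit_homography hGam hal Gg he.
  by rewrite (normc_orbit_sub Er).
have hmax g : Gam g -> normc (homography g u - homography g u') <= 2 / height_unit (iota := iota) al gamma0.
  move=> Gg; have [-> Er] := hE g Gg; rewrite ler_pM2l // lef_pV2 ?posrE //.
    exact: (hU Er).
  exact: (ht0 Er).
have tr B : exists2 p, Gam p & exists2 t : R[i], B < normc t &
    forall z : R[i], bact p (Some z) = Some (z + t).
  have [p Gp [t ht hp]] := translation_large (B + 1); exists p => //; exists t => [|z].
    by apply: lt_le_trans ht; rewrite ltrDl.
  by have [e1 _ e2] := hp z; rewrite -e1; apply/bact_some.
split; first exact: (kap_gt0 cK GK GV G1 GM ux0 hF iF hmu Ku Ku' uu' Ga J0 J1 fu fu' jj j1 hmax tr mN NK iN N0).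
have [c' [C [c0 Cp hb]]] := shadow_balls cK GK GV G1 GM ux0 hF iF hmu Ku Ku' uu' Ga J0 J1 fu fu' jj j1
  hmax tr mN NK mK iN N0 rho0 C01.
set k := kap _ _ _ _ _ _ in hb *.
(* [shadow_balls] attaches the weight to g; choosing one g for each r makes it a function of the
   orbit point, with the default 1 elsewhere to stay positive. *)
have /choice[w0 hw0] r : exists w : R, 0 < w /\ (orbit_of u r -> normc r <= rho -> forall y, 0 < y ->
    y * ht r <= C0 ->
    rm (mu x0) (Kb `&` bball r y) <= C * (w * (y * ht r) `^ k) /\
    c' * (w * (y * ht r) `^ k) <= rm (mu x0) (N `&` bball r y)).
  have [[g Gg ->]|nr] := pselect (orbit_of u r); last by exists 1; split.
  have [hr|nh] := pselect (normc (homography g u) <= rho); last by exists 1; split.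
  have [w wp hw] := hb g Gg hr; have [e Er] := hE g Gg.
  have h0 := ht0 Er.
  exists (w * (1 / 2) `^ k); split; first by rewrite mulr_gt0 // powR_gt0.
  move=> _ _ y y0 yC; have := hw y y0; rewrite e.
  have -> : y / (2 / ht (homography g u)) = (1 / 2) * (y * ht (homography g u)).
    by field; exact: lt0r_neq0.
  have -> : (1 / 2 * (y * ht (homography g u))) `^ k = (1 / 2) `^ k * (y * ht (homography g u)) `^ k.
    by rewrite powRM // mulr_ge0 // ltW.
  rewrite !(mulrA w); apply.
  rewrite mulrA ler_pdivlMr //; apply: (le_trans yC); rewrite ler_peMr ?ler1n //.
  exact: le_trans C01.
exists c', C, w0; split => // r; [by have [] := hw0 r|by have [] := hw0 r].
Qed.

(* Orbit points of comparable heights are separated, so that their balls are disjoint. *)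
Lemma weights_bounded u u' rho (c1 k C0 : R) (w : R[i] -> R) : ends u u' -> 0 < c1 -> 1 <= C0 -> 0 <= k ->
  (forall r, orbit_of u r -> normc r <= rho -> forall y, 0 < y -> y * ht r <= C0 ->
     c1 * (w r * (y * ht r) `^ k) <= rm (mu x0) (N `&` bball r y)) -> (forall r, 0 <= w r) ->
  forall Q, 1 <= Q -> exists2 W : R, 0 <= W & forall H (s : seq R[i]), 0 < H -> uniq s ->
   (forall r, r \in s -> [/\ orbit_of u r, normc r <= rho, H / Q <= ht r & ht r <= H]) ->
   \sum_(r <- s) w r <= W.
Proof.
move=> he c10 C01 k0 hw w0 Q Q1.
have [cs cs0 sep] := orbit_separated hK hGam hal Gg0 hfix hexp.
pose e := Num.min (cs / 2) 1.
have e0 : 0 < e by rewrite lt_min ltr01 andbT divr_gt0.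
have e1 : e <= 1 by rewrite ge_min lexx orbT.
have e2 : e <= cs / 2 by rewrite ge_min lexx.
have Q0 : 0 < Q by exact: lt_le_trans Q1.
pose D := c1 * (e / Q) `^ k.
have D0 : 0 < D by rewrite mulr_gt0 // powR_gt0 // divr_gt0.
exists (rm (mu x0) N / D) => [|H s H0 us hs]; first by rewrite divr_ge0 ?rm_ge0 // ltW.
rewrite ler_pdivlMr // mulr_suml.
have mB r y : measurable (N `&` bball r y : set (bdry_borel R)) by apply: measurableI => //; exact: measurable_bball.
apply: (@le_trans _ _ (\sum_(r <- s) rm (mu x0) (N `&` bball r (e / H)))).
  rewrite big_seq [leRHS]big_seq; apply: ler_sum => r rs.
  have [Tr nr hQ hH] := hs r rs.
  have eH : 0 < e / H by rewrite divr_gt0.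
  have h1 : e / H * ht r <= e by rewrite mulrAC ler_pdivrMr // ler_pM2l.
  have h2 : e / Q <= e / H * ht r.
    rewrite -mulrA ler_pM2l //; move: hQ; rewrite ler_pdivrMr // => hQ.
    by rewrite mulrC ler_pdivlMr // mulrC ler_pdivrMr.
  apply: le_trans (hw r Tr nr _ eH (le_trans h1 (le_trans e1 C01))).
  rewrite /D mulrCA ler_pM2l //; apply: ler_wpM2l => //.
  by apply: ge0_ler_powR; rewrite ?nnegrE ?divr_ge0 ?(ltW e0) ?(ltW Q0) // (le_trans _ h2) // divr_ge0 ?(ltW e0) ?(ltW Q0).
apply: (rm_bigU_disj (mu x0) (F := fun r => N `&` bball r (e / H)) (fun r => mB r _)) => //.
move=> r s' rs ss nrs; apply/seteqP; split=> // xi [[_ b1] [_ b2]].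
case: xi b1 b2 => [z|] b1 b2; last by case: b1.
move/bballP: b1 => b1; move/bballP: b2 => b2.
have [Tr nr _ hr] := hs r rs; have [Ts ns _ hs'] := hs s' ss.
have := sep r s' H (orbit_of_sub he Tr) (orbit_of_sub he Ts) (elimN eqP nrs) hr hs'.
have := normc_triangle r z s'.
have eH : e / H <= cs / 2 / H by rewrite ler_pM2r // invr_gt0.
have cH : cs / H = cs / 2 / H + cs / 2 / H by field; exact: lt0r_neq0.
rewrite (le_normcB r z) => t1 t2.
move: (le_lt_trans (le_trans t2 t1) (ltrD (lt_le_trans b1 eH) (lt_le_trans b2 eH))).
by rewrite -cH ltxx.
Qed.

Lemma base_ball_gt0 u u' : ends u u' -> 0 < rm (mu x0) (N `&` bball u (normc (u - u') / 4)).
Proof.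
move=> he; set d4 := _ / 4; have d40 : 0 < d4 by rewrite divr_gt0 // dist_gt0 // ends_neq.
have Ou : orbit_of u u.
  exists 1%g; first exact: G1.
  by have := bact1 (Some u : bdry R) => /bact_some[_ ->].
have [Eu hu] : E u /\ 0 < ht u.
  by have Eu := orbit_of_sub he Ou; split => //; exact: (ht0 Eu).
have C1 : 1 <= 1 + d4 * ht u by rewrite lerDl mulr_ge0 // ltW.
have [k0 [c' [C [w [c0 _ w0 hw]]]]] := orbit_balls he
  (normc_ge0' u) C1.
have yC : d4 * ht u <= 1 + d4 * ht u by rewrite lerDr.
have [_ low] := hw u Ou (lexx _) d4 d40 yC.
apply: lt_le_trans low; apply: mulr_gt0 => //; apply: mulr_gt0; first exact: w0.
by apply: powR_gt0; exact: mulr_gt0.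
Qed.

End Balls.

(** * The convergent case *)

Section Convergence.
Local Notation f := (fun n : nat => phi (expR n%:R)).
Local Notation k0 := (Num.min (exponent al) (exponent (conj al))).

(** Above 1 the assumption bounds phi. Heights below 1 take finitely many values, because the
    squared height divided by the squared unit is a natural number. *)
Lemma height_ratio_bounded (Phi : R) : (forall t, 1 <= t -> phi t <= Phi) ->
  exists2 P : R, 0 <= P & forall r, E r -> phi (ht r) / ht r <= P.
Proof.
move=> hPhi; set U := height_unit (iota := iota) al gamma0.
pose M := (Num.truncn (U^-1 ^+ 2)).+1.
pose S := \sum_(0 <= n < M) phi (U * Num.sqrt n%:R).
have p0 (n : nat) : 0 < phi (U * Num.sqrt n%:R) by apply: hphi; rewrite mulr_ge0 ?sqrtr_ge0 // ltW.
have S0 : 0 <= S by apply: sumr_ge0 => n _; exact: ltW.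
have Phi0 : 0 <= Phi by apply: le_trans (hPhi 1 (lexx _)); exact/ltW/hphi.
exists ((Phi + S) / U) => [|r Er]; first by rewrite divr_ge0 ?addr_ge0 // ltW.
have hu := hU Er; rewrite -/U in hu.
have h0 : 0 < ht r by exact: lt_le_trans hu.
apply: ler_pM; rewrite ?invr_ge0 ?(ltW h0) ?(ltW (hphi (ltW h0))) //; last by rewrite lef_pV2 ?posrE.
have [h1|h1] := lerP 1 (ht r); first by apply: (le_trans (hPhi _ h1)); rewrite lerDl.
have [C [B [D [OC _ _ _ [_ _ eh]]]]] := orbit_form hGam hal Gg0 hfix hexp Er.
have [n hn] := normc_int hK OC; rewrite -/U in eh.
have eC : normc C = Num.sqrt n%:R by rewrite -hn sqrtr_sqr ger0_norm ?normc_ge0'.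
have nM : (n < M)%N.
  rewrite -(ltr_nat R) -hn; apply: le_lt_trans (truncnS_gt _).
  rewrite ler_pXn2r ?nnegrE ?normc_ge0' ?invr_ge0 ?(ltW U0) //.
  by rewrite -[leRHS]mul1r ler_pdivlMr // mulrC -eh ltW.
rewrite eh eC; apply: (@le_trans _ _ S); last by rewrite lerDr.
rewrite /S (@big_cat_nat _ _ _ n) //=; last exact: ltnW.
rewrite [X in _ + X]big_ltn // addrCA lerDl addr_ge0 //; apply: sumr_ge0 => i _; exact: ltW.
Qed.

Let Kb0 : 0 < rm (mu x0) Kb := patterson_Kbar_gt0 (fun g => @GK g) ux0 hmu.
Let KbKb : Kb `<=` Kb. Proof. by []. Qed.

Lemma exponent_gt0 u u' : ends u u' -> 0 < exponent u.
Proof.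
move=> he; have [] // := orbit_balls mK KbKb Kbar_invariant Kb0 he (lexx 0) (lexx 1).
Qed.

Lemma min_exponent_gt0 : 0 < k0.
Proof.
rewrite lt_min (exponent_gt0 (u' := conj al)); last by left.
by rewrite (exponent_gt0 (u' := al)) //; right.
Qed.

Let k00 := min_exponent_gt0.

Variable M : R.
Hypothesis hM : forall q, \sum_(0 <= i < q) f i `^ k0 <= M.

Let f0 n : 0 < f n. Proof. by apply: slow_gt0. Qed.

(** The terms of the bounded series bound phi at the points e^n; slow variation covers the intervals
    between them. *)
Lemma rate_bounded : exists2 Phi : R, 1 <= Phi & forall t, 1 <= t -> phi t <= Phi.
Proof.
have [A A1 hA] := slow_scale hslow ler01.
pose Q := Num.max 1 (M `^ k0^-1).
have Q1 : 1 <= Q by rewrite le_max lexx.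
have fQ n : f n <= Q.
  have h : f n `^ k0 <= M.
    apply: le_trans (hM n.+1); rewrite big_nat_recr //= lerDr.
    by apply: sumr_ge0 => i _; exact: powR_ge0.
  rewrite le_max; apply/orP; right.
  have -> : f n = (f n `^ k0) `^ k0^-1 by rewrite -powRrM divff ?gt_eqF // powRr1 // ltW.
  apply: ge0_ler_powR; rewrite ?nnegrE ?invr_ge0 ?powR_ge0 ?(ltW k00) //.
  exact: le_trans (powR_ge0 _ _) h.
exists (A * Q) => [|t t1]; first by rewrite mulr_ege1.
have t0 : 0 < t by exact: lt_le_trans t1.
have l0 : 0 <= ln t by exact: ln_ge0.
have := hA (Num.truncn (ln t))%:R (ln t) (ler0n _ _) l0; rewrite lnK // => /(_ _)/le_trans; apply.
  have /andP[h1 h2] := truncn_itv l0; rewrite -natr1 in h2.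
  by rewrite ler_norml; apply/andP; split; lra.
by rewrite ler_pM2l ?(lt_le_trans ltr01).
Qed.

(** The first Borel-Cantelli lemma. The factor kk is arbitrary because the lower limit has to exceed
    every constant. *)
Lemma level_series u u' rho (kk : R) : ends u u' -> 0 <= rho -> 0 < kk -> exists s : nat -> seq R[i],
  (forall n r, r \in s n <-> [/\ orbit_of u r, normc r <= rho, expR n%:R <= ht r & ht r <= expR n.+1%:R]) /\
  (mu x0).-negligible (lim_sup_set (fun n => \big[setU/set0]_(r <- s n)
     (Kb `&` bball r (kk * phi (ht r) / ht r)) : set (bdry_borel R))).
Proof.
move=> he rho0 kk0.
have /choice[s hs] n : exists s : seq R[i], uniq s /\
    forall r, r \in s <-> [/\ orbit_of u r, normc r <= rho, expR n%:R <= ht r & ht r <= expR n.+1%:R].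
  by have [s us hs] := orbit_shell rho (expR n%:R) (expR n.+1%:R) he; exists s.
exists s; split; first by move=> n r; have [_] := hs n; apply.
have [Phi Phi1 hPhi] := rate_bounded.
have [A A1 hA] := slow_scale hslow ler01.
pose C0 := Num.max 1 (kk * Phi).
have C01 : 1 <= C0 by rewrite le_max lexx.
have [ku [c1 [C [w [c10 Cp wp hw]]]]] :=
  orbit_balls mK KbKb Kbar_invariant Kb0 he rho0 C01.
have w0 r : 0 <= w r := ltW (wp r).
have e1 : 1 <= expR 1 :> R by exact: (expR_nat_ge1 1).
have [W W0 hW] := weights_bounded mK he c10 C01 (ltW ku)
  (fun r Er nr y y0 yC => (hw r Er nr y y0 yC).2) w0 e1.
pose B n : set (bdry_borel R) := \big[setU/set0]_(r <- s n) (Kb `&` bball r (kk * phi (ht r) / ht r)).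
have mb r y : measurable (Kb `&` bball r y : set (bdry_borel R)).
  by apply: measurableI => //; exact: measurable_bball.
have mB n : measurable (B n) by apply: measurable_bigU => r; exact: mb.
(* The exponent of u may exceed the minimum k0 of the series; the excess power of phi is absorbed by
   its bound Phi. *)
pose D := C * (W * ((kk * A) `^ exponent u * Phi `^ (exponent u - k0))).
have kk0u : k0 <= exponent u by case: he => [] [-> _]; rewrite ge_min lexx ?orbT.
have D0 : 0 <= D by rewrite !mulr_ge0 ?powR_ge0 // ltW.
have A0 : 0 < A by exact: lt_le_trans A1.
have kA0 : 0 <= kk * A by rewrite mulr_ge0 // ltW.
have hB n : rm (mu x0) (B n) <= D * f n `^ k0.
  apply: (le_trans (rm_bigU_le (mu x0) (F := fun r => Kb `&` bball r (kk * phi (ht r) / ht r))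
    (fun r => mb r _) (mB n) (fun _ Hx => Hx))).
  have [us ms] := hs n.
  apply: (@le_trans _ _ (\sum_(r <- s n) C * (w r * ((kk * A * f n) `^ exponent u)))).
    rewrite big_seq [leRHS]big_seq; apply: ler_sum => r /ms[Er nr h1 h2].
    have e2 : 1 <= expR n%:R :> R by exact: expR_nat_ge1.
    have hr0 : 0 < ht r by exact: lt_le_trans h1.
    have hr1 : 1 <= ht r by exact: le_trans h1.
    have ph := hphi (ltW hr0).
    have y0 : 0 < kk * phi (ht r) / ht r by rewrite divr_gt0 // mulr_gt0.
    have yh : kk * phi (ht r) / ht r * ht r = kk * phi (ht r) by rewrite divfK // gt_eqF.
    have [|le_b _] := hw r Er nr _ y0.
      by rewrite yh le_max; apply/orP; right; rewrite ler_pM2l // hPhi.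
    apply: (le_trans le_b); rewrite ler_pM2l // yh; apply: ler_wpM2l; first exact: w0.
    apply: ge0_ler_powR; [exact: ltW|by rewrite nnegrE mulr_ge0 // ltW|by rewrite nnegrE mulr_ge0 // ltW|].
    rewrite -mulrA ler_pM2l //.
    have l1 : n%:R <= ln (ht r) by rewrite -ler_expR lnK.
    have l2 : ln (ht r) <= n.+1%:R by rewrite -ler_expR lnK.
    rewrite -natr1 in l2.
    have := hA n%:R (ln (ht r)) (ler0n _ _) (le_trans (ler0n _ _) l1); rewrite lnK //; apply.
    by have := unit_step l1 l2; rewrite opprK addrC.
  rewrite -mulr_sumr -mulr_suml /D -!mulrA ler_pM2l //.
  have -> : (kk * (A * f n)) `^ exponent u = (kk * A) `^ exponent u * (f n `^ (exponent u - k0) * f n `^ k0).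
    rewrite -powRD; last by rewrite (gt_eqF (f0 n)) implybT.
    by rewrite subrK mulrA powRM ?(ltW (f0 n)).
  apply: ler_pM; rewrite ?sumr_ge0 ?mulr_ge0 ?powR_ge0 //.
    apply: (hW (expR n.+1%:R)) => // r /ms[Er nr h1 h2].
    split => //.
    by rewrite -natr1 expRD mulfK // gt_eqF // expR_gt0.
  apply: ler_wpM2l; rewrite ?powR_ge0 //; apply: ler_wpM2r; rewrite ?powR_ge0 //.
  apply: ge0_ler_powR; rewrite ?nnegrE ?subr_ge0 ?(ltW (f0 n)) ?(le_trans ler01) //.
  by apply: hPhi; rewrite expR_nat_ge1.
exists (lim_sup_set B); split => //.
  by apply: bigcapT_measurable => n; apply: bigcup_measurable => j _; exact: mB.
apply: lim_sup_set_cvg0 => //.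
apply: (@le_lt_trans _ _ (D * M)%:E); last exact: ltry.
apply: lime_le; first by apply: is_cvg_nneseries => n _ _; exact: measure_ge0.
apply: nearW => q; apply: (@le_trans _ _ (\sum_(0 <= i < q) (D * f i `^ k0)%:E)%E).
  apply: lee_sum => i _; apply: (@le_trans _ _ (rm (mu x0) (B i))%:E); last by rewrite lee_fin.
  by rewrite (rmK (mu x0) (mB i)).
by rewrite sumEFin lee_fin -mulr_sumr; apply: ler_wpM2l.
Qed.

Lemma convergence_case : {ae mu x0, forall xi, forall x, xi = Some x -> Khat K x ->
  limf_einf (fun r : R[i] => (ht r / phi (ht r) * normc (x - r))%:E) (frechet E) = +oo%E}.
Proof.
have [Phi Phi1 hPhi] := rate_bounded.
have [P P0 hP] := height_ratio_bounded hPhi.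
have h0 : ends al (conj al) by left.
have h1 : ends (conj al) al by right.
have st u u' (he : ends u u') (p : nat * nat) : exists s : nat -> seq R[i],
  (forall n r, r \in s n <-> [/\ orbit_of u r, normc r <= p.1%:R, expR n%:R <= ht r & ht r <= expR n.+1%:R]) /\
  (mu x0).-negligible (lim_sup_set (fun n => \big[setU/set0]_(r <- s n)
     (Kb `&` bball r (p.2.+1%:R * phi (ht r) / ht r)) : set (bdry_borel R))).
  by apply: (level_series he).
have /choice[s0 hs0] := st _ _ h0; have /choice[s1 hs1] := st _ _ h1.
pose L (s : nat * nat -> nat -> seq R[i]) p : set (bdry_borel R) :=
  lim_sup_set (fun n => \big[setU/set0]_(r <- s p n) (Kb `&` bball r (p.2.+1%:R * phi (ht r) / ht r))).
have neg s : (forall p, (mu x0).-negligible (L s p)) ->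
    (mu x0).-negligible (\bigcup_m \bigcup_k L s (m, k)).
  by move=> h; apply: negligible_bigcup => m; apply: negligible_bigcup => k; exact: h.
apply: (@negligibleS _ _ _ _ ((\bigcup_m \bigcup_k L s0 (m, k)) `|` (\bigcup_m \bigcup_k L s1 (m, k)))); last first.
  by apply: negligibleU; apply: neg => p; [have [] := hs0 p|have [] := hs1 p].
move=> xi; apply: contraPP => nxi; rewrite /setC /= => /(_ _).
apply=> x ex Kx; rewrite ex in nxi.
have bnd s u u' (m k : nat) : ends u u' -> ~ (\bigcup_m \bigcup_k L s (m, k)) (Some x) ->
   (forall p n r, r \in s p n <-> [/\ orbit_of u r, normc r <= p.1%:R, expR n%:R <= ht r & ht r <= expR n.+1%:R]) ->
   exists H : R, forall r, orbit_of u r -> normc r <= m%:R -> normc (x - r) < k.+1%:R * phi (ht r) / ht r -> ht r <= H.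
  move=> he nx hs; have nL : ~ L s (m, k) (Some x) by move=> h; apply: nx; exists m => //; exists k.
  have [n hn] : exists n, forall j, (n <= j)%N ->
      ~ (\big[setU/set0]_(r <- s (m, k) j) (Kb `&` bball r (k.+1%:R * phi (ht r) / ht r))) (Some x).
    apply: contrapT => h; apply: nL => n _; apply: contrapT => h2; apply: h; exists n => j nj Bj.
    by apply: h2; exists j.
  exists (expR n%:R) => r Er rm xr; rewrite leNgt; apply/negP => nr.
  have r1 : 1 <= ht r by apply: le_trans (ltW nr); rewrite expR_nat_ge1.
  have r0 : 0 < ht r by exact: lt_le_trans r1.
  have /andP[h3 h4] := truncn_itv (ln_ge0 r1).
  set j := Num.truncn (ln (ht r)) in h3 h4.
  have nj : (n <= j)%N.
    rewrite -ltnS -(ltr_nat R); apply: lt_trans h4; by rewrite -ltr_expR lnK.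
  apply: (hn j nj); rewrite -bigcup_seq; exists r => /=.
    apply/hs; split => //; first by rewrite -[leRHS](lnK r0) ler_expR.
    by rewrite -[leLHS](lnK r0) ler_expR ltW.
  by split => //; apply/bballP.
pose m0 : nat := (Num.truncn (normc x)).+1.
have main (k : nat) : finite_set (E `\` [set r | (k.+1%:R%:E <= (ht r / phi (ht r) * normc (x - r))%:E)%E]).
  (* A radius large enough to contain every r with |x - r| < (k + 1) phi(h) / h, by the bound P on
     phi(h) / h. *)
  pose m := (m0 + (Num.truncn (k.+1%:R * P)).+1)%N.
  have [H0 hH0] := bnd s0 al (conj al) m k h0 (fun hx => nxi (or_introl hx)) (fun p => (hs0 p).1).
  have [H1 hH1] := bnd s1 (conj al) al m k h1 (fun hx => nxi (or_intror hx)) (fun p => (hs1 p).1).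
  apply: sub_finite_set (orbit_finite hK hGam hal Gg0 hfix hexp (Num.max H0 H1) m%:R) => r /= [Er].
  rewrite lee_fin => /negP; rewrite -ltNge => hr; split => //.
  have r0 := ht0 Er; have ph := hphi (ltW r0).
  have xr : normc (x - r) < k.+1%:R * phi (ht r) / ht r.
    by move: hr; rewrite mulrAC ltr_pdivrMr // => hr; rewrite ltr_pdivlMr // mulrC.
  have nr : normc r <= m%:R.
    have t := normc_triangle r x 0; rewrite !subr0 (le_normcB r x) in t.
    apply: (le_trans t); rewrite natrD addrC; apply: lerD; first exact/ltW/truncnS_gt.
    apply: (le_trans (ltW xr)); apply: le_trans (ltW (truncnS_gt _)).
    by rewrite -mulrA ler_pM2l // hP.
  split => //; rewrite le_max; apply/orP.
  by case: (orbit_cases Er) => Er'; [left; exact: hH0|right; exact: hH1].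
rewrite limf_einfE; apply: eq_infty => t; pose k := Num.truncn `|t|.
apply: (@le_trans _ _ (k.+1%:R%:E)).
  by rewrite lee_fin; apply: (le_trans (ler_norm _)); exact/ltW/truncnS_gt.
apply: le_trans (ereal_sup_ubound _); last first.
  by exists [set r | (k.+1%:R%:E <= (ht r / phi (ht r) * normc (x - r))%:E)%E]; first exact: main.
by apply: le_ereal_inf_tmp => _ [r hr <-].
Qed.

End Convergence.

(** * The divergent case *)

Section Divergence.
Variables u u' : R[i].
Hypothesis he : ends u u'.
Let d4 := normc (u - u') / 4.
Let d40 : 0 < d4.
Proof. by rewrite divr_gt0 // dist_gt0 //; exact: ends_neq he. Qed.

Hypothesis nonescape : forall eps, 0 < eps -> exists2 D, 0 <= D & forall n,
  rm (mu x0) (Kb `&` bball u d4 `&` escaping Gam x0 D n) <= eps.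

Section Level.
Variable N : set (bdry_borel R).
Hypotheses (mN : measurable N) (NK : N `<=` Kb).
Hypotheses (iN : forall g xi, Gam g -> N (bact g xi) <-> N xi) (N0 : 0 < rm (mu x0) N).

(** At most half of the mass of N near u escapes at level n; by [orbit_near] the other half is
    covered by balls around orbit points of height about e^n. *)
Lemma level_mass : exists C2 rho m : R, [/\ 1 <= C2, 0 <= rho, 0 < m &
  forall (n : nat) (s : seq R[i]),
  (forall r, r \in s <-> [/\ orbit_of u r, normc r <= rho, expR n%:R / C2 <= ht r & ht r <= C2 * expR n%:R]) ->
  m <= \sum_(r <- s) rm (mu x0) (Kb `&` bball r (2 * C2 * expR (- n%:R)))].
Proof.
set m0 := rm (mu x0) (N `&` bball u d4); have m00 : 0 < m0 := base_ball_gt0 mN NK iN N0 he.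
have m20 : 0 < m0 / 2 by rewrite divr_gt0.
have [D D0 hD] := nonescape m20.
have [C2 C21 hC] := orbit_near he D0.
have C20 : 0 < C2 by exact: lt_le_trans C21.
pose rho := normc u + d4 + C2.
exists C2, rho, (m0 / 2); split => //; first by rewrite /rho !addr_ge0 ?normc_ge0' // ltW.
move=> n s hs.
have mB r y : measurable (Kb `&` bball r y : set (bdry_borel R)) by apply: measurableI => //; exact: measurable_bball.
have mNb : measurable (N `&` bball u d4 : set (bdry_borel R)) by apply: measurableI => //; exact: measurable_bball.
have mEs : measurable (Kb `&` bball u d4 `&` escaping Gam x0 D n : set (bdry_borel R)).
  by apply: measurableI => //; apply: measurable_escaping => //; case: ux0.
set U := \big[setU/set0]_(r <- s) (Kb `&` bball r (2 * C2 * expR (- n%:R)) : set (bdry_borel R)).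
have mU : measurable U by apply: measurable_bigU => r; exact: mB.
have sub : N `&` bball u d4 `<=` (Kb `&` bball u d4 `&` escaping Gam x0 D n) `|` U.
  move=> xi [Nxi b]; have [es|nes] := pselect (escaping Gam x0 D n xi); first by left; split => //; split => //; exact: NK.
  right; case: xi Nxi b nes => [z|] Nxi b nes; last by case: b.
  move/bballP: b => b.
  have [g Gg hg] : exists2 g, Gam g & hdist (hact g x0) (z, expR (- n%:R)) <= D.
    apply: contrapT => h; apply: nes; exists z => // g Gg; rewrite leNgt; apply/negP => hg.
    by apply: h; exists g => //; exact: ltW.
  have [r [Or r1 r2 r3]] := hC z n%:R g Gg hg.
  have e1 : expR (- n%:R) <= 1 :> R.
    rewrite -[leRHS](expR0 R) ler_expR oppr_le0; exact: ler0n.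
  have et := expR_gt0 (- n%:R).
  rewrite /U -bigcup_seq; exists r; last first.
    split; first exact: NK.
    apply/bballP; apply: (le_lt_trans r1); rewrite -mulrA ltr_pMl ?ltr1n //.
    exact: mulr_gt0.
  apply/hs; split => //.
  have t1 := normc_triangle r z 0; have t2 := normc_triangle z u 0; rewrite !subr0 in t1 t2.
  rewrite (le_normcB r z) in t1; rewrite /rho; have := ler_wpM2l (ltW C20) e1; rewrite mulr1 => e2.
  move: t1 t2 r1 b e2; move: (normc (z - r)) (normc r) (normc z) (normc (z - u)) (normc u) (C2 * _) d4.
  by move=> *; lra.
have h1 := rm_le (mu x0) mNb (measurableU _ _ mEs mU) sub.
have h2 := rmU_le (mu x0) mEs mU; have h3 := hD n.
have h4 := rm_bigU_le (mu x0) (F := fun r => Kb `&` bball r (2 * C2 * expR (- n%:R))) (fun r => mB r _) mU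
  (fun _ Hx => Hx).
move: h1 h2 h3 h4; rewrite -/m0; move: (rm _ _) (rm _ _) (rm _ _) (\sum_(_ <- _) _) => b1 b2 b3 b4; lra.
Qed.

End Level.

Local Notation N := (Kb `\` good).

Lemma bad_invariant g (xi : bdry R) : Gam g -> N (bact g xi) <-> N xi.
Proof.
have act h z : Gam h -> good z -> good (bact h z).
  case: z => [z|] Gh hz; first exact: (good_act Gh hz).
  by have [r _ [y _ ey]] := hz 0%N I.
have half h z : Gam h -> N z -> N (bact h z).
  move=> Gh [Kz nz]; split; first exact: Kbar_bact cK (GK Gh) Kz.
  by move=> hz; apply: nz; have := act _ _ (GV Gh) hz; rewrite bactK.
move=> Gg; split; last exact: half.
by move=> /(half _ _ (GV Gg)); rewrite bactK.
Qed.

Lemma bad_null : (\int[lebesgue_measure]_(t in (`[1%R, +oo[ : set R)) (phi t `^ exponent u / t)%:E)%E = +oo%E ->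
  rm (mu x0) N = 0.
Proof.
move=> Joo; apply/eqP; rewrite eq_le rm_ge0 andbT leNgt; apply/negP => N0.
have mG : measurable good by exact: measurable_good.
have mN : measurable N by exact: measurableD.
have NK : N `<=` Kb by move=> xi [].
have iN g xi : Gam g -> N (bact g xi) <-> N xi by exact: bad_invariant.
have [C2 [rho [m [C21 rho0 m0 hm]]]] := level_mass mN NK iN N0.
have C20 : 0 < C2 by exact: lt_le_trans C21.
have [cs cs0 sep] := orbit_separated hK hGam hal Gg0 hfix hexp.
(* Points of levels up to j have height at most C2 / e_j, so they are cs e_j / C2 = 2 B e_j
   apart. *)
have [B B0 BE] : exists2 B, 0 < B & B = cs / (2 * C2).
  by exists (cs / (2 * C2)) => //; rewrite divr_gt0 // mulr_gt0.
pose C0 := 1 + 3 * B * C2 + 2 * C2 * C2.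
have BC0 : 0 < 3 * B * C2 by rewrite !mulr_gt0.
have CC0 : 0 < 2 * C2 * C2 by rewrite !mulr_gt0.
have C01 : 1 <= C0 by rewrite /C0 -addrA lerDl addr_ge0 // ltW.
have [k0 [c' [C [w [c0 Cp w0 hw]]]]] := orbit_balls mN NK iN N0 he
  rho0 C01.
set k := exponent u in k0 hw Joo.
have Q1 : 1 <= C2 * C2 by rewrite -[leLHS]mulr1 ler_pM.
have [W W0 hW] := weights_bounded mN he c0 C01 (ltW k0)
  (fun r Er nr y y0 yC => (hw r Er nr y y0 yC).2) (fun r => ltW (w0 r)) Q1.
(* The height windows of a level have ratio C2^2; as e^L exceeds it, different levels have no common
   point. *)
pose L := (Num.truncn (C2 * C2)).+1.
have hL : C2 * C2 < expR L%:R.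
  apply: lt_le_trans (truncnS_gt _) _; apply: le_trans (expR_ge1Dx _); by rewrite lerDr.
have L0 : (0 < L)%N by [].
have [ee eeP] : exists ee : nat -> R, forall n, ee n = expR (- (n * L)%:R) by exists (fun n => expR (- (n * L)%:R)).
have ee0 n : 0 < ee n by rewrite eeP expR_gt0.
have eeE n : expR (n * L)%:R * ee n = 1 by rewrite eeP expR_mulN.
have /choice[s hs] n : exists s : seq R[i], uniq s /\ forall r, r \in s <->
   [/\ orbit_of u r, normc r <= rho, expR (n * L)%:R / C2 <= ht r & ht r <= C2 * expR (n * L)%:R].
  have [s us h] := orbit_shell rho (expR (n * L)%:R / C2) (C2 * expR (n * L)%:R) he.
  by exists s.
have wn n r : r \in s n -> [/\ orbit_of u r, E r, normc r <= rho, C2^-1 <= ee n * ht r & ee n * ht r <= C2].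
  case: (hs n) => _ h /h[Or nr h1 h2]; split => //; first exact: (orbit_of_sub he Or).
    by have := ler_wpM2l (ltW (ee0 n)) h1; rewrite mulrA (mulrC (ee n)) eeE mul1r.
  have e2 : ee n * (C2 * expR (n * L)%:R) = C2 by rewrite mulrCA (mulrC (ee n)) eeE mulr1.
  by have := ler_wpM2l (ltW (ee0 n)) h2; rewrite e2.
have balls n r : r \in s n -> forall y, 0 < y -> y <= 3 * B * ee n ->
    rm (mu x0) (Kb `&` bball r y) <= C * C2 `^ k * (w r * (y / ee n) `^ k) /\
    c' * C2^-1 `^ k * (w r * (y / ee n) `^ k) <= rm (mu x0) (N `&` bball r y).
  move=> rn y y0 yB; have [Or Er nr z1 z2] := wn n r rn; have en := ee0 n.
  have t0 : 0 < y / ee n by rewrite divr_gt0.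
  have tz : y / ee n * (ee n * ht r) = y * ht r by rewrite mulrA divfK // gt_eqF.
  have [p1 p2] := powR_window (ltW k0) C20 t0 z1 z2; rewrite tz in p1 p2.
  have yC : y * ht r <= C0.
    rewrite -tz; apply: (@le_trans _ _ (3 * B * C2)).
      apply: ler_pM => //; [exact: ltW|by apply: le_trans z1; rewrite invr_ge0 ltW|by rewrite ler_pdivrMr].
    by rewrite /C0 addrAC lerDr addr_ge0 // ltW.
  have [up low] := hw r Or nr y y0 yC; have wr := w0 r; split.
    apply: (le_trans up); rewrite mulr_swap; apply: ler_wpM2l; first exact: ltW.
    by apply: ler_wpM2l; first exact: ltW.
  apply: le_trans low; rewrite mulr_swap; apply: ler_wpM2l; first exact: ltW.
  by apply: ler_wpM2l; first exact: ltW.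
have separated i j r r' : (i <= j)%N -> r \in s i -> r' \in s j -> (i < j)%N || (r != r') ->
    2 * B * ee j <= normc (r - r').
  move=> ij ri rj nij; have [_ Er _ z1 z2] := wn i r ri; have [_ Er' _ z1' z2'] := wn j r' rj.
  have [_ hi] := hs i; have [_ _ _ h2] := (hi r).1 ri.
  have [_ hj] := hs j; have [_ _ h3 h4] := (hj r').1 rj.
  have eij : expR (i * L)%:R <= expR (j * L)%:R :> R by rewrite ler_expR ler_nat leq_mul2r ij orbT.
  have nr : r <> r'.
    case/orP: nij => [lij|/eqP //] er; rewrite -er in h3.
    have e1 : expR (i * L)%:R * expR L%:R <= expR (j * L)%:R :> R.
      by rewrite -expRD ler_expR -natrD ler_nat -{2}(mul1n L) -mulnDl addn1 leq_mul2r lij orbT.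
    have h5 := le_trans h3 h2; rewrite ler_pdivrMr // in h5.
    have h6 := le_trans e1 h5; have Xi : 0 < expR (i * L)%:R :> R by exact: expR_gt0.
    have e2 : C2 * expR (i * L)%:R * C2 = expR (i * L)%:R * (C2 * C2) by rewrite mulrAC mulrC.
    by move: h6; rewrite e2 ler_pM2l // leNgt hL.
  have := sep r r' (C2 * expR (j * L)%:R) Er Er' nr (le_trans h2 _) h4.
  rewrite ler_pM2l // => /(_ eij); apply: le_trans.
  rewrite BE le_eqVlt; apply/orP; left; apply/eqP.
  have -> : ee j = (expR (j * L)%:R)^-1 by rewrite eeP expRN.
  by field; rewrite !gt_eqF ?expR_gt0.
have Ck : 0 < (2 * C2 * C2) `^ k by rewrite powR_gt0 // !mulr_gt0.
have [c1 c10 c1E] : exists2 c1, 0 < c1 & c1 = m / (C * (2 * C2 * C2) `^ k).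
  by exists (m / (C * (2 * C2 * C2) `^ k)) => //; rewrite divr_gt0 // mulr_gt0.
have mass n : c1 <= \sum_(r <- s n) w r <= W + 1.
  have [usn hsn] := hs n; apply/andP; split.
    rewrite c1E ler_pdivrMr ?mulr_gt0 //; apply: (le_trans (hm _ _ hsn)).
    rewrite mulr_suml big_seq [leRHS]big_seq; apply: ler_sum => r rn.
    have [Or Er nr z1 z2] := wn n r rn; rewrite -eeP.
    have y0 : 0 < 2 * C2 * ee n by rewrite !mulr_gt0.
    have yh : 2 * C2 * ee n * ht r <= 2 * C2 * C2 by rewrite -mulrA ler_pM2l // mulr_gt0.
    have yC : 2 * C2 * ee n * ht r <= C0 by apply: (le_trans yh); rewrite /C0 lerDr addr_ge0 // ltW.
    have [up _] := hw r Or nr _ y0 yC; apply: (le_trans up).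
    rewrite mulrCA; apply: ler_wpM2l; first exact: ltW (w0 r).
    rewrite ler_pM2l //; apply: ge0_ler_powR => //; first exact: ltW.
      by rewrite nnegrE mulr_ge0 ?(ltW y0) // ltW // (ht0 Er).
    by rewrite nnegrE !mulr_ge0 // ltW.
  apply: (@le_trans _ _ W); last by rewrite lerDl.
  apply: (hW (C2 * expR (n * L)%:R)) => // [|r /hsn[Or nr h1 h2]]; first by rewrite mulr_gt0 // expR_gt0.
  split => //; apply: le_trans h1; rewrite le_eqVlt; apply/orP; left; apply/eqP.
  by field; rewrite gt_eqF.
have us n : uniq (s n) by have [] := hs n.
have [A A1 hA] := rate_scale hslow (ln_ge0 C21).
have A0 : 0 < A by exact: lt_le_trans A1.
(* The bound is independent of l: the index only shrinks the radii by a factor [kp], which affects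
   neither the divergence nor the constants. *)
have approx_ge l : (c' * C2^-1 `^ k * c1) ^+ 2 / (8 * (C * C2 `^ k * (C * C2 `^ k / (c' * C2^-1 `^ k)) * (3 / B) `^ k * (W + 1))) <=
    rm (mu x0) (N `&` approximable l).
  have [kp [kp0 kpB kpA]] : exists kp, [/\ 0 < kp, kp <= B & kp <= (A * C2 * l.+1%:R)^-1].
    exists (Num.min B (A * C2 * l.+1%:R)^-1); rewrite lt_min B0 invr_gt0 !mulr_gt0 //.
    by rewrite !ge_min !lexx orbT.
  pose X n : R := expR (n * L)%:R; pose q n := kp * rate phi (X n).
  have rX n : 0 < rate phi (X n) by apply: (rate_gt0 hphi); exact: ltW (expR_gt0 _).
  have q0 n : 0 < q n by exact: mulr_gt0.
  have qB n : q n <= B by apply: le_trans kpB; rewrite ler_piMr ?(ltW kp0) // rate_le1.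
  have div (p : nat) (M : R) : exists n, M <= \sum_(p <= i < n) q i `^ k.
    have [n hn] := rate_series_diverges hslow (ltW k0) L0 Joo p (M / kp `^ k); exists n.
    move: hn; rewrite ler_pdivrMr ?powR_gt0 // mulr_suml => /le_trans; apply.
    apply: ler_sum => i _; rewrite /q powRM ?(ltW kp0) ?(ltW (rX i)) // mulrC; exact: lexx.
  pose p := (Num.truncn (C2 * l.+1%:R)).+1.
  have cp : 0 < c' * C2^-1 `^ k by rewrite mulr_gt0 // powR_gt0 // invr_gt0.
  have Cp' : 0 < C * C2 `^ k by rewrite mulr_gt0 // powR_gt0.
  have W1 : 0 < W + 1 by rewrite ltr_wpDl.
  have lim := level_limsup_ge mK mN NK cp Cp' c10 W1 B0 w0 ee0 us balls separated mass q0 qB div p.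
  apply: (le_trans lim); apply: rm_le.
  - by apply: bigcup_measurable => n _; exact: measurable_level_union.
  - by apply: measurableI => //; exact: measurable_approximable.
  move=> xi [n /= pn]; rewrite /level_union -bigcup_seq => -[r rn [Nxi b]]; split; first exact: Nxi.
  have [_ Er _ z1 z2] := wn n r rn; have r0 := ht0 Er.
  have [_ hsn] := hs n; have [_ _ h1 h2] := (hsn r).1 rn.
  have h3 : l.+1%:R <= ht r.
    apply: le_trans h1; rewrite ler_pdivlMr // mulrC; apply: (le_trans (ltW (truncnS_gt _))).
    apply: (@le_trans _ _ n%:R); first by rewrite ler_nat.
    apply: (@le_trans _ _ (n * L)%:R); first by rewrite ler_nat leq_pmulr.
    by apply: le_trans (expR_ge1Dx _); rewrite lerDr.
  have r1 : 1 <= ht r by apply: le_trans h3; rewrite ler1n.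
  exists r; first by split; [exact: Er|apply: le_trans h3; rewrite ler_nat].
  case: xi Nxi b => [z|] Nxi b; last by case: b.
  move/bballP: b => b; apply/bballP; apply: (lt_le_trans b).
  have rs : rate phi (X n) <= A * rate phi (ht r).
    apply: hA => //; first by rewrite -[leLHS](expR0 R) ler_expR; exact: ler0n.
    rewrite /X expRK; exact: (ln_ratio C20 r0 h1 h2).
  exact: (fine_radius A0 C20 (ltr0Sn _ _) r0 (ee0 n) (rX n) kp0 kpA rs z2 (erefl _)).
set c00 := _ ^+ 2 / _ in approx_ge.
have c000 : 0 < c00.
  have cp : 0 < c' * C2^-1 `^ k by rewrite mulr_gt0 // powR_gt0 // invr_gt0.
  have Cp' : 0 < C * C2 `^ k by rewrite mulr_gt0 // powR_gt0.
  have W1 : 0 < W + 1 by rewrite ltr_wpDl.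
  have B3 : 0 < (3 / B) `^ k by rewrite powR_gt0 // divr_gt0.
  rewrite /c00; apply: divr_gt0; first by apply: exprn_gt0; exact: mulr_gt0.
  by apply: mulr_gt0 => //; apply: mulr_gt0 => //; apply: mulr_gt0 => //; apply: mulr_gt0 => //; exact: divr_gt0.
have mNa l : measurable (N `&` approximable l : set (bdry_borel R)).
  by apply: measurableI => //; exact: measurable_approximable.
(* N avoids [good], the intersection of these decreasing sets, so the masses tend to 0, against
   [approx_ge]. *)
have cv : (fun l => mu x0 (N `&` approximable l)) @ \oo --> 0%E.
  have -> : 0%E = mu x0 (\bigcap_l (N `&` approximable l)).
    rewrite (_ : \bigcap_l _ = set0) ?measure0 //; apply/seteqP; split => // xi h.
    by have [[_ nG] _] := h 0%N I; apply: nG => l _; have [_] := h l I.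
  apply: nonincreasing_cvg_mu => [||//|l l' ll].
  - by rewrite ltey_eq fin_num_measure.
  - exact: mNa.
  - by apply: bigcap_measurable.
  - apply/subsetPset => xi [Nxi h]; split => //.
    exact: (approximable_le ll h).
have /fine_cvgP[_ /cvgr0_norm_lt/(_ _ c000)] := cv.
move=> [l _ /(_ l (leqnn l))] /=; apply/negP; rewrite -leNgt.
by apply: le_trans (ler_norm _); exact: approx_ge.
Qed.

End Divergence.

End Density.

(** * Non-escape of mass from the finiteness of the Gibbs measure *)

Section NonEscape.
Variables (F : vect R -> R) (a c : R).
Hypotheses (hF : holder_with (Khat K) F a c) (iF : invariant_under (Khat K) Gam F).
Variables mu mu' : hpoint R -> {finite_measure set (bdry_borel R) -> \bar R}.
Hypothesis hmu' : patterson_density (Khat K) Gam x0 (F \o @flip R) mu'.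
Variable mF : {measure set (quotient_T1 (Khat K) Gam) -> \bar R}.
Hypothesis hmF : gibbs_measure x0 F mu' mu mF.
Hypothesis hmF_fin : (mF (T1 (Khat K)) < +oo)%E.

(** The same lift is bounded below by a multiple of the escaping mass and above by an arbitrarily
    small constant. The multiple is positive because [mu'] charges a ball around the other
    endpoint. *)
Lemma nonescape u u' eps : endpoints (iota := iota) al u u' -> 0 < eps -> exists2 D, 0 <= D & forall n,
  rm (mu x0) (Kb `&` bball u (normc (u - u') / 4) `&` escaping Gam x0 D n) <= eps.
Proof.
move=> he eps0.
have x00 : 0 < x0.2 by case: ux0.
have [Ku Ku'] := ends_Khat he; have ne := ends_neq he.
have dflip : crit_delta Gam x0 (F \o @flip R) = crit_delta Gam x0 F.
  by rewrite /crit_delta (critical_exponent_flip cK GK GV ux0 hF iF).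
have dens := gibbs_density cK GK GV G1 ux0 hF iF dflip.
have [D1 [D3 [k [D10 D30 kp hk]]]] := lift_lower cK ux0 mu mu' mK dens Ku Ku' ne.
set V := rm (mu' x0) _ in hk.
have V0 : 0 < V.
  rewrite /V (le_normcB u u').
  exact: (base_ball_gt0 (holder_with_flip cK hF) (invariant_flip cK iF) hmu' mK (fun _ Hx => Hx)
    Kbar_invariant (patterson_Kbar_gt0 GK ux0 hmu') (endpoints_sym he)).
have kV : 0 < k * V * eps by rewrite !mulr_gt0.
have [D2 D20 hD2] := quotient_escape cK (@closed_Khat R K) GK GV G1 GM x00 (fun D => fi_proper hK hGam D x00) hmF hmF_fin D10 kV.
exists (D2 + D3) => [|n]; first exact: addr_ge0.
by have := le_trans (hk n D2 D20) (hD2 n); rewrite lee_fin -[leRHS]mulrA !ler_pM2l.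
Qed.

End NonEscape.

End OrbitApproximation.
Theorem theorem5p1 (R : realType)
  (K : fieldExtType rat) (iota : {rmorphism K -> R[i]})
  (hK : rational_or_imaginary_quadratic iota)
  (Gam : set (PSL2 R))
  (hGam : finite_index_subgroup Gam (PSL2_integers iota))
  (alpha0 : R[i]) (halpha0 : quadratic_irrational iota alpha0)
  (gamma0 : PSL2 R) (hgamma0 : primitive Gam gamma0)
  (hfix : bact gamma0 (Some alpha0) = Some alpha0)
  (hexp : 1 < normc (derive1 (homography gamma0) alpha0))
  (x0 : hpoint R) (hx0 : upper (Khat K) x0)
  (F : vect R -> R) (hF : potential (Khat K) Gam F)
  (hdelta : critical_exponent Gam F x0 x0 \is a fin_num)
  (mu mu' : hpoint R -> {finite_measure set (bdry_borel R) -> \bar R})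
  (hmu : patterson_density (Khat K) Gam x0 F mu)
  (hmu' : patterson_density (Khat K) Gam x0 (F \o @flip R) mu')
  (mF : {measure set (quotient_T1 (Khat K) Gam) -> \bar R})
  (hmF : gibbs_measure x0 F mu' mu mF)
  (hmF_fin : (mF (T1 (Khat K)) < +oo)%E)
  (delta0 : R)
  (hdelta0 : delta0 = crit_delta (cyclic_subgroup gamma0) x0 F)
  (phi : R -> R) (hphi : forall t : R, 0 <= t -> 0 < phi t)
  (hslow : slowly_varying (fun t => phi (expR t))) :
  let E := bdry_orbit Gam [set z | z = alpha0 \/ z = galois_conj iota alpha0] in
  let J := (\int[lebesgue_measure]_(t in (`[1%R, +oo[ : set R))
             (phi t `^ (crit_delta Gam x0 F - delta0) / t)%:E)%E in
  let L (x : R[i]) := limf_einf (fun r : R[i] =>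
             (height iota r / phi (height iota r) * normc (x - r))%:E)
             (frechet E) in
  (J = +oo%E ->
     {ae mu x0, forall xi, forall x, xi = Some x -> Khat K x -> L x = 0%E}) /\
  ((J < +oo)%E ->
     {ae mu x0, forall xi, forall x, xi = Some x -> Khat K x -> L x = +oo%E}).
Proof.
move=> E J L; have Gg0 : Gam gamma0 by case: hgamma0.
have [[a [c hFw]] iF] : (exists a c, holder_with (Khat K) F a c) /\ invariant_under (Khat K) Gam F.
  by case: hF => h1 h2; split; first exact: holder_holder_with h1.
pose ex := exponent (iota := iota) Gam alpha0 gamma0 x0 F.
have dE : crit_delta Gam x0 F - delta0 = Num.min (ex alpha0) (ex (galois_conj iota alpha0)).
  by rewrite hdelta0 (crit_delta_cyclic hGam halpha0 Gg0 hfix hexp hx0 hFw iF) opprB addrC subrK.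
split => [Joo|Jfin].
  (* u is an endpoint with the smaller exponent; its orbit alone already gives the lower limit 0. *)
  have [u [u' [he eu]]] : exists u u', endpoints (iota := iota) alpha0 u u' /\
      crit_delta Gam x0 F - delta0 = ex u.
    rewrite dE; have [h|h] := leP (ex alpha0) (ex (galois_conj iota alpha0)).
      by exists alpha0, (galois_conj iota alpha0); split => //; left.
    by exists (galois_conj iota alpha0), alpha0; split => //; right.
  have ne eps := nonescape (eps := eps) hK hGam halpha0 Gg0 hfix hexp hx0 hFw iF hmu' hmF hmF_fin he.
  rewrite /J eu in Joo.
  have N0 := bad_null hK hGam halpha0 Gg0 hfix hexp hx0 hphi hslow hFw iF hmu he ne Joo.
  have mN : measurable ((Kbar (Khat K) : set (bdry_borel R)) `\` good (iota := iota) Gam alpha0 phi).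
    by apply: measurableD; [exact: Kbar_measurable|exact: measurable_good].
  exists ((Kbar (Khat K) : set (bdry_borel R)) `\` good (iota := iota) Gam alpha0 phi); split; first exact: mN.
    by rewrite -(rmK (mu x0) mN) N0.
  move=> xi; apply: contraPP => nxi; rewrite /setC /= => /(_ _).
  apply=> x ex' Kx; rewrite ex' in nxi.
  have gx : good (iota := iota) Gam alpha0 phi (Some x) by apply: contrapT => ng; apply: nxi; split.
  exact: (good_liminf hGam halpha0 hphi gx).
have h0 : endpoints (iota := iota) alpha0 alpha0 (galois_conj iota alpha0) by left.
rewrite /J dE in Jfin.
have k0 : 0 <= Num.min (ex alpha0) (ex (galois_conj iota alpha0)).
  exact: ltW (min_exponent_gt0 hK hGam halpha0 Gg0 hfix hexp hx0 hFw iF hmu).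
have [M hM] := series_bounded hslow k0 (ltnSn 0) Jfin.
apply: (convergence_case hK hGam halpha0 Gg0 hfix hexp hx0 hphi hslow hFw iF hmu (M := M)).
by move=> q; apply: le_trans (hM q); apply: ler_sum => i _; rewrite muln1.
Qed.
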